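(* Let $X\subset\mathbb{P}^N$ be a non-degenerate manifold of dimension $n$, let $SX\subset\mathbb{P}^N$ be its secant variety, and put $s:=\dim SX$ and $c:=N-s$. Let $X^*\subset\mathbb{P}^{N*}$ denote the dual variety of $X$, and let $n^*:=\dim X^*$. The following holds: (i) The twisted normal bundle $N_{X/\mathbb{P}^N}(-1)$ is $k$-ample for $k\geq s-1-n$. (ii) $n^*\geq n+c$. In particular, if $SX\neq\mathbb{P}^N$ then $X^*$ is a singular variety. (iii) If $s\leq 2n-1$, then every hyperplane section of $X$ is reduced. If $s\leq 2n-2$, then every hyperplane section of $X$ is normal.
   Context: We work over the complex numbers. A manifold $X\subset\mathbb{P}^N$ means an irreducible non-singular closed projective subvariety of $\mathbb{P}^N$; it is non-degenerate if it is not contained in any hyperplane of $\mathbb{P}^N$. For $x\in X$, $T_xX\subset\mathbb{P}^N$ denotes the embedded (projective) tangent space to $X$ at $x$, a linear subspace of dimension $\dim X$. The secant variety $SX\subset\mathbb{P}^N$ is the closure of the union of all lines $\langle x,x'\rangle$ with $x,x'\in X$, $x\neq x'$. The dual variety $X^*\subset\mathbb{P}^{N*}$ is the set of hyperplanes $H\subset\mathbb{P}^N$ such that $T_xX\subset H$ for some $x\in X$, that is, the image of the conormal variety $\{(x,H)\mid T_xX\subset H\}\subset X\times\mathbb{P}^{N*}$ under the second projection. Hyperplane sections are the scheme-theoretic intersections $X\cap H$. A vector bundle $E$ on a projective variety $X$ is $k$-ample (in the sense of Sommese) if, for some integer $a>0$, the line bundle $\mathcal{O}_{\mathbb{P}(E)}(a)$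 on the bundle $\mathbb{P}(E)$ of one-dimensional quotients of $E$ is globally generated and all fibres of the morphism from $\mathbb{P}(E)$ to projective space defined by its global sections have dimension at most $k$. *)

(* Defs.v *)
From HB Require Import structures.
From mathcomp Require Import all_boot all_order all_algebra.
From mathcomp Require Import ring_quotient generic_quotient.
From mathcomp Require Import boolp classical_sets functions.
From mathcomp Require Import topology_structure.
From mathcomp Require Import mpoly ring.
Set Implicit Arguments.
Unset Strict Implicit.
Unset Printing Implicit Defensive.

Import GRing.Theory.
Local Open Scope quotient_scope.
Local Open Scope classical_set_scope.
Local Open Scope ring_scope.

(* Everything is stated over a field F, but it is meant for an algebraically
   closed F: varieties are sets of F-points. *)

Section Dimension.
Variable T : topologicalType.
Implicit Types (A : set T) (d : nat).

Definition irreducible A :=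
  A !=set0 /\ forall B C : set T, closed B -> closed C ->
    A `<=` B `|` C -> A `<=` B \/ A `<=` C.

Definition dim_ge A d := exists Z : nat -> set T,
  (forall i, (i <= d)%N -> irreducible (Z i) /\ closure (Z i) `&` A = Z i) /\
  (forall i, (i < d)%N -> Z i `<` Z i.+1).

(* The empty set satisfies [dim_le] for every bound, but never [has_dim]. *)
Definition dim_le A d := ~ dim_ge A d.+1.

Definition has_dim A d := dim_ge A d /\ dim_le A d.

End Dimension.

Definition proj (F : fieldType) (n : nat) : Type :=
  {L : {vspace 'rV[F]_n.+1} | \dim L == 1%N}.

HB.instance Definition _ (F : fieldType) n := Choice.on (proj F n).

Section Projective.
Variables (F : fieldType) (n : nat).
Local Notation S := {mpoly F[n.+1]}.
Local Notation V := 'rV[F]_n.+1.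
Local Notation P := (proj F n).
Implicit Types (X : set P) (x h : P).

Definition hcoord x : set V := [set v | v \in val x /\ v != 0].

Definition form (p : S) := exists d, p \is d.-homog.

Definition nonzero_locus (B : set S) : set P :=
  [set x | exists p, B p /\ exists v, hcoord x v /\ p.@[v 0] != 0].

Definition zariski_open : set_system P :=
  [set A | exists B : set S, (forall p, B p -> form p) /\ A = nonzero_locus B].

Lemma hcoord_ex x : exists v, hcoord x v.
Proof.
exists (vpick (val x)); split; first exact: memv_pick.
by rewrite vpick0 -dimv_eq0 (eqP (valP x)).
Qed.

Lemma hcoord_scale x v w : hcoord x v -> hcoord x w ->
  exists a : F, a != 0 /\ w = a *: v.
Proof.
move=> [vx v0] [wx w0].
have ev : val x = <[v]>%VS.
  apply/esym/eqP; rewrite eqEdim -memvE vx dim_vline v0.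
  by rewrite (eqP (valP x)).
move: wx; rewrite ev => /vlineP[a wE]; exists a; split => //.
by apply: contraNneq w0 => a0; rewrite wE a0 scale0r.
Qed.

Lemma form_scale (p : S) v a d : p \is d.-homog ->
  p.@[(a *: v : V) 0] = a ^+ d * p.@[v 0].
Proof.
move=> hp; rewrite !mevalE mulr_sumr; apply: eq_big_seq => m mp.
have -> : d = mdeg m by move/dhomogP: hp => /(_ m mp).
rewrite mulrCA; congr (_ * _).
rewrite mdegE -prodrXr -big_split /=; apply: eq_bigr => i _.
by rewrite mxE exprMn.
Qed.

Lemma form_neq0 (p : S) x v w : form p -> hcoord x v -> hcoord x w ->
  p.@[v 0] != 0 -> p.@[w 0] != 0.
Proof.
move=> [d hp] xv xw pv; have [a [a0 ->]] := hcoord_scale xv xw.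
by rewrite (form_scale _ _ hp) mulf_neq0 // expf_neq0.
Qed.

Lemma zariski_openT : zariski_open setT.
Proof.
exists [set 1]; split=> [p ->|]; first by exists 0%N; exact: dhomog1.
apply/seteqP; split=> // x _; exists 1; split => //.
by have [v xv] := hcoord_ex x; exists v; rewrite meval1 oner_neq0.
Qed.

Lemma zariski_openI : setI_closed zariski_open.
Proof.
move=> _ _ [B [hB ->]] [C [hC ->]].
exists [set r | exists p q, [/\ B p, C q & r = p * q]]; split.
  move=> _ [p [q [/hB [d pd] /hC [e qe] ->]]].
  by exists (d + e)%N; exact: dhomogM.
apply/seteqP; split=> x.
  move=> [[p [Bp [v [xv pv]]]] [q [Cq [w [xw qw]]]]].
  exists (p * q); split; first by exists p, q.
  exists v; split => //; rewrite mevalM mulf_neq0 //.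
  exact: form_neq0 (hC _ Cq) xw xv qw.
move=> [_ [[p [q [Bp Cq ->]]] [v [xv]]]].
rewrite mevalM mulf_eq0 => /norP[pv qv].
by split; [exists p | exists q]; (split=> //; exists v).
Qed.

Lemma zariski_open_bigU (I : Type) (f : I -> set P) :
  (forall i, zariski_open (f i)) -> zariski_open (\bigcup_i f i).
Proof.
move=> fo.
exists [set p | exists B i, [/\ forall q, B q -> form q,
                               f i = nonzero_locus B & B p]]; split.
  by move=> p [B [i [hB _ Bp]]]; exact: hB.
apply/seteqP; split=> x.
  move=> [i _]; have [B [hB fE]] := fo i.
  rewrite fE => -[p [Bp xp]]; exists p; split => //.
  by exists B, i.
move=> [p [[B [i [hB fE Bp]]] xp]]; exists i => //.
by rewrite fE; exists p.
Qed.

HB.instance Definition _ := isOpenTopological.Build P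
  zariski_openT zariski_openI zariski_open_bigU.

Record ideal := Ideal {
  ideal_set :> S -> Prop;
  ideal0 : ideal_set 0;
  idealD : forall p q, ideal_set p -> ideal_set q -> ideal_set (p + q);
  idealM : forall p q, ideal_set q -> ideal_set (p * q) }.

Definition vanishing X : set S :=
  [set p | forall x v, X x -> hcoord x v -> p.@[v 0] = 0].

Lemma vanishing0 X : vanishing X 0.
Proof. by move=> x v _ _; rewrite meval0. Qed.

Lemma vanishingD X p q : vanishing X p -> vanishing X q -> vanishing X (p + q).
Proof.
by move=> Ip Iq x v Xx xv; rewrite mevalD (Ip x v) // (Iq x v) // addr0.
Qed.

Lemma vanishingM X p q : vanishing X q -> vanishing X (p * q).
Proof. by move=> Iq x v Xx xv; rewrite mevalM (Iq x v) // mulr0. Qed.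

(* The homogeneous ideal of X; it also contains the non-homogeneous
   polynomials whose homogeneous components all vanish on X. *)
Definition vanishing_ideal X : ideal :=
  Ideal (@vanishing0 X) (@vanishingD X) (@vanishingM X).

(* The embedded tangent space at x, as a linear subspace of F^(n+1). *)
Definition tangent X x : set V :=
  [set w | forall p v, vanishing_ideal X p -> hcoord x v ->
    \sum_(i < n.+1) p^`M(i).@[v 0] * w 0 i = 0].

Definition variety X := closed X /\ irreducible X.

Definition nonsingular_at X x := exists m, has_dim X m /\
  exists U : {vspace V}, \dim U = m.+1 /\ tangent X x = [set w | w \in U].

Definition nonsingular X := forall x, X x -> nonsingular_at X x.

Definition manifold X := variety X /\ nonsingular X.

(* The hyperplane, as a linear subspace of F^(n+1), given by a point h of the
   dual projective space, i.e. by a line of linear forms on F^(n+1). *)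
Definition hyperplane h : set V :=
  [set w | forall l, hcoord h l -> \sum_(i < n.+1) l 0 i * w 0 i = 0].

Definition non_degenerate X :=
  forall h, ~ (forall x, X x -> hcoord x `<=` hyperplane h).

Definition secant_variety X : set P :=
  closure [set z : P | exists x y : P, [/\ X x, X y, x <> y &
                                   (val z <= val x + val y)%VS]].

Definition dual_variety X : set P :=
  [set h | exists x, X x /\ tangent X x `<=` hyperplane h].

Definition linear_form (l : V) : S := \sum_(i < n.+1) l 0 i *: 'X_i.

(* The ideal I(X) + (l), where l is an equation of the hyperplane h. *)
Definition section_set X h : set S := [set p | exists q r l,
  [/\ vanishing_ideal X q, l \in val h & p = q + r * linear_form l]].

Lemma section0 X h : section_set X h 0.
Proof.
exists 0, 0, 0; split; [exact: vanishing0 | exact: mem0v |].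
by rewrite mul0r addr0.
Qed.

Lemma sectionD X h p q :
  section_set X h p -> section_set X h q -> section_set X h (p + q).
Proof.
have [v [vh v0]] := hcoord_ex h.
have lin (a : F) (l : V) : linear_form (a *: l) = a%:MP * linear_form l.
  rewrite /linear_form mulr_sumr; apply: eq_bigr => i _.
  by rewrite mxE mul_mpolyC scalerA.
have ev : val h = <[v]>%VS.
  apply/esym/eqP; rewrite eqEdim -memvE vh dim_vline v0.
  by rewrite (eqP (valP h)).
move=> [p1 [r1 [l1 [Ip1 h1 ->]]]] [p2 [r2 [l2 [Ip2 h2 ->]]]].
move: h1 h2; rewrite ev => /vlineP[a1 ->] /vlineP[a2 ->].
exists (p1 + p2), (r1 * a1%:MP + r2 * a2%:MP), v; split.
- exact: vanishingD.
- by [].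
- by rewrite !lin !mulrA mulrDl addrACA.
Qed.

Lemma sectionM X h p q : section_set X h q -> section_set X h (p * q).
Proof.
move=> [q1 [r [l [Iq lh ->]]]]; exists (p * q1), (p * r), l; split => //.
  exact: vanishingM.
by rewrite mulrDr mulrA.
Qed.

Definition section_ideal X h : ideal :=
  Ideal (@section0 X h) (@sectionD X h) (@sectionM X h).

Definition homogeneous_set (A : set S) :=
  forall p d, A p -> A (pihomog mdeg d p).

(* The points of the scheme Proj (S / J): homogeneous primes containing J, but
   not the irrelevant ideal. *)
Definition proj_point (J : ideal) (Q : prime_idealr S) :=
  [/\ homogeneous_set [set p | p \in Q], forall p, J p -> p \in Q &
      exists i, 'X_i \notin Q].

Section Stalk.
Variables (J : ideal) (Q : prime_idealr S).

(* The stalk of the structure sheaf of Proj (S / J) at Q, that is the degree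
   zero part (S / J)_(Q) of the homogeneous localisation. *)
Record hfrac := HFrac {
  hnum : S; hden : S; hdeg : nat;
  hnum_homog : hnum \is hdeg.-homog;
  hden_homog : hden \is hdeg.-homog;
  hden_notin : hden \notin Q }.

HB.instance Definition _ := gen_eqMixin hfrac.
HB.instance Definition _ := gen_choiceMixin hfrac.

Definition hfrac_rel (a b : hfrac) : Prop := exists u,
  [/\ form u, u \notin Q & J (u * (hnum a * hden b - hnum b * hden a))].

Lemma notin_primeM (u v : S) : u \notin Q -> v \notin Q -> u * v \notin Q.
Proof. by move=> uQ vQ; rewrite prime_idealrM negb_or uQ. Qed.

Lemma notin_prime1 : (1 : S) \notin Q.
Proof. by rewrite idealr1. Qed.

Lemma formM (p q : S) : form p -> form q -> form (p * q).
Proof. by move=> [d pd] [e qe]; exists (d + e)%N; exact: dhomogM. Qed.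

Lemma form1 : form 1.
Proof. by exists 0%N; exact: dhomog1. Qed.

Lemma idealN p : J p -> J (- p).
Proof. by move=> Jp; rewrite -mulN1r; exact: idealM. Qed.

Lemma hfrac_relE a b : hnum a * hden b = hnum b * hden a -> hfrac_rel a b.
Proof.
move=> e; exists 1; split; [exact: form1 | exact: notin_prime1 |].
by rewrite e subrr mulr0; exact: ideal0.
Qed.

Definition hfrac_eq : rel hfrac := fun a b => `[< hfrac_rel a b >].

Lemma hfrac_equiv : equiv_class_of hfrac_eq.
Proof.
have sym a b : hfrac_rel a b -> hfrac_rel b a.
  move=> [u [fu uQ Ju]]; exists u; split => //.
  by rewrite -opprB mulrN; exact: idealN.
split.
- by move=> a; apply/asboolP; exact: hfrac_relE.
- by move=> a b; apply/asboolP/asboolP; exact: sym.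
- move=> b a c /asboolP[u [fu uQ Ju]] /asboolP[w [fw wQ Jw]].
  apply/asboolP; exists (u * w * hden b); split.
  + by apply: formM; [exact: formM | exists (hdeg b); exact: hden_homog].
  + by rewrite !notin_primeM // hden_notin.
  + set J1 := _ * _ in Ju; set J2 := _ * _ in Jw.
    have -> : u * w * hden b * (hnum a * hden c - hnum c * hden a) =
       w * hden c * J1 + u * hden a * J2 by rewrite /J1 /J2; ring.
    by apply: idealD; exact: idealM.
Qed.

Canonical hfrac_equiv_rel := EquivRelPack hfrac_equiv.

Definition stalk := {eq_quot hfrac_eq}.

HB.instance Definition _ := Choice.on stalk.
HB.instance Definition _ := EqQuotient.on stalk.

Lemma stalkP a b : reflect (hfrac_rel a b) (a == b %[mod stalk]).
Proof. by rewrite eqmodE; exact: asboolP. Qed.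

Lemma stalk_reprP a : hfrac_rel a (repr (\pi_stalk a)).
Proof. by apply/stalkP; rewrite reprK. Qed.

Definition hfrac_const (p : S) (hp : p \is 0%N.-homog) : hfrac :=
  HFrac hp (dhomog1 _ _) notin_prime1.

Lemma hfrac_opp_homog a : - hnum a \is (hdeg a).-homog.
Proof. by rewrite rpredN; exact: hnum_homog. Qed.

Definition hfrac_opp a : hfrac :=
  HFrac (hfrac_opp_homog a) (hden_homog a) (hden_notin a).

Lemma hfrac_add_homog a b :
  hnum a * hden b + hnum b * hden a \is (hdeg a + hdeg b)%N.-homog.
Proof.
rewrite rpredD //; first exact: dhomogM (hnum_homog a) (hden_homog b).
by rewrite addnC; exact: dhomogM (hnum_homog b) (hden_homog a).
Qed.

Definition hfrac_add a b : hfrac :=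
  HFrac (hfrac_add_homog a b) (dhomogM (hden_homog a) (hden_homog b))
        (notin_primeM (hden_notin a) (hden_notin b)).

Definition hfrac_mul a b : hfrac :=
  HFrac (dhomogM (hnum_homog a) (hnum_homog b))
        (dhomogM (hden_homog a) (hden_homog b))
        (notin_primeM (hden_notin a) (hden_notin b)).

Definition stalk0 : stalk := \pi_stalk (hfrac_const (dhomog0 _ _ _)).
Definition stalk1 : stalk := \pi_stalk (hfrac_const (dhomog1 _ _)).
Definition stalk_opp (x : stalk) : stalk := \pi_stalk (hfrac_opp (repr x)).
Definition stalk_add (x y : stalk) : stalk :=
  \pi_stalk (hfrac_add (repr x) (repr y)).
Definition stalk_mul (x y : stalk) : stalk :=
  \pi_stalk (hfrac_mul (repr x) (repr y)).

Lemma stalk_oppE a : stalk_opp (\pi_stalk a) = \pi_stalk (hfrac_opp a).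
Proof.
have [u [fu uQ Ju]] := stalk_reprP a.
apply/eqP/stalkP; exists u; split => //=.
set b := repr _ in Ju *.
have -> : u * (- hnum b * hden a - - hnum a * hden b) =
  u * (hnum a * hden b - hnum b * hden a) by ring.
by [].
Qed.

Lemma stalk_addE a b :
  stalk_add (\pi_stalk a) (\pi_stalk b) = \pi_stalk (hfrac_add a b).
Proof.
have [u [fu uQ Ju]] := stalk_reprP a; have [w [fw wQ Jw]] := stalk_reprP b.
apply/eqP/stalkP; exists (u * w); split; rewrite ?notin_primeM //=.
  exact: formM.
set a' := repr _ in Ju *; set b' := repr _ in Jw *.
set J1 := _ * _ in Ju; set J2 := _ * _ in Jw.
have -> : u * w * ((hnum a' * hden b' + hnum b' * hden a') * (hden a * hden b)
    - (hnum a * hden b + hnum b * hden a) * (hden a' * hden b')) =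
  - (w * hden b * hden b') * J1 + - (u * hden a * hden a') * J2.
  by rewrite /J1 /J2; ring.
by apply: idealD; exact: idealM.
Qed.

Lemma stalk_mulE a b :
  stalk_mul (\pi_stalk a) (\pi_stalk b) = \pi_stalk (hfrac_mul a b).
Proof.
have [u [fu uQ Ju]] := stalk_reprP a; have [w [fw wQ Jw]] := stalk_reprP b.
apply/eqP/stalkP; exists (u * w); split; rewrite ?notin_primeM //=.
  exact: formM.
set a' := repr _ in Ju *; set b' := repr _ in Jw *.
set J1 := _ * _ in Ju; set J2 := _ * _ in Jw.
have -> : u * w * (hnum a' * hnum b' * (hden a * hden b)
    - hnum a * hnum b * (hden a' * hden b')) =
  - (w * hnum b' * hden b) * J1 + - (u * hnum a * hden a') * J2.
  by rewrite /J1 /J2; ring.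
by apply: idealD; exact: idealM.
Qed.

Lemma stalk_piE a b : hnum a * hden b = hnum b * hden a ->
  \pi_stalk a = \pi_stalk b.
Proof. by move=> e; apply/eqP/stalkP; exact: hfrac_relE. Qed.

Lemma stalk_addA : associative stalk_add.
Proof.
elim/quotW=> a; elim/quotW=> b; elim/quotW=> c.
rewrite (stalk_addE a b) (stalk_addE b c) !stalk_addE.
by apply: stalk_piE => /=; ring.
Qed.

Lemma stalk_addC : commutative stalk_add.
Proof.
elim/quotW=> a; elim/quotW=> b.
by rewrite !stalk_addE; apply: stalk_piE => /=; ring.
Qed.

Lemma stalk_add0 : left_id stalk0 stalk_add.
Proof.
by elim/quotW=> a; rewrite stalk_addE; apply: stalk_piE => /=; ring.
Qed.

Lemma stalk_addN : left_inverse stalk0 stalk_opp stalk_add.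
Proof.
elim/quotW=> a; rewrite stalk_oppE stalk_addE.
by apply: stalk_piE => /=; ring.
Qed.

HB.instance Definition _ := GRing.isZmodule.Build stalk
  stalk_addA stalk_addC stalk_add0 stalk_addN.

Lemma stalk_mulA : associative stalk_mul.
Proof.
elim/quotW=> a; elim/quotW=> b; elim/quotW=> c.
rewrite (stalk_mulE a b) (stalk_mulE b c) !stalk_mulE.
by apply: stalk_piE => /=; ring.
Qed.

Lemma stalk_mulC : commutative stalk_mul.
Proof.
elim/quotW=> a; elim/quotW=> b.
by rewrite !stalk_mulE; apply: stalk_piE => /=; ring.
Qed.

Lemma stalk_mul1 : left_id stalk1 stalk_mul.
Proof.
by elim/quotW=> a; rewrite stalk_mulE; apply: stalk_piE => /=; ring.
Qed.

Lemma stalk_mulDl : left_distributive stalk_mul stalk_add.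
Proof.
elim/quotW=> a; elim/quotW=> b; elim/quotW=> c.
rewrite (stalk_addE a b) (stalk_mulE a c) (stalk_mulE b c).
rewrite stalk_mulE stalk_addE.
by apply: stalk_piE => /=; ring.
Qed.

HB.instance Definition _ := GRing.Zmodule_isComPzRing.Build stalk
  stalk_mulA stalk_mulC stalk_mul1 stalk_mulDl.

End Stalk.

Definition reduced_ring (A : comPzRingType) :=
  forall (a : A) m, a ^+ m = 0 -> a = 0.

(* A is an integral domain which is integrally closed in its fraction field K:
   the injectivity of iota makes A a domain. *)
Definition normal_domain (A : comPzRingType) :=
  exists (K : fieldType) (iota : {rmorphism A -> K}),
  [/\ injective iota,
      forall z, exists a b, iota b != 0 /\ z = iota a / iota b &
      forall z d (c : 'I_d -> A),
        z ^+ d + \sum_(i < d) iota (c i) * z ^+ i = 0 -> exists a, z = iota a].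

Definition reduced_scheme (J : ideal) :=
  forall Q, proj_point J Q -> reduced_ring (stalk J Q).

Definition normal_scheme (J : ideal) :=
  forall Q, proj_point J Q -> normal_domain (stalk J Q).

Section Bundles.
Variable X : set P.

(* The function f of a point y of X and of homogeneous coordinates v of y is,
   near x, a section of O_X(m). *)
Definition regular_at (m : nat) (f : P -> V -> F) x :=
  exists e (a b : S) (U : set P),
  [/\ a \is (e + m)%N.-homog, b \is e.-homog, open U, U x &
      forall y v, X y -> U y -> hcoord y v ->
        b.@[v 0] != 0 /\ f y v = a.@[v 0] / b.@[v 0]].

(* A family of vector spaces over X, with a notion of regularity of a section
   at a point; the values of sections outside X are irrelevant. *)
Record vfamily := Family {
  fiber :> P -> lmodType F;
  regular_section_at : (forall x, fiber x) -> P -> Prop }.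

Variable E : vfamily.

Definition local_frame r (U : set P) (e : 'I_r -> forall x, E x) :=
  [/\ open U,
      forall y, X y -> U y -> forall u : E y,
        exists! c : 'I_r -> F, u = \sum_i c i *: e i y &
      forall (s : forall x, E x) (c : 'I_r -> P -> F),
        (forall y, X y -> U y -> s y = \sum_i c i y *: e i y) ->
        forall x, X x -> U x ->
          (regular_section_at s x <->
           forall i, regular_at 0 (fun y _ => c i y) x)].

Definition vector_bundle r := forall x, X x ->
  exists (U : set P) (e : 'I_r -> forall x, E x), U x /\ local_frame U e.

(* Points of the bundle P(E) of one-dimensional quotients of E: a point of X
   and the kernel of a one-dimensional quotient of the fibre. *)
Record pbundle := PBundle {
  pbase : P;
  pker : set (E pbase);
  pbase_in : X pbase;
  pker_quot : exists phi : {linear E pbase -> F^o},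
    (exists u, phi u <> 0) /\ pker = [set u | phi u = 0] }.

Arguments pker : clear implicits.

HB.instance Definition _ := gen_eqMixin pbundle.
HB.instance Definition _ := gen_choiceMixin pbundle.

(* phi identifies the quotient of the fibre corresponding to q with F. *)
Definition quotient_by (q : pbundle) (phi : {linear E (pbase q) -> F^o}) :=
  pker q = [set u | phi u = 0].

Arguments quotient_by : clear implicits.

Section Coordinates.
Variable r : nat.

(* Polynomials in r fibre coordinates whose coefficients are polynomials in
   the homogeneous coordinates of P^n. *)
Definition bihomog (d m : nat) (p : {mpoly S[r]}) :=
  p \is m.-homog /\ forall mu, p@_mu \is d.-homog.

Definition bieval (p : {mpoly S[r]}) (v : V) (t : 'I_r -> F) : F :=
  (map_mpoly (meval (v 0)) p).@[t].

Definition frame_coords (e : 'I_r -> forall x, E x) (q : pbundle)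
  (phi : {linear E (pbase q) -> F^o}) : 'I_r -> F :=
  fun i => phi (e i (pbase q)).

End Coordinates.

(* The Zariski topology of P(E), generated by the nonvanishing loci of the
   bihomogeneous polynomials in the coordinates given by local frames. *)
Definition pbundle_subbase : set (set pbundle) := [set A |
  exists r (U : set P) (e : 'I_r -> forall x, E x) d m (p : {mpoly S[r]}),
  [/\ local_frame U e, bihomog d m p &
      A = [set q | U (pbase q) /\ exists phi v,
        [/\ quotient_by q phi, hcoord (pbase q) v &
            bieval p v (frame_coords e phi) != 0]]]].

HB.instance Definition _ :=
  isSubBaseTopological.Build pbundle pbundle_subbase id.

(* Sections of O_P(E)(a): the value at q lies in the a-th tensor power of the
   one-dimensional quotient at q, and every identification phi of the latter
   with F makes it a scalar. *)
Definition osection :=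
  forall q : pbundle, {linear E (pbase q) -> F^o} -> F.

Definition global_section (a : nat) (sigma : osection) :=
  forall q0, exists r (W : set pbundle) (U : set P)
    (e : 'I_r -> forall x, E x) d m (f g : {mpoly S[r]}),
  [/\ local_frame U e, open W, W q0, bihomog d (m + a) f /\ bihomog d m g &
      forall q phi v, W q -> quotient_by q phi -> hcoord (pbase q) v ->
        [/\ U (pbase q), bieval g v (frame_coords e phi) != 0 &
            sigma q phi = bieval f v (frame_coords e phi) /
                          bieval g v (frame_coords e phi)]].

Definition globally_generated (a : nat) := forall q, exists sigma phi,
  [/\ global_section a sigma, quotient_by q phi & sigma q phi <> 0].

(* The fibre through q0 of the morphism to projective space defined by the
   global sections of O_P(E)(a). *)
Definition section_fiber (a : nat) (q0 : pbundle) : set pbundle := [set q |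
  exists phi0 phi (c : F), [/\ quotient_by q0 phi0,
    quotient_by q phi, c != 0 &
    forall sigma, global_section a sigma -> sigma q phi = c * sigma q0 phi0]].

Definition k_ample (k : nat) :=
  (exists r, vector_bundle r) /\
  exists a, [/\ (0 < a)%N, globally_generated a &
                forall q, dim_le (section_fiber a q) k].

End Bundles.

Section TwistedNormal.
Variables (X : set P) (x : P).

(* With I the homogeneous ideal of X, the fibre at x of
   N(-1) = Hom(I/I^2, O_X(-1)) consists of the S-linear maps from I to the
   functions of the homogeneous coordinates v of x (S acting on the latter by
   evaluation), taking an element of I of degree d + 1 to a function of degree
   d. S-linearity forces these maps to vanish on I^2. Extending them by 0 for
   p outside I and v outside x makes their equality extensional. *)
Definition normal_map : {pred S -> V -> F^o} := fun phi => `[<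
  [/\ forall p v, ~ (vanishing_ideal X p /\ hcoord x v) -> phi p v = 0,
      forall p q v, vanishing_ideal X p -> vanishing_ideal X q ->
        phi (p + q) v = phi p v + phi q v,
      forall p q v, vanishing_ideal X q ->
        phi (p * q) v = p.@[v 0] * phi q v &
      forall d q v (c : F), vanishing_ideal X q -> q \is d.+1.-homog ->
        c != 0 -> phi q (c *: v) = c ^+ d * phi q v] >].

Lemma normal_map_submod : submod_closed normal_map.
Proof.
split; first by apply/asboolP; split=> *; rewrite /= ?addr0 ?mulr0.
move=> a f g /asboolP[f1 f2 f3 f4] /asboolP[g1 g2 g3 g4].
have E p v : (a *: f + g) p v = a * f p v + g p v by [].
apply/asboolP; split=> [p v h|p q v Ip Iq|p q v Iq|d q v c Iq hq c0];
  rewrite !E.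
- by rewrite f1 // g1 // mulr0 addr0.
- by rewrite f2 // g2 // mulrDr addrACA.
- by rewrite f3 // g3 // mulrDr mulrCA.
- by rewrite (f4 d) // (g4 d) // mulrDr mulrCA.
Qed.

HB.instance Definition _ :=
  GRing.isSubmodClosed.Build F (S -> V -> F^o) normal_map normal_map_submod.

Record tnormal := TNormal { tnormal_val : S -> V -> F^o;
                            tnormalP : tnormal_val \in normal_map }.

HB.instance Definition _ := [isSub for tnormal_val].
HB.instance Definition _ := [Choice of tnormal by <:].
HB.instance Definition _ := [SubChoice_isSubLmodule of tnormal by <:].

End TwistedNormal.

Definition twisted_normal (X : set P) : vfamily :=
  @Family (tnormal X) (fun s x => forall d p,
    vanishing_ideal X p -> p \is d.+1.-homog ->
    regular_at X d (fun y v => tnormal_val (s y) p v) x).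

End Projective.

(* Main.v *)
(* Let x and y be independent points of the cone of X, h a hyperplane containing the tangent space
   at y but not x, and z = x - y.  A Taylor expansion and the Nullstellensatz show that y is
   algebraic over F(z, h): a derivation that kills z and h kills y.  As z lies on the cone of SX,
   counting transcendence degrees by derivations replaces the theorem of Fulton and Hansen.

   If (y, h) is generic in the conormal variety this gives n + N <= s + n*, and the same argument
   for X*, together with biduality, excludes that X* be smooth when SX <> P^N.  If h is constant and
   y runs through a subvariety Z of the contact locus of h, it gives n + dim Z + 1 <= s.

   Near a point, general linear forms identify X with a hypersurface P = 0 which is monic in the
   last variable, and the section by h with a hypersurface R = 0 in one variable less; singular
   points of R come from the contact locus of h, whose dimension is at most s - n - 1.  Hence R has
   no multiple factor if s <= 2 n - 1, and its singular locus has codimension at least two if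
   s <= 2 n - 2; normality then follows by a Hartogs argument over the factorial ring of
   coefficients.  The same charts show that the sections p |-> dp(w) of N(-1), for w a vector,
   generate N(-1); the fibres of the map they define on P(N(-1)) embed into contact loci. *)
From HB Require Import structures.
Require Import Defs.
From mathcomp Require Import all_boot all_order all_algebra.
From mathcomp Require Import perm finmap ring_quotient generic_quotient.
From mathcomp Require Import boolp classical_sets functions topology_structure.
From mathcomp Require Import reals complex.
From mathcomp Require Import mpoly ring zify.
Set Implicit Arguments.
Unset Strict Implicit.
Unset Printing Implicit Defensive.
Import GRing.Theory.
Local Open Scope classical_set_scope.
Local Open Scope quotient_scope.
Local Open Scope ring_scope.

(** Varieties are mere sets of points, so generic points have to be made: in the ring of all
    functions on a cone, or on a product of such sets, Zorn's lemma gives a prime ideal that avoids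
    the polynomial functions not vanishing identically, and its residue field L receives the generic
    coordinates. A chain of closed irreducible sets of length d yields d + 1 coordinates that are
    independent in L, and conversely; the extra one is the scaling of the cone, whence the shifts by
    one in all counts. The integrality of y lives in L['X]. With T = 'X, the points T x and T y
    differ by T z, and an equation of X vanishes at both; so its differential at T y, applied to z,
    is divisible by T with quotient in the Rees algebra of the filtration by degree in y. By
    Cramer's rule the maximal minors at T y, times h.z, are divisible by T as well. As X is smooth,
    minors and equations generate an ideal containing a power of each variable, and comparing
    coefficients of T writes (h.z) y_i^(k+1) as a polynomial of degree k in y over F[z, h]. *)

Definition is_ideal (R : comPzRingType) (P : R -> Prop) :=
  [/\ P 0, forall a b, P a -> P b -> P (a + b) & forall a b, P b -> P (a * b)].

Definition prime_ideal (R : comPzRingType) (P : R -> Prop) :=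
  [/\ is_ideal P, ~ P 1 & forall a b, P (a * b) -> P a \/ P b].

(** * Residue fields, homomorphisms and derivations *)

Section ResidueField.
Variables (R : comPzRingType) (P : R -> Prop).
Hypothesis Pp : prime_ideal P.

Let P0 : P 0. Proof. by case: Pp => -[]. Qed.
Let PD a b : P a -> P b -> P (a + b). Proof. by case: Pp => -[_ + _] _ _; apply. Qed.
Let PM a b : P b -> P (a * b). Proof. by case: Pp => -[_ _ +] _ _; apply. Qed.
Let P1 : ~ P 1. Proof. by case: Pp. Qed.
Let Pprime a b : P (a * b) -> P a \/ P b. Proof. by case: Pp => _ _; apply. Qed.
Let PN a : P a -> P (- a). Proof. by move=> Pa; rewrite -mulN1r; exact: PM. Qed.

(** Fractions with denominator outside P, compared modulo P: the fraction field of R/P is formed in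
    one step, without the quotient ring R/P. *)
Record pfrac := PFrac { pnum : R; pden : R; pdenP : ~ P pden }.
HB.instance Definition _ := gen_eqMixin pfrac.
HB.instance Definition _ := gen_choiceMixin pfrac.

Definition pfrac_rel (x y : pfrac) : bool :=
  `[< P (pnum x * pden y - pnum y * pden x) >].

Lemma pfrac_equiv : equiv_class_of pfrac_rel.
Proof.
split.
- by move=> x; apply/asboolP; rewrite subrr.
- move=> x y; apply/asboolP/asboolP => h; rewrite -opprB; exact: PN.
- move=> y x z /asboolP h1 /asboolP h2; apply/asboolP.
  have : P (pden y * (pnum x * pden z - pnum z * pden x)).
    have -> : pden y * (pnum x * pden z - pnum z * pden x) =
      pden z * (pnum x * pden y - pnum y * pden x) +
      pden x * (pnum y * pden z - pnum z * pden y) by ring.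
    by apply: PD; apply: PM.
  by case/Pprime => // /pdenP.
Qed.

Canonical pfrac_equiv_rel := EquivRelPack pfrac_equiv.
Definition residue_field := {eq_quot pfrac_rel}.
HB.instance Definition _ := Choice.on residue_field.
HB.instance Definition _ := EqQuotient.on residue_field.
Local Notation K := residue_field.

Lemma pfracE x y : reflect (P (pnum x * pden y - pnum y * pden x))
  (x == y %[mod K]).
Proof. by rewrite eqmodE; exact: asboolP. Qed.

Lemma pfrac_pi x y : pnum x * pden y = pnum y * pden x -> \pi_K x = \pi_K y.
Proof. by move=> e; apply/eqP/pfracE; rewrite e subrr. Qed.

Lemma pfrac_repr x : P (pnum x * pden (repr (\pi_K x)) -
  pnum (repr (\pi_K x)) * pden x).
Proof. by apply/pfracE; rewrite reprK. Qed.

Lemma pdenM x y : ~ P (pden x * pden y).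
Proof. by case/Pprime => /pdenP. Qed.

Definition pfadd x y := @PFrac (pnum x * pden y + pnum y * pden x) _ (@pdenM x y).
Definition pfmul x y := @PFrac (pnum x * pnum y) _ (@pdenM x y).
Definition pfopp x := @PFrac (- pnum x) _ (@pdenP x).
Definition pfof a := @PFrac a 1 P1.
Definition pfinv x := if pselect (P (pnum x)) is right h then PFrac (pden x) h
  else pfof 0.

Definition rf_add (x y : K) := \pi_K (pfadd (repr x) (repr y)).
Definition rf_mul (x y : K) := \pi_K (pfmul (repr x) (repr y)).
Definition rf_opp (x : K) := \pi_K (pfopp (repr x)).
Definition rf_inv (x : K) := \pi_K (pfinv (repr x)).
Definition rf_of a := \pi_K (pfof a).

Lemma rf_addE x y : rf_add (\pi_K x) (\pi_K y) = \pi_K (pfadd x y).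
Proof.
apply/eqP/pfracE => /=; move: (pfrac_repr x) (pfrac_repr y).
set x' := repr _; set y' := repr _ => hx hy.
have -> : (pnum x' * pden y' + pnum y' * pden x') * (pden x * pden y) -
   (pnum x * pden y + pnum y * pden x) * (pden x' * pden y') =
   - (pden y * pden y') * (pnum x * pden x' - pnum x' * pden x)
   - (pden x * pden x') * (pnum y * pden y' - pnum y' * pden y) by ring.
by apply: PD; [apply: PM | apply: PN; apply: PM].
Qed.

Lemma rf_mulE x y : rf_mul (\pi_K x) (\pi_K y) = \pi_K (pfmul x y).
Proof.
apply/eqP/pfracE => /=; move: (pfrac_repr x) (pfrac_repr y).
set x' := repr _; set y' := repr _ => hx hy.
have -> : pnum x' * pnum y' * (pden x * pden y) -
   pnum x * pnum y * (pden x' * pden y') =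
   - (pnum y' * pden y) * (pnum x * pden x' - pnum x' * pden x)
   - (pnum x * pden x') * (pnum y * pden y' - pnum y' * pden y) by ring.
by apply: PD; [apply: PM | apply: PN; apply: PM].
Qed.

Lemma rf_oppE x : rf_opp (\pi_K x) = \pi_K (pfopp x).
Proof.
apply/eqP/pfracE => /=; move: (pfrac_repr x); set x' := repr _ => hx.
by have -> : - pnum x' * pden x - - pnum x * pden x' =
   pnum x * pden x' - pnum x' * pden x by ring.
Qed.

Lemma rf_addA : associative rf_add.
Proof.
elim/quotW=> a; elim/quotW=> b; elim/quotW=> c.
rewrite (rf_addE b c) (rf_addE a b) !rf_addE.
by apply: pfrac_pi => /=; ring.
Qed.

Lemma rf_addC : commutative rf_add.
Proof.
by elim/quotW=> a; elim/quotW=> b; rewrite !rf_addE; apply: pfrac_pi => /=; ring.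
Qed.

Lemma rf_add0 : left_id (rf_of 0) rf_add.
Proof. by elim/quotW=> a; rewrite rf_addE; apply: pfrac_pi => /=; ring. Qed.

Lemma rf_addN : left_inverse (rf_of 0) rf_opp rf_add.
Proof.
by elim/quotW=> a; rewrite rf_oppE rf_addE; apply: pfrac_pi => /=; ring.
Qed.

HB.instance Definition _ := GRing.isZmodule.Build residue_field
  rf_addA rf_addC rf_add0 rf_addN.

Lemma rf_mulA : associative rf_mul.
Proof.
elim/quotW=> a; elim/quotW=> b; elim/quotW=> c.
rewrite (rf_mulE b c) (rf_mulE a b) !rf_mulE.
by apply: pfrac_pi => /=; ring.
Qed.

Lemma rf_mulC : commutative rf_mul.
Proof.
by elim/quotW=> a; elim/quotW=> b; rewrite !rf_mulE; apply: pfrac_pi => /=; ring.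
Qed.

Lemma rf_mul1 : left_id (rf_of 1) rf_mul.
Proof. by elim/quotW=> a; rewrite rf_mulE; apply: pfrac_pi => /=; ring. Qed.

Lemma rf_mulDl : left_distributive rf_mul rf_add.
Proof.
elim/quotW=> a; elim/quotW=> b; elim/quotW=> c.
rewrite (rf_addE a b) (rf_mulE a c) (rf_mulE b c) rf_mulE rf_addE.
by apply: pfrac_pi => /=; ring.
Qed.

Lemma rf_of_eq0 a : rf_of a = rf_of 0 <-> P a.
Proof.
split=> [/eqP/pfracE /=|h]; first by rewrite mulr1 mul0r subr0.
by apply/eqP/pfracE => /=; rewrite mulr1 mul0r subr0.
Qed.

Lemma rf_1neq0 : rf_of 1 != rf_of 0.
Proof. by apply/eqP => /rf_of_eq0. Qed.

HB.instance Definition _ := GRing.Zmodule_isComNzRing.Build residue_field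
  rf_mulA rf_mulC rf_mul1 rf_mulDl rf_1neq0.

Lemma rf_eq0 x : (\pi_K x == rf_of 0) = `[< P (pnum x) >].
Proof.
apply/pfracE/asboolP => /=; by rewrite mulr1 mul0r subr0.
Qed.

Lemma rf_mulV (x : K) : x != 0 -> rf_inv x * x = 1.
Proof.
elim/quotW: x => x x0; rewrite /rf_inv.
have rx : repr (\pi_K x) = x %[mod K] by rewrite reprK.
rewrite -{2}rx [LHS]rf_mulE; apply/eqP/pfracE => /=.
have h : ~ P (pnum (repr (\pi_K x))).
  by move/asboolP; rewrite -rf_eq0 rx; apply/negP.
rewrite /pfinv; case: pselect => // h' /=.
by rewrite mulr1 mul1r mulrC subrr.
Qed.

Lemma rf_inv0 : rf_inv 0 = 0.
Proof.
rewrite /rf_inv /pfinv; case: pselect => // -[].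
by apply/asboolP; rewrite -rf_eq0 reprK.
Qed.

HB.instance Definition _ := GRing.ComNzRing_isField.Build residue_field
  rf_mulV rf_inv0.

Lemma rf_of_additive : zmod_morphism rf_of.
Proof.
move=> a b; change (rf_of (a - b) = rf_add (rf_of a) (rf_opp (rf_of b))).
rewrite /rf_of rf_oppE rf_addE; by apply: pfrac_pi => /=; ring.
Qed.
HB.instance Definition _ := GRing.isZmodMorphism.Build R residue_field rf_of
  rf_of_additive.
Lemma rf_of_multiplicative : monoid_morphism rf_of.
Proof.
split=> // a b; change (rf_of (a * b) = rf_mul (rf_of a) (rf_of b)).
rewrite /rf_of rf_mulE; by apply: pfrac_pi => /=; ring.
Qed.
HB.instance Definition _ := GRing.isMonoidMorphism.Build R residue_field rf_of
  rf_of_multiplicative.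

Lemma prime_residue_field : exists (L : fieldType) (g : {rmorphism R -> L}),
  (forall a, g a = 0 <-> P a) /\ (forall z, exists a b, g b != 0 /\ z = g a / g b).
Proof.
exists residue_field, rf_of; split; first exact: rf_of_eq0.
elim/quotW=> x; exists (pnum x), (pden x).
have d0 : rf_of (pden x) != 0 by apply/eqP => /rf_of_eq0 /pdenP.
split=> //; apply: (mulIf d0); rewrite divfK //.
change (rf_mul (\pi_K x) (rf_of (pden x)) = rf_of (pnum x)).
by rewrite /rf_of rf_mulE; apply: pfrac_pi => /=; ring.
Qed.
End ResidueField.

(** Krull's argument: an ideal maximal among those containing I and disjoint from the multiplicative
    set S is prime, for if a and b lay outside it, both enlarged ideals would meet S, and a product
    of two such elements of S would fall into the ideal. *)
Lemma prime_avoiding (R : comPzRingType) (I S : R -> Prop) : is_ideal I ->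
  S 1 -> (forall a b, S a -> S b -> S (a * b)) -> (forall a, I a -> ~ S a) ->
  exists P : R -> Prop, [/\ prime_ideal P, forall a, I a -> P a &
    forall a, P a -> ~ S a].
Proof.
move=> [I0 ID IM] S1 SM IS.
pose Q (A : set R) := [/\ A 0, forall a b, A a -> A b -> A (a + b),
  forall a b, A b -> A (a * b) & forall a, A a -> ~ S a] .
(* The union with I makes the condition hold for the empty set too, which is the union of the empty
   chain in Zorn's lemma. *)
pose Q' A := Q (A `|` I)%classic.
have QI : Q' set0 by split=> [|a b [//|Ia] [//|Ib]|a b [//|Ib]|a [//|Ia]];
  [right; exact: I0 | right; exact: ID | right; exact: IM | exact: IS].
have [|A [QA maxA]] := @Zorn_bigcup R Q'.
  move=> F FQ tot; split.
  - by right.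
  - move=> a b [[X FX Xa]|Ia] [[Y FY Yb]|Ib].
    + wlog XY : a b X Y FX FY Xa Yb / (X `<=` Y)%classic.
        move=> H; case: (tot X Y FX FY) => ?; first exact: (H a b X Y).
        by rewrite addrC; apply: (H b a Y X).
      have [_ D _ _] := FQ _ FY.
      have [|] := D a b (or_introl (XY _ Xa)) (or_introl Yb); last by right.
      by left; exists Y.
    + have [_ D _ _] := FQ _ FX.
      have [|] := D a b (or_introl Xa) (or_intror Ib); last by right.
      by left; exists X.
    + have [_ D _ _] := FQ _ FY.
      have [|] := D a b (or_intror Ia) (or_introl Yb); last by right.
      by left; exists Y.
    + by right; exact: ID.
  - move=> a b [[X FX Xb]|Ib]; last by right; exact: IM.
    have [_ _ M _] := FQ _ FX.
    have [|] := M a b (or_introl Xb); last by right.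
    by left; exists X.
  - move=> a [[X FX Xa]|]; last exact: IS.
    by have [_ _ _] := FQ _ FX; apply; left.
exists (A `|` I)%classic; have [A0 AD AM AS] := QA; split; last exact: AS.
2: by right.
split=> [|/AS//|a b]; first by split.
move=> Pab; apply: contrapT => /not_orP [na nb].
have ext c : ~ (A `|` I)%classic c -> exists s r, S s /\
    (A `|` I)%classic (s - r * c).
  move=> nc; pose A' : set R := [set x | exists r, (A `|` I)%classic (x - r * c)]%classic.
  have h0 x : (A `|` I)%classic x -> A' x.
    by move=> ?; exists 0; rewrite mul0r subr0.
  have h : ~ Q' A'.
    apply: maxA; split=> [x Ax|A'A]; first by apply: h0; left.
    by apply: nc; left; apply: A'A; exists 1; rewrite mul1r subrr; exact: A0.
  have : ~ forall x, A' x -> ~ S x.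
    move=> nS; apply: h; split.
    - by right.
    - move=> x y; have hx z : (A' `|` I)%classic z -> A' z.
        by case=> // Iz; apply: h0; right.
      move=> /hx [r hr] /hx [t ht]; left; exists (r + t).
      have -> : x + y - (r + t) * c = (x - r * c) + (y - t * c) by ring.
      exact: AD.
    - move=> x y [[r hr]|Iy]; last by right; exact: IM.
      left; exists (x * r); rewrite -mulrA -mulrBr; exact: AM.
    - by move=> x [/nS //|]; exact: IS.
  move=> /existsNP [x /not_implyP [[r hr] /contrapT Sx]].
  by exists x, r.
have [s [r [Ss hs]]] := ext _ na; have [t [q [St ht]]] := ext _ nb.
apply: (AS (s * t)); last exact: SM.
have -> : s * t = t * (s - r * a) + r * a * (t - q * b) + r * q * (a * b) by ring.
by apply: (AD); [apply: (AD)|]; apply: (AM).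
Qed.

(** The source of all generic points: I collects what must vanish at the point and S what must
    not. *)
Lemma generic_field (R : comPzRingType) (I S : R -> Prop) : is_ideal I ->
  S 1 -> (forall a b, S a -> S b -> S (a * b)) -> (forall a, I a -> ~ S a) ->
  exists (L : fieldType) (g : {rmorphism R -> L}),
    (forall a, I a -> g a = 0) /\ (forall a, S a -> g a != 0).
Proof.
move=> Ii S1 SM IS; have [P [Pp IP PS]] := prime_avoiding Ii S1 SM IS.
have [L [g [gP _]]] := prime_residue_field Pp.
exists L, g; split=> a; first by move/IP/gP.
by move=> Sa; apply/eqP => /gP /PS.
Qed.

(* A derivation is a ring homomorphism to the dual numbers a + b eps. *)
Definition dual (R : comNzRingType) : Type := (R * R)%type.
Definition Dual (R : comNzRingType) (a b : R) : dual R := (a, b).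
Definition dfst (R : comNzRingType) (x : dual R) : R := x.1.
Definition dsnd (R : comNzRingType) (x : dual R) : R := x.2.
Section Dual.
Variable R : comNzRingType.
HB.instance Definition _ := GRing.Zmodule.copy (dual R) (R * R)%type.
Definition dual_mul (x y : dual R) : dual R := (x.1 * y.1, x.1 * y.2 + x.2 * y.1).
Definition dual_one : dual R := (1, 0).
Fact dual_mulA : associative dual_mul.
Proof. by move=> x y z; congr (_, _) => /=; ring. Qed.
Fact dual_mulC : commutative dual_mul.
Proof. by move=> x y; congr (_, _) => /=; ring. Qed.
Fact dual_mul1 : left_id dual_one dual_mul.
Proof. by move=> [x y]; congr (_, _) => /=; ring. Qed.
Fact dual_mulD : left_distributive dual_mul +%R.
Proof. by move=> [a b] [c d] [e f]; congr (_, _) => /=; ring. Qed.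
Fact dual_1neq0 : dual_one != 0.
Proof. by apply/eqP => -[/eqP]; rewrite oner_eq0. Qed.
HB.instance Definition _ := GRing.Zmodule_isComNzRing.Build (dual R)
  dual_mulA dual_mulC dual_mul1 dual_mulD dual_1neq0.
Lemma dfstM (x y : dual R) : dfst (x * y) = dfst x * dfst y. Proof. by []. Qed.
Lemma dsndM (x y : dual R) : dsnd (x * y) = dfst x * dsnd y + dsnd x * dfst y.
Proof. by []. Qed.
Lemma dfstD (x y : dual R) : dfst (x + y) = dfst x + dfst y. Proof. by []. Qed.
Lemma dsndD (x y : dual R) : dsnd (x + y) = dsnd x + dsnd y. Proof. by []. Qed.
Lemma dual_eq (x y : dual R) : dfst x = dfst y -> dsnd x = dsnd y -> x = y.
Proof. by case: x y => a b [c d]; rewrite /dfst /dsnd /= => -> ->. Qed.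
End Dual.

Section Subring.
Variable R : comNzRingType.
Implicit Types (K : R -> Prop) (p q : {poly R}).

Definition subring K :=
  [/\ K 1, forall a b, K a -> K b -> K (a - b) & forall a b, K a -> K b -> K (a * b)].

Lemma subring0 K : subring K -> K 0.
Proof. by case=> K1 KB _; rewrite -(subrr 1); exact: KB. Qed.
Lemma subringN K a : subring K -> K a -> K (- a).
Proof. by move=> sK Ka; rewrite -sub0r; case: (sK) => _ KB _; apply: KB => //; exact: subring0. Qed.
Lemma subringD K a b : subring K -> K a -> K b -> K (a + b).
Proof. by move=> sK Ka Kb; rewrite -[b]opprK; case: (sK) => _ KB _; apply: KB => //; exact: subringN. Qed.
Lemma subring_sum K I (r : seq I) (P : pred I) (f : I -> R) : subring K ->
  (forall i, P i -> K (f i)) -> K (\sum_(i <- r | P i) f i).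
Proof.
move=> sK Kf; apply: big_ind => //; first exact: subring0.
by move=> ? ?; exact: subringD.
Qed.
Lemma subringX K a n : subring K -> K a -> K (a ^+ n).
Proof.
move=> [K1 KB KM] Ka; elim: n => [|n IH]; first by rewrite expr0.
by rewrite exprS; exact: KM.
Qed.

Definition poly_in K p := forall i, K p`_i.
Definition adjoin K t := fun a => exists p, poly_in K p /\ a = p.[t].
Definition adjoins K (s : seq R) := foldl adjoin K s.

Section PolyIn.
Variable K : R -> Prop.
Hypothesis sK : subring K.
Lemma poly_inC a : K a -> poly_in K a%:P.
Proof. by move=> Ka i; rewrite coefC; case: ifP => // _; exact: subring0. Qed.
Lemma poly_inX : poly_in K 'X.
Proof. by move=> i; rewrite coefX; case: (i == _); [case: sK|exact: subring0]. Qed.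
Lemma poly_inB p q : poly_in K p -> poly_in K q -> poly_in K (p - q).
Proof. by move=> hp hq i; rewrite coefB; case: sK => _ KB _; exact: KB. Qed.
Lemma poly_inM p q : poly_in K p -> poly_in K q -> poly_in K (p * q).
Proof.
move=> hp hq i; rewrite coefM; apply: subring_sum => // j _.
by case: sK => _ _ KM; exact: KM.
Qed.
End PolyIn.
End Subring.

Lemma subring_poly (R : comNzRingType) (K : R -> Prop) :
  subring K -> subring (poly_in K).
Proof.
move=> sK; split; [by apply: poly_inC; case: (sK)|exact: poly_inB|exact: poly_inM].
Qed.

Section Adjoin.
Variable R : comNzRingType.
Implicit Types (K : R -> Prop) (p q : {poly R}).

Lemma subring_adjoin K t : subring K -> subring (adjoin K t).
Proof.
move=> sK; have [P1 PB PM] := subring_poly sK; split.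
- by exists 1; split => //; rewrite hornerE.
- move=> _ _ [p [hp ->]] [q [hq ->]]; exists (p - q); split; last by rewrite !hornerE.
  exact: PB.
- move=> _ _ [p [hp ->]] [q [hq ->]]; exists (p * q); split; last by rewrite !hornerE.
  exact: PM.
Qed.

Lemma sub_adjoin K t a : subring K -> K a -> adjoin K t a.
Proof. by move=> sK Ka; exists a%:P; rewrite hornerC; split=> //; exact: poly_inC. Qed.

Lemma mem_adjoin K t : subring K -> adjoin K t t.
Proof. by move=> sK; exists 'X; rewrite hornerX; split=> //; exact: poly_inX. Qed.

Lemma adjoins_spec K (s : seq R) : subring K ->
  [/\ subring (adjoins K s), forall a, K a -> adjoins K s a &
      forall t, t \in s -> adjoins K s t].
Proof.
elim: s K => [|t s IH] K sK /=; first by split.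
have [sA KA sub] := IH _ (subring_adjoin t sK); split=> //.
  by move=> a Ka; apply: KA; exact: sub_adjoin.
move=> u; rewrite inE => /orP[/eqP ->|/sub //]; apply: KA; exact: mem_adjoin.
Qed.

End Adjoin.

Section HomExt.
Variables (L : fieldType) (K : L -> Prop).
Hypothesis sK : subring K.
Implicit Types (p q : {poly L}).

(** Homomorphisms are total functions constrained on a subring only, so that rings can grow by
    adjunction inside the fixed field L. *)
Definition hom_on (R : comNzRingType) (A : L -> Prop) (f : L -> R) :=
  [/\ f 1 = 1, forall a b, A a -> A b -> f (a - b) = f a - f b &
      forall a b, A a -> A b -> f (a * b) = f a * f b].

Lemma pseudo_div p q : poly_in K p -> poly_in K q -> q != 0 ->
  exists k s r, [/\ poly_in K s, poly_in K r,
    lead_coef q ^+ k *: p = s * q + r & (size r < size q)%N].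
Proof.
move=> hp hq q0; have [P1 PB PM] := subring_poly sK.
have PC a : K a -> poly_in K a%:P by exact: poly_inC.
have Kl : K (lead_coef q) by exact: hq.
have [n] := ubnP (size p); elim: n p hp => // n IH p hp pn.
have [lt|le] := ltnP (size p) (size q).
  exists 0%N, 0, p; split=> //; first by move=> i; rewrite coef0; exact: subring0.
  by rewrite expr0 scale1r mul0r add0r.
have p0 : p != 0 by rewrite -size_poly_gt0 (leq_trans _ le) // size_poly_gt0.
pose m := 'X^(size p - size q) * (lead_coef p)%:P : {poly L}.
have hm : poly_in K m.
  apply: PM; last by apply: PC; exact: hp.
  exact: (@subringX _ (poly_in K) 'X _ (subring_poly sK) (poly_inX sK)).
pose p' := lead_coef q *: p - m * q.
have hp' : poly_in K p' by apply: PB; [rewrite -mul_polyC; apply: PM => //; exact: PC|exact: PM].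
have sp' : (size p' < size p)%N.
  have sp : (0 < size p)%N by rewrite size_poly_gt0.
  rewrite -[X in (_ < X)%N](prednK sp) ltnS; apply/leq_sizeP => j.
  rewrite leq_eqVlt => /orP[/eqP <-|lj]; rewrite coefB coefZ mulrAC coefMC.
    have q1 : (0 < size q)%N by rewrite size_poly_gt0.
    rewrite coefXnM ifF; last by apply/negbTE; lia.
    have -> : ((size p).-1 - (size p - size q) = (size q).-1)%N.
      by lia.
    by rewrite mulrC subrr.
  rewrite (nth_default 0 (s := p)); last by rewrite -(prednK sp).
  rewrite coefXnM; case: ifP => [_|/negbT]; first by rewrite mulr0 mul0r subrr.
  rewrite -leqNgt => lej; rewrite (nth_default 0 (s := q)) ?mulr0 ?mul0r ?subrr //.
  by rewrite leq_subRL // subnK // -(prednK sp).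
have [|k [s [r [hs hr e sr]]]] := IH p' hp'; first by rewrite (leq_trans sp').
exists k.+1, (s + lead_coef q ^+ k *: m), r; split=> //.
  apply: (subringD (subring_poly sK)) => //; rewrite -mul_polyC; apply: PM => //.
  by apply: PC; exact: subringX.
rewrite exprSr -scalerA mulrDl addrAC -e /p' scalerBr -scalerAl.
by rewrite subrK.
Qed.

Variable t : L.
Definition transc := forall p, poly_in K p -> p.[t] = 0 -> p = 0.
(** Substitute for the minimal polynomial over a ring: of least size, but neither monic nor
    unique. *)
Definition minimal_at p0 := [/\ poly_in K p0, p0 != 0, p0.[t] = 0 &
  forall p, poly_in K p -> p.[t] = 0 -> (size p < size p0)%N -> p = 0].

Lemma transc_or_minimal : transc \/ exists p0, minimal_at p0.
Proof.
have [h|/existsNP [p /not_implyP [hp /not_implyP [pt p0]]]] := pselect transc.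
  by left.
right; have [n] := ubnP (size p).
elim: n p hp pt p0 => // n IH p hp pt p0 pn.
have [h|] := pselect (forall q, poly_in K q -> q.[t] = 0 ->
  (size q < size p)%N -> q = 0).
  by exists p; split=> //; apply/eqP.
move=> /existsNP [q /not_implyP [hq /not_implyP [qt /not_implyP [qp q0]]]].
by apply: (IH q) => //; rewrite (leq_trans qp).
Qed.

Section Ext.
Variables (R : comNzRingType) (f : L -> R).
Hypothesis hf : hom_on K f.

Lemma hom_on0 : f 0 = 0.
Proof. by case: hf => _ fB _; rewrite -(subrr 1) fB ?subrr //; case: sK. Qed.
Lemma hom_onD a b : K a -> K b -> f (a + b) = f a + f b.
Proof.
move=> Ka Kb; case: hf => _ fB _.
have -> : a + b = a - (0 - b) by rewrite sub0r opprK.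
have K0 := subring0 sK; rewrite fB //; last by case: sK => _ KB _; exact: KB.
by rewrite fB // hom_on0 sub0r opprK.
Qed.
Lemma hom_on_sum I (r : seq I) (g : I -> L) : (forall i, K (g i)) ->
  f (\sum_(i <- r) g i) = \sum_(i <- r) f (g i).
Proof.
move=> Kg; elim: r => [|i r IH]; first by rewrite !big_nil hom_on0.
by rewrite !big_cons hom_onD ?IH //; exact: subring_sum.
Qed.

Definition pev r p := (map_poly f p).[r].
Lemma pevB r p q : poly_in K p -> poly_in K q -> pev r (p - q) = pev r p - pev r q.
Proof.
move=> hp hq; rewrite /pev -hornerN -hornerD; congr horner; apply/polyP => i.
rewrite coefB !coef_map_id0 ?hom_on0 // coefB.
by case: hf => _ fB _; rewrite fB.
Qed.
Lemma pevM r p q : poly_in K p -> poly_in K q -> pev r (p * q) = pev r p * pev r q.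
Proof.
move=> hp hq; rewrite /pev -hornerM; congr horner; apply/polyP => i.
rewrite coefM !coef_map_id0 ?hom_on0 // coefM hom_on_sum.
  apply: eq_bigr => j _; rewrite !coef_map_id0 ?hom_on0 //.
  by case: hf => _ _ fM; rewrite fM.
by move=> j; case: sK => _ _ KM; exact: KM.
Qed.
Lemma pevC r a : pev r a%:P = f a.
Proof.
rewrite /pev; suff -> : map_poly f a%:P = (f a)%:P by rewrite hornerC.
apply/polyP => i; rewrite coef_map_id0 ?hom_on0 // !coefC.
by case: ifP => // _; rewrite hom_on0.
Qed.
Lemma pevX r : pev r 'X = r.
Proof.
rewrite /pev; suff -> : map_poly f 'X = 'X by rewrite hornerX.
apply/polyP => i; rewrite coef_map_id0 ?hom_on0 // !coefX.
by case: (i == _); rewrite ?hom_on0 //; case: hf.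
Qed.

Lemma hom_ext r : (forall p, poly_in K p -> p.[t] = 0 -> pev r p = 0) ->
  exists g : L -> R, [/\ hom_on (adjoin K t) g, forall a, K a -> g a = f a,
    g t = r & forall p, poly_in K p -> g p.[t] = pev r p].
Proof.
move=> wd; have [P1 PB PM] := subring_poly sK.
pose g a := if pselect (exists p, poly_in K p /\ a = p.[t]) is left h
  then pev r (projT1 (cid h)) else 0.
have gE p : poly_in K p -> g p.[t] = pev r p.
  move=> hp; rewrite /g; case: pselect => [h|[]]; last by exists p.
  case: cid => q /= [hq e]; apply/eqP; rewrite -subr_eq0 -pevB //; apply/eqP/wd.
    exact: PB.
  by rewrite !hornerE e subrr.
exists g; split=> //; last by rewrite -[in g t](hornerX t) gE ?pevX //; exact: poly_inX.
  split.
  - by rewrite -(hornerC 1 t) gE // pevC; case: hf.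
  - move=> _ _ [p [hp ->]] [q [hq ->]].
    by rewrite -hornerN -hornerD !gE ?pevB //; exact: PB.
  - move=> _ _ [p [hp ->]] [q [hq ->]].
    by rewrite -hornerM !gE ?pevM //; exact: PM.
by move=> a Ka; rewrite -[in g a](hornerC a t) gE ?pevC //; exact: (poly_inC sK).
Qed.

(** Pseudo-division by [p0] leaves a remainder that kills t and is shorter than [p0], hence zero: a
    power of the leading coefficient times p is a multiple of [p0]. The image of that coefficient is
    asked to be regular rather than nonzero, since R may be the ring of dual numbers. *)
Lemma hom_ext_alg p0 r : minimal_at p0 -> pev r p0 = 0 ->
  (forall x, f (lead_coef p0) * x = 0 -> x = 0) ->
  forall p, poly_in K p -> p.[t] = 0 -> pev r p = 0.
Proof.
move=> [h0 n0 r0 min] e0 reg p hp pt.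
have [k [s [q [hs hq e sq]]]] := pseudo_div hp h0 n0.
have Kl : K (lead_coef p0) by exact: h0.
have q0 : q = 0.
  apply: min => //; have := congr1 (fun u => u.[t]) e.
  by rewrite /= !hornerE pt r0 !mulr0 add0r => <-.
have : pev r (lead_coef p0 ^+ k *: p) = 0.
  by rewrite e q0 addr0 pevM // e0 mulr0.
rewrite -mul_polyC pevM //; last by apply: poly_inC => //; exact: subringX.
rewrite pevC; elim: k {e} => [|k IH]; first by rewrite expr0; case: hf => -> _ _; rewrite mul1r.
have Kk : K (lead_coef p0 ^+ k) by exact: subringX.
by rewrite exprS; case: hf => _ _ fM; rewrite fM // -mulrA => /reg /IH.
Qed.

End Ext.

(** Euclidean descent: the remainder of [p0] by q has at t a value that is a multiple of q(t), and
    sizes drop down to a constant. A remainder vanishing at t would be zero, and the quotient would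
    then be a polynomial shorter than [p0] that kills t. *)
Lemma minimal_invertible p0 : minimal_at p0 -> forall q, poly_in K q ->
  q.[t] != 0 -> exists c, poly_in K c /\ exists e, [/\ K e, e != 0 & c.[t] * q.[t] = e].
Proof.
move=> [h0 n0 r0 min] q hq qt; have [P1 PB PM] := subring_poly sK.
have KX a n : K a -> K (a ^+ n) by move=> ?; exact: subringX.
have PZ a p : K a -> poly_in K p -> poly_in K (a *: p).
  by move=> Ka hp; rewrite -mul_polyC; apply: PM => //; exact: (poly_inC sK).
have K0 := subring0 sK.
have P0 : poly_in K 0 by move=> i; rewrite coef0.
suff H n : forall q, poly_in K q -> q.[t] != 0 -> (size q < n)%N -> (size q < size p0)%N ->
    exists c, poly_in K c /\ exists e, [/\ K e, e != 0 & c.[t] * q.[t] = e].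
  have [k [s [r [hs hr e sr]]]] := pseudo_div hq h0 n0.
  have e' : r.[t] = lead_coef p0 ^+ k * q.[t].
    by have := congr1 (fun u => u.[t]) e; rewrite /= !hornerE r0 mulr0 add0r => <-.
  have [|c [hc [a [Ka a0 ea]]]] := H _ r hr _ (ltnSn _) sr.
    by rewrite e' mulf_neq0 // expf_neq0 // lead_coef_eq0.
  exists (lead_coef p0 ^+ k *: c); split; first by apply: PZ => //; apply: KX; exact: h0.
  by exists a; split=> //; rewrite -ea e' hornerZ; ring.
elim: n => // n IH q' hq' qt' sq' sp.
have q0' : q' != 0 by apply: contraNneq qt' => ->; rewrite horner0.
have [s1|s1] := leqP (size q') 1.
  exists 1; split=> //; exists q'.[t]; split=> //; last by rewrite hornerE mul1r.
  by rewrite (size1_polyC s1) hornerC.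
have [k [s [r [hs hr e sr]]]] := pseudo_div h0 hq' q0'.
have e' : r.[t] = - s.[t] * q'.[t].
  have := congr1 (fun u => u.[t]) e; rewrite /= !hornerE r0 mulr0 => /eqP.
  by rewrite eq_sym addrC addr_eq0 => /eqP ->; rewrite mulNr.
have rt : r.[t] != 0.
  apply/eqP => rt0; have r0' : r = 0 by apply: min => //; exact: ltn_trans sr sp.
  have st : s.[t] = 0.
    apply/eqP; move: e'; rewrite rt0 => /esym/eqP.
    by rewrite mulf_eq0 oppr_eq0 (negbTE qt') orbF.
  move: e; rewrite r0' addr0 => e.
  have lk : lead_coef q' ^+ k != 0 by rewrite expf_neq0 // lead_coef_eq0.
  have s0 : s != 0.
    apply/eqP => s0; move/eqP: e; rewrite s0 mul0r scaler_eq0 (negbTE lk).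
    by rewrite (negbTE n0).
  have := congr1 (fun u : {poly L} => size u) e; rewrite /= size_scale // size_mul // => es.
  move/eqP: s0; apply; apply: min => //; rewrite es.
  by rewrite -subn1 -addnBA ?(ltnW s1) // -[X in (X < _)%N]addn0 ltn_add2l subn_gt0.
have [||c [hc [a [Ka a0 ea]]]] := IH r hr rt.
- by rewrite (leq_trans sr).
- exact: ltn_trans sr sp.
exists (- (c * s)); split; first by rewrite -sub0r; apply: PB => //; exact: PM.
by exists a; split=> //; rewrite -ea e' hornerN hornerM; ring.
Qed.

(* Atiyah-Macdonald 5.23, for one generator. *)
Lemma hom_ext1 b : adjoin K t b -> b != 0 -> exists a, [/\ K a, a != 0 &
  forall (W : closedFieldType) (f : L -> W), hom_on K f -> f a != 0 ->
  exists g : L -> W, [/\ hom_on (adjoin K t) g, forall x, K x -> g x = f x &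
    g b != 0]].
Proof.
move=> [q [hq ->]] qt; have [P1 PB PM] := subring_poly sK.
have [tr|[p0 m0]] := transc_or_minimal.
  exists (lead_coef q); split; first exact: hq.
    by rewrite lead_coef_eq0; apply: contraNneq qt => ->; rewrite horner0.
  move=> W f hf fl; pose Q := map_poly f q.
  (* Here t is transcendental and may be sent anywhere off the zeros of Q; such a point is found as
     a root of Q - 1, unless Q - 1 is a nonzero constant. *)
  have [r Qr] : exists r, Q.[r] != 0.
    have [s1|s1] := boolP (size (Q - 1%:P) == 1%N); last first.
      have /closed_rootP[r] := s1; rewrite /root !hornerE subr_eq0 => /eqP e.
      by exists r; rewrite e oner_neq0.
    have /size_poly1P[c c0 e] := s1.
    have : Q = (c + 1)%:P by rewrite polyCD -e subrK.
    move=> QE; exists 0; rewrite QE hornerC.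
    have : Q`_(size q).-1 = f (lead_coef q) by rewrite coef_map_id0 ?hom_on0.
    rewrite QE coefC; case: ifP => _ e'; first by rewrite e'.
    by move: fl; rewrite -e' eqxx.
  have [|g [hg gf _ gE]] := @hom_ext _ f hf r.
    by move=> p hp /(tr _ hp) ->; rewrite -polyC0 (pevC hf) (hom_on0 hf).
  by exists g; split=> //; rewrite gE.
have [c [hc [e [Ke e0 ce]]]] := minimal_invertible m0 hq qt.
have [h0 n0 r0 min] := m0.
have Kl : K (lead_coef p0) by exact: h0.
exists (lead_coef p0 * e); split; first by case: sK => _ _; exact.
  by rewrite mulf_neq0 // lead_coef_eq0.
move=> W f hf; have [_ _ fM] := hf; rewrite fM // mulf_eq0 negb_or => /andP[fl fe].
have sp : size (map_poly f p0) = size p0.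
  by rewrite size_map_poly_id0.
have [|r fr] := closed_rootP (map_poly f p0) _.
  rewrite sp; apply/eqP => s1; have := size1_polyC (eq_leq s1) => e1.
  by move: r0 n0; rewrite e1 hornerC => ->; rewrite eqxx.
have [|g [hg gf gt gE]] := @hom_ext _ f hf r.
  apply: (hom_ext_alg hf m0); first exact/eqP.
  by move=> x /eqP; rewrite mulf_eq0 (negbTE fl) => /eqP.
exists g; split=> //; apply: contraNneq fe => gq.
have [_ _ gM] := hg.
by rewrite -gf // -ce gM ?gq ?mulr0 //; [exists c | exists q].
Qed.
End HomExt.

Lemma hom_extension (L : fieldType) (s : seq L) (K : L -> Prop) b : subring K ->
  adjoins K s b -> b != 0 -> exists a, [/\ K a, a != 0 &
  forall (W : closedFieldType) (f : L -> W), hom_on K f -> f a != 0 ->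
  exists g : L -> W, [/\ hom_on (adjoins K s) g, forall x, K x -> g x = f x &
    g b != 0]].
Proof.
elim: s K => [|t s IH] K sK /=.
  by move=> Kb b0; exists b; split=> // W f hf fb; exists f.
move=> hb b0; have [a [ha a0 H]] := IH _ (subring_adjoin t sK) hb b0.
have [c [hc c0 H']] := hom_ext1 sK ha a0.
exists c; split=> // W f hf fc; have [g [hg gf ga]] := H' W f hf fc.
have [k [hk kg kb]] := H W g hg ga; exists k; split=> // x Kx.
by rewrite kg ?gf //; exact: sub_adjoin.
Qed.

Section Derivation.
Variables (L : fieldType).
Hypothesis charL : forall n, n.+1%:R != 0 :> L.

Definition der_on (A : L -> Prop) (d : L -> L) :=
  [/\ d 1 = 0, forall a b, A a -> A b -> d (a - b) = d a - d b &
      forall a b, A a -> A b -> d (a * b) = a * d b + d a * b].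

Lemma der_on_hom A d : der_on A d <-> hom_on A (fun a => Dual a (d a)).
Proof.
split=> [[d1 dB dM]|[d1 dB dM]].
  split; first by rewrite d1.
  - by move=> a b Aa Ab; rewrite dB.
  - by move=> a b Aa Ab; rewrite dM.
split; first by case: d1.
- by move=> a b Aa Ab; have [] := dB _ _ Aa Ab.
- by move=> a b Aa Ab; have [] := dM _ _ Aa Ab.
Qed.

(** The infinitesimal part of the value is affine in b with the derivative as slope, so the value of
    a derivation at t can be solved for. *)
Lemma horner_dual (P : {poly dual L}) (t b : L) :
  [/\ dfst P.[Dual t b] = (map_poly (@dfst L) P).[t] &
   dsnd P.[Dual t b] = dsnd P.[Dual t 0] + b * (map_poly (@dfst L) P)^`().[t]].
Proof.
elim/poly_ind: P => [|P c [IH1 IH2]]; first by rewrite map_poly0 deriv0 !horner0 mulr0 addr0.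
have [IH3 _] : dfst P.[Dual t 0] = (map_poly (@dfst L) P).[t] /\ True.
  split=> //; elim/poly_ind: P {IH1 IH2} => [|P d IH]; first by rewrite map_poly0 !horner0.
  have e : map_poly (@dfst L) (P * 'X + d%:P) = map_poly (@dfst L) P * 'X + (dfst d)%:P.
    apply/polyP => i; rewrite coef_map_id0 // !coefD !coefC !coefMX dfstD.
    by case: i => [|i] /=; rewrite ?coef_map_id0.
  by rewrite e !hornerE dfstD dfstM IH.
have e : map_poly (@dfst L) (P * 'X + c%:P) = map_poly (@dfst L) P * 'X + (dfst c)%:P.
  apply/polyP => i; rewrite coef_map_id0 // !coefD !coefC !coefMX dfstD.
  by case: i => [|i] /=; rewrite ?coef_map_id0.
rewrite e derivD derivM derivX derivC !hornerE !dfstD !dsndD !dfstM !dsndM IH1 IH2 IH3.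
by split=> //; rewrite /dfst /dsnd /=; ring.
Qed.

(** In characteristic zero the derivative is a nonzero polynomial, and it is too short to vanish at
    t. *)
Lemma minimal_deriv (K : L -> Prop) t p0 : subring K -> minimal_at K t p0 ->
  p0^`().[t] != 0.
Proof.
move=> sK [h0 n0 r0 min].
have s2 : (1 < size p0)%N.
rewrite ltnNge; apply/negP => s1; move: r0 n0; rewrite (size1_polyC s1) hornerC => ->.
by rewrite eqxx.
apply/eqP => dp; have : p0^`() = 0.
  apply: min => //; last by rewrite lt_size_deriv.
  move=> i; rewrite coef_deriv -mulr_natr; case: (sK) => K1 _ KM; apply: KM => //.
  by elim: i.+1 => [|k IH]; [exact: subring0|rewrite -natr1; apply: subringD].
move/polyP => /(_ (size p0).-2); rewrite coef_deriv coef0 => /eqP.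
rewrite -mulr_natr mulf_eq0 (negbTE (charL _)) orbF.
have -> : (size p0).-2.+1 = (size p0).-1 by lia.
by rewrite -/(lead_coef p0) lead_coef_eq0 (negbTE n0).
Qed.

Lemma der_ext1 (K : L -> Prop) t d : subring K -> der_on K d ->
  exists d', der_on (adjoin K t) d' /\ forall a, K a -> d' a = d a.
Proof.
move=> sK /der_on_hom hf; set f := fun a => _ in hf.
have fst_map p : map_poly (@dfst L) (map_poly f p) = p.
  by apply/polyP => i; rewrite coef_map_id0 // coef_map_id0 //; exact: (hom_on0 sK hf).
suff [b rE] : exists b, forall p, poly_in K p -> p.[t] = 0 -> pev f (Dual t b) p = 0.
  have [g [hg gf gt gE]] := hom_ext sK hf rE.
  exists (fun a => dsnd (g a)); split; last by move=> a Ka; rewrite gf.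
  have g1 a : adjoin K t a -> g a = Dual a (dsnd (g a)).
    move=> [p [hp ->]]; apply: dual_eq; rewrite // gE // /pev.
    by have [-> _] := horner_dual (map_poly f p) t b; rewrite fst_map.
  apply/der_on_hom; have [g0 gB gM] := hg; have [A1 AB AM] := subring_adjoin t sK.
  split; first by rewrite -g1.
  - by move=> a b' Aa Ab; rewrite -!g1 ?gB //; exact: AB.
  - by move=> a b' Aa Ab; rewrite -!g1 ?gM //; exact: AM.
have [tr|[p0 m0]] := transc_or_minimal K t.
  exists 0 => p hp /(tr _ hp) ->.
  by rewrite -polyC0 (pevC sK hf) (hom_on0 sK hf).
have [h0 n0 r0 min] := m0.
have dp := minimal_deriv sK m0.
(* Forced by differentiating p0(t) = 0: d applied to the coefficients, plus p0'(t) times d t, must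
   vanish. *)
exists (- dsnd (map_poly f p0).[Dual t 0] / p0^`().[t]).
apply: (hom_ext_alg sK hf m0).
  rewrite /pev; set b := _ / _; have [e1 e2] := horner_dual (map_poly f p0) t b.
  by apply: dual_eq; rewrite ?e1 ?e2 fst_map ?r0 // /b divfK // addrN.
move=> x fx; have := congr1 (@dfst L) fx; rewrite dfstM => /eqP.
rewrite mulf_eq0 lead_coef_eq0 (negbTE n0) /= => /eqP x0.
have := congr1 (@dsnd L) fx; rewrite dsndM x0 mulr0 addr0 => /eqP.
rewrite mulf_eq0 lead_coef_eq0 (negbTE n0) /= => /eqP x1.
exact: dual_eq.
Qed.

Lemma der_extension (s : seq L) (K : L -> Prop) d : subring K -> der_on K d ->
  exists d', der_on (adjoins K s) d' /\ forall a, K a -> d' a = d a.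
Proof.
elim: s K d => [|t s IH] K d sK hd /=; first by exists d.
have [d1 [h1 e1]] := der_ext1 t sK hd.
have [d2 [h2 e2]] := IH _ _ (subring_adjoin t sK) h1.
by exists d2; split=> // a Ka; rewrite e2 ?e1 //; exact: sub_adjoin.
Qed.
End Derivation.

Inductive gen (R : comPzRingType) (G : R -> Prop) : R -> Prop :=
| gen0 : gen G 0
| genDM r g a : G g -> gen G a -> gen G (a + r * g).

Lemma gen_mem (R : comPzRingType) (G : R -> Prop) a : G a -> gen G a.
Proof. by move=> Ga; rewrite -[a]mul1r -[1 * a]add0r; apply: genDM => //; exact: gen0. Qed.
Lemma genD (R : comPzRingType) (G : R -> Prop) a b : gen G a -> gen G b -> gen G (a + b).
Proof. by move=> Ga; elim=> [|r g c Gg _ IH]; rewrite ?addr0 // addrA; exact: genDM. Qed.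
Lemma genM (R : comPzRingType) (G : R -> Prop) a b : gen G b -> gen G (a * b).
Proof.
elim=> [|r g c Gg _ IH]; first by rewrite mulr0; exact: gen0.
by rewrite mulrDr mulrA; exact: genDM.
Qed.
Lemma gen_ideal (R : comPzRingType) (G : R -> Prop) : is_ideal (gen G).
Proof. by split; [exact: gen0|exact: genD|exact: genM]. Qed.
Lemma gen_min (R : comPzRingType) (G I : R -> Prop) : is_ideal I ->
  (forall a, G a -> I a) -> forall a, gen G a -> I a.
Proof.
move=> [I0 ID IM] GI a; elim=> // r g b Gg _ Ib; apply: ID => //; apply: IM.
exact: GI.
Qed.
Lemma mpoly_alg_ind (R : comNzRingType) n (P : {mpoly R[n]} -> Prop) :
  (forall c, P c%:MP) -> (forall i, P 'X_i) ->
  (forall p q, P p -> P q -> P (p + q)) -> (forall p q, P p -> P q -> P (p * q)) ->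
  forall p, P p.
Proof.
move=> PC PX PD PM p; have P0 : P 0 by rewrite -mpolyC0.
have P1 : P 1 by rewrite -mpolyC1.
rewrite (mpolyE p); apply: big_ind => // m _.
rewrite -mul_mpolyC; apply: (PM) => //; rewrite mpolyXE_id.
apply: big_ind => // i _; elim: (m i) => [|k IH]; first by rewrite expr0.
by rewrite exprS; exact: (PM).
Qed.

Section Mmap.
Variables (R S : comNzRingType) (n : nat).
Lemma mmap_comp (T : comNzRingType) (g : {rmorphism S -> T}) (j : {rmorphism R -> S})
  (a : 'I_n -> S) p : g (mmap j a p) = mmap (g \o j) (g \o a) p.
Proof.
elim/mpoly_alg_ind: p => [c|i|p q IHp IHq|p q IHp IHq].
- by rewrite !mmapC.
- by rewrite !mmapX !mmap1U.
- by rewrite !rmorphD /= IHp IHq.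
- by rewrite !rmorphM /= IHp IHq.
Qed.
Lemma mmap_hom (j : {rmorphism R -> S}) (g : {rmorphism {mpoly R[n]} -> S}) p :
  (forall c, g c%:MP = j c) -> g p = mmap j (fun i => g 'X_i) p.
Proof.
move=> gc; elim/mpoly_alg_ind: p => [c|i|p q IHp IHq|p q IHp IHq].
- by rewrite !mmapC.
- by rewrite !mmapX !mmap1U.
- by rewrite !rmorphD /= IHp IHq.
- by rewrite !rmorphM /= IHp IHq.
Qed.
Lemma mmap_ext (j : {rmorphism R -> S}) (a b : 'I_n -> S) p : a =1 b ->
  mmap j a p = mmap j b p.
Proof. by move=> /funext ->. Qed.
Lemma mmap_subring (j : {rmorphism R -> S}) (a : 'I_n -> S) (K : S -> Prop) p :
  subring K -> (forall c, K (j c)) -> (forall i, K (a i)) -> K (mmap j a p).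
Proof.
move=> sK Kj Ka; elim/mpoly_alg_ind: p => [c|i|p q IHp IHq|p q IHp IHq].
- by rewrite mmapC; exact: Kj.
- by rewrite mmapX mmap1U; exact: Ka.
- by rewrite rmorphD; exact: subringD.
- by rewrite rmorphM; case: sK => _ _; apply.
Qed.
End Mmap.

Definition msub (F : comNzRingType) n d (q : 'I_d -> {mpoly F[n]}) (Q : {mpoly F[d]}) :
  {mpoly F[n]} := mmap (@mpolyC n F) q Q.
HB.instance Definition _ (F : comNzRingType) n d (q : 'I_d -> {mpoly F[n]}) :=
  GRing.RMorphism.copy (msub q) (mmap (@mpolyC n F) q).

Lemma msub_meval (F : comNzRingType) n d (q : 'I_d -> {mpoly F[n]}) Q v :
  (msub q Q).@[v] = Q.@[fun i => (q i).@[v]].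
Proof.
elim/mpoly_alg_ind: Q => [c|i|p p' IHp IHq|p p' IHp IHq].
- by rewrite /msub mmapC !mevalC.
- by rewrite /msub mmapX mmap1U mevalXU.
- by rewrite !rmorphD /= IHp IHq.
- by rewrite !rmorphM /= IHp IHq.
Qed.

Lemma mpoly0C (F : comNzRingType) (Q : {mpoly F[0]}) : exists c, Q = c%:MP.
Proof.
elim/mpoly_alg_ind: Q => [c|[]//|p q [c ->] [d ->]|p q [c ->] [d ->]].
- by exists c.
- by exists (c + d); rewrite mpolyCD.
- by exists (c * d); rewrite mpolyCM.
Qed.

(** * The Nullstellensatz and noetherian rings *)

Section Points.
Variable F : closedFieldType.

(** The values of g at the p i generate a polynomial ring, so every point a specialises it; by
    [hom_extension] the specialisation extends to the coordinates, keeping f nonzero, as soon as a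
    avoids one hypersurface G = 0. This is Chevalley's theorem for a dominant map. *)
Lemma generic_lift n d (L : fieldType) (g : {rmorphism {mpoly F[n]} -> L})
  (p : 'I_d -> {mpoly F[n]}) f :
  (forall Q : {mpoly F[d]}, g (msub p Q) = 0 -> Q = 0) -> g f != 0 ->
  exists G : {mpoly F[d]}, G != 0 /\ forall a, G.@[a] != 0 -> exists v,
    [/\ forall q, g q = 0 -> q.@[v] = 0, forall i, (p i).@[v] = a i & f.@[v] != 0].
Proof.
move=> inj gf.
pose K x := exists Q, x = g (msub p Q).
have sK : subring K.
  split; first by exists 1; rewrite !rmorph1.
    by move=> _ _ [Q ->] [Q' ->]; exists (Q - Q'); rewrite !rmorphB.
  by move=> _ _ [Q ->] [Q' ->]; exists (Q * Q'); rewrite !rmorphM.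
pose s := [seq g 'X_i | i <- enum 'I_n].
have [sA KA sub] := adjoins_spec s sK.
have img q : adjoins K s (g q).
  elim/mpoly_alg_ind: q => [c|i|q q' h h'|q q' h h'].
  - by apply: KA; exists c%:MP; rewrite /msub mmapC.
  - by apply: sub; apply: map_f; rewrite mem_enum.
  - by rewrite rmorphD; exact: subringD.
  - by rewrite rmorphM; case: sA => _ _; apply.
have [_ [[G ->] G0 H]] := hom_extension sK (img f) gf.
exists G; split; first by apply: contraNneq G0 => ->; rewrite !rmorph0.
move=> a Ga.
pose phi x := if pselect (K x) is left h then (projT1 (cid h)).@[a] else 0.
have phiE Q : phi (g (msub p Q)) = Q.@[a].
  rewrite /phi; case: pselect => [h|[]]; last by exists Q.
  case: cid => Q' /= e; congr meval; apply/eqP; rewrite eq_sym -subr_eq0; apply/eqP.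
  by apply: inj; rewrite !rmorphB e subrr.
have hphi : hom_on K phi.
  split; first by rewrite -(rmorph1 (g \o msub p)) phiE meval1.
  - by move=> _ _ [Q ->] [Q' ->]; rewrite -!rmorphB !phiE mevalB.
  - by move=> _ _ [Q ->] [Q' ->]; rewrite -!rmorphM !phiE mevalM.
have [|psi [hpsi psiE psif]] := H F phi hphi; first by rewrite phiE.
have psi0 : psi 0 = 0 by exact: (hom_on0 sA hpsi).
pose v i := psi (g 'X_i).
have psiv q : psi (g q) = q.@[v].
  elim/mpoly_alg_ind: q => [c|i|q q' h h'|q q' h h'].
  - have e : g c%:MP = g (msub p c%:MP) by rewrite /msub mmapC.
    by rewrite e psiE ?phiE ?mevalC //; exists c%:MP.
  - by rewrite mevalXU.
  - by rewrite rmorphD (hom_onD sA hpsi) // h h' mevalD.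
  - by case: hpsi => _ _ hM; rewrite rmorphM hM // h h' mevalM.
exists v; split=> [q gq|i|]; last by rewrite -psiv.
  by rewrite -psiv gq.
have e : g (p i) = g (msub p 'X_i) by rewrite /msub mmapX mmap1U.
by rewrite -psiv e psiE ?phiE ?mevalXU //; exists 'X_i.
Qed.

(** If no power of f lies in the ideal, some prime contains the ideal and avoids the powers of f;
    [generic_lift] for the empty family p then gives a zero of G at which f is nonzero. *)
Lemma nullstellensatz n (G : {mpoly F[n]} -> Prop) f :
  (forall v, (forall q, G q -> q.@[v] = 0) -> f.@[v] = 0) ->
  exists k, gen G (f ^+ k).
Proof.
move=> fv; apply: contrapT => /forallNP nk.
have [||||L [g [gI gS]]] := @generic_field {mpoly F[n]} (gen G) (fun a => exists k, a = f ^+ k).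
- exact: gen_ideal.
- by exists 0%N; rewrite expr0.
- by move=> _ _ [k ->] [l ->]; exists (k + l)%N; rewrite exprD.
- by move=> a Ga [k ak]; apply: (nk k); rewrite -ak.
have gf : g f != 0 by apply: gS; exists 1%N; rewrite expr1.
have [|G0 [G00 H]] := @generic_lift n 0 L g (fun _ => 0) f _ gf.
  move=> Q; have [c ->] := mpoly0C Q; rewrite /msub mmapC => gc.
  have [-> |c0] := eqVneq c 0; first by rewrite mpolyC0.
  have : g (c%:MP * (c^-1)%:MP) = 0 by rewrite rmorphM gc mul0r.
  by rewrite -mpolyCM divff // mpolyC1 rmorph1 => /eqP; rewrite oner_eq0.
have [|v [v0 _ vf]] := H (fun _ => 0).
  have [c e] := mpoly0C G0; move: G00; rewrite e mevalC.
  by apply: contraNneq => ->; rewrite mpolyC0.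
move: vf; rewrite fv ?eqxx // => q Gq; apply: v0; apply: gI; exact: gen_mem.
Qed.
End Points.

Definition noeth (R : comNzRingType) := forall I : R -> Prop, is_ideal I ->
  exists s : seq R, (forall x, x \in s -> I x) /\ forall a, I a -> gen (fun x => x \in s) a.

Lemma gen_sub (R : comPzRingType) (G H : R -> Prop) : (forall a, G a -> H a) ->
  forall a, gen G a -> gen H a.
Proof.
move=> GH; apply: gen_min; first exact: gen_ideal.
by move=> a /GH; exact: gen_mem.
Qed.

Lemma noeth_field (F : fieldType) : noeth F.
Proof.
move=> I [I0 ID IM]; have [[a [Ia a0]]|h] := pselect (exists a, I a /\ a != 0).
  exists [:: a]; split=> [x|b _]; first by rewrite inE => /eqP ->.
  rewrite -(divfK a0 b); apply: genM; apply: gen_mem; exact: mem_head.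
exists [::]; split=> // a Ia; have -> : a = 0; last exact: gen0.
by apply: contrapT => /eqP a0; apply: h; exists a.
Qed.

Lemma noeth_surj (R S : comNzRingType) (h : {rmorphism R -> S}) :
  (forall s, exists r, h r = s) -> noeth R -> noeth S.
Proof.
move=> sur nR I [I0 ID IM]; have [|s [sI sg]] := nR (fun r => I (h r)).
  by split=> [|a b|a b]; rewrite ?rmorph0 ?rmorphD ?rmorphM //; [exact: ID|exact: IM].
exists (map h s); split=> [x /mapP[r /sI hr ->] //|a]; have [r <-] := sur a => /sg.
elim=> [|b g c gs _ IH]; first by rewrite rmorph0; exact: gen0.
by rewrite rmorphD rmorphM; apply: genDM => //; exact: map_f.
Qed.

Section HilbertBasis.
Variable R : comNzRingType.
Hypothesis nR : noeth R.

Lemma noeth_poly : noeth {poly R}.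
Proof.
move=> I [I0 ID IM].
(* The ideals of coefficients in degree d increase with d and are constant from some D on;
   generators are lifted once for each d up to D. *)
pose J d a := exists p : {poly R}, [/\ I p, (size p <= d.+1)%N & p`_d = a].
have Jid d : is_ideal (J d).
  split; first by exists 0; rewrite size_poly0 coef0.
  - move=> _ _ [p [Ip sp <-]] [q [Iq sq <-]]; exists (p + q); split; first exact: ID.
      by rewrite (leq_trans (size_polyD _ _)) // geq_max sp.
    by rewrite coefD.
  - move=> a _ [p [Ip sp <-]]; exists (a%:P * p); split; first exact: IM.
      rewrite mul_polyC; exact: leq_trans (size_scale_leq _ _) sp.
    by rewrite coefCM.
have Jle d e a : (d <= e)%N -> J d a -> J e a.
  move=> de [p [Ip sp <-]]; exists ('X^(e - d) * p); split; first exact: IM.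
    rewrite (leq_trans (size_polyMleq _ _)) // size_polyXn /=.
    by move: sp de; move: (size p) => b; lia.
  by rewrite coefXnM ltnNge leq_subr /= subKn.
have [|s [sI sg]] := nR (I := fun a => exists d, J d a).
  split; first by exists 0%N; case: (Jid 0%N).
  - move=> a b [d Ja] [e Jb]; exists (maxn d e); case: (Jid (maxn d e)) => _ + _.
    by apply; [apply: Jle Ja; exact: leq_maxl|apply: Jle Jb; exact: leq_maxr].
  - by move=> a b [d Jb]; exists d; case: (Jid d) => _ _; apply.
have [D HD] : exists D, forall x, x \in s -> J D x.
  elim: s sI {sg} => [|x s IH] sI; first by exists 0%N.
  have [d Jd] := sI x (mem_head _ _).
  have [|D HD] := IH; first by move=> y ys; apply: sI; rewrite inE ys orbT.
  exists (maxn d D) => y; rewrite inE => /orP[/eqP ->|/HD h].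
    by apply: Jle Jd; exact: leq_maxl.
  by apply: Jle h; exact: leq_maxr.
have lift d (t : seq R) : (forall x, x \in t -> J d x) -> exists u : seq {poly R},
    (forall p, p \in u -> I p /\ (size p <= d.+1)%N) /\
    forall a, gen (fun x => x \in t) a -> exists q, [/\ gen (fun x => x \in u) q,
      (size q <= d.+1)%N & q`_d = a].
  move=> tJ; have [u [u1 u2]] : exists u : seq {poly R},
    (forall p, p \in u -> I p /\ (size p <= d.+1)%N) /\
    forall x, x \in t -> exists p, p \in u /\ p`_d = x.
    elim: t tJ => [|x t IH] tJ; first by exists [::].
    have [p [Ip sp px]] := tJ x (mem_head _ _).
    have [|u [u1 u2]] := IH; first by move=> y ys; apply: tJ; rewrite inE ys orbT.
    exists (p :: u); split=> q; rewrite inE => /orP[/eqP ->|] //.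
    - exact: u1.
    - by exists p; rewrite mem_head.
    - by move=> /u2 [r [ru <-]]; exists r; rewrite inE ru orbT.
  exists u; split=> // a; elim=> [|r x b xt _ [q [gq sq <-]]].
    by exists 0; rewrite size_poly0 coef0; split=> //; exact: gen0.
  have [p [pu <-]] := u2 _ xt; exists (q + r%:P * p); split.
  - exact: genDM.
  - rewrite (leq_trans (size_polyD _ _)) // geq_max sq mul_polyC.
    exact: leq_trans (size_scale_leq _ _) (u1 _ pu).2.
  - by rewrite coefD coefCM.
have [U [UI Ug]] : exists U : seq {poly R}, (forall p, p \in U -> I p) /\
   forall d, (d <= D)%N -> forall a, J d a -> exists q, [/\ gen (fun x => x \in U) q,
      (size q <= d.+1)%N & q`_d = a].
  have : exists U : seq {poly R}, (forall p, p \in U -> I p) /\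
   forall d, (d < D.+1)%N -> forall a, J d a -> exists q, [/\ gen (fun x => x \in U) q,
      (size q <= d.+1)%N & q`_d = a].
    elim: D.+1 => [|e [U [UI Ug]]]; first by exists [::].
    have [t [tJ tg]] := nR (Jid e); have [u [u1 u2]] := lift e t tJ.
    exists (U ++ u); split=> [p|d].
      by rewrite mem_cat => /orP[/UI //|/u1 []].
    rewrite ltnS leq_eqVlt => /orP[/eqP -> a /tg /u2|/Ug h a /h] [q [gq sq qa]];
    by exists q; split=> //; apply: gen_sub gq => x; rewrite mem_cat => ->; rewrite ?orbT.
  by [].
have [u [u1 u2]] := lift D s HD.
exists (U ++ u); split=> [p|p]; first by rewrite mem_cat => /orP[/UI //|/u1 []].
have gU q : gen (fun x => x \in U) q -> gen (fun x => x \in U ++ u) q.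
  by apply: gen_sub => x; rewrite mem_cat => ->.
have gu q : gen (fun x => x \in u) q -> gen (fun x => x \in U ++ u) q.
  by apply: gen_sub => x; rewrite mem_cat => ->; rewrite orbT.
have gI q : gen (fun x => x \in U ++ u) q -> I q.
  by apply: gen_min => // x; rewrite mem_cat => /orP[/UI //|/u1 []].
have [n] := ubnP (size p); elim: n p => // n IH p pn Ip.
have [->|p0] := eqVneq p 0; first exact: gen0.
have sp : (0 < size p)%N by rewrite size_poly_gt0.
have [q [gq sq qE]] : exists q, [/\ gen (fun x => x \in U ++ u) q,
    (size q <= size p)%N & q`_(size p).-1 = p`_(size p).-1].
  have Jp : J (size p).-1 p`_(size p).-1 by exists p; rewrite prednK.
  have [le|lt] := leqP (size p).-1 D.
    have [q [gq sq qE]] := Ug _ le _ Jp; exists q; split=> //; first exact: gU.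
    by rewrite -(prednK sp).
  have [|q [gq sq qE]] := u2 p`_(size p).-1; first by apply: sg; exists (size p).-1.
  exists ('X^((size p).-1 - D) * q); split; first by apply: genM; exact: gu.
    rewrite (leq_trans (size_polyMleq _ _)) // size_polyXn /=.
    by move: sq lt sp; move: (size p) (size q) => a b; lia.
  by rewrite coefXnM ltnNge leq_subr /= subKn // ltnW.
rewrite -(subrK q p); apply: genD => //; apply: IH; last first.
  by apply: ID => //; rewrite -mulN1r; apply: IM; exact: gI.
have : (size (p - q)%R < size p)%N; last by move=> h; exact: leq_trans h _.
rewrite -[X in (_ < X)%N](prednK sp) ltnS; apply/leq_sizeP => j.
rewrite leq_eqVlt => /orP[/eqP <-|lj]; rewrite coefB ?qE ?subrr //.
have sj : (size p <= j)%N by rewrite -(prednK sp).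
by rewrite !nth_default ?subrr // (leq_trans sq).
Qed.
End HilbertBasis.

Lemma noeth_mpoly (F : fieldType) n : noeth {mpoly F[n]}.
Proof.
elim: n => [|n IH].
  apply: (noeth_surj (h := @mpolyC 0 F)) (@noeth_field F) => Q.
  by have [c ->] := mpoly0C Q; exists c.
pose h0 : {rmorphism {mpoly F[n]} -> {mpoly F[n.+1]}} := @mwiden n F.
pose h : {rmorphism {poly {mpoly F[n]}} -> {mpoly F[n.+1]}} :=
  horner_morph (fun p => mulrC 'X_ord_max (h0 p)).
apply: (noeth_surj (h := h)) (noeth_poly IH) => Q.
elim/mpoly_alg_ind: Q => [c|i|q q' [p <-] [p' <-]|q q' [p <-] [p' <-]].
- by exists (c%:MP)%:P; rewrite /= horner_morphC /= mwidenC.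
- have [j|->] := unliftP ord_max i; last by exists 'X; rewrite /= horner_morphX.
  move=> ->; exists ('X_j)%:P; rewrite /= horner_morphC /= mwidenX mnmwiden1.
  by congr ('X_[U_(_)]); apply: val_inj; rewrite /= /bump leqNgt ltn_ord.
- by exists (p + p'); rewrite rmorphD.
- by exists (p * p'); rewrite rmorphM.
Qed.

Lemma noeth_maximal (R : comNzRingType) (Fam : (R -> Prop) -> Prop) : noeth R ->
  (forall I, Fam I -> is_ideal I) -> (exists I, Fam I) ->
  exists I, Fam I /\ forall J, Fam J -> (forall a, I a -> J a) -> forall a, J a -> I a.
Proof.
move=> nR Fid [I0 FI0]; apply: contrapT => /forallNP nmax.
have step (I : {I | Fam I}) : {J : {I | Fam I} | (forall a, sval I a -> sval J a) /\
    ~ forall a, sval J a -> sval I a}.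
  apply: cid; case: I => I FI /=; have := nmax I => /not_andP[//|].
  move=> /existsNP [J /not_implyP [FJ /not_implyP [IJ nJI]]].
  by exists (exist _ J FJ).
pose I := fix I k := if k is k'.+1 then sval (step (I k')) else exist _ I0 FI0.
have mono k l : (k <= l)%N -> forall a, sval (I k) a -> sval (I l) a.
  move=> /subnKC <-; elim: (l - k)%N => [|m IH] a; first by rewrite addn0.
  rewrite addnS => /IH; have /= [h _] := svalP (step (I (k + m)%N)); exact: h.
have [|s [sI sg]] := nR (fun a => exists k, sval (I k) a).
  split.
  - by exists 0%N; case: (Fid _ FI0).
  - move=> a b [k Ia] [l Ib]; exists (maxn k l).
    case: (Fid _ (svalP (I (maxn k l)))) => _ + _; apply.
      exact: mono (leq_maxl _ _) _ Ia.
    exact: mono (leq_maxr _ _) _ Ib.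
  - by move=> a b [k Ib]; exists k; case: (Fid _ (svalP (I k))) => _ _; apply.
have [k Hk] : exists k, forall x, x \in s -> sval (I k) x.
  elim: s sI {sg} => [|x s IH] sI; first by exists 0%N.
  have [d Jd] := sI x (mem_head _ _).
  have [|D HD] := IH; first by move=> y ys; apply: sI; rewrite inE ys orbT.
  exists (maxn d D) => y; rewrite inE => /orP[/eqP ->|/HD h].
    exact: mono (leq_maxl _ _) _ Jd.
  exact: mono (leq_maxr _ _) _ h.
have /= := svalP (step (I k)); case=> _; apply=> a Ia.
have /sg : exists k, sval (I k) a by exists k.+1.
by apply: gen_min => //; exact: Fid (svalP (I k)).
Qed.

(** The value t = 0 is excluded because scaling by 0 leaves a cone. Algebraic closedness replaces
    the counting of roots: if q vanishes everywhere, q - 1 has no root and is therefore constant. *)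
Lemma poly_eq0_everywhere (F : closedFieldType) (p : {poly F}) :
  (forall t, t != 0 -> p.[t] = 0) -> p = 0.
Proof.
move=> h; suff : p * 'X = 0 by move/eqP; rewrite mulf_eq0 polyX_eq0 orbF => /eqP.
have {}h t : (p * 'X).[t] = 0.
  by rewrite hornerM hornerX; have [->|/h ->] := eqVneq t 0; rewrite ?mulr0 ?mul0r.
move: (p * 'X) h => q h.
have [s1|s1] := boolP (size (q - 1%:P) == 1%N); last first.
  have /closed_rootP[r] := s1; rewrite /root !hornerE h sub0r oppr_eq0.
  by rewrite oner_eq0.
have /size_poly1P[c c0 e] := s1.
have qE : q = (c + 1)%:P by rewrite polyCD -e subrK.
by move: (h 0); rewrite qE hornerC => ->.
Qed.

Lemma mpoly_eq0_everywhere (F : closedFieldType) n (p : {mpoly F[n]}) :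
  (forall v, p.@[v] = 0) -> p = 0.
Proof.
move=> h; have [k] := @nullstellensatz F n (fun _ => False) p (fun v _ => h v).
have /[apply] : forall q : {mpoly F[n]}, gen (fun _ => False) q -> q = 0.
  by move=> q; elim.
by move/eqP; rewrite expf_eq0 => /andP[_ /eqP].
Qed.

Lemma homog_eval (R : comNzRingType) n (p : {mpoly R[n]}) (a : R) v :
  p.@[fun i => a * v i] = \sum_(d < msize p) a ^+ d * (pihomog mdeg d p).@[v].
Proof.
have {1}-> : p = \sum_(d < msize p) pihomog mdeg d p by exact: pihomog_partitionE.
rewrite rmorph_sum; apply: eq_bigr => d _ /=.
rewrite !mevalE mulr_sumr; apply: eq_big_seq => m mp.
have -> : nat_of_ord d = mdeg m by move/dhomogP: (pihomogP mdeg d p) => /(_ m mp).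
rewrite mulrCA; congr (_ * _); rewrite mdegE -prodrXr -big_split /=.
by apply: eq_bigr => i _; rewrite exprMn.
Qed.

(** * Closed subsets of projective space and their dimension *)

Section Proj.
Variables (F : closedFieldType) (n : nat).
Local Notation S := {mpoly F[n.+1]}.
Local Notation V := 'rV[F]_n.+1.
Local Notation P := (proj F n).
Implicit Types (X A B : set P) (v w : V) (p q : S).

Fact pt_subproof v : v != 0 -> \dim <[v]>%VS == 1%N.
Proof. by move=> v0; rewrite dim_vline v0. Qed.
Definition pt v (v0 : v != 0) : P := exist _ <[v]>%VS (pt_subproof v0).
Lemma hcoord_pt v (v0 : v != 0) : hcoord (pt v0) v.
Proof. by split=> //; exact: memv_line. Qed.
Lemma hcoord_line x v : hcoord x v -> val x = <[v]>%VS.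
Proof.
move=> [vx v0]; apply/esym/eqP; rewrite eqEdim -memvE vx dim_vline v0.
by rewrite (eqP (valP x)).
Qed.
Lemma hcoord_inj x y v : hcoord x v -> hcoord y v -> x = y.
Proof. by move=> hx hy; apply: val_inj; rewrite (hcoord_line hx) (hcoord_line hy). Qed.
Lemma hcoordZ x v a : hcoord x v -> a != 0 -> hcoord x (a *: v).
Proof. by move=> [vx v0] a0; split; [exact: memvZ|rewrite scaler_eq0 negb_or a0]. Qed.

(** The affine cone without its vertex, on which polynomials that are not homogeneous can be
    evaluated too. *)
Definition pcone X : set V := [set v | exists x, X x /\ hcoord x v].
Lemma pcone_neq0 X v : pcone X v -> v != 0.
Proof. by move=> [x [_ []]]. Qed.
Lemma pconeZ X v a : pcone X v -> a != 0 -> pcone X (a *: v).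
Proof. by move=> [x [Xx xv]] a0; exists x; split=> //; exact: hcoordZ. Qed.
Lemma vanishingE X p : vanishing X p <-> forall v, pcone X v -> p.@[v 0] = 0.
Proof.
split=> [h v [x [Xx xv]]|h x v Xx xv]; first exact: h Xx xv.
by apply: h; exists x.
Qed.

Lemma mevalZv p a v : p.@[(a *: v) 0] = p.@[fun i => a * v 0 i].
Proof. by apply: meval_eq => i; rewrite mxE. Qed.

Lemma pihomog_big d p : (msize p <= d)%N -> pihomog mdeg d p = 0.
Proof.
move=> h; rewrite pihomogE big1_seq // => m /andP[/eqP md /msize_mdeg_lt].
by rewrite md ltnNge h.
Qed.

Lemma pihomog_eval0 p v : (forall a, a != 0 -> p.@[(a *: v) 0] = 0) ->
  forall d, (pihomog mdeg d p).@[v 0] = 0.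
Proof.
move=> h d; pose Q := \poly_(d < msize p) (pihomog mdeg d p).@[v 0].
have Q0 : Q = 0.
  apply: poly_eq0_everywhere => t t0; rewrite horner_poly.
  by rewrite -[RHS](h t t0) mevalZv homog_eval; apply: eq_bigr => i _; rewrite mulrC.
have [lt|ge] := ltnP d (msize p).
  by move/polyP: Q0 => /(_ d); rewrite coef_poly lt coef0.
by rewrite pihomog_big // meval0.
Qed.

Lemma vanishing_homog X p d : vanishing X p -> vanishing X (pihomog mdeg d p).
Proof.
move=> /vanishingE h; apply/vanishingE => v Xv; apply: pihomog_eval0 => a a0.
by apply: h; exact: pconeZ.
Qed.

Lemma open_zariski A : open A = zariski_open A. Proof. by []. Qed.

Definition zeros (B : S -> Prop) : set P :=
  [set x | forall v, hcoord x v -> forall p, B p -> p.@[v 0] = 0].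

(** The members of B need not be forms: vanishing on all coordinate vectors of x is invariant under
    scaling, hence the same as the vanishing of every homogeneous component. *)
Lemma zeros_closed (B : S -> Prop) : closed (zeros B).
Proof.
rewrite -openC open_zariski.
exists [set q | exists p d, B p /\ q = pihomog mdeg d p]; split.
  by move=> _ [p [d [_ ->]]]; exists d; exact: pihomogP.
apply/seteqP; split=> x.
  move=> /existsNP [v /not_implyP [xv /existsNP [p /not_implyP [Bp /eqP pv]]]].
  have [d pd] : exists d, (pihomog mdeg d p).@[v 0] != 0.
    apply: contrapT => /forallNP h; move/eqP: pv; apply.
    rewrite (pihomog_partitionE (mf := mdeg) (leqnn (msize p))) rmorph_sum big1 // => i _.
    by apply/eqP; apply: contrapT => /negP; exact: h.
  by exists (pihomog mdeg d p); split; [exists p, d|exists v].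
move=> [_ [[p [d [Bp ->]]] [v [xv pv]]]] h; move/eqP: pv; apply.
by apply: pihomog_eval0 => a a0; apply: h => //; exact: hcoordZ.
Qed.

Lemma closureE_zeros A : closure A = zeros (vanishing A).
Proof.
apply/seteqP; split=> x.
  apply: (@subset_trans _ (closure (zeros (vanishing A)))); last first.
    exact: zeros_closed.
  by apply: closure_subset => y Ay v yv p hp; exact: (hp y v Ay yv).
move=> h; apply: contrapT => nx.
have : zariski_open (~` closure A) by rewrite -open_zariski openC; exact: closed_closure.
move=> [B [Bf BE]]; have : (~` closure A) x by [].
rewrite BE => -[p [Bp [v [xv /eqP]]]]; apply; apply: h => //.
move=> y w Ay yw; apply/eqP; apply: contrapT => /negP pw.
have : (~` closure A) y by rewrite BE; exists p; split=> //; exists w.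
by apply; exact: subset_closure.
Qed.

Lemma closed_zeros A : closed A <-> A = zeros (vanishing A).
Proof. by rewrite closure_id closureE_zeros. Qed.

Lemma closed_pcone A v : closed A -> v != 0 ->
  (forall p, vanishing A p -> p.@[v 0] = 0) -> pcone A v.
Proof.
move=> /closed_zeros AE v0 h; exists (pt v0); split; last exact: hcoord_pt.
rewrite AE => w vw p Ap; have [a [a0 ->]] := hcoord_scale (hcoord_pt v0) vw.
have : forall d, (pihomog mdeg d p).@[v 0] = 0 by move=> d; apply: h; exact: vanishing_homog.
move=> hd; rewrite mevalZv homog_eval big1 // => i _; by rewrite hd mulr0.
Qed.

Lemma vanishing_anti A B : A `<=` B -> forall p, vanishing B p -> vanishing A p.
Proof. by move=> AB p h x v /AB; exact: h. Qed.

Lemma closed_sub_vanishing A B : closed B ->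
  (forall p, vanishing B p -> vanishing A p) -> A `<=` B.
Proof.
move=> cB h x Ax; rewrite (iffLR (closed_zeros _) cB) => v xv p Bp.
exact: (h p Bp x v Ax xv).
Qed.

Lemma vanishing_ideal_is A : is_ideal (vanishing A).
Proof. split; [exact: vanishing0|exact: vanishingD|exact: vanishingM]. Qed.

(** Neither p nor q need be homogeneous. On each line of the cone they restrict to polynomials in
    the scaling parameter with product zero, so that one of the two vanishes; if neither vanished on
    A, a homogeneous component of each would cut A into two proper closed subsets. *)
Lemma irreducible_prime A : irreducible A -> prime_ideal (vanishing A).
Proof.
move=> [[x0 Ax0] irr]; split; first exact: vanishing_ideal_is.
  have [v xv] := hcoord_ex x0; move=> /(_ x0 v Ax0 xv).
  by rewrite meval1 => /eqP; rewrite oner_eq0.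
move=> p q pq; apply: contrapT => /not_orP [np nq].
have ex (r : S) : ~ vanishing A r -> exists d, ~ A `<=` zeros (eq (pihomog mdeg d r)).
  move=> nr; apply: contrapT => /forallNP h; apply: nr => x v Ax xv.
  rewrite (pihomog_partitionE (mf := mdeg) (leqnn (msize r))) rmorph_sum big1 // => i _.
  have /contrapT /(_ x Ax v xv) := h i; exact.
have [d hd] := ex p np; have [e he] := ex q nq.
have [] := irr (zeros (eq (pihomog mdeg d p))) (zeros (eq (pihomog mdeg e q))) => //.
- exact: zeros_closed.
- exact: zeros_closed.
move=> x Ax; have [v xv] := hcoord_ex x.
pose f := \poly_(i < msize p) (pihomog mdeg i p).@[v 0].
pose g := \poly_(i < msize q) (pihomog mdeg i q).@[v 0].
have fg : f * g = 0.
  apply: poly_eq0_everywhere => t t0; rewrite hornerM !horner_poly.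
  have := pq x (t *: v) Ax (hcoordZ xv t0); rewrite mevalM !mevalZv !homog_eval => e'.
  by rewrite -[RHS]e'; congr (_ * _); apply: eq_bigr => i _; rewrite mulrC.
have coefd (r : S) i : \poly_(i < msize r) (pihomog mdeg i r).@[v 0] = 0 ->
    (pihomog mdeg i r).@[v 0] = 0.
  move=> /polyP /(_ i); rewrite coef_poly coef0; case: ltnP => // h _.
  by rewrite pihomog_big // meval0.
move/eqP: fg; rewrite mulf_eq0 => /orP[/eqP h|/eqP h]; [left|right] => w xw _ <-;
  have [a [a0 ->]] := hcoord_scale xv xw.
  by rewrite (form_scale _ _ (pihomogP mdeg d p)) coefd // mulr0.
by rewrite (form_scale _ _ (pihomogP mdeg e q)) coefd // mulr0.
Qed.

Lemma prime_irreducible A : A !=set0 ->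
  (forall p q, vanishing A (p * q) -> vanishing A p \/ vanishing A q) -> irreducible A.
Proof.
move=> A0 pr; split=> // B C cB cC ABC; apply: contrapT => /not_orP [nB nC].
have ex D : closed D -> ~ A `<=` D -> exists p, vanishing D p /\ ~ vanishing A p.
  move=> cD nD; apply: contrapT => /forallNP h; apply: nD.
  apply: closed_sub_vanishing => // p Dp; apply: contrapT => nA; exact: (h p).
have [p [Bp Ap]] := ex B cB nB; have [q [Cq Aq]] := ex C cC nC.
have [] := pr p q => // x v Ax xv; rewrite mevalM.
by case: (ABC x Ax) => [/Bp|/Cq] -> //; rewrite ?mul0r ?mulr0.
Qed.

Lemma closed_minimal (Fam : set P -> Prop) : (forall A, Fam A -> closed A) ->
  (exists A, Fam A) -> exists A, Fam A /\ forall B, Fam B -> B `<=` A -> B = A.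
Proof.
move=> Fc [A0 FA0].
have [||I [[A [FA IA]] max]] := @noeth_maximal _
    (fun I => exists A, Fam A /\ I = vanishing A) (@noeth_mpoly F n.+1).
- by move=> _ [A [_ ->]]; exact: vanishing_ideal_is.
- by exists (vanishing A0), A0.
exists A; split=> // B FB BA; apply/seteqP; split=> //.
apply: closed_sub_vanishing; first exact: Fc.
have := max (vanishing B); rewrite IA; apply; first by exists B.
exact: vanishing_anti.
Qed.

Lemma irreducible_closure A : irreducible A -> irreducible (closure A).
Proof.
move=> [[x Ax] irr]; split; first by exists x; exact: subset_closure.
move=> B C cB cC h; have [] := irr B C cB cC.
- exact: subset_trans (@subset_closure _ A) h.
- by move=> AB; left; rewrite (iffLR (closure_id _) cB); exact: closure_subset.
- by move=> AC; right; rewrite (iffLR (closure_id _) cC); exact: closure_subset.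
Qed.
End Proj.

(* Generic points: val evaluates a function at the generic point of E. *)
Lemma set_generic (F : closedFieldType) (T : Type) (E : set T) (PF : (T -> F) -> Prop) :
  PF (fun=> 1) -> (forall f g, PF f -> PF g -> PF (fun t => f t * g t)) ->
  E !=set0 ->
  (forall f g, PF f -> PF g -> (forall t, E t -> f t * g t = 0) ->
     (forall t, E t -> f t = 0) \/ (forall t, E t -> g t = 0)) ->
  exists (L : fieldType) (val : {rmorphism (T -> F) -> L}),
    (forall f, (forall t, E t -> f t = 0) -> val f = 0) /\
    (forall f, PF f -> val f = 0 -> forall t, E t -> f t = 0).
Proof.
move=> PF1 PFM [t0 Et0] pr.
have [||||L [g [gI gS]]] := @generic_field (T -> F) (fun f => forall t, E t -> f t = 0)
  (fun f => PF f /\ exists t, E t /\ f t != 0).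
- split=> // [f g hf hg t Et|f g hg t Et]; first by rewrite fctE hf // hg // addr0.
  by rewrite fctE hg // mulr0.
- split; first exact: PF1.
  by exists t0; split=> //; exact: oner_neq0.
- move=> f g [PFf [t [Et ft]]] [PFg [u [Eu gu]]]; split; first exact: PFM.
  apply: contrapT => /forallNP h; have [|h'|h'] := pr f g PFf PFg.
  + move=> w Ew; apply/eqP; apply: contrapT => /negP fg; apply: (h w); split=> //.
  + by move: ft; rewrite h' // eqxx.
  + by move: gu; rewrite h' // eqxx.
- by move=> f hf [_ [t [Et]]]; rewrite hf // eqxx.
exists L, g; split=> // f PFf gf t Et; apply/eqP; apply: contrapT => /negP ft.
suff : g f != 0 by rewrite gf eqxx.
by apply: gS; split=> //; exists t.
Qed.

Lemma msize_mderiv (R : nzRingType) n (p : {mpoly R[n]}) i k :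
  (msize p <= k.+1)%N -> (msize p^`M(i) <= k)%N.
Proof.
move=> h; rewrite [msize p^`M(i)]mmeasureE; apply/bigmax_leqP_seq => m mp _.
have : (m + U_(i))%MM \in msupp p.
  move: mp; rewrite !mcoeff_msupp mcoeff_mderiv; apply: contraNneq => ->.
  by rewrite mul0rn.
move/msize_mdeg_lt; rewrite mdegD mdeg1 addn1 => h'.
by rewrite -ltnS; exact: leq_trans h' h.
Qed.

Lemma mderiv_eq0 (R : idomainType) n (p : {mpoly R[n]}) :
  (forall k, k.+1%:R != 0 :> R) ->
  (forall i, p^`M(i) = 0) -> exists c, p = c%:MP.
Proof.
move=> ch dp; exists p@_0; apply/mpolyP => m; rewrite mcoeffC.
have [->|m0] := eqVneq 0%MM m; first by rewrite mulr1.
rewrite mulr0; have [i mi] : exists i, (0 < m i)%N.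
  apply: contrapT => /forallNP h; move/eqP: m0; apply; apply/mnmP => i.
  by rewrite mnm0E; apply/esym/eqP; rewrite -leqn0 leqNgt; apply/negP; exact: h.
have := congr1 (mcoeff (m - U_(i))%MM) (dp i); rewrite mcoeff_mderiv mcoeff0.
rewrite submK; last by apply/mnm_lepP => j; rewrite mnm1E; case: eqP => // <-.
by rewrite -mulr_natr => /eqP; rewrite mulf_eq0 (negbTE (ch _)) orbF => /eqP.
Qed.

Lemma mderivXU (R : nzRingType) n (i k : 'I_n) : ('X_k)^`M(i) = (i == k)%:R :> {mpoly R[n]}.
Proof.
rewrite mderivX mnm1E eq_sym; case: eqP => [->|_]; last by rewrite scale0r.
rewrite scale1r; have -> : (U_(k) - U_(k))%MM = 0%MM :> 'X_{1..n}.
  by apply/mnmP => l; rewrite !mnmE subnn.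
by rewrite mpolyX0.
Qed.

(** * Derivations and transcendence degree *)

Section Derivations.
Variables (F L : fieldType) (j : {rmorphism F -> L}).
Hypothesis charF : forall k, k.+1%:R != 0 :> F.

Definition algind d (a : 'I_d -> L) := forall Q, mmap j a Q = 0 -> Q = 0.

Definition der_over (B : L -> Prop) (e : L -> L) :=
  der_on B e /\ forall c, B (j c) /\ e (j c) = 0.

Lemma der0 (B : L -> Prop) e : subring B -> der_on B e -> e 0 = 0.
Proof. by move=> [B1 _ _] [_ eB _]; have := eB 1 1 B1 B1; rewrite !subrr. Qed.
Lemma derD (B : L -> Prop) e a b : subring B -> der_on B e -> B a -> B b -> e (a + b) = e a + e b.
Proof.
move=> sB de Ba Bb; have [_ eB _] := de.
have BN : B (- b) by exact: subringN.
rewrite -[b in LHS]opprK eB // -[- b]sub0r eB //; last exact: subring0.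
by rewrite (der0 sB de) sub0r opprK.
Qed.
Lemma der_sum B e I (r : seq I) (f : I -> L) : subring B -> der_on B e ->
  (forall i, B (f i)) -> e (\sum_(i <- r) f i) = \sum_(i <- r) e (f i).
Proof.
move=> sB de Bf; elim: r => [|i r IH]; first by rewrite !big_nil (der0 sB de).
by rewrite !big_cons (derD sB de) ?IH //; exact: subring_sum.
Qed.

Lemma der_mmap B e d (a : 'I_d -> L) p : subring B -> der_over B e ->
  (forall i, B (a i)) ->
  e (mmap j a p) = \sum_i mmap j a p^`M(i) * e (a i).
Proof.
move=> sB [de ej] Ba.
have Bm q : B (mmap j a q) by apply: mmap_subring => // c; case: (ej c).
elim/mpoly_alg_ind: p => [c|k|p q IHp IHq|p q IHp IHq].
- rewrite mmapC (ej c).2 big1 // => i _; by rewrite mderivC rmorph0 mul0r.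
- rewrite mmapX mmap1U (bigD1 k) //= big1 ?addr0 => [|i ik].
    by rewrite mderivXU eqxx rmorph1 mul1r.
  by rewrite mderivXU (negbTE ik) rmorph0 mul0r.
- rewrite rmorphD /= (derD sB de) // IHp IHq -big_split; apply: eq_bigr => i _ /=.
  by rewrite mderivD rmorphD /= mulrDl.
- have [_ _ eM] := de; rewrite rmorphM /= eM // IHp IHq mulr_sumr mulr_suml -big_split.
  apply: eq_bigr => i _ /=; rewrite mderivM rmorphD !rmorphM /=; ring.
Qed.

(** The Jacobian criterion in characteristic zero: applying the derivations to a relation Q turns
    its partial derivatives into relations of smaller degree, hence zero, so that Q is constant. *)
Lemma algind_of_der D r (B : L -> Prop) (e : 'I_D -> L -> L) (z : 'I_r -> L) :
  subring B -> (forall i, der_over B (e i)) -> (forall k, B (z k)) ->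
  row_free (\matrix_(k, i) e i (z k)) -> algind z.
Proof.
move=> sB he Bz rf Q; have [m] := ubnP (msize Q); elim: m Q => // m IH Q sQ Qz.
have dQ k : Q^`M(k) = 0.
  have [s0|s0] := posnP (msize Q).
    by move/eqP: s0; rewrite msize_poly_eq0 => /eqP ->; rewrite mderiv0.
  apply: IH.
    rewrite (leq_trans _ (sQ : (msize Q <= m)%N)) // -[X in (_ < X)%N](prednK s0) ltnS.
    by apply: msize_mderiv; rewrite prednK.
  pose w := \row_k mmap j z Q^`M(k).
  have : w *m \matrix_(k, i) e i (z k) = 0 *m \matrix_(k, i) e i (z k).
    rewrite mul0mx; apply/rowP => i; rewrite !mxE.
    have := der_mmap Q sB (he i) Bz; rewrite Qz (der0 sB (he i).1) => h.
    by rewrite [RHS]h; apply: eq_bigr => l _; rewrite !mxE.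
  by move/(row_free_inj rf)/rowP/(_ k); rewrite !mxE.
have [c Qc] := mderiv_eq0 charF dQ.
by move: Qz; rewrite Qc mmapC => /eqP; rewrite fmorph_eq0 => /eqP ->; rewrite mpolyC0.
Qed.

Let charL k : k.+1%:R != 0 :> L.
Proof. by rewrite -(rmorph_nat j) fmorph_eq0. Qed.

Definition image_of d (a : 'I_d -> L) : L -> Prop := fun x => exists Q, x = mmap j a Q.

Lemma subring_image d (a : 'I_d -> L) : subring (image_of a).
Proof.
split; first by exists 1; rewrite rmorph1.
  by move=> _ _ [Q ->] [Q' ->]; exists (Q - Q'); rewrite rmorphB.
by move=> _ _ [Q ->] [Q' ->]; exists (Q * Q'); rewrite rmorphM.
Qed.

(** The values of a derivation of F[a] at the generators can be prescribed as soon as they respect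
    the relations between these generators. *)
Lemma der_image d (a w : 'I_d -> L) :
  (forall Q, mmap j a Q = 0 -> \sum_i mmap j a Q^`M(i) * w i = 0) ->
  exists e, [/\ der_over (image_of a) e & forall i, e (a i) = w i].
Proof.
move=> h; pose D Q := \sum_i mmap j a Q^`M(i) * w i.
have DB Q Q' : D (Q - Q') = D Q - D Q'.
  by rewrite /D -sumrB; apply: eq_bigr => i _; rewrite mderivB rmorphB mulrBl.
have DM Q Q' : D (Q * Q') = mmap j a Q * D Q' + D Q * mmap j a Q'.
  rewrite /D mulr_sumr mulr_suml -big_split; apply: eq_bigr => i _ /=.
  by rewrite mderivM rmorphD !rmorphM /=; ring.
have DC c : D c%:MP = 0.
  by rewrite /D big1 // => i _; rewrite mderivC rmorph0 mul0r.
pose e x := if pselect (image_of a x) is left H then D (projT1 (cid H)) else 0.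
have eE Q : e (mmap j a Q) = D Q.
  rewrite /e; case: pselect => [H|[]]; last by exists Q.
  case: cid => Q' /= eQ; apply/eqP; rewrite -subr_eq0 -DB; apply/eqP/h.
  by rewrite rmorphB /= eQ subrr.
exists e; split.
  split; first split.
  - by rewrite -(rmorph1 (mmap j a)) eE -mpolyC1 DC.
  - by move=> _ _ [Q ->] [Q' ->]; rewrite -rmorphB !eE DB.
  - by move=> _ _ [Q ->] [Q' ->]; rewrite -rmorphM !eE DM.
  move=> c; have <- : mmap j a c%:MP = j c by rewrite mmapC.
  by split; [exists c%:MP|rewrite eE DC].
move=> k; have <- : mmap j a 'X_k = a k by rewrite mmapX mmap1U.
rewrite eE /D (bigD1 k) //= big1 ?addr0 => [|i ik].
  by rewrite mderivXU eqxx rmorph1 mul1r.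
by rewrite mderivXU (negbTE ik) rmorph0 mul0r.
Qed.

Lemma der_extend d (a w : 'I_d -> L) (s : seq L) :
  (forall Q, mmap j a Q = 0 -> \sum_i mmap j a Q^`M(i) * w i = 0) ->
  exists e, [/\ der_over (adjoins (image_of a) s) e & forall i, e (a i) = w i].
Proof.
move=> h; have [e [[de ej] ea]] := der_image h.
have sI := subring_image a; have [sA IA _] := adjoins_spec s sI.
have [e' [de' ee']] := der_extension charL s sI de.
exists e'; split.
  split=> // c; have [Ic ec] := ej c; split; first exact: IA.
  by rewrite ee'.
by move=> i; rewrite ee' ?ea //; exists 'X_i; rewrite mmapX mmap1U.
Qed.

Lemma der_comb D (B : L -> Prop) (e : 'I_D -> L -> L) (c : 'I_D -> L) :
  (forall i, der_over B (e i)) -> subring B -> (forall k, B (j k)) ->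
  der_over B (fun x => \sum_i c i * e i x).
Proof.
move=> he sB Bj; split; first split.
- by rewrite big1 // => i _; have [[-> _ _] _] := he i; rewrite mulr0.
- move=> a b Ba Bb; rewrite -sumrB; apply: eq_bigr => i _.
  by have [[_ eB _] _] := he i; rewrite eB // mulrBr.
- move=> a b Ba Bb; rewrite mulr_sumr mulr_suml -big_split; apply: eq_bigr => i _ /=.
  by have [[_ _ eM] _] := he i; rewrite eM //; ring.
move=> k; split=> //; rewrite big1 // => i _; have [_ /(_ k) [_ ->]] := he i.
by rewrite mulr0.
Qed.

(* Transcendence degrees are counted through derivations: D independent elements
   give D derivations, whose values on z and h form a matrix of rank D. *)
Lemma algind_count D (p : 'I_D -> L) a b (z : 'I_a -> L) (h : 'I_b -> L) (s : seq L) :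
  algind p -> (forall i, z i \in s) -> (forall i, h i \in s) ->
  (forall B e, subring B -> (forall x, x \in s -> B x) -> (forall i, B (p i)) ->
     der_over B e ->
     (forall i, e (z i) = 0) -> (forall i, e (h i) = 0) -> forall i, e (p i) = 0) ->
  exists r1 r2 (f1 : 'I_r1 -> 'I_a) (f2 : 'I_r2 -> 'I_b),
    [/\ (D <= r1 + r2)%N, (r1 <= a)%N, algind (z \o f1) & algind (h \o f2)].
Proof.
move=> ip zs hs H.
have /choice [e he] : forall i : 'I_D, exists e,
    der_over (adjoins (image_of p) s) e /\ forall k, e (p k) = (i == k)%:R.
  move=> i; have [|e [de ep]] := @der_extend D p (fun k => (i == k)%:R) s.
    by move=> Q /ip ->; rewrite big1 // => k _; rewrite mderiv0 rmorph0 mul0r.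
  by exists e.
have [sB IB sub] := adjoins_spec s (subring_image p).
set B := adjoins _ _ in he sB IB sub.
have Bj k : B (j k) by apply: IB; exists k%:MP; rewrite mmapC.
have Bp i : B (p i) by apply: IB; exists 'X_i; rewrite mmapX mmap1U.
pose M1 := \matrix_(k, i) e i (z k); pose M2 := \matrix_(k, i) e i (h k).
(* A vector c in the kernel combines the derivations e i into one that kills z and h, hence p; but
   its value at p k is the k-th entry of c. *)
have cf : row_full (col_mx M1 M2).
  rewrite /row_full -mxrank_tr -/(row_free _) -kermx_eq0.
  apply/eqP/row_matrixP => i; rewrite row0.
  set c := row i _; have : c *m (col_mx M1 M2)^T = 0.
    by apply/sub_kermxP; exact: row_sub.
  rewrite tr_col_mx mul_mx_row => /eqP; rewrite row_mx_eq0 => /andP[/eqP c1 /eqP c2].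
  have kill := H B (fun x => \sum_i c 0 i * e i x) sB sub Bp.
  apply/rowP => k; rewrite [RHS]mxE.
  rewrite -[RHS](kill _ _ _ k).
  - rewrite (bigD1 k) //= (he k).2 eqxx mulr1 big1 ?addr0 // => i' ik.
    by rewrite (he i').2 (negbTE ik) mulr0.
  - by apply: der_comb => // i'; case: (he i').
  - by move=> l; have /rowP/(_ l) := c1; rewrite !mxE => h0; rewrite -[RHS]h0;
      apply: eq_bigr => i' _; rewrite !mxE.
  - by move=> l; have /rowP/(_ l) := c2; rewrite !mxE => h0; rewrite -[RHS]h0;
      apply: eq_bigr => i' _; rewrite !mxE.
exists (\rank M1), (\rank M2), (maxrankfun M1), (maxrankfun M2); split.
- have e' : \rank (col_mx M1 M2) = D by exact/eqP.
  rewrite -[X in (X <= _)%N]e' -addsmxE; by case: (mxrank_adds_leqif M1 M2).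
- exact: rank_leq_row.
- apply: (@algind_of_der D _ B e) => // [i|k|]; [by case: (he i)|exact/sub/zs|].
  by rewrite (_ : \matrix_(k, i) _ = rowsub (maxrankfun M1) M1) ?maxrowsub_free //;
    apply/matrixP => k i; rewrite !mxE.
- apply: (@algind_of_der D _ B e) => // [i|k|]; [by case: (he i)|exact/sub/hs|].
  by rewrite (_ : \matrix_(k, i) _ = rowsub (maxrankfun M2) M2) ?maxrowsub_free //;
    apply/matrixP => k i; rewrite !mxE.
Qed.
End Derivations.

(** * Chains of closed sets and independent coordinates *)

Section Chains.
Variables (F : closedFieldType) (n : nat).
Local Notation S := {mpoly F[n.+1]}.
Local Notation V := 'rV[F]_n.+1.
Local Notation P := (proj F n).
Implicit Types (X Z : set P).

Definition indep_on X d (q : 'I_d -> S) := forall Q, vanishing X (msub q Q) -> Q = 0.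

Definition of_upoly d (p : {poly {mpoly F[d]}}) : {mpoly F[d.+1]} :=
  horner_morph (fun p => mulrC 'X_ord_max (mwiden p)) p.
HB.instance Definition _ d := GRing.RMorphism.copy (@of_upoly d)
  (horner_morph (fun p : {mpoly F[d]} => mulrC 'X_ord_max (mwiden p))).

Lemma of_upoly_surj d (Q : {mpoly F[d.+1]}) : exists p, of_upoly p = Q.
Proof.
elim/mpoly_alg_ind: Q => [c|i|q q' [p <-] [p' <-]|q q' [p <-] [p' <-]].
- by exists (c%:MP)%:P; rewrite /of_upoly horner_morphC /= mwidenC.
- have [j|->] := unliftP ord_max i; last by exists 'X; rewrite /of_upoly horner_morphX.
  move=> ->; exists ('X_j)%:P; rewrite /of_upoly horner_morphC /= mwidenX mnmwiden1.
  by congr ('X_[U_(_)]); apply: val_inj; rewrite /= /bump leqNgt ltn_ord.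
- by exists (p + p'); rewrite rmorphD.
- by exists (p * p'); rewrite rmorphM.
Qed.

Definition fsnoc (T : Type) d (q : 'I_d -> T) (f : T) : 'I_d.+1 -> T :=
  fun i => if unlift ord_max i is Some k then q k else f.

Lemma msub_mwiden d (q : 'I_d -> S) f Q : msub (fsnoc q f) (mwiden Q) = msub q Q.
Proof.
elim/mpoly_alg_ind: Q => [c|i|p p' IHp IHq|p p' IHp IHq].
- by rewrite mwidenC /msub !mmapC.
- rewrite mwidenX mnmwiden1 /msub !mmapX !mmap1U /fsnoc.
  have -> : widen_ord (leqnSn d) i = lift ord_max i.
    by apply: val_inj; rewrite /= /bump leqNgt ltn_ord.
  by rewrite liftK.
- by rewrite mwidenD !rmorphD /= IHp IHq.
- by rewrite mwidenM !rmorphM /= IHp IHq.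
Qed.

(** In a relation involving f, the term free of f vanishes on Z, hence is the zero polynomial; f can
    then be cancelled because it lies outside the prime ideal of X. Each step of a chain thus adds
    one independent element. *)
Lemma indep_snoc Z X d (q : 'I_d -> S) f : irreducible X -> Z `<=` X ->
  indep_on Z q -> vanishing Z f -> ~ vanishing X f -> indep_on X (fsnoc q f).
Proof.
move=> /irreducible_prime [_ _ pr] ZX iq Zf Xf Q.
have [p <-] := of_upoly_surj Q.
elim/poly_ind: p => [|p c IH]; first by rewrite rmorph0.
rewrite rmorphD rmorphM /=.
have -> : of_upoly 'X = 'X_ord_max :> {mpoly F[d.+1]} by rewrite /of_upoly horner_morphX.
have -> : of_upoly c%:P = mwiden c by rewrite /of_upoly horner_morphC.
rewrite rmorphD rmorphM /= msub_mwiden.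
have -> : msub (fsnoc q f) 'X_ord_max = f.
  by rewrite /msub mmapX mmap1U /fsnoc unlift_none.
move=> h; have c0 : c = 0.
  apply: iq => x v Zx xv; have := h x v (ZX _ Zx) xv.
  by rewrite mevalD mevalM (Zf x v) // mulr0 add0r.
move: h; rewrite c0 rmorph0 mwiden0 !addr0 => /pr [|//] /IH ->.
by rewrite mul0r.
Qed.

(** The count is d + 1 and not d because the cone over the bottom set already carries one
    independent element: a coordinate that scaling makes transcendental. *)
Lemma chain_indep d (Z : nat -> set P) :
  (forall i, (i <= d)%N -> irreducible (Z i)) ->
  (forall i, (i < d)%N -> Z i `<=` Z i.+1 /\ exists f, vanishing (Z i) f /\ ~ vanishing (Z i.+1) f) ->
  exists q : 'I_d.+1 -> S, indep_on (Z d) q.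
Proof.
elim: d => [|d IH] irr lt.
  have [[x Zx] _] := irr 0%N isT; have [v [xv v0]] := hcoord_ex x.
  have [i vi] : exists i, v 0 i != 0.
    apply: contrapT => /forallNP h; move/eqP: v0; apply; apply/rowP => i.
    by rewrite mxE; apply/eqP; apply: contrapT => /negP; exact: h.
  exists (fun=> 'X_i) => Q hQ.
  have hz t : t != 0 -> Q.@[fun=> t] = 0.
    move=> t0; have [tv0 tv] : t / v 0 i != 0 /\ hcoord x (t / v 0 i *: v).
      by split; [rewrite mulf_neq0 ?invr_neq0|apply: hcoordZ => //; rewrite mulf_neq0 ?invr_neq0].
    have := hQ x _ Zx tv; rewrite msub_meval => <-; apply: meval_eq => k.
    by rewrite mevalXU mxE divfK.
  pose U := mmap (@polyC F) (fun=> 'X) Q.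
  have UE t : U.[t] = Q.@[fun=> t].
    rewrite /U; elim/mpoly_alg_ind: Q {hQ hz U} => [c|k|p p' IHp IHq|p p' IHp IHq].
    - by rewrite mmapC hornerC mevalC.
    - by rewrite mmapX mmap1U hornerX mevalXU.
    - by rewrite rmorphD hornerD IHp IHq mevalD.
    - by rewrite rmorphM hornerM IHp IHq mevalM.
  have U0 : U = 0 by apply: poly_eq0_everywhere => t t0; rewrite UE hz.
  apply: mpoly_eq0_everywhere => w; rewrite (@meval_eq _ _ _ (fun=> w ord0)); last first.
    by move=> k; rewrite ord1.
  by rewrite -UE U0 horner0.
have [|i id|q iq] := IH.
- by move=> i id; apply: irr; exact: leqW.
- by apply: lt; exact: ltnW.
have [ZZ [f [Zf nf]]] := lt d (ltnSn d).
by exists (fsnoc q f); apply: indep_snoc iq Zf nf => //; exact: irr.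
Qed.

Lemma dim_ge_indep X d : dim_ge X d -> exists Z, [/\ closed Z, irreducible Z, Z `<=` closure X &
  exists q : 'I_d.+1 -> S, indep_on Z q].
Proof.
move=> [Z [irr lt]]; have cZ i : (i <= d)%N -> irreducible (closure (Z i)).
  by move=> /irr [h _]; exact: irreducible_closure.
have mono i : (i < d)%N -> closure (Z i) `<=` closure (Z i.+1).
  by move=> /lt [h _]; exact: closure_subset.
exists (closure (Z d)); split; [exact: closed_closure|exact: cZ| |].
  apply: closure_subset; have [_ <-] := irr d (leqnn d); exact: subIsetr.
apply: (@chain_indep d (fun i => closure (Z i)) cZ) => i id; split; first exact: mono.
apply: contrapT => /forallNP h; have [_ nle] := lt i id; apply: nle.
have [_ <-] := irr i (ltnW id); have [_ <-] := irr i.+1 id.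
move=> x [cx Xx]; split=> //; apply: (closed_sub_vanishing _ _) cx.
  exact: closed_closure.
move=> p hp; apply: contrapT => np; exact: (h p).
Qed.
End Chains.

Lemma mpolyXU_neq0 (R : nzRingType) m (i : 'I_m) : 'X_i != 0 :> {mpoly R[m]}.
Proof.
apply/eqP => /(congr1 (mcoeff U_(i))); rewrite mcoeffX eqxx mcoeff0 => /eqP.
by rewrite oner_eq0.
Qed.

Section DimGe.
Variables (F : closedFieldType) (n : nat).
Local Notation S := {mpoly F[n.+1]}.
Local Notation V := 'rV[F]_n.+1.
Local Notation P := (proj F n).
Implicit Types (X Z : set P).

Definition coords d (A : 'I_d -> 'I_n.+1) : 'I_d -> S := fun i => 'X_(A i).

Lemma msub_coords d (A : 'I_d -> 'I_n.+1) Q (v : V) :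
  (msub (coords A) Q).@[v 0] = Q.@[fun i => v 0 (A i)].
Proof. by rewrite msub_meval; apply: meval_eq => i; rewrite mevalXU. Qed.

Lemma indep_nonempty X d (q : 'I_d -> S) : indep_on X q -> X !=set0.
Proof.
move=> iq; apply: contrapT => nX; have : (1 : {mpoly F[d]}) = 0.
  by apply: iq => x v Xx; case: nX; exists x.
by move/eqP; rewrite oner_eq0.
Qed.

(** A minimal closed subset on which q stays independent is irreducible: were it covered by two
    proper closed subsets, each would carry a relation, and the product of the two would be a
    relation on the whole. *)
Lemma minimal_indep X d (q : 'I_d -> S) : closed X -> indep_on X q ->
  exists Z, [/\ closed Z, irreducible Z, Z `<=` X & indep_on Z q].
Proof.
move=> cX iX.
have [||Z [[cZ ZX iZ] min]] := @closed_minimal F n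
   (fun Z => [/\ closed Z, Z `<=` X & indep_on Z q]).
- by move=> Z [].
- by exists X; split=> //; exact: subset_refl.
exists Z; split=> //; split; first exact: indep_nonempty iZ.
move=> B C cB cC ZBC; apply: contrapT => /not_orP [nB nC].
have ex D : closed D -> ~ Z `<=` D -> exists Q, Q != 0 /\ vanishing (Z `&` D) (msub q Q).
  move=> cD nD; apply: contrapT => /forallNP h; apply: nD.
  have <- : Z `&` D = Z; last exact: subIsetr.
  apply: min; last exact: subIsetl.
  split; [exact: closedI|by move=> x [/ZX]|].
  move=> Q hQ; apply/eqP; apply: contrapT => /negP Q0; exact: (h Q).
have [Q1 [Q10 h1]] := ex B cB nB; have [Q2 [Q20 h2]] := ex C cC nC.
have : Q1 * Q2 = 0.
  apply: iZ => x v Zx xv; rewrite rmorphM mevalM.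
  by case: (ZBC x Zx) => [Bx|Cx]; [rewrite (h1 x v)|rewrite (h2 x v)];
    rewrite ?mul0r ?mulr0.
by move/eqP; rewrite mulf_eq0 (negbTE Q10) (negbTE Q20).
Qed.

Lemma mpoly_nonzero_point m (G : {mpoly F[m]}) : G != 0 -> exists a, G.@[a] != 0.
Proof.
move=> G0; apply: contrapT => /forallNP h; move/eqP: G0; apply.
by apply: mpoly_eq0_everywhere => v; apply/eqP; apply: contrapT => /negP; exact: h.
Qed.

(** Hyperplane cuts: the equation f makes the last coordinate [la] times the first, where [la] is
    chosen so that the cut meets the open set over which points lift to X. The other d + 1
    coordinates then remain independent on the cut, and the induction applies to an irreducible part
    of it. *)
Lemma indep_dim_ge X d (A : 'I_d.+1 -> 'I_n.+1) : closed X -> irreducible X ->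
  indep_on X (coords A) -> dim_ge X d.
Proof.
elim: d X A => [|d IH] X A cX iX ind.
  exists (fun=> X); split=> // i _; split=> //.
  by rewrite setIC; apply/seteqP; split=> [x []|x Xx] //; split=> //; exact: subset_closure.
have [L [g [gP _]]] := prime_residue_field (irreducible_prime iX).
have [||G [G0 HG]] := @generic_lift F n.+1 d.+2 L g (coords A) 1.
- by move=> Q /gP; exact: ind.
- by rewrite rmorph1 oner_neq0.
have [|b] := @mpoly_nonzero_point _ (G * 'X_ord0) _; first by rewrite mulf_neq0 // mpolyXU_neq0.
rewrite mevalM mevalXU mulf_eq0 negb_or => /andP[Gb b0].
pose la := b ord_max / b ord0.
pose A' : 'I_d.+1 -> 'I_n.+1 := A \o lift ord_max.
pose f : S := 'X_(A ord_max) - la *: 'X_(A ord0).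
have fE (v : V) : f.@[v 0] = v 0 (A ord_max) - la * v 0 (A ord0).
  by rewrite mevalB mevalZ !mevalXU.
have nXf : ~ vanishing X f.
  have -> : f = msub (coords A) ('X_ord_max - la *: 'X_ord0).
    by rewrite rmorphB /= /msub mmapZ !mmapX !mmap1U /= mul_mpolyC.
  move=> /ind /eqP; apply/negP; apply/eqP => /(congr1 (meval (fun i => (i == ord_max)%:R))).
  by rewrite mevalB mevalZ !mevalXU meval0 eqxx /= mulr0 subr0 => /eqP; rewrite oner_eq0.
pose X' := X `&` zeros (eq f).
have cX' : closed X' by apply: closedI => //; exact: zeros_closed.
have ind' : indep_on X' (coords A').
  move=> Q hQ; apply/eqP; apply: contrapT => /negP Q0.
  pose W : 'I_d.+2 -> {mpoly F[d.+1]} := fsnoc (fun i => 'X_i) (la *: 'X_ord0).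
  have WE a i : (W i).@[a] = fsnoc a (la * a ord0) i.
    by rewrite /W /fsnoc; case: unliftP => [k _|_]; rewrite ?mevalZ mevalXU.
  (* The restriction of G to the hyperplane of the cut; it is nonzero because b lies on this
     hyperplane. *)
  pose G' : {mpoly F[d.+1]} := mmap (@mpolyC d.+1 F) W G.
  have G'E a : G'.@[a] = G.@[fsnoc a (la * a ord0)].
    by rewrite -[G']/(msub W G) msub_meval; apply: meval_eq => i; exact: WE.
  have G'0 : G' != 0.
    apply: contraNneq Gb => e; have := G'E (b \o lift ord_max).
    rewrite e meval0 => ->; apply/eqP; apply: meval_eq => i; rewrite /fsnoc.
    case: unliftP => [k ->|->] //=.
    have -> : lift ord_max ord0 = ord0 :> 'I_d.+2 by apply: val_inj.
    by rewrite /la divfK.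
  have [|a] := @mpoly_nonzero_point _ (Q * (G' * 'X_ord0)) _.
    by rewrite !mulf_neq0 // mpolyXU_neq0.
  rewrite !mevalM mevalXU !mulf_eq0 !negb_or => /and3P[Qa Ga a0].
  have [|v [v0 va _]] := HG (fsnoc a (la * a ord0)); first by rewrite -G'E.
  pose w : V := \row_i v i.
  have wv : w 0 =1 v by move=> i; rewrite mxE.
  have wA i : w 0 (A i) = fsnoc a (la * a ord0) i.
    by rewrite wv -va /coords mevalXU.
  have w0 : w != 0.
    apply: contraNneq a0 => e; have := wA ord0; rewrite e mxE /fsnoc.
    case: unliftP => [k ek|/eqP]; last by rewrite -val_eqE.
    have -> : k = ord0 by apply: val_inj; move/(congr1 val): ek; rewrite /= /bump; lia.
    by move=> <-.
  have [x [Xx xw]] : pcone X w.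
    apply: closed_pcone => // p hp; rewrite (meval_eq _ wv); apply: v0; exact/gP.
  have X'x : X' x.
    split=> //; rewrite /zeros => u xu _ <-; have [c [c0 ->]] := hcoord_scale xw xu.
    rewrite fE ![(c *: w) _ _]mxE !wA /fsnoc unlift_none.
    case: unliftP => [k ek|/eqP]; last by rewrite -val_eqE.
    have -> : k = ord0 by apply: val_inj; move/(congr1 val): ek; rewrite /= /bump; lia.
    by rewrite mulrCA subrr.
  have := hQ x w X'x xw; rewrite msub_coords => e; move/eqP: Qa; apply; rewrite -[RHS]e.
  by apply: meval_eq => i; rewrite /A' /= wA /fsnoc liftK.
have [Z [cZ iZ ZX' indZ]] := minimal_indep cX' ind'.
have [C [C1 C2]] := IH Z A' cZ iZ indZ.
have Csub i : (i <= d)%N -> C i `<=` Z by move=> /C1 [_ <-]; exact: subIsetr.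
exists (fun i => if (i <= d)%N then C i else X); split=> i id.
  case: ifP => [le|_]; last first.
    split=> //; rewrite setIC; apply/seteqP; split=> [x []|x Xx] //.
    by split=> //; exact: subset_closure.
  have [irr e] := C1 i le; split=> //; apply/seteqP; split=> x.
    move=> [cx Xx]; rewrite -e; split=> //.
    rewrite (iffLR (closure_id _) cZ); exact: (closure_subset (Csub i le)) cx.
  by move=> Cx; split; [exact: subset_closure|have /ZX' [] := Csub i le x Cx].
rewrite -ltnS id; case: ifP => [lt|_]; first exact: C2.
split=> [x /(Csub i id) /ZX' [] //|XC].
apply: nXf => x v Xx xv; have /(Csub i id) /ZX' [_ h] := XC x Xx.
exact: h.
Qed.

End DimGe.

Lemma subring_prod (R : comNzRingType) (K : R -> Prop) I (r : seq I) (f : I -> R) :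
  subring K -> (forall i, K (f i)) -> K (\prod_(i <- r) f i).
Proof. by move=> [K1 _ KM] Kf; apply: big_ind. Qed.

Lemma subring_det (R : comNzRingType) (K : R -> Prop) m (M : 'M[R]_m) :
  subring K -> (forall i k, K (M i k)) -> K (\det M).
Proof.
move=> sK KM; apply: subring_sum => // s _; have [K1 KB KMul] := sK.
apply: KMul; last exact: subring_prod.
by apply: subringX => //; exact: subringN.
Qed.

Lemma subring_adj (R : comNzRingType) (K : R -> Prop) m (M : 'M[R]_m) :
  subring K -> (forall i k, K (M i k)) -> forall i k, K ((\adj M) i k).
Proof.
move=> sK KM i k; rewrite mxE /cofactor; have [K1 KB KMul] := sK; apply: KMul.
  by apply: subringX => //; exact: subringN.
by apply: subring_det => // a b; rewrite !mxE.
Qed.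

Lemma homog_mmap (R S : comNzRingType) n (j : {rmorphism R -> S}) (p : {mpoly R[n]}) (t : S) a :
  mmap j (fun i => t * a i) p = \sum_(d < msize p) t ^+ d * mmap j a (pihomog mdeg d p).
Proof.
have {1}-> : p = \sum_(d < msize p) pihomog mdeg d p by exact: pihomog_partitionE.
rewrite rmorph_sum; apply: eq_bigr => d _ /=.
rewrite /mmap mulr_sumr; apply: eq_big_seq => m mp.
have -> : nat_of_ord d = mdeg m by move/dhomogP: (pihomogP mdeg d p) => /(_ m mp).
rewrite mulrCA; congr (_ * _); rewrite /mmap1 mdegE -prodrXr -big_split /=.
by apply: eq_bigr => i _; rewrite exprMn.
Qed.

Lemma homog_mmapd (R S : comNzRingType) n (j : {rmorphism R -> S}) (p : {mpoly R[n]}) (t : S) a d :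
  p \is d.-homog -> mmap j (fun i => t * a i) p = t ^+ d * mmap j a p.
Proof.
move=> hp; rewrite /mmap mulr_sumr; apply: eq_big_seq => m mp.
have -> : d = mdeg m by move/dhomogP: hp => /(_ m mp).
rewrite mulrCA; congr (_ * _); rewrite /mmap1 mdegE -prodrXr -big_split /=.
by apply: eq_bigr => i _; rewrite exprMn.
Qed.

Lemma mderiv_homog (R : comNzRingType) n (p : {mpoly R[n]}) i d :
  p \is d.-homog -> p^`M(i) \is d.-1.-homog.
Proof.
move=> /dhomogP h; apply/dhomogP => m; rewrite mcoeff_msupp mcoeff_mderiv => mp.
have : mdeg (m + U_(i))%MM = d.
  by apply: h; rewrite mcoeff_msupp; apply: contraNneq mp => ->; rewrite mul0rn.
by rewrite mdegD mdeg1 addn1 => <-.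
Qed.

(** The remainder e is located in K: when K is a Rees algebra, this bounds its degree in y. *)
Lemma taylor (R S : comNzRingType) n (j : {rmorphism R -> S}) (K : S -> Prop)
  (a b : 'I_n -> S) (t : S) p : subring K -> (forall c, K (j c)) -> (forall i, K (a i)) ->
  (forall i, K (b i)) -> K t -> exists e, K e /\
    mmap j (fun i => a i + t * b i) p =
      mmap j a p + t * (\sum_i mmap j a p^`M(i) * b i) + t ^+ 2 * e.
Proof.
move=> sK Kj Ka Kb Kt; have [K1 KB KM] := sK; have K0 := subring0 sK.
have KD x y : K x -> K y -> K (x + y) by exact: subringD.
have Kev q : K (mmap j a q) by exact: mmap_subring.
have Kdev q : K (\sum_i mmap j a q^`M(i) * b i).
  by apply: subring_sum => // i _; exact: KM.
elim/mpoly_alg_ind: p => [c|k|p q [e [Ke IHp]] [f [Kf IHq]]|p q [e [Ke IHp]] [f [Kf IHq]]].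
- exists 0; split=> //; rewrite !mmapC big1 ?mulr0 ?addr0 // => i _.
  by rewrite mderivC rmorph0 mul0r.
- exists 0; split=> //; rewrite !mmapX !mmap1U (bigD1 k) //= big1 => [|i ik].
    by rewrite mderivXU eqxx rmorph1 mul1r addr0 mulr0 addr0.
  by rewrite mderivXU (negbTE ik) rmorph0 mul0r.
- exists (e + f); split; first exact: KD.
  rewrite !rmorphD /= IHp IHq.
  under [in RHS]eq_bigr do rewrite mderivD rmorphD mulrDl /=.
  by rewrite big_split /=; ring.
- pose D q := \sum_i mmap j a q^`M(i) * b i.
  exists (mmap j a p * f + e * mmap j a q + (D p + t * e) * (D q + t * f)); split.
    exact: (KD _ _ (KD _ _ (KM _ _ (Kev p) Kf) (KM _ _ Ke (Kev q)))
      (KM _ _ (KD _ _ (Kdev p) (KM _ _ Kt Ke)) (KD _ _ (Kdev q) (KM _ _ Kt Kf)))).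
  rewrite !rmorphM /= IHp IHq -/(D p) -/(D q).
  have -> : \sum_i mmap j a (p * q)^`M(i) * b i = mmap j a p * D q + D p * mmap j a q.
    rewrite /D mulr_sumr mulr_suml -big_split; apply: eq_bigr => i _ /=.
    by rewrite mderivM rmorphD !rmorphM /=; ring.
  by ring.
Qed.

(** * Derivations on secant lines *)

Section Rees.
Variables (L : fieldType) (PA : idomainType) (al : {rmorphism PA -> L}) (n : nat).
Variable y : 'I_n -> L.

Definition filt m (x : L) := exists Q : {mpoly PA[n]}, (msize Q <= m.+1)%N /\ x = mmap al y Q.

Lemma filt0 m : filt m 0.
Proof. by exists 0; rewrite msize0 rmorph0. Qed.
Lemma filtC m a : filt m (al a).
Proof. by exists a%:MP; rewrite mmapC; split=> //; rewrite msizeC; case: eqP. Qed.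
Lemma filtB m x x' : filt m x -> filt m x' -> filt m (x - x').
Proof.
move=> [Q [sQ ->]] [Q' [sQ' ->]]; exists (Q - Q'); rewrite rmorphB; split=> //.
by rewrite (leq_trans (msizeD_le _ _)) // geq_max sQ msizeN.
Qed.
Lemma filtM m m' x x' : filt m x -> filt m' x' -> filt (m + m') (x * x').
Proof.
move=> [Q [sQ ->]] [Q' [sQ' ->]]; exists (Q * Q'); rewrite rmorphM; split=> //.
have [->|Q0] := eqVneq Q 0; first by rewrite mul0r msize0.
have [->|Q'0] := eqVneq Q' 0; first by rewrite mulr0 msize0.
rewrite msizeM //.
by move: sQ sQ'; move: (msize Q) (msize Q') => a b; lia.
Qed.
Lemma filtY i m : filt m.+1 (y i).
Proof. by exists 'X_i; rewrite mmapX mmap1U msizeX mdeg1. Qed.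
Lemma filt_sum m I (r : seq I) (f : I -> L) : (forall i, filt m (f i)) -> filt m (\sum_(i <- r) f i).
Proof.
move=> h; apply: big_ind => //; first exact: filt0.
by move=> a b ha hb; rewrite -[b]opprK; apply: filtB => //; rewrite -sub0r; apply: filtB => //; exact: filt0.
Qed.

(** The Rees algebra of the filtration by degree in y. *)
Definition rees (P : {poly L}) := forall i, filt i P`_i.

Lemma subring_rees : subring rees.
Proof.
split.
- by move=> i; rewrite coef1; case: (i == 0)%N; [rewrite -(rmorph1 al); exact: filtC|exact: filt0].
- by move=> P Q hP hQ i; rewrite coefB; exact: filtB.
- move=> P Q hP hQ i; rewrite coefM; apply: filt_sum => k.
  by have := filtM (hP k) (hQ (i - k)%N); rewrite subnKC // -ltnS.
Qed.
Lemma rees_X : rees 'X.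
Proof.
by move=> i; rewrite coefX; case: (i == 1)%N; [rewrite -(rmorph1 al); exact: filtC|exact: filt0].
Qed.
Lemma rees_C a : rees (al a)%:P.
Proof. by move=> i; rewrite coefC; case: (i == 0)%N; [exact: filtC|exact: filt0]. Qed.
Lemma rees_Y i : rees ('X * (y i)%:P).
Proof.
move=> k; rewrite coefXM coefC; case: k => [|[|k]] /=; try exact: filt0.
exact: filtY.
Qed.

(* Up to u, the monomials of bounded degree in y generate a module stable under y_i:
   determinant trick. *)
Lemma filt_algebraic u (k : 'I_n -> nat) :
  (forall i, filt (k i) (al u * y i ^+ (k i).+1)) ->
  forall i, exists p : {poly PA}, exists t, p \is monic /\
    root (map_poly al p) (al u ^+ t * y i).
Proof.
move=> h i; pose M := (\sum_i (k i).+1)%N.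
(* A monomial of degree greater than M has some exponent above k l, so that one factor al u lowers
   its degree; powers of al u bring everything down to degree M. *)
have red m : forall x, filt m x -> exists t, filt M (al u ^+ t * x).
  elim: m => [|m IH] x.
    move=> [Q [sQ ->]]; exists 0%N, Q; rewrite expr0 mul1r; split=> //.
    exact: leq_trans sQ _.
  move=> hx; have [le|lt] := leqP m.+1 M.
    have [Q [sQ ->]] := hx; exists 0%N, Q; rewrite expr0 mul1r; split=> //.
    by rewrite (leq_trans sQ) // ltnS.
  suff hm : filt m (al u * x).
    by have [t ht] := IH _ hm; exists t.+1; rewrite exprSr -mulrA.
  have [Q [sQ ->]] := hx; rewrite (mpolyE Q) rmorph_sum mulr_sumr /= big_seq.
  apply: big_ind; first exact: filt0.
    by move=> a b ha hb; rewrite -[b]opprK; apply: filtB => //; rewrite -sub0r; apply: filtB => //; exact: filt0.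
  move=> mu muQ; rewrite mmapZ mmapX mulrCA; apply: (@filtM 0 m); first exact: filtC.
  have smu : (mdeg mu <= m.+1)%N by rewrite -ltnS (leq_trans (msize_mdeg_lt muQ)).
  move: smu; rewrite leq_eqVlt => /orP[/eqP smu|smu]; last first.
    apply: (@filtM 0 m); first exact: filtC.
    by exists 'X_[mu]; rewrite mmapX msizeX.
  have [l hl] : exists l, ((k l).+1 <= mu l)%N.
    apply: contrapT => /forallNP hn; move: lt; rewrite -smu ltnNge mdegE leq_sum //.
    by move=> l _; apply: ltnW; rewrite ltnNge; apply/negP; exact: hn.
  have -> : mmap1 y mu = y l ^+ (k l).+1 * mmap1 y (mu - U_(l) *+ (k l).+1)%MM.
    rewrite /mmap1 (bigD1 l) //= [in RHS](bigD1 l) //= mulrA -exprD mnmBE mulmnE mnm1E eqxx mul1n subnKC //.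
    congr (_ * _); apply: eq_bigr => l' ll'; rewrite mnmBE mulmnE mnm1E eq_sym (negbTE ll') mul0n subn0 //.
  have mE : m = (k l + (m - k l))%N.
    by rewrite subnKC //; rewrite -ltnS (leq_trans hl) // -smu mdegE (bigD1 l) //= leq_addr.
  rewrite mulrA [X in filt X]mE; apply: filtM; first exact: h.
  exists 'X_[mu - U_(l) *+ (k l).+1]; rewrite mmapX msizeX; split=> //.
  have := congr1 mdeg (@submK _ (U_(l) *+ (k l).+1)%MM mu _).
  rewrite mdegD mdegMn mdeg1 mul1n => e; rewrite ltnS leq_subRL //.
    rewrite -ltnS -addSn addnC e ?smu //.
    by apply/mnm_lepP => l'; rewrite mulmnE mnm1E; case: eqP => [<-|]; rewrite ?mul1n.
  by rewrite -ltnS (leq_trans hl) // -smu mdegE (bigD1 l) //= leq_addr.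
pose T : finType := 'X_{1..n < M.+1}.
pose mon (mu : T) : 'X_{1..n} := bmnm mu.
have [t ht] : exists t, forall mu : T, filt M (al u ^+ t * (y i * mmap1 y (mon mu))).
  have /choice [t ht] : forall mu : T, exists t, filt M (al u ^+ t * (y i * mmap1 y mu)).
    move=> mu; apply: (red M.+1); exists ('X_i * 'X_[mon mu]); rewrite rmorphM /= !mmapX mmap1U.
    by split=> //; rewrite -mpolyXD msizeX mdegD mdeg1 add1n ltnS; exact: bmdeg.
  exists (\max_mu t mu)%N => mu.
  rewrite -(subnK (leq_bigmax mu)) exprD -mulrA -rmorphXn /=.
  by apply: (@filtM 0 M); [exact: filtC|exact: ht].
have /choice [Q hQ] := ht.
(* Multiplication by (al u)^t y_i on the span of the monomials of degree at most M. The vector of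
   these monomials is an eigenvector, nonzero because 1 is one of its entries. *)
pose Mx : 'M[PA]_#|T| := \matrix_(a, b) (Q (enum_val b))@_(mon (enum_val a)).
exists (char_poly Mx), t; split; first exact: char_poly_monic.
rewrite map_char_poly -eigenvalue_root_char; apply/eigenvalueP.
exists (\row_a mmap1 y (mon (enum_val a))).
  apply/rowP => b; rewrite !mxE; have [sQ] := hQ (enum_val b).
  rewrite -mulrA => ->; rewrite (mmapE M.+1) // (reindex (fun a : 'I_#|T| => enum_val a)) /=; last first.
    by exists enum_rank => a _; rewrite ?enum_rankK ?enum_valK.
  by apply: eq_bigr => a _; rewrite !mxE mulrC.
apply/eqP => /rowP /(_ (enum_rank (bm0 : T))).
by rewrite !mxE enum_rankK /= mmap11 => /eqP; rewrite oner_eq0.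
Qed.
End Rees.

Section DerAlgebraic.
Variables (F L : fieldType) (j : {rmorphism F -> L}).
Hypothesis charF : forall k, k.+1%:R != 0 :> F.

Lemma der_horner (B : L -> Prop) e (p : {poly L}) t : subring B -> der_on B e ->
  B t -> (forall i, B p`_i /\ e p`_i = 0) -> e p.[t] = p^`().[t] * e t.
Proof.
move=> sB de Bt; elim/poly_ind: p => [|p c IH] hp.
  by rewrite deriv0 !horner0 mul0r (der0 sB de).
have hp' i : B p`_i /\ e p`_i = 0.
  by have := hp i.+1; rewrite coefD coefMX coefC /= addr0.
have [Bc ec] : B c /\ e c = 0 by have := hp 0%N; rewrite coefD coefMX coefC /= add0r.
have Bp : B p.[t].
  rewrite horner_coef; apply: subring_sum => // i _; case: (sB) => _ _; apply.
    by case: (hp' i).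
  exact: subringX.
have [_ _ eM] := de; have BM : B (p.[t] * t) by case: sB => _ _; apply.
rewrite !hornerE (derD sB de) // ec addr0 eM // IH // derivD derivM derivX derivC.
by rewrite !hornerE; ring.
Qed.

(** Separability: for p0 of least degree over the image of [al], one has 0 = e(p0(t)) = p0'(t) e(t),
    and p0'(t) is nonzero in characteristic zero. *)
Lemma der_algebraic (PA : comNzRingType) (al : {rmorphism PA -> L}) (B : L -> Prop) e
  (p : {poly PA}) t : subring B -> der_on B e -> B t ->
  (forall a, B (al a) /\ e (al a) = 0) -> p \is monic -> root (map_poly al p) t -> e t = 0.
Proof.
move=> sB de Bt ha pm rt; pose K x := exists a, x = al a.
have sK : subring K.
  split; first by exists 1; rewrite rmorph1.
    by move=> _ _ [a ->] [b ->]; exists (a - b); rewrite rmorphB.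
  by move=> _ _ [a ->] [b ->]; exists (a * b); rewrite rmorphM.
have [tr|[p0 m0]] := transc_or_minimal K t.
  have : map_poly al p = 0.
    by apply: tr; [move=> i; rewrite coef_map; exists p`_i|exact/rootP].
  have : map_poly al p \is monic by exact: monic_map.
  by move=> /[swap] ->; rewrite monicE lead_coef0 eq_sym oner_eq0.
have charL k : k.+1%:R != 0 :> L by rewrite -(rmorph_nat j) fmorph_eq0.
have dp := minimal_deriv charL sK m0; have [h0 n0 r0 _] := m0.
have := der_horner (p := p0) sB de Bt _; rewrite r0 (der0 sB de) => h.
apply/eqP; have : p0^`().[t] * e t = 0.
  by rewrite -h // => i; have [a ->] := h0 i.
by move/eqP; rewrite mulf_eq0 (negbTE dp).
Qed.
End DerAlgebraic.

Section Smooth.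
Variables (F : closedFieldType) (n : nat).
Local Notation S := {mpoly F[n.+1]}.
Local Notation V := 'rV[F]_n.+1.
Local Notation P := (proj F n).
Implicit Types (X Z : set P).

Section Grad.
Variables (R : comNzRingType) (j : {rmorphism F -> R}) (y : 'I_n.+1 -> R).
Definition grad (p : S) : 'rV[R]_n.+1 := \row_i mmap j y p^`M(i).
Definition jac r (f : 'I_r -> S) : 'M[R]_(r, n.+1) := \matrix_(a, i) mmap j y (f a)^`M(i).
End Grad.

(** The Jacobian form of smoothness in codimension r. The gradients are those of forms, so that the
    minors built from them are homogeneous, and they span the whole conormal space at v. *)
Definition smooth_rank X r := forall v, pcone X v -> exists f : 'I_r -> S,
  [/\ forall a, vanishing X (f a) /\ Defs.form (f a), row_free (jac idfun (v 0) f) &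
   forall p, vanishing X p -> (grad idfun (v 0) p <= jac idfun (v 0) f)%MS].

Definition minor_mx r (f : 'I_r -> S) (c : 'I_r -> 'I_n.+1) : 'M[S]_r :=
  \matrix_(a, b) (f a)^`M(c b).
Definition minor r (f : 'I_r -> S) (c : 'I_r -> 'I_n.+1) : S := \det (minor_mx f c).

Lemma mmap_minor (R : comNzRingType) (j : {rmorphism F -> R}) y r (f : 'I_r -> S) c :
  mmap j y (minor f c) = \det (colsub c (jac j y f)).
Proof.
rewrite /minor -det_map_mx; congr (\det _); apply/matrixP => a b.
by rewrite !mxE.
Qed.

(** Cramer's rule without division, needed over L['X], where the minor is not invertible: a
    combination of the rows of D is recovered, up to the minor, from its columns c. *)
Lemma cramer_span (R : comNzRingType) r (D : 'M[R]_(r, n.+1)) (s : 'rV[R]_r) c :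
  colsub c (s *m D) *m \adj (colsub c D) *m D = \det (colsub c D) *: (s *m D).
Proof.
have -> : colsub c (s *m D) = s *m colsub c D.
  by apply/matrixP => a b; rewrite !mxE; apply: eq_bigr => i _; rewrite !mxE.
by rewrite -(mulmxA s) mul_mx_adj mul_mx_scalar scalemxAl.
Qed.

Lemma minor_neq0 r (M : 'M[F]_(r, n.+1)) : row_free M ->
  exists c : 'I_r -> 'I_n.+1, \det (colsub c M) != 0.
Proof.
move=> rf; have rk : row_full M^T by rewrite /row_full mxrank_tr.
exists (fullrankfun rk); have := fullrowsub_unit rk.
rewrite -unitmx_tr unitmxE unitfE; congr (\det _ != 0).
by apply/matrixP => a b; rewrite !mxE.
Qed.

Lemma smooth_cramer X r (f : 'I_r -> S) c p v : smooth_rank X r ->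
  (forall a, vanishing X (f a)) -> pcone X v -> (minor f c).@[v 0] != 0 ->
  vanishing X p -> exists s, grad idfun (v 0) p = s *m jac idfun (v 0) f.
Proof.
move=> sX If Xv mv Ip; have [g [_ gf gs]] := sX v Xv.
have fg : (jac idfun (v 0) f <= jac idfun (v 0) g)%MS.
  apply/row_subP => a; have -> : row a (jac idfun (v 0) f) = grad idfun (v 0) (f a).
    by apply/rowP => i; rewrite !mxE.
  exact: gs.
have ff : row_free (jac idfun (v 0) f).
  apply/row_freeP; exists (\matrix_(i, b) (i == c b)%:R *m invmx (colsub c (jac idfun (v 0) f))).
  rewrite mulmxA; have -> : jac idfun (v 0) f *m (\matrix_(i, b) (i == c b)%:R) = colsub c (jac idfun (v 0) f).
    apply/matrixP => a b; rewrite !mxE (bigD1 (c b)) //= mxE eqxx mulr1 big1 ?addr0 ?mxE //.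
    by move=> i ic; rewrite !mxE (negbTE ic) mulr0.
  by rewrite mulmxV // unitmxE unitfE -(mmap_minor idfun).
have gf' : (jac idfun (v 0) g <= jac idfun (v 0) f)%MS.
  by rewrite -(geq_leqif (mxrank_leqif_sup fg)) (eqP gf) (eqP ff).
by have /submxP := submx_trans (gs p Ip) gf'.
Qed.

Section Key.
Variables (L : fieldType) (j : {rmorphism F -> L}) (X : set P) (r : nat).
Hypothesis charF : forall k, k.+1%:R != 0 :> F.
Hypothesis cX : closed X.
Hypothesis sX : smooth_rank X r.

Definition on_cone (y : 'I_n.+1 -> L) := forall p, vanishing X p -> mmap j y p = 0.

(** Passage from points over F to the point y over L: the identity of [cramer_span] holds at every
    point of the cone where the minor is nonzero, so its entries times the minor lie in the ideal of
    X and vanish at y. *)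
Lemma rank_cramer y (f : 'I_r -> S) c p : on_cone y -> (forall a, vanishing X (f a)) ->
  mmap j y (minor f c) != 0 -> vanishing X p ->
  exists s, grad j y p = s *m jac j y f.
Proof.
move=> yX If my Ip.
pose D : 'M[S]_(r, n.+1) := \matrix_(a, i) (f a)^`M(i).
pose G : 'rV[S]_n.+1 := \row_i p^`M(i).
pose M : 'rV[S]_n.+1 := colsub c G *m \adj (colsub c D) *m D - \det (colsub c D) *: G.
have detE : \det (colsub c D) = minor f c.
  by congr (\det _); apply/matrixP => a b; rewrite !mxE.
have mapD (R : comNzRingType) (k : {rmorphism F -> R}) w : map_mx (mmap k w) D = jac k w f.
  by apply/matrixP => a i; rewrite !mxE.
have mapG (R : comNzRingType) (k : {rmorphism F -> R}) w : map_mx (mmap k w) G = grad k w p.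
  by apply/matrixP => a i; rewrite !mxE.
have mapM (R : comNzRingType) (k : {rmorphism F -> R}) w : map_mx (mmap k w) M =
   colsub c (grad k w p) *m \adj (colsub c (jac k w f)) *m jac k w f -
   \det (colsub c (jac k w f)) *: grad k w p.
  have cE m' (N : 'M[S]_(m', n.+1)) :
      map_mx (mmap k w) (colsub c N) = colsub c (map_mx (mmap k w) N).
    by apply/matrixP => a b; rewrite !mxE.
  by rewrite map_mxB map_mxZ !map_mxM map_mx_adj -det_map_mx !cE !mapD !mapG.
have M0 i : vanishing X (minor f c * M 0 i).
  apply/vanishingE => v Xv; rewrite mevalM.
  have [->|mv] := eqVneq (minor f c).@[v 0] 0; first by rewrite mul0r.
  have [s sE] := smooth_cramer sX If Xv mv Ip.
  have e0 : map_mx (mmap idfun (v 0)) M = 0 by rewrite mapM sE cramer_span subrr.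
  have := congr1 (fun N : 'rV[F]_n.+1 => N 0 i) e0; rewrite mxE [RHS]mxE => e1.
  by rewrite (e1 : (M 0 i).@[v 0] = 0) mulr0.
have My : map_mx (mmap j y) M = 0.
  apply/rowP => i; rewrite mxE [RHS]mxE; have := yX _ (M0 i).
  by rewrite rmorphM => /eqP; rewrite mulf_eq0 (negbTE my) => /eqP.
exists ((\det (colsub c (jac j y f)))^-1 *: (colsub c (grad j y p) *m \adj (colsub c (jac j y f)))).
move: My; rewrite mapM => /eqP; rewrite subr_eq0 => /eqP e.
by rewrite -scalemxAl e scalerA mulVf ?scale1r // -mmap_minor.
Qed.

(** Over L there is no tangent space as a set of F-vectors; tangency of h at y is expressed by h
    lying in the span of the gradients at y. *)
Definition conormal (y h : 'I_n.+1 -> L) := exists m (g : 'I_m -> S) (s : 'I_m -> L),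
  (forall a, vanishing X (g a)) /\ forall i, h i = \sum_a s a * mmap j y (g a)^`M(i).

Lemma conormal_cramer y h (f : 'I_r -> S) c : on_cone y -> (forall a, vanishing X (f a)) ->
  mmap j y (minor f c) != 0 -> conormal y h -> exists s, \row_i h i = s *m jac j y f.
Proof.
move=> yX If my [m [g [s [Ig hE]]]].
have /choice [t tE] : forall a, exists t, grad j y (g a) = t *m jac j y f.
  by move=> a; exact: rank_cramer my (Ig a).
exists (\sum_a s a *: t a); rewrite mulmx_suml.
under eq_bigr do rewrite -scalemxAl -tE.
by apply/rowP => i; rewrite mxE hE summxE; apply: eq_bigr => a _; rewrite !mxE.
Qed.

(** At each point of the cone some maximal minor is nonzero, so the equations of X and the minors
    have at most the vertex as common zero. *)
Lemma minors_nullstellensatz i : exists k, gen (fun p => vanishing X p \/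
   exists (f : 'I_r -> S) c, (forall a, vanishing X (f a) /\ Defs.form (f a)) /\ p = minor f c)
   ('X_i ^+ k).
Proof.
apply: nullstellensatz => v hv; apply/eqP; apply: contrapT => /negP.
rewrite mevalXU => vi; pose w : V := \row_i v i.
have wv : w 0 =1 v by move=> k; rewrite mxE.
have w0 : w != 0 by apply: contraNneq vi => e; rewrite -wv e mxE.
have Xw : pcone X w.
  by apply: closed_pcone => // p hp; rewrite (meval_eq _ wv); apply: hv; left.
have [f [If ff _]] := sX Xw; have [c dc] := minor_neq0 ff.
move: dc; rewrite -(mmap_minor idfun) -/(meval _ _) (meval_eq _ wv) hv ?eqxx //.
by right; exists f, c.
Qed.

(* The secant map (x, y) |-> x - y is finite over the hyperplanes h tangent to X
   at y and not containing x - y: hence a derivation that kills x - y and h kills y. *)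
Lemma key_derivation x y h (B : L -> Prop) e : on_cone x -> on_cone y -> conormal y h ->
  \sum_i h i * (x i - y i) != 0 -> subring B -> der_over j B e ->
  (forall i, B (x i)) -> (forall i, B (y i)) -> (forall i, B (h i)) ->
  (forall i, e (x i - y i) = 0) -> (forall i, e (h i) = 0) -> forall i, e (y i) = 0.
Proof.
move=> xX yX yh u0 sB de Bx By Bh ez eh i0.
pose z i := x i - y i.
pose zh (k : 'I_(n.+1 + n.+1)) := match fintype.split k with inl i => z i | inr i => h i end.
pose al : {rmorphism {mpoly F[n.+1 + n.+1]} -> L} := mmap j zh.
have alC c : al c%:MP = j c by rewrite /al /= mmapC.
have alz i : al 'X_(lshift _ i) = z i.
  by rewrite /al /= mmapX mmap1U /zh -[lshift _ _]/(unsplit (inl i)) unsplitK.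
have alh i : al 'X_(rshift _ i) = h i.
  by rewrite /al /= mmapX mmap1U /zh -[rshift _ _]/(unsplit (inr i)) unsplitK.
pose K := rees al y.
have sK : subring K by exact: subring_rees.
have [K1 KB KM] := sK; have K0 := subring0 sK.
pose jP : {rmorphism F -> {poly L}} := polyC \o j.
pose Y i : {poly L} := 'X * (y i)%:P.
have KY i : K (Y i) by exact: rees_Y.
have Kj c : K (jP c) by rewrite /jP /= -alC; exact: rees_C.
have KX : K 'X by exact: rees_X.
have Kz i : K (z i)%:P by rewrite -alz; exact: rees_C.
have Kh i : K (h i)%:P by rewrite -alh; exact: rees_C.
have Kev q : K (mmap jP Y q) by exact: mmap_subring.
have evC (w : 'I_n.+1 -> L) q : mmap jP (fun i => (w i)%:P) q = (mmap j w q)%:P.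
  rewrite (mmap_comp (@polyC L)); by apply: mmap_ext.
have evX (w : 'I_n.+1 -> L) q d : q \is d.-homog ->
    mmap jP (fun i => 'X * (w i)%:P) q = 'X ^+ d * (mmap j w q)%:P.
  by move=> hq; rewrite (homog_mmapd _ _ _ hq) evC.
have coneX (w : 'I_n.+1 -> L) q : on_cone w -> vanishing X q ->
    mmap jP (fun i => 'X * (w i)%:P) q = 0.
  move=> wX hq; rewrite homog_mmap big1 // => d _.
  by rewrite evC wX ?mulr0 //; exact: vanishing_homog.
(* 'X x is 'X y + 'X z, and q vanishes at both 'X x and 'X y: Taylor's expansion leaves a linear
   term that is divisible by 'X inside K. *)
have tan q : vanishing X q -> exists g, K g /\
    \sum_i mmap jP Y q^`M(i) * (z i)%:P = 'X * g.
  move=> hq; have [g [Kg gE]] := taylor (b := fun i => (z i)%:P) q sK Kj KY Kz KX.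
  exists (- g); split; first exact: (subringN sK Kg).
  have : mmap jP (fun i => Y i + 'X * (z i)%:P) q = 0.
    rewrite -(coneX x q xX hq); apply: mmap_ext => i.
    by rewrite /Y -mulrDr -polyCD /z addrC subrK.
  rewrite gE (coneX y q yX hq) add0r expr2 -mulrA -mulrDr => /eqP.
  by rewrite mulf_eq0 polyX_eq0 /= addr_eq0 mulrN => /eqP.
pose u := \sum_i h i * z i.
have minorT (f : 'I_r -> S) c : (forall a, vanishing X (f a) /\ Defs.form (f a)) ->
    exists g, K g /\ mmap jP Y (minor f c) * u%:P = 'X * g.
  move=> If; have /choice [d hd] : forall a, exists d, f a \is d.-homog by move=> a; case: (If a).
  pose D := jac jP Y f.
  have DE a i : D a i = 'X ^+ (d a).-1 * (jac j y f a i)%:P.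
    by rewrite !mxE (evX y _ _ (mderiv_homog i (hd a))).
  have [m0|m0] := eqVneq (mmap j y (minor f c)) 0.
    exists 0; split=> //; rewrite mulr0 mmap_minor.
    have -> : colsub c (jac jP Y f) = diag_mx (\row_a 'X ^+ (d a).-1) *m map_mx (@polyC L) (colsub c (jac j y f)).
      by rewrite mul_diag_mx; apply/matrixP => a b; rewrite [in LHS]mxE DE !mxE.
    by rewrite det_mulmx det_map_mx -mmap_minor m0 mulr0 mul0r.
  have [s sE] := conormal_cramer yX (fun a => (If a).1) m0 yh.
  pose E := (\sum_a (d a).-1)%N.
  pose H : 'rV[{poly L}]_n.+1 := \row_i (h i)%:P.
  pose s' : 'rV[{poly L}]_r := \row_a ((s 0 a)%:P * 'X ^+ (E - (d a).-1)).
  (* The rows of D have different degrees in 'X; s' compensates for this, and 'X ^ E is cancelled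
     once Cramer's rule has been applied. *)
  have HE : 'X ^+ E *: H = s' *m D.
    apply/rowP => i; rewrite !mxE; have := congr1 (fun M : 'rV[L]_n.+1 => M 0 i) sE.
    rewrite !mxE => ->; rewrite rmorph_sum mulr_sumr; apply: eq_bigr => a _.
    have eE : 'X^E = 'X^(E - (d a).-1) * 'X^((d a).-1) :> {poly L}.
      by rewrite -exprD subnK // /E (bigD1 a) //= leq_addr.
    rewrite [s' _ _]mxE DE eE /= polyCM.
    move: ('X^(E - (d a).-1)) ('X^((d a).-1)) (s 0 a)%:P (jac j y f a i)%:P => w1 w2 w3 w4.
    by ring.
  have := cramer_span D s' c; rewrite -HE.
  have -> : colsub c ('X ^+ E *: H) = 'X ^+ E *: colsub c H.
    by apply/matrixP => a b; rewrite !mxE.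
  rewrite -!scalemxAl scalerA [_ * 'X ^+ E]mulrC -scalerA => /matrixP cr0.
  have cr : colsub c H *m \adj (colsub c D) *m D = \det (colsub c D) *: H.
    apply/matrixP => a b; have := cr0 a b; rewrite [LHS]mxE [RHS]mxE => /mulfI; apply.
    by rewrite expf_neq0 // polyX_eq0.
  pose N := colsub c H *m \adj (colsub c D).
  have KD a i : K (D a i) by rewrite mxE.
  have KN a : K (N 0 a).
    rewrite mxE; apply: subring_sum => // b _; apply: (KM); first by rewrite !mxE.
    by apply: subring_adj => // k l; rewrite mxE.
  have /choice [g hg] := fun a => tan (f a) (If a).1.
  exists (\sum_a N 0 a * g a); split.
    by apply: subring_sum => // a _; apply: (KM) => //; case: (hg a).
  rewrite mmap_minor -/D /u rmorph_sum [LHS]mulr_sumr /=.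
  under eq_bigr do rewrite polyCM mulrA.
  transitivity (\sum_i (N *m D) 0 i * (z i)%:P).
    by apply: eq_bigr => i _; rewrite /N cr !mxE.
  under [LHS]eq_bigr do rewrite [(N *m D) _ _]mxE mulr_suml.
  rewrite exchange_big [RHS]mulr_sumr; apply: eq_bigr => a _ /=.
  rewrite mulrCA -(hg a).2 mulr_sumr; apply: eq_bigr => i _.
  by rewrite [D _ _]mxE mulrA.
have uE : u = al (\sum_i 'X_(rshift _ i) * 'X_(lshift _ i)).
  by rewrite rmorph_sum; apply: eq_bigr => i _; rewrite rmorphM /= -/al alz alh.
have /choice [k hk] : forall i, exists k, filt al y k (u * y i ^+ k.+1).
  move=> i; have [k gk] := minors_nullstellensatz i.
  have [g [Kg gE]] : exists g, K g /\ mmap jP Y ('X_i ^+ k) * u%:P = 'X * g.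
    elim: gk => [|q p a Hp _ [g [Kg gE]]].
      by exists 0; rewrite rmorph0 mul0r mulr0.
    have [g' [Kg' gE']] : exists g, K g /\ mmap jP Y p * u%:P = 'X * g.
      case: Hp => [hp|[f [c [If ->]]]]; last exact: minorT.
      by exists 0; rewrite coneX // mul0r mulr0.
    exists (g + mmap jP Y q * g'); split; first exact: (subringD sK Kg (KM _ _ (Kev q) Kg')).
    rewrite rmorphD rmorphM /= mulrDl gE -mulrA gE' mulrCA -mulrDr //.
  move: gE; rewrite rmorphXn /= mmapX mmap1U /Y exprMn -polyC_exp.
  (* An exponent 0 would make u divisible by 'X, hence zero. Otherwise the coefficients of degree k
     + 1 show that u y_i^(k+1) has degree at most k in y. *)
  case: k {gk} => [|k] gE.
    move: gE => /(congr1 (fun p : {poly L} => p`_0)); rewrite coefXM /= !expr0 !mul1r coefC /=.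
    by move/eqP; rewrite -/u (negbTE u0).
  exists k; have -> : u * y i ^+ k.+1 = g`_k; last exact: Kg.
  move: gE => /(congr1 (fun p : {poly L} => p`_k.+1)).
  by rewrite coefXM /= -mulrA coefXnM ltnn subnn -polyCM coefC /= mulrC => <-.
pose u' := \sum_i 'X_(rshift _ i) * 'X_(lshift _ i) : {mpoly F[n.+1 + n.+1]}.
have [|p [t [pm rt]]] := @filt_algebraic L _ al n.+1 y u' k _ i0.
  by move=> i; rewrite -uE.
rewrite -uE in rt.
have Bz i : B (z i) by case: (sB) => _ BB _; exact: BB.
have Bal a : B (al a) /\ e (al a) = 0.
  have Bzh l : B (zh l) by rewrite /zh; case: fintype.split.
  split; first by apply: mmap_subring => // c; case: de => _ /(_ c) [].
  rewrite (der_mmap a sB de Bzh) big1 // => l _.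
  by rewrite /zh; case: fintype.split => q; rewrite ?ez ?eh mulr0.
have Bu : B u by rewrite uE; case: (Bal (\sum_i 'X_(rshift _ i) * 'X_(lshift _ i))).
have eu : e u = 0 by rewrite uE; case: (Bal (\sum_i 'X_(rshift _ i) * 'X_(lshift _ i))).
have But l : B (u ^+ l) /\ e (u ^+ l) = 0.
  have [[e1 _ eM] _] := de; elim: l => [|l [IH1 IH2]].
    by rewrite expr0; case: sB.
  rewrite exprS eM // IH2 eu mulr0 mul0r addr0; split=> //.
  by case: sB => _ _; apply.
have [But1 eut] := But t.
have BM : B (u ^+ t * y i0) by case: sB => _ _; apply.
have := der_algebraic j charF sB de.1 BM Bal pm rt.
have [[_ _ eM] _] := de; rewrite eM // eut mul0r addr0 => /eqP.
by rewrite mulf_eq0 expf_eq0 (negbTE u0) andbF => /eqP.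
Qed.
End Key.
End Smooth.

Lemma dim_ge_le (T : topologicalType) (A : set T) d e : (e <= d)%N -> dim_ge A d -> dim_ge A e.
Proof.
move=> ed [Z [h1 h2]]; exists Z; split=> i ie; first by apply: h1; exact: leq_trans ie ed.
by apply: h2; exact: leq_trans ie ed.
Qed.

Lemma dim_le_ge (T : topologicalType) (A : set T) d e : dim_le A d -> dim_ge A e -> (e <= d)%N.
Proof.
move=> le ge; rewrite leqNgt; apply/negP => lt; apply: le; exact: dim_ge_le lt ge.
Qed.

Lemma has_dim_uniq (T : topologicalType) (A : set T) d e : has_dim A d -> has_dim A e -> d = e.
Proof.
move=> [g1 l1] [g2 l2]; apply/eqP; rewrite eqn_leq (dim_le_ge l2 g1).
exact: dim_le_ge l1 g2.
Qed.

Definition cstr (F : nzRingType) (T : Type) : F -> (T -> F) := fun c _ => c.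
Section Cstr.
Variables (F : nzRingType) (T : Type).
Lemma cstr_additive : zmod_morphism (@cstr F T). Proof. by []. Qed.
HB.instance Definition _ := GRing.isZmodMorphism.Build F (T -> F) (@cstr F T) cstr_additive.
Lemma cstr_multiplicative : monoid_morphism (@cstr F T). Proof. by []. Qed.
HB.instance Definition _ := GRing.isMonoidMorphism.Build F (T -> F) (@cstr F T) cstr_multiplicative.
End Cstr.

Lemma val_mmap (F L : fieldType) (T : Type) (val : {rmorphism (T -> F) -> L}) n
  (a : 'I_n -> T -> F) p :
  mmap (val \o @cstr F T) (fun i => val (a i)) p = val (fun t => p.@[fun i => a i t]).
Proof.
elim/mpoly_alg_ind: p => [c|i|p q IHp IHq|p q IHp IHq].
- by rewrite mmapC; congr (val _); apply/funext => t; rewrite mevalC.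
- by rewrite mmapX mmap1U; congr (val _); apply/funext => t; rewrite mevalXU.
- rewrite rmorphD /= IHp IHq -rmorphD; congr (val _); apply/funext => t.
  by rewrite mevalD.
- rewrite rmorphM /= IHp IHq -rmorphM; congr (val _); apply/funext => t.
  by rewrite mevalM.
Qed.

(** * Generic points of products *)

Section PrimeSets.
Variable F : closedFieldType.

(** The functions in PF are those whose nonvanishing is detected by a generic point of E; E is
    irreducible as far as they can see. *)
Definition prime_set (T : Type) (E : set T) (PF : (T -> F) -> Prop) :=
  [/\ PF (fun=> 1), forall f g, PF f -> PF g -> PF (fun t => f t * g t), E !=set0 &
   forall f g, PF f -> PF g -> (forall t, E t -> f t * g t = 0) ->
     (forall t, E t -> f t = 0) \/ (forall t, E t -> g t = 0)].

(** Regularity in each variable separately replaces the tensor product of the two coordinate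
    rings. *)
Definition pair_fun (T1 T2 : Type) (P1 : (T1 -> F) -> Prop) (P2 : (T2 -> F) -> Prop)
  (f : T1 * T2 -> F) := (forall t, P2 (fun u => f (t, u))) /\ (forall u, P1 (fun t => f (t, u))).

(** If f is nonzero at (x0, y0) and g at (x1, y1), primality of E2 gives one y with f (x0, y) and g
    (x1, y) nonzero, and for this y primality of E1 gives a common x. *)
Lemma prime_pair (T1 T2 : Type) E1 E2 P1 P2 : @prime_set T1 E1 P1 -> @prime_set T2 E2 P2 ->
  prime_set (E1 `*` E2) (pair_fun P1 P2).
Proof.
move=> [P11 P1M [a1 Ea1] pr1] [P21 P2M [a2 Ea2] pr2]; split.
- by split=> t; [exact: P21|exact: P11].
- by move=> f g [f2 f1] [g2 g1]; split=> t; [exact: (P2M _ _ (f2 t) (g2 t))|exact: (P1M _ _ (f1 t) (g1 t))].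
- by exists (a1, a2).
move=> f g [f2 f1] [g2 g1] fg; apply: contrapT => /not_orP [].
move=> /existsNP [[x0 y0] /not_implyP [[/= Ex0 Ey0] f0]].
move=> /existsNP [[x1 y1] /not_implyP [[/= Ex1 Ey1] g0]].
have [y [Ey fy gy]] : exists y, [/\ E2 y, f (x0, y) <> 0 & g (x1, y) <> 0].
  apply: contrapT => /forallNP h.
  have [y Ey|h'|h'] := pr2 (fun u => f (x0, u)) (fun u => g (x1, u)) (f2 x0) (g2 x1).
  - apply/eqP; rewrite mulf_eq0; apply: contrapT => /negP; rewrite negb_or => /andP[/eqP ? /eqP ?].
    exact: (h y).
  - by apply: f0; exact: h'.
  - by apply: g0; exact: h'.
have [x Ex|h'|h'] := pr1 (fun u => f (u, y)) (fun u => g (u, y)) (f1 y) (g1 y).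
- by apply: fg.
- by apply: fy; exact: h'.
- by apply: gy; exact: h'.
Qed.

Definition poly_fun k (f : ('I_k -> F) -> F) := exists p : {mpoly F[k]}, forall s, f s = p.@[s].

Lemma prime_affine k : prime_set [set: 'I_k -> F] (@poly_fun k).
Proof.
split.
- by exists 1 => s; rewrite meval1.
- by move=> f g [p pE] [q qE]; exists (p * q) => s; rewrite mevalM pE qE.
- by exists (fun=> 0).
move=> f g [p pE] [q qE] fg; have : p * q = 0.
  by apply: mpoly_eq0_everywhere => v; rewrite mevalM -pE -qE fg.
move/eqP; rewrite mulf_eq0 => /orP[/eqP p0|/eqP q0]; [left|right] => t _.
  by rewrite pE p0 meval0.
by rewrite qE q0 meval0.
Qed.

Definition cone_fun n (f : 'rV[F]_n.+1 -> F) := exists p : {mpoly F[n.+1]}, forall v, f v = p.@[v 0].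

Lemma prime_cone n (X : set (proj F n)) : irreducible X -> prime_set (pcone X) (@cone_fun n).
Proof.
move=> irr; have [[x Xx] _] := irr; have [_ _ pr] := irreducible_prime irr; split.
- by exists 1 => s; rewrite meval1.
- by move=> f g [p pE] [q qE]; exists (p * q) => s; rewrite mevalM pE qE.
- by have [v xv] := hcoord_ex x; exists v; exists x.
move=> f g [p pE] [q qE] fg; have [] := pr p q.
- by apply/vanishingE => v Xv; rewrite mevalM -pE -qE fg.
- by move=> /vanishingE h; left=> v Xv; rewrite pE h.
- by move=> /vanishingE h; right=> v Xv; rewrite qE h.
Qed.

(** Each coefficient of Q, as a polynomial in the b, is a polynomial in the a that vanishes wherever
    m does not, hence everywhere by primality. The b may thus depend on t and degenerate where m =
    0. *)
Lemma indep_pair (T1 T2 : Type) (E1 : set T1) (E2 : set T2) (P1 : (T1 -> F) -> Prop) d1 d2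
  (a : 'I_d1 -> T1 -> F) (b : 'I_d2 -> T1 -> T2 -> F) (m : T1 -> F) :
  prime_set E1 P1 -> P1 m -> (forall Q : {mpoly F[d1]}, P1 (fun t => Q.@[fun i => a i t])) ->
  (exists t, E1 t /\ m t != 0) ->
  (forall Q : {mpoly F[d1]}, (forall t, E1 t -> Q.@[fun i => a i t] = 0) -> Q = 0) ->
  (forall t, E1 t -> m t != 0 -> forall Q : {mpoly F[d2]},
     (forall u, E2 u -> Q.@[fun i => b i t u] = 0) -> Q = 0) ->
  forall Q : {mpoly F[d1 + d2]}, (forall t u, E1 t -> E2 u ->
     Q.@[fun i => match fintype.split i with inl k => a k t | inr k => b k t u end] = 0) ->
  Q = 0.
Proof.
move=> [_ _ _ pr] Pm Pa [t0 [Et0 mt0]] ia ib Q hQ.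
pose A := {mpoly {mpoly F[d1]}[d2]}.
have [phi [phiC phiX]] : exists phi : {rmorphism {mpoly F[d1 + d2]} -> A},
    (forall c, phi c%:MP = (c%:MP)%:MP) /\
    forall i, phi 'X_i = match fintype.split i with inl k => ('X_k)%:MP | inr k => 'X_k end.
  exists (mmap (@mpolyC d2 {mpoly F[d1]} \o @mpolyC d1 F)
    (fun i => match fintype.split i with inl k => ('X_k)%:MP | inr k => 'X_k end)).
  by split=> [c|i] /=; rewrite ?mmapC // mmapX mmap1U.
have [psi0 [psi0C psi0X]] : exists psi0 : {rmorphism {mpoly F[d1]} -> {mpoly F[d1 + d2]}},
    (forall c, psi0 c%:MP = c%:MP) /\ forall k, psi0 'X_k = 'X_(lshift _ k).
  exists (mmap (@mpolyC (d1 + d2) F) (fun k => 'X_(lshift _ k))).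
  by split=> [c|i] /=; rewrite ?mmapC // mmapX mmap1U.
have [psi [psiC psiX]] : exists psi : {rmorphism A -> {mpoly F[d1 + d2]}},
    (forall c, psi c%:MP = psi0 c) /\ forall k, psi 'X_k = 'X_(rshift _ k).
  exists (mmap psi0 (fun k => 'X_(rshift _ k))).
  by split=> [c|i] /=; rewrite ?mmapC // mmapX mmap1U.
have psiK q : psi (phi q) = q.
  elim/mpoly_alg_ind: q => [c|i|p q IHp IHq|p q IHp IHq].
  - by rewrite phiC psiC psi0C.
  - rewrite phiX; case: splitP => k ik; rewrite ?psiC ?psiX ?psi0X;
      congr ('X_[U_(_)]); exact: val_inj.
  - by rewrite !rmorphD /= IHp IHq.
  - by rewrite !rmorphM /= IHp IHq.
have eD (u : 'I_d1 -> F) w (p q : A) : (map_mpoly (meval u) (p + q)).@[w] =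
    (map_mpoly (meval u) p).@[w] + (map_mpoly (meval u) q).@[w].
  by rewrite rmorphD mevalD.
have eM (u : 'I_d1 -> F) w (p q : A) : (map_mpoly (meval u) (p * q)).@[w] =
    (map_mpoly (meval u) p).@[w] * (map_mpoly (meval u) q).@[w].
  by rewrite rmorphM mevalM.
have ev (u : 'I_d1 -> F) w q : q.@[fun i => match fintype.split i with inl k => u k | inr k => w k end] =
    (map_mpoly (meval u) (phi q)).@[w].
  elim/mpoly_alg_ind: q => [c|i|p q IHp IHq|p q IHp IHq].
  - by rewrite phiC map_mpolyC /= !mevalC.
  - rewrite mevalXU phiX; case: (fintype.split i) => k.
      by rewrite map_mpolyC /= mevalC mevalXU.
    by rewrite map_mpolyX mevalXU.
  - by rewrite mevalD IHp IHq rmorphD /= eD.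
  - by rewrite mevalM IHp IHq rmorphM /= eM.
rewrite -(psiK Q); suff -> : phi Q = 0 by rewrite rmorph0.
apply/mpolyP => mu; rewrite mcoeff0; apply: ia.
have [|//|h] := pr _ m (Pa (phi Q)@_mu) Pm; last by move: mt0; rewrite h ?eqxx.
move=> t Et; have [->|mt] := eqVneq (m t) 0; first by rewrite mulr0.
have /(congr1 (mcoeff mu)) : map_mpoly (meval (fun i => a i t)) (phi Q) = 0.
  by apply: (ib t Et mt) => u Eu; rewrite -ev; exact: hQ.
by rewrite mcoeff_map_mpoly mcoeff0 /= => ->; rewrite mul0r.
Qed.
End PrimeSets.

Section SmoothDef.
Variables (F : closedFieldType) (n : nat).
Local Notation S := {mpoly F[n.+1]}.
Local Notation V := 'rV[F]_n.+1.
Local Notation P := (proj F n).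
Implicit Types (X Z : set P).

Lemma gradD (R : comNzRingType) (j : {rmorphism F -> R}) y (p q : S) :
  grad j y (p + q) = grad j y p + grad j y q.
Proof. by apply/rowP => i; rewrite !mxE mderivD rmorphD. Qed.

Lemma grad_sum (R : comNzRingType) (j : {rmorphism F -> R}) y I (r : seq I) (f : I -> S) :
  grad j y (\sum_(i <- r) f i) = \sum_(i <- r) grad j y (f i).
Proof.
elim: r => [|i r IH]; first by rewrite !big_nil; apply/rowP => k; rewrite !mxE mderiv0 rmorph0.
by rewrite !big_cons gradD IH.
Qed.

Lemma gradM (R : comNzRingType) (j : {rmorphism F -> R}) y (p q : S) :
  grad j y (p * q) = mmap j y p *: grad j y q + mmap j y q *: grad j y p.
Proof.
apply/rowP => i; rewrite !mxE mderivM rmorphD !rmorphM /= addrC; congr (_ + _).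
exact: mulrC.
Qed.

(** Euler's relation without homogeneity: p vanishes on the whole line of y, and the sum is the
    coefficient of 'X in p((1 + 'X) y). *)
Lemma euler X (L : fieldType) (j : {rmorphism F -> L}) y p : on_cone j X y -> vanishing X p ->
  \sum_i mmap j y p^`M(i) * y i = 0.
Proof.
move=> yX Ip; pose jP : {rmorphism F -> {poly L}} := polyC \o j.
have evC q : mmap jP (fun i => (y i)%:P) q = (mmap j y q)%:P.
  by rewrite (mmap_comp (@polyC L)); apply: mmap_ext.
pose K := fun _ : {poly L} => True.
have [//|//|//|//|//|e [_]] := @taylor F {poly L} n.+1 jP K (fun i => (y i)%:P) (fun i => (y i)%:P) 'X p.
have -> : mmap jP (fun i => (y i)%:P + 'X * (y i)%:P) p = 0.
  rewrite (@mmap_ext _ _ _ _ _ (fun i => (1 + 'X) * (y i)%:P)); last first.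
    by move=> i; rewrite mulrDl mul1r.
  by rewrite homog_mmap big1 // => d _; rewrite evC yX ?mulr0 //; exact: vanishing_homog.
rewrite evC yX // add0r => /(congr1 (fun q : {poly L} => q`_1)).
rewrite coef0 coefD coefXM /= expr2 -mulrA coefXM /= coefXM /= addr0 => /esym.
rewrite coef_sum => e0; rewrite -[RHS]e0; apply: eq_bigr => i _.
by rewrite evC -polyCM coefC.
Qed.

Lemma on_cone_point X v : pcone X v -> on_cone idfun X (v 0).
Proof. by move=> Xv p /vanishingE; apply. Qed.

Lemma dot_grad (v : V) p (w : V) :
  \sum_(i < n.+1) p^`M(i).@[v 0] * w 0 i = (grad idfun (v 0) p *m w^T) 0 0.
Proof. by rewrite mxE; apply: eq_bigr => i _; rewrite !mxE. Qed.

Lemma tangentE X x v w : hcoord x v -> X x ->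
  tangent X x w <-> forall p, vanishing X p -> \sum_(i < n.+1) p^`M(i).@[v 0] * w 0 i = 0.
Proof.
move=> xv Xx; split=> [h p Ip|h p u Ip xu]; first exact: h.
have [a [a0 ->]] := hcoord_scale xv xu.
rewrite dot_grad (pihomog_partitionE (mf := mdeg) (leqnn (msize p))) grad_sum.
rewrite mulmx_suml summxE big1 // => d _.
set q := pihomog _ _ _; have Iq : vanishing X q by exact: vanishing_homog.
have -> : grad idfun ((a *: v) 0) q = a ^+ d.-1 *: grad idfun (v 0) q.
  apply/rowP => i; rewrite !mxE.
  rewrite (@mmap_ext _ _ _ _ _ (fun i => a * v 0 i)); last by move=> k; rewrite mxE.
  by rewrite (homog_mmapd _ _ _ (mderiv_homog i (pihomogP mdeg d p))).
by rewrite -scalemxAl mxE -dot_grad h // mulr0.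
Qed.

(** Forms of the ideal with independent gradients at v, taken as many as possible, span the conormal
    space; their number follows from the dimension m + 1 of the tangent space, which is the kernel
    of their Jacobian matrix. *)
Lemma nonsingular_smooth X m : nonsingular X -> has_dim X m -> (m <= n)%N /\ smooth_rank X (n - m).
Proof.
move=> ns hm.
have key v : pcone X v -> (m <= n)%N /\ exists f : 'I_(n - m) -> S,
  [/\ forall a, vanishing X (f a) /\ Defs.form (f a), row_free (jac idfun (v 0) f) &
   forall p, vanishing X p -> (grad idfun (v 0) p <= jac idfun (v 0) f)%MS].
  move=> [x [Xx xv]]; have [m' [hm' [U [dU tU]]]] := ns x Xx.
  have e := has_dim_uniq hm hm'; rewrite -{m' hm'}e in dU.
  pose Q k := exists f : 'I_k -> S, (forall a, vanishing X (f a) /\ Defs.form (f a)) /\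
    row_free (jac idfun (v 0) f).
  have Q0 : exists k, `[< Q k >].
    exists 0%N; apply/asboolP; exists (fun=> 0); split; first by case.
    by rewrite -row_leq_rank.
  have Qb k : `[< Q k >] -> (k <= n.+1)%N.
    by move=> /asboolP [f [_ /eqP <-]]; exact: rank_leq_col.
  have [k /asboolP [f [If ff]] kmax] := ex_maxnP Q0 Qb.
  have spanf p : vanishing X p -> Defs.form p -> (grad idfun (v 0) p <= jac idfun (v 0) f)%MS.
    move=> Ip fp; apply: contrapT => /negP np.
    have : (k.+1 <= k)%N; last by rewrite ltnn.
    apply: kmax; apply/asboolP; exists (fsnoc f p); split.
      by move=> a; rewrite /fsnoc; case: unliftP => [b|] _ //.
    rewrite /row_free eqn_leq rank_leq_row /=.
    have lt : (jac idfun (v 0) f < jac idfun (v 0) (fsnoc f p))%MS.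
      rewrite ltmxE; apply/andP; split.
        apply/row_subP => a; have <- : row (lift ord_max a) (jac idfun (v 0) (fsnoc f p)) = row a (jac idfun (v 0) f).
          by apply/rowP => i; rewrite !mxE /fsnoc liftK.
        exact: row_sub.
      apply: contra np => le; apply: submx_trans le.
      have -> : grad idfun (v 0) p = row ord_max (jac idfun (v 0) (fsnoc f p)).
        by apply/rowP => i; rewrite !mxE /fsnoc unlift_none.
      exact: row_sub.
    by rewrite -[X in (X < _)%N](eqP ff); exact: (rank_ltmx lt).
  have spanI p : vanishing X p -> (grad idfun (v 0) p <= jac idfun (v 0) f)%MS.
    move=> Ip; rewrite (pihomog_partitionE (mf := mdeg) (leqnn (msize p))) grad_sum.
    apply: summx_sub => d _; apply: spanf; first exact: vanishing_homog.
    by exists d; exact: pihomogP.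
  have tE w : w \in U <-> w *m (jac idfun (v 0) f)^T = 0.
    have -> : (w \in U : Prop) = tangent X x w by rewrite tU.
    rewrite (tangentE w xv Xx); split=> h.
      apply/rowP => a; rewrite mxE [RHS]mxE -[RHS](h (f a) (If a).1).
      by apply: eq_bigr => i _; rewrite !mxE mulrC.
    move=> p /spanI /submxP [s sE]; rewrite dot_grad sE -mulmxA.
    by rewrite -[jac _ _ _]trmxK -trmx_mul h trmx0 mulmx0 mxE.
  have kE : (m.+1 + k = n.+1)%N.
    pose B : 'M[F]_(m.+1, n.+1) := \matrix_(a, i) (vbasis U)`_a 0 i.
    have rB a : row a B = (vbasis U)`_a by apply/rowP => i; rewrite !mxE.
    have BU a : row a B \in U.
      rewrite rB; apply: (basis_mem (vbasisP U)); apply: mem_nth.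
      by rewrite size_tuple dU.
    have fB : row_free B.
      rewrite -kermx_eq0; apply/eqP/row_matrixP => i; rewrite row0.
      set c := row i _; have cB : c *m B = 0 by apply/sub_kermxP; exact: row_sub.
      have := basis_free (vbasisP U); move: (vbasis U) rB {BU}; rewrite dU => b rB /freeP fb.
      apply/rowP => a; rewrite [RHS]mxE; apply: (fb (fun a => c 0 a)).
      by rewrite -[RHS]cB mulmx_sum_row; apply: eq_bigr => ? _; rewrite rB.
    have sK : (B == kermx (jac idfun (v 0) f)^T)%MS.
      apply/andP; split.
        by apply/row_subP => a; apply/sub_kermxP/tE/BU.
      apply/row_subP => a; set w := row a _.
      have wU : w \in U by apply/tE/sub_kermxP; exact: row_sub.
      apply/submxP; exists (\row_b coord (vbasis U) (cast_ord (esym dU) b) w).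
      rewrite {1}(coord_vbasis wU) mulmx_sum_row (reindex (cast_ord dU)) /=; last first.
        by exists (cast_ord (esym dU)) => a' _; rewrite ?cast_ordK ?cast_ordKV.
      by apply: eq_bigr => b _; rewrite rB mxE cast_ordK.
    have := mxrank_ker (jac idfun (v 0) f)^T; rewrite -(eqmx_rank sK) (eqP fB) mxrank_tr (eqP ff).
    have : (k <= n.+1)%N by rewrite -[X in (X <= _)%N](eqP ff); exact: rank_leq_col.
    by lia.
  have km : k = (n - m)%N by lia.
  split; first by lia.
  by rewrite -km; exists f.
have [Z [/(_ 0%N isT) [[[x Zx] _] e] _]] := hm.1.
have Xx : X x by move: Zx; rewrite -e => -[].
have [v xv] := hcoord_ex x; have [le _] := key v (ex_intro _ x (conj Xx xv)).
by split=> // w Xw; have [_] := key w Xw.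
Qed.
End SmoothDef.

(** * Secant and dual varieties *)

Section Secant.
Variables (F : closedFieldType) (n : nat).
Local Notation S := {mpoly F[n.+1]}.
Local Notation V := 'rV[F]_n.+1.
Local Notation P := (proj F n).
Implicit Types (X Z : set P).
Hypothesis charF : forall k, k.+1%:R != 0 :> F.

Lemma vanishing_closure X p : vanishing (closure X) p <-> vanishing X p.
Proof.
split; first exact: (vanishing_anti (@subset_closure _ X)).
by move=> h x v; rewrite closureE_zeros => hx xv; exact: hx.
Qed.

Lemma cone_fun_poly (k : nat) (q : 'I_k -> S) (p : {mpoly F[k]}) (a : 'I_k -> V -> F) :
  (forall i v, a i v = (q i).@[v 0]) -> cone_fun (fun v => p.@[fun i => a i v]).
Proof.
move=> aq; exists (msub q p) => v; rewrite msub_meval; apply: meval_eq => i.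
by rewrite aq.
Qed.

Lemma sub_pair_fun (p : S) :
  pair_fun (@cone_fun F n) (@cone_fun F n) (fun t => p.@[(t.1 - t.2) 0]).
Proof.
split=> v /=.
  exists (msub (fun i => (v 0 i)%:MP - 'X_i) p) => w; rewrite msub_meval.
  by apply: meval_eq => i; rewrite !mxE mevalB mevalC mevalXU.
exists (msub (fun i => 'X_i - (v 0 i)%:MP) p) => w; rewrite msub_meval.
by apply: meval_eq => i; rewrite !mxE mevalB mevalC mevalXU.
Qed.

Lemma secant_vanishing X p : irreducible X -> (exists x y, [/\ X x, X y & x <> y]) ->
  vanishing (secant_variety X) p <->
  forall v w, pcone X v -> pcone X w -> p.@[(v - w) 0] = 0.
Proof.
move=> irr [x0 [y0 [Xx0 Xy0 xy0]]]; rewrite vanishing_closure; split; last first.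
  move=> h z u [x [y [Xx Xy _ zxy]]] [zu u0].
  have /memv_addP [a ax [b bY uE]] := subvP zxy _ zu.
  have pX (a' : V) (x' : P) : a' \in val x' -> X x' -> a' != 0 -> pcone X a' by move=> ? ? ?; exists x'.
  have [b0|b0] := eqVneq b 0.
    have Xa : pcone X a by apply: pX ax Xx _; rewrite uE b0 addr0 in u0.
    (* A point of X itself is a difference of two nonzero vectors of its own line, because 2 is
       nonzero. *)
    have -> : u = (2%:R *: a) - a by rewrite uE b0 addr0 scaler_nat mulr2n addrK.
    by apply: h => //; apply: pconeZ => //; exact: charF.
  have Xb : pcone X b by exact: pX bY Xy b0.
  have [a0|a0] := eqVneq a 0.
    have -> : u = (2%:R *: b) - b by rewrite uE a0 add0r scaler_nat mulr2n addrK.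
    by apply: h => //; apply: pconeZ => //; exact: charF.
  have -> : u = a - (-1 *: b) by rewrite uE scaleN1r opprK.
  apply: h; first exact: pX ax Xx a0.
  by apply: pconeZ; rewrite // oppr_eq0 oner_eq0.
move=> hp; have pc := prime_pair (prime_cone irr) (prime_cone irr).
have [_ _ _ pr] := pc.
have [v0 xv0] := hcoord_ex x0; have [w0 yw0] := hcoord_ex y0.
have [i [k ik]] : exists i k, v0 0 i * w0 0 k - v0 0 k * w0 0 i != 0.
  apply: contrapT => /forallNP h; apply: xy0.
  have [_ v00] := xv0; have [i vi] : exists i, v0 0 i != 0.
    apply: contrapT => /forallNP h'; move/eqP: v00; apply; apply/rowP => i.
    by rewrite mxE; apply/eqP; apply: contrapT => /negP; exact: h'.
  have wE : w0 = (w0 0 i / v0 0 i) *: v0.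
    apply/rowP => k; rewrite mxE; have /forallNP /(_ k) /negP := h i.
    rewrite negbK subr_eq0 => /eqP e; apply: (mulfI vi).
    by rewrite e; field.
  apply: (@hcoord_inj _ _ _ _ w0) => //; rewrite wE; apply: hcoordZ => //.
  by have [_] := yw0; apply: contraNneq => e; rewrite wE e scale0r.
pose m (t : V * V) := t.1 0 i * t.2 0 k - t.1 0 k * t.2 0 i.
have Pm : pair_fun (@cone_fun F n) (@cone_fun F n) m.
  split=> v.
    exists ((v 0 i) *: 'X_k - (v 0 k) *: 'X_i) => w.
    by rewrite mevalB !mevalZ !mevalXU.
  exists ((v 0 k) *: 'X_i - (v 0 i) *: 'X_k) => w.
  by rewrite mevalB !mevalZ !mevalXU /m /= [v 0 k * _]mulrC [v 0 i * _]mulrC.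
have [|h|h] := pr _ m (sub_pair_fun p) Pm.
- move=> [v w] [/= Xv Xw]; have [->|mn] := eqVneq (m (v, w)) 0; first by rewrite mulr0.
  rewrite (_ : p.@[_] = 0) ?mul0r //.
  have vw0 : v - w != 0.
    by rewrite subr_eq0; apply: contraNneq mn => ->; rewrite /m /= mulrC subrr.
  have [x [Xx xv]] := Xv; have [y [Xy yw]] := Xw.
  apply: (hp (pt vw0)); last exact: hcoord_pt.
  exists x, y; split=> //.
    move=> xy; have [a [a0 wE]] := hcoord_scale xv (ecast x (hcoord x w) (esym xy) yw).
    by move/eqP: mn; apply; rewrite /m /= wE !mxE; ring.
  rewrite /pt /= -memvE; apply: memv_add; first by case: xv.
  by rewrite memvN; case: yw.
- by move=> v w Xv Xw; exact: (h (v, w)).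
have := h (v0, w0) (conj (ex_intro _ x0 (conj Xx0 xv0)) (ex_intro _ y0 (conj Xy0 yw0))).
by rewrite /m /= => /eqP; rewrite (negbTE ik).
Qed.

Lemma two_points_secant X s : has_dim (secant_variety X) s ->
  exists x y, [/\ X x, X y & x <> y].
Proof.
move=> [[Z [/(_ 0%N isT) [[[z Zz] _] e] _]] _].
have Sz : secant_variety X z by move: Zz; rewrite -e => -[].
apply: contrapT => h; move: Sz; rewrite /secant_variety (_ : [set _ | _] = set0).
  by rewrite closure0.
by apply/seteqP; split=> // u [x [y [Xx Xy xy _]]]; case: h; exists x, y.
Qed.

Lemma secant_irreducible X : irreducible X -> (exists x y, [/\ X x, X y & x <> y]) ->
  irreducible (secant_variety X).
Proof.
move=> irr two; apply: prime_irreducible.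
  have [x [y [Xx Xy xy]]] := two; exists x; apply: subset_closure.
  by exists x, y; split=> //; exact: addvSl.
move=> p q /(secant_vanishing _ irr two) pq.
have [_ _ _ pr] := prime_pair (prime_cone irr) (prime_cone irr).
have [|h|h] := pr _ _ (sub_pair_fun p) (sub_pair_fun q).
- by move=> [v w] [/= Xv Xw]; rewrite -mevalM; exact: pq.
- by left; apply/(secant_vanishing _ irr two) => v w Xv Xw; exact: (h (v, w)).
- by right; apply/(secant_vanishing _ irr two) => v w Xv Xw; exact: (h (v, w)).
Qed.

(** The bound is d + 1 because z lies on the cone over Y. *)
Lemma algind_dim (L : fieldType) (j : {rmorphism F -> L}) Y (z : 'I_n.+1 -> L) r
  (A : 'I_r -> 'I_n.+1) d : closed Y -> irreducible Y -> on_cone j Y z ->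
  algind j (z \o A) -> dim_le Y d -> (r <= d.+1)%N.
Proof.
move=> cY iY zY ind le; case: r A ind => // r A ind; rewrite ltnS.
apply: (dim_le_ge le); apply: (indep_dim_ge cY iY (A := A)) => Q /zY h; apply: ind.
rewrite -[RHS]h /msub.
rewrite (mmap_comp (mmap j z : {rmorphism _ -> _})).
rewrite (_ : (_ \o @mpolyC _ _) = j); last by apply/funext => c; rewrite /= mmapC.
by apply: mmap_ext => i; rewrite /= /coords mmapX mmap1U.
Qed.

Lemma prime_generic (T : Type) (E : set T) PF : prime_set E PF ->
  exists (L : fieldType) (val : {rmorphism (T -> F) -> L}),
    (forall f, (forall t, E t -> f t = 0) -> val f = 0) /\
    (forall f, PF f -> val f = 0 -> forall t, E t -> f t = 0).
Proof. by move=> [P1 PM E0 pr]; exact: set_generic. Qed.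

Definition alg_fun (T : Type) (PF : (T -> F) -> Prop) := forall d (a : 'I_d -> T -> F),
  (forall i, PF (a i)) -> forall Q : {mpoly F[d]}, PF (fun t => Q.@[fun i => a i t]).

Lemma alg_pair (T1 T2 : Type) (P1 : (T1 -> F) -> Prop) (P2 : (T2 -> F) -> Prop) :
  alg_fun P1 -> alg_fun P2 -> alg_fun (pair_fun P1 P2).
Proof.
move=> a1 a2 d a ha Q; split=> t.
  by apply: (a2 d (fun i u => a i (t, u))) => i; case: (ha i).
by apply: (a1 d (fun i u => a i (u, t))) => i; case: (ha i).
Qed.

Lemma alg_cone : alg_fun (@cone_fun F n).
Proof. by move=> d a /choice [q qE] Q; exact: (cone_fun_poly Q qE). Qed.

Lemma alg_poly k : alg_fun (@poly_fun F k).
Proof.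
move=> d a /choice [q qE] Q; exists (msub q Q) => s; rewrite msub_meval.
by apply: meval_eq => i; rewrite qE.
Qed.

(** Polynomials are traded for coordinates by [algind_count]: a derivation that kills all
    coordinates kills every polynomial in them. *)
Lemma indep_coords X d (q : 'I_d -> S) : irreducible X -> indep_on X q ->
  exists r (A : 'I_r -> 'I_n.+1), (d <= r)%N /\ indep_on X (coords F A).
Proof.
move=> irr iq; have [L [val [v0 vE]]] := prime_generic (prime_cone irr).
pose j : {rmorphism F -> L} := val \o @cstr F V.
pose y i := val (fun v : V => v 0 i).
have ev p : mmap j y p = val (fun v => p.@[v 0]).
  rewrite [LHS](val_mmap val (fun i v => v 0 i) p).
  by congr (val _).
have evs r (p : 'I_r -> S) Q : mmap j y (msub p Q) = mmap j (fun i => mmap j y (p i)) Q.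
  rewrite /msub (mmap_comp (mmap j y : {rmorphism _ -> _})).
  rewrite (_ : (_ \o @mpolyC _ _) = j) //; apply/funext => c.
  by rewrite /= mmapC.
have eX p : mmap j y p = 0 <-> vanishing X p.
  rewrite ev; split=> [h|/vanishingE h]; last by apply: v0 => v; exact: h.
  by apply/vanishingE; apply: vE h; exists p.
pose p i := mmap j y (q i).
have ip : algind j p by move=> Q; rewrite -evs => /eX; exact: iq.
have [||B e sB By Bp de ey _ i|r1 [r2 [f1 [f2 []]]]] := algind_count charF (z := y) (h := fun i : 'I_0 => 0) (s := [seq y i | i <- enum 'I_n.+1]) ip.
- by move=> i; apply: map_f; rewrite mem_enum.
- by case.
- rewrite /p (der_mmap _ sB de) => [|k]; last by apply: By; apply: map_f; rewrite mem_enum.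
  by rewrite big1 // => k _; rewrite ey mulr0.
case: r2 f2 => [|r2] f2; last by case: (f2 ord0).
rewrite addn0 => le _ ind _; exists r1, f1; split=> // Q /eX; rewrite evs => h; apply: ind.
by rewrite -[RHS]h; apply: mmap_ext => i; rewrite /= /coords mmapX mmap1U.
Qed.

(** A derivation killing x - y and h kills y by [key_derivation], then x, hence every p i. At most s
    + 1 coordinates of x - y are independent, since this vector lies on the cone of the secant
    variety. *)
Lemma secant_bound (L : fieldType) (j : {rmorphism F -> L}) X s r D x y h (p : 'I_D -> L) :
  closed X -> irreducible X -> smooth_rank X r -> has_dim (secant_variety X) s ->
  on_cone j X x -> on_cone j X y -> on_cone j (secant_variety X) (fun i => x i - y i) ->
  conormal j X y h -> \sum_i h i * (x i - y i) != 0 ->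
  algind j p -> (forall i, exists k, [\/ p i = x k, p i = y k | p i = h k]) ->
  exists r2 (f : 'I_r2 -> 'I_n.+1), (D <= s.+1 + r2)%N /\ algind j (h \o f).
Proof.
move=> cX iX sX dS xX yX zS yh u0 ip pE.
have iS := secant_irreducible iX (two_points_secant dS).
pose z i := x i - y i.
pose E g := [seq g i : L | i <- enum 'I_n.+1].
have Em g i : g i \in E g by apply: map_f; rewrite mem_enum.
have [||B e sB Bs Bp de ez eh i|r1 [r2 [f1 [f2 [le _ ind1 ind2]]]]] :=
  algind_count charF (z := z) (h := h) (s := E z ++ E h ++ E x ++ E y) ip.
- by move=> i; rewrite mem_cat Em.
- by move=> i; rewrite !mem_cat Em orbT.
- have Bx k : B (x k) by apply: Bs; rewrite !mem_cat Em !orbT.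
  have By k : B (y k) by apply: Bs; rewrite !mem_cat Em !orbT.
  have Bh k : B (h k) by apply: Bs; rewrite !mem_cat Em !orbT.
  have ey := key_derivation charF cX sX xX yX yh u0 sB de Bx By Bh ez eh.
  have ex k : e (x k) = 0.
    rewrite -[x k](subrK (y k)) (derD sB de.1) ?ey ?ez ?addr0 //.
    by have [_ KB _] := sB; apply: KB.
  by have [k [->|->|->]] := pE i.
exists r2, f2; split=> //; apply: leq_trans le _; rewrite leq_add2r.
exact: (algind_dim (@closed_closure _ _) iS zS ind1 dS.2).
Qed.

End Secant.

Section Dual.
Variables (F : closedFieldType) (n : nat).
Local Notation S := {mpoly F[n.+1]}.
Local Notation V := 'rV[F]_n.+1.
Local Notation P := (proj F n).
Implicit Types (X Z : set P).
Hypothesis charF : forall k, k.+1%:R != 0 :> F.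

Definition gens X k (f : 'I_k -> S) := (forall a, vanishing X (f a)) /\
  forall p, vanishing X p -> gen (fun q => exists a, q = f a) p.

Lemma vanishing_gens X : exists k (f : 'I_k -> S), gens X f.
Proof.
have [s [sI gs]] := noeth_mpoly (vanishing_ideal_is X).
exists (size s), (fun i => s`_i); split=> [a|p /gs]; first by apply: sI; rewrite mem_nth.
apply: gen_sub => q qs; have lt : (index q s < size s)%N by rewrite index_mem.
by exists (Ordinal lt); rewrite nth_index.
Qed.

Section Field.
Variables (L : fieldType) (j : {rmorphism F -> L}).

Lemma grad_gens X k (f : 'I_k -> S) y p : gens X f -> on_cone j X y -> vanishing X p ->
  (grad j y p <= jac j y f)%MS.
Proof.
move=> [If gf] yX /gf; elim=> [|r g q [a ->] gq IH].
  have -> : grad j y 0 = 0 by apply/rowP => i; rewrite !mxE mderiv0 rmorph0.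
  exact: sub0mx.
rewrite gradD addmx_sub // gradM (yX (f a)) // scale0r addr0 scalemx_sub //.
have -> : grad j y (f a) = row a (jac j y f) by apply/rowP => i; rewrite !mxE.
exact: row_sub.
Qed.

Lemma conormal_gens X k (f : 'I_k -> S) y h : gens X f -> on_cone j X y ->
  conormal j X y h <-> ((\row_i h i) <= jac j y f)%MS.
Proof.
move=> gf yX; split=> [[m [g [s [Ig hE]]]]|/submxP [s sE]].
  have -> : \row_i h i = \sum_a s a *: grad j y (g a).
    by apply/rowP => i; rewrite summxE mxE hE; apply: eq_bigr => a _; rewrite !mxE.
  apply: summx_sub => a _; apply: scalemx_sub; exact: (grad_gens gf yX (Ig a)).
exists k, f, (s 0); split=> [|i]; first exact: gf.1.
have /rowP /(_ i) := sE; rewrite mxE => ->; rewrite mxE; apply: eq_bigr => a _.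
by rewrite mxE.
Qed.
End Field.

Lemma hyperplaneE (h : P) (l w : V) : hcoord h l -> hyperplane h w <-> \sum_(i < n.+1) l 0 i * w 0 i = 0.
Proof.
move=> hl; split=> [|w0 l' hl']; first exact.
have [a [_ ->]] := hcoord_scale hl hl'.
by under eq_bigr => i _ do rewrite mxE -mulrA; rewrite -mulr_sumr w0 mulr0.
Qed.

Lemma tangent_hyperplane X x v (h : P) (l : V) : X x -> hcoord x v -> hcoord h l ->
  tangent X x `<=` hyperplane h <-> conormal idfun X (v 0) (l 0).
Proof.
move=> Xx xv hl; have [k [f gf]] := vanishing_gens X.
have vX : on_cone idfun X (v 0) by apply: on_cone_point; exists x.
rewrite (conormal_gens _ gf vX); have -> : \row_i l 0 i = l by apply/rowP => i; rewrite mxE.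
have jE (w : V) : (forall p, vanishing X p -> \sum_(i < n.+1) p^`M(i).@[v 0] * w 0 i = 0) <->
    jac idfun (v 0) f *m w^T = 0.
  split=> [h'|h' p Ip].
    apply/colP => a; rewrite mxE [RHS]mxE -[RHS](h' (f a)); last exact: gf.1.
    by apply: eq_bigr => i _; rewrite !mxE.
  have /submxP [s sE] := grad_gens gf vX Ip.
  by rewrite dot_grad sE -mulmxA h' mulmx0 mxE.
have lE (w : V) : \sum_(i < n.+1) l 0 i * w 0 i = (l *m w^T) 0 0.
  by rewrite mxE; apply: eq_bigr => i _; rewrite mxE.
split=> [sub|/submxP [s sE] w /(tangentE w xv Xx) /jE w0]; last first.
  by apply/(hyperplaneE w hl); rewrite lE sE -mulmxA w0 mulmx0 mxE.
rewrite submxE; apply/eqP/rowP => b; rewrite [RHS]mxE; set C := cokermx _.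
have := sub (col b C)^T; rewrite (tangentE _ xv Xx) jE (hyperplaneE _ hl) lE trmxK => h0.
have -> : (l *m C) 0 b = (l *m col b C) 0 0 by rewrite !mxE; apply: eq_bigr => i _; congr (_ * _); rewrite [RHS]mxE.
by apply: h0; rewrite colE mulmxA mulmx_coker mul0mx.
Qed.

(** The vectors conormal to X at v, parametrised by an affine space when f generates the ideal: the
    conormal variety becomes the image of a cone times an affine space, which makes it irreducible.
    The value 0 is allowed and stands for no hyperplane. *)
Definition cmb k (f : 'I_k -> S) (v : V) (s : 'I_k -> F) : V :=
  (\row_a s a) *m jac idfun (v 0) f.

Lemma cmbE k (f : 'I_k -> S) v s i : cmb f v s 0 i = \sum_a s a * (f a)^`M(i).@[v 0].
Proof. by rewrite mxE; apply: eq_bigr => a _; rewrite !mxE. Qed.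

Lemma dual_cone X k (f : 'I_k -> S) l : gens X f ->
  pcone (dual_variety X) l <-> l != 0 /\ exists v s, pcone X v /\ l = cmb f v s.
Proof.
move=> gf; split=> [[h [[x [Xx sub]] hl]]|[l0 [v [s [[x [Xx xv]] lE]]]]].
  split; first by case: hl.
  have [v xv] := hcoord_ex x; have Xv : pcone X v by exists x.
  have := iffLR (tangent_hyperplane Xx xv hl) sub.
  move=> /(conormal_gens _ gf (on_cone_point Xv)).
  move=> /submxP [s sE]; exists v, (s 0); split=> //; rewrite /cmb.
  have -> : \row_a s 0 a = s by apply/rowP => a; rewrite mxE.
  by rewrite -sE; apply/rowP => i; rewrite mxE.
exists (pt l0); split; last exact: hcoord_pt.
exists x; split=> //; apply/(tangent_hyperplane Xx xv (hcoord_pt l0)).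
have Xv : pcone X v by exists x.
apply/(conormal_gens _ gf (on_cone_point Xv)).
have -> : \row_i l 0 i = l by apply/rowP => i; rewrite mxE.
by rewrite lE submxMl.
Qed.

Lemma vanishing_at0 X p : X !=set0 -> vanishing X p -> p.@[(0 : V) 0] = 0.
Proof.
move=> [x Xx] hp; have [v xv] := hcoord_ex x.
rewrite (meval_eq (v2 := fun i => 0 * v 0 i)) => [|i]; last by rewrite mxE mul0r.
by rewrite homog_eval big1 // => d _; rewrite (vanishing_homog d hp Xx xv) mulr0.
Qed.

Lemma dual_vanishing X k (f : 'I_k -> S) G : gens X f -> dual_variety X !=set0 ->
  vanishing (dual_variety X) G <-> forall v s, pcone X v -> G.@[cmb f v s 0] = 0.
Proof.
move=> gf ne; split=> [hG v s Xv|hG]; last first.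
  by apply/vanishingE => l /(dual_cone _ gf) [_ [v [s [Xv ->]]]]; exact: hG.
have [->|l0] := eqVneq (cmb f v s) 0; first exact: vanishing_at0 ne hG.
by move/vanishingE: hG; apply; apply/(dual_cone _ gf); split=> //; exists v, s.
Qed.

Definition cone_pair k := pair_fun (@cone_fun F n) (@poly_fun F k).

Lemma prime_conormal X k : irreducible X -> prime_set (pcone X `*` [set: 'I_k -> F]) (@cone_pair k).
Proof. by move=> irr; apply: prime_pair (prime_cone irr) (prime_affine F k). Qed.

Lemma alg_conormal k : alg_fun (@cone_pair k).
Proof. by apply: alg_pair; [exact: alg_cone|exact: alg_poly]. Qed.

Lemma cmb_pair k (f : 'I_k -> S) i : cone_pair (fun t : V * ('I_k -> F) => cmb f t.1 t.2 0 i).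
Proof.
split=> [v|s] /=.
  exists (\sum_a (f a)^`M(i).@[v 0] *: 'X_a) => s; rewrite cmbE raddf_sum /=.
  by apply: eq_bigr => a _; rewrite mevalZ mevalXU mulrC.
exists (\sum_a s a *: (f a)^`M(i)) => v; rewrite cmbE raddf_sum /=.
by apply: eq_bigr => a _; rewrite mevalZ.
Qed.

Lemma conePair1 k p : cone_pair (fun t : V * ('I_k -> F) => p.@[t.1 0]).
Proof.
by split=> t /=; [exists (p.@[t 0])%:MP => s; rewrite mevalC|exists p].
Qed.

Lemma dual_irreducible X : irreducible X -> dual_variety X !=set0 -> irreducible (dual_variety X).
Proof.
move=> irr ne; have [k [f gf]] := vanishing_gens X.
have [_ _ _ pr] := prime_conormal k irr.
have pf G : cone_pair (fun t : V * ('I_k -> F) => G.@[cmb f t.1 t.2 0]).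
  by apply: (alg_conormal (a := fun i t => cmb f t.1 t.2 0 i)) => i; exact: cmb_pair.
apply: prime_irreducible => // p q /(dual_vanishing _ gf ne) pq.
have [|h|h] := pr _ _ (pf p) (pf q).
- by move=> [v s] [/= Xv _]; rewrite -mevalM; exact: pq.
- by left; apply/(dual_vanishing _ gf ne) => v s Xv; exact: (h (v, s)).
- by right; apply/(dual_vanishing _ gf ne) => v s Xv; exact: (h (v, s)).
Qed.

(** The determinant trick: det(1 - C) kills the nonzero vector Y, hence is zero in L, and its value
    under [ev] is det 1. *)
Lemma nakayama (R : comNzRingType) (L : fieldType) (al : {rmorphism R -> L})
  (ev : {rmorphism R -> F}) M (Y : 'I_M -> L) t0 : Y t0 != 0 ->
  (forall t, exists c : 'I_M -> R, (forall t', ev (c t') = 0) /\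
     Y t = \sum_t' al (c t') * Y t') ->
  exists G, al G = 0 /\ ev G = 1.
Proof.
move=> Y0 /choice [c cE]; pose C : 'M[R]_M := \matrix_(t, t') c t t'.
exists (\det (1%:M - C)); split.
  apply/eqP; rewrite -det_map_mx -det_tr; apply/det0P; exists (\row_t Y t).
    by apply: contraNneq Y0 => /(congr1 (fun A : 'rV_M => A 0 t0)); rewrite !mxE => ->.
  apply/rowP => t; rewrite mxE [RHS]mxE.
  transitivity (\sum_t' ((t == t')%:R * Y t' - al (c t t') * Y t')).
    by apply: eq_bigr => t' _; rewrite !mxE rmorphB rmorph_nat mulrC mulrBl.
  rewrite sumrB -(cE t).2 (bigD1 t) //= eqxx mul1r big1 ?addr0 ?subrr // => t' tt'.
  by rewrite eq_sym (negbTE tt') mul0r.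
rewrite -det_map_mx (_ : map_mx ev _ = 1%:M) ?det1 //.
apply/matrixP => t t'; rewrite !mxE rmorphB (cE t).1 subr0.
by rewrite rmorph_nat.
Qed.

Lemma dhomog_prod_ord k (d : 'I_k -> nat) (p : 'I_k -> S) : (forall i, p i \is (d i).-homog) ->
  \prod_i p i \is (\sum_i d i).-homog.
Proof.
elim: k d p => [|k IH] d p h; first by rewrite !big_ord0; exact: dhomog1.
by rewrite !big_ord_recl; apply: dhomogM => //; exact: IH.
Qed.

Lemma minor_homog r (f : 'I_r -> S) : (forall a, Defs.form (f a)) ->
  exists e, forall c, minor f c \is e.-homog.
Proof.
move=> /choice [d hd]; exists (\sum_a (d a).-1)%N => c.
rewrite /minor /determinant; apply: rpred_sum => s _.
rewrite -signr_odd; case: (odd _); rewrite ?expr1 ?expr0 ?mulN1r ?mul1r ?rpredN;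
  by apply: dhomog_prod_ord => a; rewrite mxE; exact: mderiv_homog.
Qed.

Definition swap r (c : 'I_r -> 'I_n.+1) b i : 'I_r -> 'I_n.+1 := fun b' => if b' == b then i else c b'.

(** Cramer's rule: the minor with column b replaced is expanded along that column. *)
Lemma adj_minor r (f : 'I_r -> S) c b i :
  \sum_a (\adj (minor_mx f c)) b a * (f a)^`M(i) = minor f (swap c b i).
Proof.
have e1 a : \adj (minor_mx f c) b a = cofactor (minor_mx f c) a b by rewrite mxE.
have e2 a : minor_mx f (swap c b i) a b = (f a)^`M(i) by rewrite mxE /swap eqxx.
have e3 a : cofactor (minor_mx f (swap c b i)) a b = cofactor (minor_mx f c) a b.
  rewrite /cofactor; have -> // : row' a (col' b (minor_mx f (swap c b i))) = row' a (col' b (minor_mx f c)).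
  apply/matrixP => a' b'; rewrite mxE [LHS]mxE mxE [RHS]mxE mxE [RHS]mxE.
  by rewrite /swap eq_sym (negbTE (neq_lift _ _)).
rewrite /minor (expand_det_col (minor_mx f (swap c b i)) b); apply: eq_bigr => a _.
by rewrite e1 e2 e3 mulrC.
Qed.

(** The matrix of the minor times the identity, less Cramer's projection: where the minor is
    nonzero, h is a combination of the gradients of f iff this matrix annihilates it. Its entries
    come from minors, so they are forms of one degree in y. *)
Definition mcoef r (f : 'I_r -> S) (c : 'I_r -> 'I_n.+1) (i i' : 'I_n.+1) : S :=
  (i == i')%:R * minor f c - \sum_b (c b == i')%:R * minor f (swap c b i).

Lemma mcoef_sum r (f : 'I_r -> S) c (R : comNzRingType) (j : {rmorphism F -> R}) y h i :
  \sum_i' h i' * mmap j y (mcoef f c i i') =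
  \det (colsub c (jac j y f)) * h i -
    (colsub c (\row_i h i) *m \adj (colsub c (jac j y f)) *m jac j y f) 0 i.
Proof.
have E i' : h i' * mmap j y (mcoef f c i i') =
    h i' * ((i == i')%:R * \det (colsub c (jac j y f))) -
    \sum_b h i' * ((c b == i')%:R * mmap j y (minor f (swap c b i))).
  rewrite rmorphB rmorphM /= rmorph_nat mmap_minor rmorph_sum mulrBr /= [X in _ - X]mulr_sumr.
  by congr (_ - _); apply: eq_bigr => b _; rewrite rmorphM /= rmorph_nat.
rewrite (eq_bigr _ (fun i' _ => E i')) sumrB; congr (_ - _).
  rewrite (bigD1 i) //= eqxx mul1r big1 ?addr0 1?mulrC // => i' ii'.
  by rewrite eq_sym (negbTE ii') mul0r mulr0.
rewrite exchange_big -mulmxA mxE /=; apply: eq_bigr => b _.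
rewrite (bigD1 (c b)) //= eqxx mul1r big1 ?addr0 => [|i' ii']; last first.
  by rewrite eq_sym (negbTE ii') mul0r mulr0.
have -> : colsub c (\row_i0 h i0) 0 b = h (c b) by rewrite !mxE.
rewrite [in RHS]mxE -adj_minor rmorph_sum; congr (_ * _); apply: eq_bigr => a _.
rewrite rmorphM /= [jac _ _ _ _ _]mxE; congr (_ * _).
have -> : colsub c (jac j y f) = map_mx (mmap j y) (minor_mx f c).
  by apply/matrixP => a' b'; rewrite !mxE.
by rewrite -map_mx_adj [RHS]mxE.
Qed.

Lemma mcoef_homog r (f : 'I_r -> S) : (forall a, Defs.form (f a)) ->
  exists e, forall c i i', mcoef f c i i' \is e.-homog.
Proof.
move=> /minor_homog [e he]; exists e => c i i'; rewrite rpredB //.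
  by case: eqP => _ /=; rewrite ?mul1r ?mul0r ?rpred0 ?he.
apply: rpred_sum => b _.
by case: eqP => _ /=; rewrite ?mul1r ?mul0r ?rpred0 ?he.
Qed.

(** Properness of the projection of the conormal variety. If h is tangent nowhere, the equations of
    X and the linear conditions [mcoef] at l have at most the vertex in common, so every monomial of
    degree d in y is a combination of them. At the generic pair (y, w) the conditions hold with w in
    place of l; the monomials are therefore combinations of themselves with coefficients multiples
    of l - w, which vanish at l, and [nakayama] gives a polynomial that vanishes on the dual variety
    and is 1 at l. *)
Lemma dual_closed X r : closed X -> irreducible X -> smooth_rank X r -> closed (dual_variety X).
Proof.
move=> cX iX sX.
have [ne|/set0P/negP] := pselect (dual_variety X !=set0); last first.
  by rewrite negbK => /eqP ->; exact: closed0.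
move=> h; rewrite closureE_zeros => clh; apply: contrapT => nh.
have [l hl] := hcoord_ex h; have [k [f gf]] := vanishing_gens X.
have [L [val [v0 vE]]] := prime_generic (prime_conormal k iX).
pose j : {rmorphism F -> L} := val \o @cstr F (V * ('I_k -> F)).
pose y i := val (fun t => t.1 0 i); pose w i := val (fun t => cmb f t.1 t.2 0 i).
have ey p : mmap j y p = val (fun t => p.@[t.1 0]).
  by rewrite [LHS](val_mmap val (fun i t => t.1 0 i) p).
have ew p : mmap j w p = val (fun t => p.@[cmb f t.1 t.2 0]).
  by rewrite [LHS](val_mmap val (fun i t => cmb f t.1 t.2 0 i) p).
have yX : on_cone j X y.
  by move=> p /vanishingE hp; rewrite ey; apply: v0 => -[v s] [/= Xv _]; exact: hp.
have wE : \row_i w i = (\row_a val (fun t => t.2 a)) *m jac j y f.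
  apply/rowP => i; rewrite mxE [RHS]mxE.
  rewrite /w (_ : (fun t : V * ('I_k -> F) => _) =
    \sum_a (fun t : V * ('I_k -> F) => t.2 a) * (fun t => (f a)^`M(i).@[t.1 0])).
    by rewrite rmorph_sum; apply: eq_bigr => a _; rewrite rmorphM !mxE ey.
  by apply/funext => t; rewrite cmbE fct_sumE.
pose G p := vanishing X p \/ exists (f' : 'I_r -> S) c i,
  [/\ forall a, vanishing X (f' a) /\ Defs.form (f' a), ~ vanishing X (minor f' c) &
  p = \sum_i' l 0 i' *: mcoef f' c i i'].
have GX i : exists e, gen G ('X_i ^+ e).
  apply: nullstellensatz => v hv; rewrite mevalXU.
  have [//|vi] := eqVneq (v i) 0; exfalso; apply: nh.
  pose u : V := \row_i v i.
  have uv : u 0 =1 v by move=> i'; rewrite mxE.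
  have u0 : u != 0.
    by apply: contraNneq vi => /(congr1 (fun A : V => A 0 i)); rewrite !mxE => ->.
  have Xu : pcone X u.
    by apply: closed_pcone => // p Xp; rewrite (meval_eq _ uv); apply: hv; left.
  have [f' [If ff _]] := sX u Xu; have [c c0] := minor_neq0 ff.
  have [x [Xx xu]] := Xu; exists x; split=> //; apply/(tangent_hyperplane Xx xu hl).
  exists r, f', (fun a => (\det (colsub c (jac idfun (u 0) f')))^-1 *
    (colsub c l *m \adj (colsub c (jac idfun (u 0) f'))) 0 a).
  split=> [a|i']; first by case: (If a).
  have mX : ~ vanishing X (minor f' c).
    by move=> /(_ x u Xx xu)/eqP; rewrite -[_.@[_]]/(mmap idfun _ _) mmap_minor (negbTE c0).
  apply: (mulfI c0); have := hv _ (or_intror (ex_intro _ f' (ex_intro _ c (ex_intro _ i' (And3 If mX erefl))))).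
  rewrite raddf_sum /=; under eq_bigr => i'' _ do rewrite mevalZ -(meval_eq _ uv).
  rewrite (mcoef_sum f' c idfun (u 0) (l 0) i') => /eqP; rewrite subr_eq0 => /eqP ->.
  rewrite (_ : \row_i l 0 i = l); last by apply/rowP => ?; rewrite mxE.
  rewrite mxE mulr_sumr; apply: eq_bigr => a _.
  by rewrite !mulrA mulfV // mul1r [jac _ _ _ _ _]mxE.
have [e eE] := choice GX; pose d := (\sum_i e i)%N.
pose T := 'X_{1..n.+1 < d.+1}.
pose mon (t : 'I_#|{: T}|) : 'X_{1..n.+1} := enum_val t.
pose Y t := if mdeg (mon t) == d then mmap j y 'X_[mon t] else 0.
have Yspan p : p \is d.-homog -> mmap j y p = \sum_t j p@_(mon t) * Y t.
  move=> hp; have sp : (msize p <= d.+1)%N.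
    rewrite mmeasureE; apply/bigmax_leqP_seq => m mp _.
    by rewrite ltnS (dhomogP _ _ _ hp m mp).
  rewrite {1}(mpolywE sp) rmorph_sum /= (reindex (@enum_val T predT)) /=; last first.
    by apply: onW_bij; exact: enum_val_bij.
  apply: eq_bigr => t _; rewrite -mul_mpolyC rmorphM /= mmapC /Y /mon.
  case: eqP => // nd; rewrite mulr0 (dhomog_nemf_coeff hp); last exact/eqP.
  by rewrite -[X in X * _]/(j 0) rmorph0 mul0r.
pose W x := exists c : 'I_#|{: T}| -> S, (forall t, (c t).@[l 0] = 0) /\
  x = \sum_t mmap j w (c t) * Y t.
have W0 : W 0.
  by exists (fun=> 0); split=> [t|]; rewrite ?meval0 // big1 // => t _; rewrite rmorph0 mul0r.
have WD x x' : W x -> W x' -> W (x + x').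
  move=> [c [c0 ->]] [c' [c'0 ->]]; exists (fun t => c t + c' t).
  split=> [t|]; first by rewrite mevalD c0 c'0 addr0.
  by rewrite -big_split; apply: eq_bigr => t _; rewrite rmorphD mulrDl.
have Wsum I (s : seq I) (g : I -> L) : (forall i, W (g i)) -> W (\sum_(i <- s) g i).
  by move=> Wg; apply: big_ind.
have GW p : gen G p -> W (mmap j y (pihomog mdeg d p)).
  elim=> [|q g a Gg _ Wa]; first by rewrite raddf0 rmorph0.
  rewrite raddfD rmorphD /=; apply: WD => //; case: Gg => [Ig|[f' [c [i [If mX ->]]]]].
    by rewrite yX //; apply: vanishing_homog; exact: vanishingM.
  have [e' he'] := mcoef_homog (fun a => (If a).2).
  rewrite (pihomog_partitionE (mf := mdeg) (leqnn (msize q))) mulr_suml.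
  rewrite [pihomog mdeg d _](linear_sum (pihomog mdeg d)) rmorph_sum; apply: (Wsum) => m /=.
  set qm := pihomog mdeg m q.
  set g' := (X in qm * X); have hg : g' \is e'.-homog.
    by apply: rpred_sum => i' _; apply: rpredZ; exact: he'.
  have hm : qm * g' \is (m + e').-homog by apply: dhomogM => //; exact: pihomogP.
  have [de|de] := eqVneq (m + e')%N d; last by rewrite (pihomog_ne0 de hm) rmorph0.
  rewrite pihomog_dE; last by rewrite -de.
  pose K i' := mcoef f' c i i'; pose q' i' := qm * K i'.
  have hq i' : q' i' \is d.-homog.
    by rewrite -de; apply: dhomogM; [exact: pihomogP|exact: he'].
  have eq0 : \sum_i' w i' * mmap j y (K i') = 0.
    have my : mmap j y (minor f' c) != 0.
      apply: contra_notN mX => /eqP; rewrite ey => m0; apply/vanishingE => v Xv.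
      exact: (vE _ (conePair1 _ _) m0 (v, fun=> 0) (conj Xv I)).
    have yw : conormal j X y w by apply/(conormal_gens _ gf yX); rewrite wE submxMl.
    have [s sE] := conormal_cramer sX yX (fun a => (If a).1) my yw.
    rewrite mcoef_sum sE cramer_span -sE [X in _ - X]mxE [X in _ - _ * X]mxE.
    by rewrite subrr.
  have -> : mmap j y (qm * g') = \sum_i' (j (l 0 i') - w i') * mmap j y (q' i').
    under [RHS]eq_bigr => i' _ do rewrite mulrBl.
    rewrite sumrB [X in _ - X](_ : _ = 0) ?subr0; last first.
      under eq_bigr => i' _ do rewrite rmorphM /= mulrCA.
      by rewrite -mulr_sumr eq0 mulr0.
    rewrite /g' mulr_sumr rmorph_sum /=; apply: eq_bigr => i' _.
    by rewrite -scalerAr -mul_mpolyC rmorphM /= mmapC.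
  apply: (Wsum) => i'; rewrite (Yspan _ (hq i')).
  exists (fun t => ((l 0 i')%:MP - 'X_i') * ((q' i')@_(mon t))%:MP); split=> [t|].
    by rewrite mevalM mevalB !mevalC mevalXU subrr mul0r.
  rewrite mulr_sumr; apply: eq_bigr => t _.
  by rewrite rmorphM rmorphB /= !mmapC mmapX mmap1U mulrA.
have WY t : W (Y t).
  rewrite /Y; case: eqP => // md; have hm : 'X_[F, mon t] \is d.-homog.
    by rewrite dhomogX; apply/eqP.
  rewrite -(pihomog_dE hm); apply: GW.
  have [i le] : exists i, (e i <= mon t i)%N.
    apply: contrapT => /forallNP lt; have : (mdeg (mon t) < d)%N; last by rewrite md ltnn.
    rewrite mdegE /d; apply: (@leq_trans (\sum_i (mon t i).+1)%N).
      rewrite big_ord_recl [leqRHS]big_ord_recl addSn ltnS leq_add2l.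
      by apply: leq_sum => i _.
    by apply: leq_sum => i _; have /negP := lt i; rewrite -ltnNge.
  have -> : mon t = (mon t - U_(i) *+ e i + U_(i) *+ e i)%MM.
    rewrite submK //; apply/mnm_lepP => i'; rewrite mulmnE mnm1E.
    by case: eqP => [<-|_]; rewrite ?mul1n ?mul0n.
  by rewrite mpolyXD -mpolyXn; apply: genM; exact: eE.
have [i yi] : exists i, y i != 0.
  apply: contrapT => /forallNP h0; have [v Xv] : exists v, pcone X v.
    by have [[x Xx] _] := iX; have [v xv] := hcoord_ex x; exists v, x.
  have /eqP[] := pcone_neq0 Xv; apply/rowP => i; rewrite mxE.
  have /negP := h0 i; rewrite negbK => /eqP yi.
  have pc := conePair1 k 'X_i.
  rewrite /y (_ : (fun t : V * ('I_k -> F) => t.1 0 i) = fun t => ('X_i).@[t.1 0]) in yi; last first.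
    by apply/funext => t; rewrite mevalXU.
  by have := vE _ pc yi (v, fun=> 0) (conj Xv I); rewrite /= mevalXU.
have md : mdeg (U_(i) *+ d)%MM = d by rewrite mdegMn mdeg1 mul1n.
have lt : (mdeg (U_(i) *+ d)%MM < d.+1)%N by rewrite md.
pose t0 := enum_rank (BMultinom lt).
have Yt0 : Y t0 != 0.
  rewrite /Y /mon /t0 enum_rankK /= md eqxx -mpolyXn rmorphXn /= mmapX mmap1U.
  exact: expf_neq0.
have [Q [Qw Ql]] := nakayama (al := mmap j w : {rmorphism S -> L}) (ev := meval (l 0)) Yt0 WY.
have : Q.@[l 0] = 0.
  apply: clh => //; apply/(dual_vanishing _ gf ne) => v s Xv.
  rewrite /= ew in Qw; apply: (vE _ _ Qw (v, s) (conj Xv I)).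
  by apply: (alg_conormal (a := fun i t => cmb f t.1 t.2 0 i)) => i'; exact: cmb_pair.
by rewrite Ql => /eqP; rewrite oner_eq0.
Qed.
End Dual.

Section Bounds.
Variables (F : closedFieldType) (n : nat).
Local Notation S := {mpoly F[n.+1]}.
Local Notation V := 'rV[F]_n.+1.
Local Notation P := (proj F n).
Implicit Types (X Y Z : set P).
Hypothesis charF : forall k, k.+1%:R != 0 :> F.

Lemma dim_coords X d : closed X -> irreducible X -> dim_ge X d ->
  exists r (A : 'I_r -> 'I_n.+1), (d < r)%N /\ indep_on X (coords F A).
Proof.
move=> cX iX /dim_ge_indep [Z [cZ iZ ZX [q iq]]]; rewrite -(closure_id X).1 // in ZX.
apply: (indep_coords charF iX (q := q)) => Q XQ; apply: iq; exact: vanishing_anti XQ.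
Qed.

Section Triple.
Variables (X Y : set P) (k : nat) (f : 'I_k -> S).
Local Notation T := (V * (V * ('I_k -> F)))%type.
(** A point of Y and, independent of it, a point of X with a hyperplane tangent there. Y is X itself
    for the dimension bound, and the dual variety for the proof that the latter is singular. *)
Definition triple_set : set T := pcone Y `*` (pcone X `*` setT).
Definition triple_fun : (T -> F) -> Prop := pair_fun (@cone_fun F n) (@cone_pair F n k).
Hypothesis iX : irreducible X.
Hypothesis iY : irreducible Y.
Hypothesis gf : gens X f.

Lemma prime_triple : prime_set triple_set triple_fun.
Proof. exact: prime_pair (prime_cone iY) (prime_conormal k iX). Qed.

Lemma alg_triple : alg_fun triple_fun.
Proof. by apply: alg_pair; [exact: alg_cone|exact: alg_conormal]. Qed.

Lemma triple1 i : triple_fun (fun t => t.1 0 i).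
Proof.
split=> t /=; last by exists 'X_i => v; rewrite mevalXU.
by split=> u /=; exists (t 0 i)%:MP => s; rewrite mevalC.
Qed.

Lemma triple2 i : triple_fun (fun t => t.2.1 0 i).
Proof.
split=> t /=; last by exists (t.1 0 i)%:MP => s; rewrite mevalC.
by split=> u /=; [exists (u 0 i)%:MP => s; rewrite mevalC|exists 'X_i => v; rewrite mevalXU].
Qed.

Lemma triple3 i : triple_fun (fun t => cmb f t.2.1 t.2.2 0 i).
Proof.
split=> t /=; first exact: cmb_pair.
by exists (cmb f t.1 t.2 0 i)%:MP => s; rewrite mevalC.
Qed.

Variables (L : fieldType) (val : {rmorphism (T -> F) -> L}).
Hypothesis v0 : forall g, (forall t, triple_set t -> g t = 0) -> val g = 0.
Hypothesis vE : forall g, triple_fun g -> val g = 0 -> forall t, triple_set t -> g t = 0.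
Let j : {rmorphism F -> L} := val \o @cstr F T.
Let x i := val (fun t => t.1 0 i).
Let y i := val (fun t => t.2.1 0 i).
Let h i := val (fun t => cmb f t.2.1 t.2.2 0 i).

Lemma triple_x p : mmap j x p = 0 <-> vanishing Y p.
Proof.
rewrite [mmap _ _ _](val_mmap val (fun i t => t.1 0 i) p); split=> [h0|/vanishingE h0].
  have [[x0 Xx0] _] := iX; have [u xu] := hcoord_ex x0.
  apply/vanishingE => v Yv; apply: (vE _ h0 (t := (v, (u, fun=> 0)))).
    by apply: (alg_triple (a := fun i t => t.1 0 i)) => i; exact: triple1.
  by split=> //; split=> //; exists x0.
by apply: v0 => -[v u] [/= Yv _]; exact: h0.
Qed.

Lemma triple_y p : mmap j y p = 0 <-> vanishing X p.
Proof.
rewrite [mmap _ _ _](val_mmap val (fun i t => t.2.1 0 i) p); split=> [h0|/vanishingE h0].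
  have [[x0 Xx0] _] := iY; have [u xu] := hcoord_ex x0.
  apply/vanishingE => v Yv; apply: (vE _ h0 (t := (u, (v, fun=> 0)))).
    by apply: (alg_triple (a := fun i t => t.2.1 0 i)) => i; exact: triple2.
  by split=> //; exists x0.
by apply: v0 => -[v [u s]] [/= _ [Yv _]]; exact: h0.
Qed.

Lemma triple_h p : dual_variety X !=set0 -> mmap j h p = 0 <-> vanishing (dual_variety X) p.
Proof.
move=> ne; rewrite (dual_vanishing _ gf ne).
rewrite [mmap _ _ _](val_mmap val (fun i t => cmb f t.2.1 t.2.2 0 i) p); split=> h0.
  have [[x0 Xx0] _] := iY; have [u xu] := hcoord_ex x0.
  move=> v s Xv; apply: (vE _ h0 (t := (u, (v, s)))).
    by apply: (alg_triple (a := fun i t => cmb f t.2.1 t.2.2 0 i)) => i; exact: triple3.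
  by split=> //; exists x0.
by apply: v0 => -[v [u s]] [/= _ [Yv _]]; exact: h0.
Qed.

Lemma triple_conormal : \row_i h i = (\row_a val (fun t => t.2.2 a)) *m jac j y f.
Proof.
apply/rowP => i; rewrite mxE [RHS]mxE.
rewrite /h (_ : (fun t : T => _) =
    \sum_a (fun t : T => t.2.2 a) * (fun t => (f a)^`M(i).@[t.2.1 0])).
  rewrite rmorph_sum; apply: eq_bigr => a _; rewrite rmorphM !mxE; congr (_ * _).
  by rewrite [RHS](val_mmap val (fun i t => t.2.1 0 i)).
by apply/funext => t; rewrite cmbE fct_sumE.
Qed.

Lemma triple_dot : exists U : T -> F, [/\
  forall t, U t = \sum_i cmb f t.2.1 t.2.2 0 i * (t.1 0 i - t.2.1 0 i),
  triple_fun U & val U = \sum_i h i * (x i - y i)].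
Proof.
exists (fun t : T => \sum_i cmb f t.2.1 t.2.2 0 i * (t.1 0 i - t.2.1 0 i)); split=> //; last first.
  rewrite (_ : (fun t : T => _) = \sum_i (fun t : T => cmb f t.2.1 t.2.2 0 i) *
     ((fun t : T => t.1 0 i) - (fun t : T => t.2.1 0 i))).
    by rewrite rmorph_sum; apply: eq_bigr => i _; rewrite rmorphM rmorphB.
  by apply/funext => t; rewrite fct_sumE.
pose a (i : 'I_(n.+1 + (n.+1 + n.+1))) : T -> F := fun t =>
  match fintype.split i with inl i => cmb f t.2.1 t.2.2 0 i | inr i =>
  match fintype.split i with inl i => t.1 0 i | inr i => t.2.1 0 i end end.
have := alg_triple (a := a) _ (\sum_i 'X_(lshift _ i) * ('X_(rshift _ (lshift _ i)) - 'X_(rshift _ (rshift _ i)))).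
rewrite (_ : (fun t : T => _) = fun t => \sum_i cmb f t.2.1 t.2.2 0 i * (t.1 0 i - t.2.1 0 i)); last first.
  apply/funext => t; rewrite raddf_sum; apply: eq_bigr => i _.
  rewrite /= mevalM mevalB !mevalXU /a.
  by rewrite (unsplitK (inl i)) !(unsplitK (inr _)) (unsplitK (inl i)).
apply=> i; rewrite /a; case: (fintype.split i) => b; first exact: triple3.
by case: (fintype.split b) => b'; [exact: triple1|exact: triple2].
Qed.

(** Transcendence degrees add up: for given y, the r coordinates of h in columns where some maximal
    minor is nonzero take arbitrary values. *)
Lemma triple_indep rX (AX : 'I_rX -> 'I_n.+1) rY (AY : 'I_rY -> 'I_n.+1) r :
  indep_on X (coords F AX) -> indep_on Y (coords F AY) -> smooth_rank X r ->
  exists p : 'I_(rY + (rX + r)) -> L, algind j p /\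
    forall i, exists l, [\/ p i = x l, p i = y l | p i = h l].
Proof.
move=> indX indY sX; have [[x0 Xx0] _] := iX; have [w xw] := hcoord_ex x0.
have Xw : pcone X w by exists x0.
have [g [Ig fg _]] := sX w Xw; have [c c0] := minor_neq0 fg.
pose b1 (i : 'I_(rX + r)) (v : V) (s : 'I_k -> F) := match fintype.split i with
  inl a => v 0 (AX a) | inr b => cmb f v s 0 (c b) end.
pose q (i : 'I_(rY + (rX + r))) : T -> F := fun t => match fintype.split i with
  inl a => t.1 0 (AY a) | inr b => b1 b t.2.1 t.2.2 end.
have indc (A : set P) d (B : 'I_d -> 'I_n.+1) : indep_on A (coords F B) ->
    forall Q : {mpoly F[d]}, (forall t, pcone A t -> Q.@[fun i => t 0 (B i)] = 0) -> Q = 0.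
  by move=> iB Q hQ; apply: iB; apply/vanishingE => v Av; rewrite msub_coords hQ.
have polyc d (B : 'I_d -> 'I_n.+1) (Q : {mpoly F[d]}) :
    cone_fun (fun t : V => Q.@[fun i => t 0 (B i)]).
  by exists (msub (coords F B) Q) => v; rewrite msub_coords.
exists (fun i => val (q i)); split=> [Q|i]; last first.
  rewrite /q /b1; case: (fintype.split i) => a; first by exists (AY a); apply: Or31.
  by case: (fintype.split a) => b; [exists (AX b); apply: Or32|exists (c b); apply: Or33].
rewrite [mmap _ _ _](val_mmap val q Q) => Q0.
have {}Q0 : forall v u, pcone Y v -> (pcone X `*` setT) u -> Q.@[fun i => q i (v, u)] = 0.
  move=> v u Yv Xu; apply: (vE _ Q0 (t := (v, u))) => //.
  apply: (alg_triple (a := q)) => i; rewrite /q /b1; case: (fintype.split i) => a.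
    exact: triple1.
  by case: (fintype.split a) => b; [exact: triple2|exact: triple3].
apply: (indep_pair (E2 := pcone X `*` setT) (m := fun=> 1) (a := fun a (t : V) => t 0 (AY a))
  (b := fun b (_ : V) (u : V * ('I_k -> F)) => b1 b u.1 u.2) (prime_cone iY)); last exact: Q0.
- by exists 1 => v; rewrite meval1.
- exact: polyc.
- have [[y0 Yy0] _] := iY; have [u yu] := hcoord_ex y0; exists u; split; first by exists y0.
  exact: oner_neq0.
- exact: indc.
move=> v Yv _ Q' hQ'.
apply: (indep_pair (E2 := setT) (m := fun v : V => (minor g c).@[v 0]) (a := fun a (t : V) => t 0 (AX a))
  (b := fun b (v : V) (s : 'I_k -> F) => cmb f v s 0 (c b)) (prime_cone iX));
  last by move=> u s Xu _; exact: (hQ' (u, s) (conj Xu I)).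
- by exists (minor g c).
- exact: polyc.
- by exists w; split=> //; rewrite -[_.@[_]]/(mmap idfun _ _) mmap_minor.
- exact: indc.
move=> u Xu mu Q2 hQ2; apply: mpoly_eq0_everywhere => a.
rewrite -[_.@[_]]/(mmap idfun _ _) mmap_minor in mu.
have /submxP [M ME] : (jac idfun (u 0) g <= jac idfun (u 0) f)%MS.
  apply/row_subP => i; have -> : row i (jac idfun (u 0) g) = grad idfun (u 0) (g i).
    by apply/rowP => l; rewrite !mxE.
  by apply: (grad_gens gf (on_cone_point Xu)); case: (Ig i).
pose D := colsub c (jac idfun (u 0) g); have Du : D \in unitmx by rewrite unitmxE unitfE.
(* Coefficients that give the chosen coordinates of h the prescribed values a. *)
pose s := \row_i a i *m invmx D *m M.
rewrite -[RHS](hQ2 (s 0) I); apply: meval_eq => b.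
have -> : cmb f u (s 0) = \row_i a i *m invmx D *m jac idfun (u 0) g.
  by rewrite /cmb (_ : \row_a s 0 a = s) ?ME ?mulmxA //; apply/rowP => i; rewrite mxE.
have -> : (\row_i a i *m invmx D *m jac idfun (u 0) g) 0 (c b) = (\row_i a i *m invmx D *m D) 0 b.
  by rewrite [LHS]mxE [RHS]mxE; apply: eq_bigr => i _; rewrite [D _ _]mxE.
by rewrite mulmxKV // mxE.
Qed.
End Triple.

(** The triple (x, y, h) has at least (m + 1) + (m + 1) + (n - m) independent elements, of which x -
    y accounts for at most s + 1 and h for at most d + 1. *)
Lemma dual_bound X m s d : closed X -> irreducible X -> nonsingular X -> non_degenerate X ->
  has_dim X m -> has_dim (secant_variety X) s -> dual_variety X !=set0 ->
  dim_le (dual_variety X) d -> (m + n <= s + d)%N.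
Proof.
move=> cX iX nX ndX dX dS ne dD; have [le sX] := nonsingular_smooth nX dX.
have [k [f gf]] := vanishing_gens X.
have [L [val [v0 vE]]] := prime_generic (prime_triple k iX iX).
have [rX [A [rXm iA]]] := dim_coords cX iX dX.1.
pose j : {rmorphism F -> L} := val \o @cstr F _.
pose x i := val (fun t => t.1 0 i).
pose y i := val (fun t => t.2.1 0 i).
pose h i := val (fun t => cmb f t.2.1 t.2.2 0 i).
have [p [ip pE]] := triple_indep iX iX gf vE iA iA sX.
have xX : on_cone j X x by move=> q /(triple_x iX v0 vE).
have yX : on_cone j X y by move=> q /(triple_y iX v0 vE).
have hD : on_cone j (dual_variety X) h by move=> q /(triple_h iX gf v0 vE _ ne).
have yh : conormal j X y h.
  by apply/(conormal_gens _ gf yX); rewrite [\row_i _](triple_conormal f val) submxMl.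
have zS : on_cone j (secant_variety X) (fun i => x i - y i).
  move=> q /(secant_vanishing charF _ iX (two_points_secant dS)) qS.
  rewrite (@mmap_ext _ _ _ _ _ (fun i => val (fun t => t.1 0 i - t.2.1 0 i))); last first.
    by move=> i; rewrite -rmorphB.
  rewrite [LHS](val_mmap val (fun i t => t.1 0 i - t.2.1 0 i) q).
  apply: v0 => -[v [u w]] [/= Xv [Xu _]]; rewrite -[RHS](qS v u Xv Xu).
  by apply: meval_eq => i; rewrite !mxE.
have u0 : \sum_i h i * (x i - y i) != 0.
  have [U [UE PU Uval]] := triple_dot f val.
  (* If h.(x - y) vanished identically, x = 2 y would give h.y = 0, then h.x = 0 for all x on the
     cone, and X would be degenerate. *)
  rewrite -Uval; apply/eqP => U0; have {}U0 := vE _ PU U0.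
  have [hh Dh] := ne; have [l hl] := hcoord_ex hh.
  have /(dual_cone _ gf) [l0 [v [t [Xv lE]]]] : pcone (dual_variety X) l by exists hh.
  have lv : \sum_i l 0 i * v 0 i = 0.
    have := U0 (2%:R *: v, (v, t)) (conj (pconeZ Xv (charF 1)) (conj Xv I)).
    rewrite UE /= -lE => e; rewrite -[RHS]e; apply: eq_bigr => i _; rewrite mxE; ring.
  apply: (ndX hh) => x1 Xx1 u xu; apply/(hyperplaneE _ hl).
  have Xu : pcone X u by exists x1.
  have := U0 (u, (v, t)) (conj Xu (conj Xv I)); rewrite UE /= -lE => e.
  rewrite -[RHS](addr0 0) -[X in _ = X + _]e -[X in _ = _ + X]lv -big_split /=.
  by apply: eq_bigr => i _; ring.
have [r2 [f2 [le2 ind2]]] := secant_bound charF cX iX sX dS xX yX zS yh u0 ip pE.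
have := algind_dim (dual_closed cX iX sX) (dual_irreducible iX ne) hD ind2 dD.
by lia.
Qed.

(* Differentiating h.y = 0 along a derivation over h gives dh.y = 0. *)
Lemma biduality X k (f : 'I_k -> S) (L : fieldType) (j : {rmorphism F -> L}) y h sg :
  gens X f -> on_cone j X y -> (forall q, mmap j h q = 0 <-> vanishing (dual_variety X) q) ->
  \row_i h i = sg *m jac j y f -> conormal j (dual_variety X) h y.
Proof.
move=> gf yX hD hE; have [k' [g gg]] := vanishing_gens (dual_variety X).
have hX : on_cone j (dual_variety X) h by move=> q /hD.
apply/(conormal_gens _ gg hX); rewrite submxE; apply/eqP/rowP => b; rewrite [RHS]mxE.
(* The vector w is tangent to the cone of the dual variety at h, so it is the value at h of a
   derivation of F[h], which extends to y and to the coefficients [sg]. *)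
set C := cokermx _; pose w i := C i b.
have gw q : vanishing (dual_variety X) q -> \sum_i mmap j h q^`M(i) * w i = 0.
  move=> Dq; have /submxP [s sE] := grad_gens gg hX Dq.
  transitivity ((grad j h q *m C) 0 b).
    by rewrite mxE; apply: eq_bigr => i _; rewrite mxE.
  by rewrite sE -mulmxA mulmx_coker mulmx0 mxE.
pose E m (u : 'I_m -> L) := [seq u i | i <- enum 'I_m].
have Em m (u : 'I_m -> L) i : u i \in E m u by apply: map_f; rewrite mem_enum.
have hw :
    forall Q, mmap j h Q = 0 -> \sum_i mmap j h Q^`M(i) * w i = 0.
  by move=> Q /hD; exact: gw.
have [e [de eh]] := der_extend charF (E _ y ++ E _ (sg 0)) hw.
have [sB IB sub] := adjoins_spec (E _ y ++ E _ (sg 0)) (subring_image j h).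
have By i : adjoins (image_of j h) (E _ y ++ E _ (sg 0)) (y i) by apply: sub; rewrite mem_cat Em.
have Bsg i : adjoins (image_of j h) (E _ y ++ E _ (sg 0)) (sg 0 i) by apply: sub; rewrite mem_cat Em orbT.
have Bh i : adjoins (image_of j h) (E _ y ++ E _ (sg 0)) (h i).
  by apply: IB; exists 'X_i; rewrite mmapX mmap1U.
have hi i : h i = \sum_a sg 0 a * mmap j y (f a)^`M(i).
  have /rowP/(_ i) := hE; rewrite mxE => ->; rewrite mxE.
  by apply: eq_bigr => a _; rewrite mxE.
have hy (z : 'I_n.+1 -> L) : (forall a, \sum_i mmap j y (f a)^`M(i) * z i = 0) ->
    \sum_i h i * z i = 0.
  move=> z0; under eq_bigr => i _ do rewrite hi mulr_suml.
  rewrite exchange_big big1 // => a _.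
  transitivity (sg 0 a * \sum_i mmap j y (f a)^`M(i) * z i); last by rewrite z0 mulr0.
  rewrite mulr_sumr.
  by apply: eq_bigr => i _; rewrite mulrA.
have [_ _ KM] := sB; have [_ _ eM] := de.1.
have ehy : \sum_i (h i * e (y i) + e (h i) * y i) = 0.
  transitivity (e (\sum_i h i * y i)); last first.
    by rewrite hy ?(der0 sB de.1) // => a; exact: euler (gf.1 a).
  by rewrite (der_sum _ sB de.1) => [|i]; [apply: eq_bigr => i _; rewrite eM|exact: KM].
move: ehy; rewrite big_split /= hy ?add0r => [ey|a]; last first.
  by rewrite -(der_mmap _ sB de By) yX ?(der0 sB de.1) //; exact: gf.1.
rewrite mxE -[RHS]ey; apply: eq_bigr => i _; rewrite mxE eh mulrC.
by [].
Qed.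

Lemma dual_nonempty X r : X !=set0 -> (0 < r)%N -> smooth_rank X r -> dual_variety X !=set0.
Proof.
case: r => // r [x Xx] _ sX; have [v xv] := hcoord_ex x.
have Xv : pcone X v by exists x.
have [g [Ig fg _]] := sX v Xv; have [k [f gf]] := vanishing_gens X.
pose l := row ord0 (jac idfun (v 0) g).
have l0 : l != 0.
  rewrite /l rowE mulmx_free_eq0 //; apply/eqP => /(congr1 (fun M : 'rV_r.+1 => M 0 0)).
  by rewrite !mxE eqxx => /eqP; rewrite oner_eq0.
have : pcone (dual_variety X) l.
  apply/(dual_cone _ gf); split=> //.
  have /submxP [s sE] := grad_gens gf (on_cone_point Xv) (Ig ord0).1.
  exists v, (s 0); split=> //; rewrite /cmb (_ : \row_a s 0 a = s) -?sE.
    by apply/rowP => i; rewrite !mxE.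
  by apply/rowP => i; rewrite mxE.
by move=> [h [Dh _]]; exists h.
Qed.
Lemma dim_ge_full Y : closed Y -> irreducible Y -> dim_ge Y n -> Y = setT.
Proof.
move=> cY iY dY; have [r [A [nr iA]]] := dim_coords cY iY dY.
have Ainj : injective A.
  move=> a b AE; apply/eqP; apply: contrapT => /negP ab.
  have : 'X_a - 'X_b = 0 :> {mpoly F[r]}.
    apply: iA => x v Yx xv; rewrite msub_coords mevalB !mevalXU AE.
    exact: subrr.
  move/(congr1 (mcoeff U_(a))); rewrite mcoeffB !mcoeffXU eqxx eq_sym (negbTE ab) subr0 mcoeff0.
  by move/eqP; rewrite oner_eq0.
have rn : #|'I_r| = #|'I_n.+1|.
  by apply/eqP; rewrite eqn_leq (leq_card A Ainj) !card_ord.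
have [B AB BA] := inj_card_bij Ainj (eq_leq (esym rn)).
apply/seteqP; split=> // z _; rewrite (closed_zeros Y).1 // => v zv p pY.
suff -> : p = 0 by rewrite meval0.
have Q0 : msub (fun i => 'X_(B i)) p = 0 :> {mpoly F[r]}.
  apply: iA => x u Yx xu; rewrite msub_meval msub_meval -[RHS](pY x u Yx xu).
  by apply: meval_eq => i; rewrite mevalXU mevalXU BA.
apply: mpoly_eq0_everywhere => u.
have := congr1 (meval (fun i => u (A i))) Q0; rewrite meval0 msub_meval => h0.
by rewrite -[RHS]h0; apply: meval_eq => i; rewrite mevalXU BA.
Qed.

Lemma dim_ge_sub X Y d : closed X -> irreducible X -> closed Y -> irreducible Y -> X `<=` Y ->
  dim_ge X d -> dim_ge Y d.
Proof.
move=> cX iX cY iY XY dX; have [r [A [dr iA]]] := dim_coords cX iX dX.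
case: r A dr iA => // r A dr iA; apply: (dim_ge_le (e := d) (d := r)) => //.
apply: (indep_dim_ge cY iY (A := A)) => Q YQ; apply: iA; exact: vanishing_anti YQ.
Qed.

(** If the dual variety were smooth, [key_derivation] would apply to it at the pair (h, y), conormal
    by [biduality], and give (d + 1) + (n + 1) <= (n + 1) + (m + 1), hence d <= m; but [dual_bound]
    gives m + n <= s + d, and s < n. *)
Lemma dual_singular X m s : closed X -> irreducible X -> nonsingular X -> non_degenerate X ->
  has_dim X m -> has_dim (secant_variety X) s -> secant_variety X <> setT ->
  dual_variety X !=set0 /\ ~ nonsingular (dual_variety X).
Proof.
move=> cX iX nX ndX dX dS SXT; have [le sX] := nonsingular_smooth nX dX.
have two := two_points_secant dS.
have cS : closed (secant_variety X) by exact: closed_closure.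
have iS := secant_irreducible charF iX two.
have sn : (s < n)%N.
  rewrite ltnNge; apply/negP => ns; apply: SXT; apply: dim_ge_full => //.
  exact: dim_ge_le ns dS.1.
have XS : X `<=` secant_variety X.
  have [a [b [Xa Xb ab]]] := two; move=> x Xx; apply: subset_closure.
  have [xa|xa] := pselect (x = a); last by exists x, a; split=> //; exact: addvSl.
  by exists x, b; split=> //; [rewrite xa|exact: addvSl].
have ms : (m <= s)%N by exact: dim_le_ge dS.2 (dim_ge_sub cX iX cS iS XS dX.1).
have ne : dual_variety X !=set0.
  by apply: (dual_nonempty (r := n - m)) => //; [case: iX|lia].
split=> // nD; have [h0 Dh0] := ne; have [d [dD _]] := nD h0 Dh0.
have bnd := dual_bound cX iX nX ndX dX dS ne dD.2.
set D := dual_variety X in ne nD Dh0 dD.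
have cD : closed D by exact: dual_closed sX.
have iD : irreducible D by exact: dual_irreducible.
have [_ sD] := nonsingular_smooth nD dD.
have [k [f gf]] := vanishing_gens X.
have [L [val [v0 vE]]] := prime_generic (prime_triple k iX iD).
have [rX [AX [rXm iAX]]] := dim_coords cX iX dX.1.
have [rD [AD [rDm iAD]]] := dim_coords cD iD dD.1.
pose j : {rmorphism F -> L} := val \o @cstr F _.
pose x i := val (fun t => t.1 0 i).
pose y i := val (fun t => t.2.1 0 i).
pose h i := val (fun t => cmb f t.2.1 t.2.2 0 i).
have [p [ip pE]] := triple_indep iX iD gf vE iAX iAD sX.
have xD : on_cone j D x by move=> q /(triple_x iX v0 vE).
have yX : on_cone j X y by move=> q /(triple_y iD v0 vE).
have hE q : mmap j h q = 0 <-> vanishing D q by exact: (triple_h iD gf v0 vE _ ne).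
have hD : on_cone j D h by move=> q /hE.
have hy : conormal j D h y := biduality gf yX hE (triple_conormal f val).
have yh0 : \sum_i y i * h i = 0.
  have [q [g [sg [Ig hg]]]] : conormal j X y h.
    by apply/(conormal_gens _ gf yX); rewrite [\row_i _](triple_conormal f val) submxMl.
  under eq_bigr => i _ do rewrite hg mulr_sumr.
  rewrite exchange_big big1 // => a _.
  transitivity (sg a * \sum_i mmap j y (g a)^`M(i) * y i); last by rewrite (euler yX (Ig a)) mulr0.
  rewrite mulr_sumr.
  by apply: eq_bigr => i _; ring.
have u0 : \sum_i y i * (x i - h i) != 0.
  under eq_bigr => i _ do rewrite mulrBr.
  rewrite sumrB yh0 subr0; apply/eqP => U0.
  pose U (t : V * (V * ('I_k -> F))) := \sum_i t.2.1 0 i * t.1 0 i.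
  have UE : val U = 0.
    rewrite -U0 (_ : U = \sum_i (fun t : V * (V * ('I_k -> F)) => t.2.1 0 i) *
      (fun t : V * (V * ('I_k -> F)) => t.1 0 i)).
      by rewrite rmorph_sum; apply: eq_bigr => i _; rewrite rmorphM.
    by apply/funext => t; rewrite fct_sumE.
  have PU : triple_fun U.
    split=> t /=; last first.
      exists (\sum_i t.1 0 i *: 'X_i) => v; rewrite raddf_sum; apply: eq_bigr => i _.
      by rewrite /= mevalZ mevalXU.
    split=> u /=; first by exists (U (t, (u, fun=> 0)))%:MP => s'; rewrite mevalC.
    exists (\sum_i t 0 i *: 'X_i) => v; rewrite raddf_sum; apply: eq_bigr => i _.
    by rewrite /= mevalZ mevalXU mulrC.
  have [l hl] := hcoord_ex h0.
  apply: (ndX h0) => x1 Xx1 u xu; apply/(hyperplaneE _ hl).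
  have Xu : pcone X u by exists x1.
  have Dl : pcone D l by exists h0.
  have := vE _ PU UE (l, (u, fun=> 0)) (conj Dl (conj Xu I)); rewrite /U /= => e.
  by rewrite -[RHS]e; apply: eq_bigr => i _; rewrite mulrC.
pose z i := x i - h i.
pose E g := [seq g i : L | i <- enum 'I_n.+1].
have Em g i : g i \in E g by apply: map_f; rewrite mem_enum.
have [||B e sB Bs Bp de ez ey i|r1 [r2 [f1 [f2 [ler le1 ind1 ind2]]]]] :=
  algind_count charF (z := z) (h := y) (s := E z ++ E h ++ E x ++ E y) ip.
- by move=> i; rewrite mem_cat Em.
- by move=> i; rewrite !mem_cat Em !orbT.
- have Bx i' : B (x i') by apply: Bs; rewrite !mem_cat Em !orbT.
  have By i' : B (y i') by apply: Bs; rewrite !mem_cat Em !orbT.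
  have Bh i' : B (h i') by apply: Bs; rewrite !mem_cat Em !orbT.
  have eh := key_derivation charF cD sD xD hD hy u0 sB de Bx Bh By ez ey.
  have ex i' : e (x i') = 0.
    rewrite -[x i'](subrK (h i')) (derD sB de.1) ?eh ?ez ?addr0 //.
    by have [_ KB _] := sB; apply: KB.
  by have [i' [] ->] := pE i; [exact: ex|exact: ey|exact: eh].
have := algind_dim cX iX yX ind2 dX.2.
by lia.
Qed.
End Bounds.

(** * Contact loci of a fixed hyperplane *)

Section Contact.
Variables (F : closedFieldType) (n : nat).
Local Notation S := {mpoly F[n.+1]}.
Local Notation V := 'rV[F]_n.+1.
Local Notation P := (proj F n).
Implicit Types (X Y Z : set P).
Hypothesis charF : forall k, k.+1%:R != 0 :> F.

Lemma mmap_linear_form (L : comNzRingType) (j : {rmorphism F -> L}) y (l : V) :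
  mmap j y (linear_form l) = \sum_i j (l 0 i) * y i.
Proof.
rewrite /linear_form rmorph_sum; apply: eq_bigr => i _.
by rewrite -mul_mpolyC rmorphM /= mmapC mmapX mmap1U.
Qed.

Lemma linear_form_homog (l : V) : linear_form l \is 1%N.-homog.
Proof. by apply: rpred_sum => i _; apply: rpredZ; rewrite dhomogX; apply/eqP; exact: mdeg1. Qed.

Section Scale.
Variables (L : fieldType) (j : {rmorphism F -> L}).

Lemma on_coneZ X y a : on_cone j X y -> on_cone j X (fun i => a * y i).
Proof.
move=> yX p Xp; rewrite homog_mmap big1 // => d _; rewrite yX ?mulr0 //.
exact: vanishing_homog.
Qed.

Lemma conormalZ X y h a : a != 0 -> on_cone j X y -> conormal j X y h ->
  conormal j X (fun i => a * y i) h.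
Proof.
move=> a0 yX [k' [g [s [Ig hE]]]]; have [k [f gf]] := vanishing_gens X.
have ayX := on_coneZ a yX; apply/(conormal_gens _ gf ayX).
have -> : \row_i h i = \sum_a s a *: grad j y (g a).
  by apply/rowP => i; rewrite summxE mxE hE; apply: eq_bigr => b _; rewrite !mxE.
apply: summx_sub => b _; apply: scalemx_sub.
rewrite (pihomog_partitionE (mf := mdeg) (leqnn (msize (g b)))) grad_sum.
apply: summx_sub => d _; set q := pihomog _ _ _.
have -> : grad j y q = a ^- d.-1 *: grad j (fun i => a * y i) q.
  apply/rowP => i; rewrite !mxE (homog_mmapd _ _ _ (mderiv_homog i (pihomogP mdeg d (g b)))).
  by rewrite mulrA mulVf ?mul1r // expf_neq0.
by apply: scalemx_sub; apply: (grad_gens gf ayX); exact: vanishing_homog.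
Qed.
End Scale.

Lemma mcoef_conormal X r (g : 'I_r -> S) c (L : fieldType) (j : {rmorphism F -> L}) y h :
  smooth_rank X r -> on_cone j X y -> (forall a, vanishing X (g a)) ->
  mmap j y (minor g c) != 0 ->
  conormal j X y h <-> forall i, \sum_i' h i' * mmap j y (mcoef g c i i') = 0.
Proof.
move=> sX yX Ig my; split=> [yh i|h0].
  have [s sE] := conormal_cramer sX yX Ig my yh.
  by rewrite mcoef_sum sE cramer_span -sE [X in _ - X]mxE [X in _ - _ * X]mxE subrr.
exists r, g, (fun a => (\det (colsub c (jac j y g)))^-1 *
    (colsub c (\row_i h i) *m \adj (colsub c (jac j y g))) 0 a).
split=> // i; rewrite mmap_minor in my; apply: (mulfI my).
have /eqP := h0 i; rewrite mcoef_sum subr_eq0 => /eqP ->.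
rewrite mxE mulr_sumr; apply: eq_bigr => a _.
by rewrite !mulrA mulfV // mul1r [jac _ _ _ _ _]mxE.
Qed.

Definition zero_locus k (I : {mpoly F[k]} -> Prop) : set ('I_k -> F) :=
  [set q | forall p, I p -> p.@[q] = 0].

Lemma zero_locus_vanish k (I : {mpoly F[k]} -> Prop) f : prime_ideal I ->
  (forall q, zero_locus I q -> f.@[q] = 0) -> I f.
Proof.
move=> [idI I1 pr] h; have [N] := nullstellensatz h.
move/(gen_min idI (fun a Ia => Ia)); elim: N => [|N IH]; first by rewrite expr0 => /I1.
by rewrite exprS => /pr [].
Qed.

Lemma prime_locus k (I : {mpoly F[k]} -> Prop) : prime_ideal I ->
  prime_set (zero_locus I) (@poly_fun F k).
Proof.
move=> pI; have [idI I1 pr] := pI; have [P1 PM _ _] := prime_affine F k; split=> //.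
  apply: contrapT => h; apply: I1; apply: (zero_locus_vanish pI) => q Iq.
  by case: h; exists q.
move=> f g [p pE] [q qE] fg; have [|Ip|Iq] := pr p q.
- by apply: zero_locus_vanish => // t It; rewrite mevalM -pE -qE fg.
- by left=> t It; rewrite pE It.
- by right=> t It; rewrite qE It.
Qed.

(** Here h = l is constant and absorbs no transcendence degree: x brings m + 1 independent elements
    and the contact locus b more, and x - y has to account for all of them, so (m + 1) + b <= s + 1.
    The locus is parametrised by G / u0 on the zeros of I, and the independent coordinates [beta]
    are the values of linear forms [tB] at its points. *)
Lemma contact_count X m s (l : V) k (I : {mpoly F[k]} -> Prop) u0 (G : 'I_n.+1 -> {mpoly F[k]})
  b (beta : 'I_b -> 'I_k) (tB : 'I_b -> V) :
  closed X -> irreducible X -> nonsingular X -> has_dim X m ->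
  has_dim (secant_variety X) s -> ~ vanishing X (linear_form l) ->
  prime_ideal I -> ~ I u0 ->
  (forall q, zero_locus I q -> u0.@[q] != 0 -> pcone X (\row_i (G i).@[q]) /\
     conormal idfun X (fun i => (G i).@[q]) (l 0)) ->
  (forall q a, zero_locus I q -> \sum_i tB a 0 i * (G i).@[q] = u0.@[q] * q (beta a)) ->
  (forall Q : {mpoly F[b]}, I (msub (fun a => 'X_(beta a)) Q) -> Q = 0) ->
  (m + b <= s)%N.
Proof.
move=> cX iX nX dX dS lX pI nu cont tE indB; have [le sX] := nonsingular_smooth nX dX.
have [rX [A [rXm iA]]] := dim_coords charF cX iX dX.1.
have pc := prime_pair (prime_cone iX) (prime_locus pI).
have [L [val [v0 vE]]] := prime_generic pc.
set T := (V * ('I_k -> F))%type in val v0 vE.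
have algp : alg_fun (pair_fun (@cone_fun F n) (@poly_fun F k)).
  by apply: alg_pair; [exact: alg_cone|exact: alg_poly].
pose j : {rmorphism F -> L} := val \o @cstr F T.
pose x i := val (fun t : T => t.1 0 i).
pose g i := val (fun t : T => (G i).@[t.2]); pose u := val (fun t : T => u0.@[t.2]).
pose y i := u^-1 * g i; pose tau a := val (fun t : T => t.2 (beta a)).
have [q0 Iq0 uq0] : exists2 q, zero_locus I q & u0.@[q] != 0.
  apply: contrapT => h; apply: nu; apply: zero_locus_vanish => // q Iq; apply/eqP.
  by apply: contrapT => /negP uq; apply: h; exists q.
have [[x0 Xx0] _] := iX; have [w0 xw0] := hcoord_ex x0.
have Xw0 : pcone X w0 by exists x0.
have fst_fun p : pair_fun (@cone_fun F n) (@poly_fun F k) (fun t : T => p.@[t.1 0]).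
  by split=> t /=; [exists (p.@[t 0])%:MP => q; rewrite mevalC|exists p].
have snd_fun p : pair_fun (@cone_fun F n) (@poly_fun F k) (fun t : T => p.@[t.2]).
  by split=> t /=; [exists p|exists (p.@[t])%:MP => q; rewrite mevalC].
have xE p : mmap j x p = 0 <-> vanishing X p.
  rewrite [mmap _ _ _](val_mmap val (fun i (t : T) => t.1 0 i) p); split=> [h0|/vanishingE h0].
    apply/vanishingE => v Xv; exact: (vE _ (fst_fun p) h0 (v, q0)).
  by apply: v0 => -[v q] [/= Xv _]; exact: h0.
have xX : on_cone j X x by move=> p /xE.
have gE p : mmap j g p = val (fun t : T => p.@[fun i => (G i).@[t.2]]).
  by rewrite [LHS](val_mmap val (fun i (t : T) => (G i).@[t.2]) p).
have un0 : u != 0.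
  by apply/eqP => /(vE _ (snd_fun u0)) /(_ (w0, q0) (conj Xw0 Iq0)) /= /eqP; rewrite (negbTE uq0).
have u_cancel (f : T -> F) :
    (forall v q, pcone X v -> zero_locus I q -> u0.@[q] != 0 -> f (v, q) = 0) -> val f = 0.
  move=> f0; apply: (mulfI un0); rewrite mulr0 -rmorphM; apply: v0 => -[v q] [/= Xv Iq].
  rewrite -[LHS]/(u0.@[q] * f (v, q)); have [->|uq] := eqVneq u0.@[q] 0; first by rewrite mul0r.
  by rewrite f0 ?mulr0.
have gX : on_cone j X g.
  move=> p /vanishingE Xp; rewrite gE; apply: u_cancel => v q _ Iq uq /=.
  by rewrite -[RHS](Xp _ (cont q Iq uq).1); apply: meval_eq => i; rewrite mxE.
have yX : on_cone j X y by exact: on_coneZ.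
have gl : conormal j X g (fun i => j (l 0 i)).
  have [Xy0 _] := cont q0 Iq0 uq0; have [f [If ff _]] := sX _ Xy0.
  have [c c0] := minor_neq0 ff; rewrite -mmap_minor in c0.
  pose mu (q : 'I_k -> F) := (minor f c).@[fun i => (G i).@[q]].
  have mu0 : mmap j g (minor f c) != 0.
    rewrite gE; apply/eqP => h0; move/eqP: c0; apply.
    rewrite -[LHS]/((minor f c).@[_]); have pf := algp _ _ (fun i => snd_fun (G i)) (minor f c).
    rewrite -[RHS](vE _ pf h0 (w0, q0) (conj Xw0 Iq0)).
    by apply: meval_eq => i; rewrite mxE.
  apply/(mcoef_conormal _ sX gX (fun a => (If a).1) mu0) => i; apply: (mulfI mu0).
  pose K := \sum_i' l 0 i' *: mcoef f c i i'.
  have -> : \sum_i' j (l 0 i') * mmap j g (mcoef f c i i') = mmap j g K.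
    by rewrite rmorph_sum; apply: eq_bigr => i' _; rewrite -mul_mpolyC rmorphM /= mmapC.
  transitivity (mmap j g (minor f c * K)); first by rewrite rmorphM.
  rewrite mulr0 gE; apply: u_cancel => v q _ Iq uq /=.
  rewrite mevalM; have [->|mq] := eqVneq (minor f c).@[fun i => (G i).@[q]] 0; first by rewrite mul0r.
  have [Xy yl] := cont q Iq uq.
  have yc : on_cone idfun X (fun i => (G i).@[q]).
    move=> p /vanishingE Xp; rewrite -[LHS]/(p.@[_]) -[RHS](Xp _ Xy).
    by apply: meval_eq => i'; rewrite mxE.
  have := iffLR (mcoef_conormal _ sX yc (fun a => (If a).1) mq) yl i.
  move=> h0; rewrite [X in _ * X](_ : _ = 0) ?mulr0 // -[RHS]h0 /K raddf_sum.
  by apply: eq_bigr => i' _; rewrite /= mevalZ.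
have yl : conormal j X y (fun i => j (l 0 i)) by apply: conormalZ => //; rewrite invr_eq0.
have ll0 : \sum_i j (l 0 i) * (x i - y i) != 0.
  under eq_bigr => i _ do rewrite mulrBr.
  rewrite sumrB [X in _ - X](_ : _ = 0) ?subr0; last first.
    have [k' [f [sg [If hg]]]] := yl.
    under eq_bigr => i _ do rewrite hg mulr_suml.
    rewrite exchange_big big1 // => a _.
    transitivity (sg a * \sum_i mmap j y (f a)^`M(i) * y i); last by rewrite (euler yX (If a)) mulr0.
    by rewrite [RHS]mulr_sumr; apply: eq_bigr => i _; rewrite -mulrA.
  by rewrite -mmap_linear_form; apply/eqP => /xE.
have tauE a : tau a = mmap j y (linear_form (tB a)).
  rewrite mmap_linear_form; apply: (mulfI un0); rewrite mulr_sumr.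
  rewrite (eq_bigr (fun i => j (tB a 0 i) * g i)) => [|i _]; last by rewrite /y mulrCA mulVKf.
  have -> : \sum_i j (tB a 0 i) * g i = val (fun t : T => \sum_i tB a 0 i * (G i).@[t.2]).
    rewrite (_ : (fun t : T => _) = \sum_i @cstr F T (tB a 0 i) * (fun t : T => (G i).@[t.2])).
      by rewrite rmorph_sum; apply: eq_bigr => i _; rewrite rmorphM.
    by apply/funext => t; rewrite fct_sumE.
  apply/eqP; rewrite -subr_eq0 -rmorphM -rmorphB; apply/eqP; apply: v0 => -[v q] [/= _ Iq].
  by rewrite -[LHS]/(u0.@[q] * q (beta a) - \sum_i tB a 0 i * (G i).@[q]) tE // subrr.
pose qf (i : 'I_(rX + b)) : T -> F := fun t => match fintype.split i with
  inl a => t.1 0 (A a) | inr a => t.2 (beta a) end.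
have ip : algind j (fun i => val (qf i)).
  move=> Q; rewrite [mmap _ _ _](val_mmap val qf Q) => Q0.
  have pq : pair_fun (@cone_fun F n) (@poly_fun F k) (fun t : T => Q.@[fun i => qf i t]).
    apply: (algp _ qf) => i; rewrite /qf; case: (fintype.split i) => a.
      by rewrite (_ : (fun t : T => _) = fun t => ('X_(A a)).@[t.1 0]) //; apply/funext => t; rewrite mevalXU.
    by rewrite (_ : (fun t : T => _) = fun t => ('X_(beta a)).@[t.2]) //; apply/funext => t; rewrite mevalXU.
  apply: (indep_pair (E2 := zero_locus I) (m := fun=> 1) (a := fun a (t : V) => t 0 (A a))
    (b := fun a (_ : V) (q : 'I_k -> F) => q (beta a)) (prime_cone iX)).
  - by exists 1 => v; rewrite meval1.
  - by move=> Q'; exists (msub (coords F A) Q') => v; rewrite msub_coords.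
  - by exists w0; split=> //; exact: oner_neq0.
  - by move=> Q' hQ'; apply: iA; apply/vanishingE => v Xv; rewrite msub_coords hQ'.
  - move=> v Xv _ Q' hQ'; apply: indB; apply: zero_locus_vanish => // q Iq.
    by rewrite msub_meval -[RHS](hQ' q Iq); apply: meval_eq => a; rewrite mevalXU.
  - by move=> v q Xv Iq; exact: (vE _ pq Q0 (v, q) (conj Xv Iq)).
pose z i := x i - y i.
pose E g := [seq g i : L | i <- enum 'I_n.+1].
have Em g' i : g' i \in E g' by apply: map_f; rewrite mem_enum.
have [||B e sB Bs Bp de ez _ i|r1 [r2 [f1 [f2 [ler le1 ind1 ind2]]]]] :=
  algind_count charF (z := z) (h := fun i : 'I_0 => 0) (s := E z ++ E x ++ E y) ip.
- by move=> i; rewrite mem_cat Em.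
- by case.
- have Bx i' : B (x i') by apply: Bs; rewrite !mem_cat Em !orbT.
  have By i' : B (y i') by apply: Bs; rewrite !mem_cat Em !orbT.
  have ey := key_derivation charF cX sX xX yX yl ll0 sB de Bx By (fun i' => (de.2 _).1) ez (fun i' => (de.2 _).2).
  have ex i' : e (x i') = 0.
    rewrite -[x i'](subrK (y i')) (derD sB de.1) ?ey ?ez ?addr0 //.
    by have [_ KB _] := sB; apply: KB.
  rewrite /qf; case: (fintype.split i) => a; first exact: ex.
  rewrite -[val _]/(tau a) tauE (der_mmap _ sB de By) big1 // => i' _.
  by rewrite ey mulr0.
case: r2 f2 ind2 ler => [|r2] f2; last by case: (f2 ord0).
have iS := secant_irreducible charF iX (two_points_secant dS).
have zS : on_cone j (secant_variety X) z.
  have wS : on_cone j (secant_variety X) (fun i => u * x i - g i).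
    move=> p /(secant_vanishing charF _ iX (two_points_secant dS)) pS.
    rewrite (@mmap_ext _ _ _ _ _ (fun i => val (fun t : T => u0.@[t.2] * t.1 0 i - (G i).@[t.2]))); last first.
      by move=> i; rewrite -rmorphM -rmorphB.
    rewrite [LHS](val_mmap val (fun i (t : T) => u0.@[t.2] * t.1 0 i - (G i).@[t.2]) p).
    apply: u_cancel => v q Xv Iq uq /=; have [Xy _] := cont q Iq uq.
    rewrite -[RHS](pS _ _ (pconeZ Xv uq) Xy); apply: meval_eq => i; by rewrite !mxE.
  have := on_coneZ u^-1 wS; congr (on_cone j _ _); apply/funext => i.
  by rewrite mulrBr mulKf.
have := algind_dim (@closed_closure _ _) iS zS ind1 dS.2.
by lia.
Qed.
End Contact.

(** * Projection to a hypersurface *)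

Section Forms.
Variables (F : closedFieldType) (n : nat).
Local Notation S := {mpoly F[n.+1]}.
Local Notation V := 'rV[F]_n.+1.
Local Notation P := (proj F n).
Implicit Types (X Y Z C : set P).
Hypothesis charF : forall k, k.+1%:R != 0 :> F.

Definition dotp (l v : V) : F := \sum_i l 0 i * v 0 i.

Lemma meval_linear_form (l v : V) : (linear_form l).@[v 0] = dotp l v.
Proof. exact: (mmap_linear_form idfun (v 0) l). Qed.

Lemma dotpZ l a v : dotp l (a *: v) = a * dotp l v.
Proof. by rewrite /dotp mulr_sumr; apply: eq_bigr => i _; rewrite mxE mulrCA. Qed.
Lemma dotpD l u v : dotp l (u + v) = dotp l u + dotp l v.
Proof. by rewrite /dotp -big_split; apply: eq_bigr => i _; rewrite mxE mulrDr. Qed.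
Lemma dotpC l v : dotp l v = dotp v l.
Proof. by apply: eq_bigr => i _; rewrite mulrC. Qed.

Lemma linear_form_eq0 (l : V) : linear_form l = 0 -> l = 0.
Proof.
move=> l0; apply/rowP => i; rewrite mxE.
have := congr1 (meval (fun k => (k == i)%:R)) l0; rewrite meval0 => <-.
rewrite [RHS](mmap_linear_form idfun (fun k => (k == i)%:R) l) (bigD1 i) //= eqxx mulr1 big1 ?addr0 // => k ki.
by rewrite (negbTE ki) mulr0.
Qed.

Lemma avoid_zeros (s : seq V) : (forall w, w \in s -> w != 0) ->
  exists t : V, forall w, w \in s -> dotp t w != 0.
Proof.
move=> s0; pose G : S := \prod_(w <- s) linear_form w.
have G0 : G != 0.
  rewrite prodf_seq_neq0; apply/allP => w ws /=; apply/eqP => /linear_form_eq0 w0.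
  by move: (s0 w ws); rewrite w0 eqxx.
have [a Ga] := mpoly_nonzero_point G0; pose t : V := \row_i a i; exists t => w ws.
rewrite dotpC -meval_linear_form; apply: contraNneq Ga => w0.
rewrite /G (perm_big _ (perm_to_rem ws)) big_cons mevalM -[a](_ : t 0 = _) ?w0 ?mul0r //.
by apply/funext => i; rewrite mxE.
Qed.

Lemma component_points Z : closed Z -> exists s : seq V, (forall w, w \in s -> w != 0) /\
  forall C, closed C -> irreducible C -> C `<=` Z -> exists C', [/\ closed C', irreducible C',
    C `<=` C', C' `<=` Z & exists2 v, v \in s & pcone C' v].
Proof.
move=> cZ; apply: contrapT => bad.
pose Fam Z := closed Z /\ ~ exists s : seq V, (forall w, w \in s -> w != 0) /\
  forall C, closed C -> irreducible C -> C `<=` Z -> exists C', [/\ closed C', irreducible C',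
    C `<=` C', C' `<=` Z & exists2 v, v \in s & pcone C' v].
have [||A [[cA bA] min]] := @closed_minimal F n Fam; [by move=> A []|by exists Z|].
apply: bA; have [iA|nA] := pselect (irreducible A).
  have [[x Ax] _] := iA; have [v xv] := hcoord_ex x.
  exists [:: v]; split=> [w|C cC iC CA]; first by rewrite inE => /eqP ->; case: xv.
  by exists A; split=> //; exists v; [rewrite inE|exists x].
have [ne|/set0P/negP] := pselect (A !=set0); last first.
  rewrite negbK => /eqP A0; exists [::]; split=> // C _ [[x Cx] _] /(_ x Cx).
  by rewrite A0.
have [B [D [cB cD ABD nB nD]]] : exists B D, [/\ closed B, closed D, A `<=` B `|` D, ~ A `<=` B & ~ A `<=` D].
  apply: contrapT => h; apply: nA; split=> // B D cB cD ABD; apply: contrapT => /not_orP [nB nD].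
  by apply: h; exists B, D.
have sub E : closed E -> ~ A `<=` E -> exists s : seq V, (forall w, w \in s -> w != 0) /\
    forall C, closed C -> irreducible C -> C `<=` A `&` E -> exists C', [/\ closed C', irreducible C',
    C `<=` C', C' `<=` A & exists2 v, v \in s & pcone C' v].
  move=> cE nE; have cAE : closed (A `&` E) by exact: closedI.
  have [[s [s0 hs]]|h] := pselect (exists s : seq V, (forall w, w \in s -> w != 0) /\
    forall C, closed C -> irreducible C -> C `<=` A `&` E -> exists C', [/\ closed C', irreducible C',
    C `<=` C', C' `<=` A `&` E & exists2 v, v \in s & pcone C' v]).
    exists s; split=> // C cC iC CA; have [C' [? ? ? C'A ?]] := hs C cC iC CA.
    by exists C'; split=> //; exact: subset_trans C'A (@subIsetl _ _ _).
  case: nE; rewrite -(min (A `&` E)); [exact: subIsetr|by split|exact: subIsetl].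
have [s1 [s10 h1]] := sub B cB nB; have [s2 [s20 h2]] := sub D cD nD.
exists (s1 ++ s2); split=> [w|C cC iC CA].
  by rewrite mem_cat => /orP[/s10|/s20].
have [_ /(_ B D cB cD (subset_trans CA ABD))] := iC; case=> [CB|CD].
  have [|C' [? ? ? ? [v vs Cv]]] := h1 C cC iC; first by move=> x Cx; split; [exact: CA|exact: CB].
  by exists C'; split=> //; exists v; rewrite // mem_cat vs.
have [|C' [? ? ? ? [v vs Cv]]] := h2 C cC iC; first by move=> x Cx; split; [exact: CA|exact: CD].
by exists C'; split=> //; exists v; rewrite // mem_cat vs orbT.
Qed.

Lemma dim_ge_proper C Y f e : closed C -> irreducible C -> closed Y -> irreducible Y -> C `<=` Y ->
  vanishing C f -> ~ vanishing Y f -> dim_ge C e -> dim_ge Y e.+1.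
Proof.
move=> cC iC cY iY CY Cf Yf dC; have [r [A [er iA]]] := dim_coords charF cC iC dC.
have iq := indep_snoc iY CY iA Cf Yf; have [r' [A' [rr' iA']]] := indep_coords charF iY iq.
case: r' A' rr' iA' => // r' A' rr' iA'; apply: (dim_ge_le (d := r')); first by lia.
exact: indep_dim_ge cY iY iA'.
Qed.

(** A bound that makes sense for reducible and for empty Z; for closed Z and e = 0 it means that Z
    is empty. *)
Definition dim_lt Z e := forall C, closed C -> irreducible C -> C `<=` Z -> ~ dim_ge C e.

Definition cut Z (l : V) : set P := [set x | Z x /\ forall v, hcoord x v -> dotp l v = 0].

Lemma pcone_cut Z l v : pcone (cut Z l) v <-> pcone Z v /\ dotp l v = 0.
Proof.
split=> [[x [[Zx lx] xv]]|[[x [Zx xv]] lv]]; first by split; [exists x|exact: lx].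
exists x; split=> //; split=> // w xw; have [a [_ ->]] := hcoord_scale xv xw.
by rewrite dotpZ lv mulr0.
Qed.

Lemma closed_cut Z l : closed Z -> closed (cut Z l).
Proof.
move=> cZ; have -> : cut Z l = Z `&` zeros (fun p => p = linear_form l).
  apply/seteqP; split=> x [Zx h]; split=> // v xv; first by move=> p ->; rewrite meval_linear_form h.
  by rewrite -meval_linear_form; exact: h.
by apply: closedI => //; exact: zeros_closed.
Qed.

Lemma dim_lt_cut Z e : closed Z -> dim_lt Z e.+1 -> exists s : seq V,
  (forall w, w \in s -> w != 0) /\
  forall t, (forall w, w \in s -> dotp t w != 0) -> dim_lt (cut Z t) e.
Proof.
move=> cZ dZ; have [s [s0 hs]] := component_points cZ; exists s; split=> // t st C cC iC CZ dC.
have CZ' : C `<=` Z by move=> x /CZ [].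
have [C' [cC' iC' CC' C'Z [v vs C'v]]] := hs C cC iC CZ'.
apply: (dZ C' cC' iC' C'Z); apply: (dim_ge_proper (f := linear_form t) cC iC cC' iC' CC') => //.
  by move=> x w Cx xw; rewrite meval_linear_form; have [_] := CZ x Cx; exact.
have [x [C'x xv]] := C'v => /(_ x v C'x xv); rewrite meval_linear_form => /eqP.
by rewrite (negbTE (st v vs)).
Qed.

Lemma dim_lt0 Z : closed Z -> dim_lt Z 0 -> Z = set0.
Proof.
move=> cZ dZ; apply/seteqP; split=> // x Zx; have ix : irreducible [set x].
  split=> [|B C _ _ BC]; first by exists x.
  by have [] := BC x erefl => h; [left|right] => y ->.
have iC := irreducible_closure ix.
apply: (dZ (closure [set x])) => //; first exact: closed_closure.
  by rewrite [X in _ `<=` X](closure_id Z).1 //; apply: closureS => y ->.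
exists (fun=> closure [set x]); split=> // i _; split=> //.
by rewrite -(closure_id _).1 ?setIid //; exact: closed_closure.
Qed.

Fixpoint cuts X (ts : seq V) : set P := if ts is t :: ts' then cut (cuts X ts') t else X.

(** General forms cut Z and K down together: each avoids finitely many points of Z and one vector of
    what is left of K. For k = m this leaves Z empty and K at most a line; K will be a tangent
    space. *)
Lemma choose_forms Z (K : {vspace V}) m k : closed Z -> dim_lt Z m -> (\dim K <= m.+1)%N -> (k <= m)%N ->
  exists ts : seq V, [/\ size ts = k, dim_lt (cuts Z ts) (m - k), closed (cuts Z ts) &
   exists K' : {vspace V}, (\dim K' <= (m - k).+1)%N /\
     forall w, w \in K -> (forall t, t \in ts -> dotp t w = 0) -> w \in K'].
Proof.
move=> cZ dZ dK; elim: k => [|k IH] km.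
  by exists [::]; split; rewrite ?subn0 //; exists K; rewrite ?subn0.
have [ts [sts dts cts [K' [dK' hK']]]] := IH (ltnW km).
have [|s [s0 hs]] := dim_lt_cut (e := (m - k.+1)%N) cts; first by rewrite -subSn.
pose w := vpick K'; pose s' := if w == 0 then s else w :: s.
have [w'|t ht] := avoid_zeros (s := s').
  by rewrite /s'; case: eqP => [_|/eqP w0]; [exact: s0|rewrite inE => /orP[/eqP ->|/s0]].
exists (t :: ts); split=> /=; first by rewrite sts.
- apply: hs => w' ws; apply: ht; rewrite /s'; case: eqP => // _; by rewrite inE ws orbT.
- exact: closed_cut.
pose H := lker (linfun (mulmxr t^T) : 'Hom(V, 'rV_1)).
have HE u : (u \in H) = (dotp t u == 0).
  rewrite memv_ker lfunE /= dotpC; apply/eqP/eqP => [/matrixP/(_ 0 0)|h].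
    by rewrite !mxE => h; rewrite -[RHS]h; apply: eq_bigr => i _; rewrite mxE.
  apply/rowP => i; rewrite ord1 !mxE -[RHS]h; apply: eq_bigr => i' _; by rewrite mxE.
exists (K' :&: H)%VS; split=> [|u uK tu]; last first.
  rewrite memv_cap HE tu ?mem_head // eqxx andbT; apply: hK' => // t' t't.
  by apply: tu; rewrite inE t't orbT.
have [K0|K0] := eqVneq K' 0%VS.
  by rewrite K0 cap0v dimv0.
have w0 : w != 0 by rewrite vpick0.
rewrite -ltnS; apply: (@leq_trans (\dim K')); last by rewrite -subSn.
rewrite ltn_neqAle dimvS ?capvSl // andbT; apply/negP => /eqP e.
have : w \in (K' :&: H)%VS.
  by have /eqP -> : (K' :&: H == K')%VS; [rewrite eqEdim capvSl e leqnn|exact: memv_pick].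
by rewrite memv_cap HE (negbTE (ht w _)) ?andbF // /s' (negbTE w0) mem_head.
Qed.
End Forms.

Section Finite.
Variables (F : closedFieldType) (n : nat).
Local Notation S := {mpoly F[n.+1]}.
Local Notation V := 'rV[F]_n.+1.
Local Notation P := (proj F n).
Implicit Types (X Y Z C : set P).
Hypothesis charF : forall k, k.+1%:R != 0 :> F.

Lemma pihomog_mul (f q : S) e d : f \is e.-homog ->
  pihomog mdeg (e + d) (f * q) = f * pihomog mdeg d q.
Proof.
move=> hf; have le : (msize q <= maxn (msize q) d.+1)%N by exact: leq_maxl.
rewrite {1}(pihomog_partitionE (mf := mdeg) le) mulr_sumr.
rewrite [LHS](linear_sum (pihomog mdeg (e + d))) /=.
have hk k : f * pihomog mdeg k q \is (e + k).-homog by apply: dhomogM => //; exact: pihomogP.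
have ltd : (d < maxn (msize q) d.+1)%N by exact: leq_maxr.
rewrite (bigD1 (Ordinal ltd)) //= pihomog_dE // big1 ?addr0 // => k kd.
by apply: (pihomog_ne0 _ (hk k)); rewrite eqn_add2l.
Qed.

Lemma pihomog_mul0 (f q : S) e d : f \is e.-homog -> (d < e)%N -> pihomog mdeg d (f * q) = 0.
Proof.
move=> hf de; rewrite {1}(pihomog_partitionE (mf := mdeg) (leqnn (msize q))) mulr_sumr.
rewrite [LHS](linear_sum (pihomog mdeg d)) /= big1 // => k _.
apply: (@pihomog_ne0 _ _ _ (e + k)%N); first by rewrite gtn_eqF // ltn_addr.
by apply: dhomogM => //; exact: pihomogP.
Qed.

Lemma mnm_large (e : 'I_n.+1 -> nat) (m : 'X_{1..n.+1}) : (\sum_i e i <= mdeg m)%N ->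
  exists i, (e i <= m i)%N.
Proof.
move=> le; apply: contrapT => /forallNP lt; have : (mdeg m < \sum_i e i)%N; last by rewrite ltnNge le.
rewrite mdegE; apply: (@leq_trans (\sum_i (m i).+1)%N).
  rewrite big_ord_recl [leqRHS]big_ord_recl addSn ltnS leq_add2l.
  by apply: leq_sum => i _.
by apply: leq_sum => i _; have /negP := lt i; rewrite -ltnNge.
Qed.

Lemma mpolyX_dvd (m : 'X_{1..n.+1}) i e : (e <= m i)%N ->
  'X_[F, m] = 'X_[(m - U_(i) *+ e)] * 'X_i ^+ e.
Proof.
move=> le; rewrite mpolyXn -mpolyXD submK //; apply/mnm_lepP => i'.
by rewrite mulmnE mnm1E; case: eqP => [<-|_]; rewrite ?mul1n ?mul0n.
Qed.

Lemma cone_generic X : irreducible X -> exists (L : fieldType) (j : {rmorphism F -> L}) y,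
  forall p, mmap j y p = 0 <-> vanishing X p.
Proof.
move=> irr; have [L [val [v0 vE]]] := prime_generic (prime_cone irr).
exists L, (val \o @cstr F V), (fun i => val (fun v : V => v 0 i)) => p.
rewrite [mmap _ _ _](val_mmap val (fun i (v : V) => v 0 i) p).
split=> [h|/vanishingE h]; last by apply: v0 => v; exact: h.
by apply/vanishingE; apply: vE h; exists p.
Qed.

Section Span.
Variables (X : set P) (k : nat) (c : 'I_k -> V).
(** The comorphism of the linear projection with coordinates c. *)
Definition theta : {mpoly F[k]} -> S := msub (fun a => linear_form (c a)).
HB.instance Definition _ := GRing.RMorphism.copy theta (msub (fun a => linear_form (c a))).

Lemma thetaC a : theta a%:MP = a%:MP. Proof. by rewrite /theta /msub mmapC. Qed.
Lemma thetaX a : theta 'X_a = linear_form (c a). Proof. by rewrite /theta /msub mmapX mmap1U. Qed.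
Lemma theta_eval Q (v : V) : (theta Q).@[v 0] = Q.@[fun a => dotp (c a) v].
Proof. by rewrite msub_meval; apply: meval_eq => a; rewrite meval_linear_form. Qed.
Lemma theta_mmap (L : comNzRingType) (j : {rmorphism F -> L}) y Q :
  mmap j y (theta Q) = mmap j (fun a => mmap j y (linear_form (c a))) Q.
Proof.
rewrite /theta /msub (mmap_comp (mmap j y : {rmorphism _ -> _})).
by rewrite (_ : (_ \o @mpolyC _ _) = j) //; apply/funext => a; rewrite /= mmapC.
Qed.

Hypothesis cX : closed X.
Hypothesis nozero : forall v, pcone X v -> (forall a, dotp (c a) v = 0) -> False.

(** Finiteness of the projection: the forms c have no common zero on X, so modulo the ideal of X
    they generate all monomials of large degree, and by induction on the degree the monomials of
    degree below d span. *)
Lemma finite_span : exists M (w : 'I_M -> S), forall a, exists e : 'I_M -> {mpoly F[k]},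
  vanishing X (a - \sum_t theta (e t) * w t).
Proof.
pose G p := vanishing X p \/ exists a, p = linear_form (c a).
have GX i : exists e, gen G ('X_i ^+ e).
  apply: nullstellensatz => v hv; rewrite mevalXU.
  have [//|vi] := eqVneq (v i) 0; exfalso; pose u : V := \row_i v i.
  have uv : u 0 =1 v by move=> i'; rewrite mxE.
  have u0 : u != 0.
    by apply: contraNneq vi => /(congr1 (fun A : V => A 0 i)); rewrite !mxE => ->.
  apply: (nozero (v := u)).
    by apply: closed_pcone => // p Xp; rewrite (meval_eq _ uv); apply: hv; left.
  by move=> a; rewrite -meval_linear_form (meval_eq _ uv); apply: hv; right; exists a.
have [e eE] := choice GX; pose d := (\sum_i e i)%N.
have genE p : gen G p -> exists s : 'I_k -> S, vanishing X (p - \sum_a linear_form (c a) * s a).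
  elim=> [|r g a Gg _ [s hs]].
    by exists (fun=> 0); rewrite big1 ?subr0 => [|a _]; [exact: vanishing0|rewrite mulr0].
  case: Gg => [Ig|[b ->]].
    by exists s; rewrite addrAC; apply: vanishingD => //; exact: vanishingM.
  exists (fun a' => s a' + if a' == b then r else 0).
  have -> : \sum_a' linear_form (c a') * (s a' + (if a' == b then r else 0)) =
      \sum_a' linear_form (c a') * s a' + r * linear_form (c b).
    under eq_bigr => a' _ do rewrite mulrDr.
    rewrite big_split /=; congr (_ + _); rewrite (bigD1 b) //= eqxx big1 ?addr0 1?mulrC // => a' ab.
    by rewrite (negbTE ab) mulr0.
  by rewrite opprD addrACA subrr addr0.
pose T := 'X_{1..n.+1 < d}; pose w (t : 'I_#|{: T}|) : S := 'X_[(enum_val t : T)].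
pose W a := exists e : 'I_#|{: T}| -> {mpoly F[k]}, vanishing X (a - \sum_t theta (e t) * w t).
have WI a : vanishing X a -> W a.
  by move=> Xa; exists (fun=> 0); rewrite big1 ?subr0 // => t _; rewrite rmorph0 mul0r.
have WD a b : W a -> W b -> W (a + b).
  move=> [ea ha] [eb hb]; exists (fun t => ea t + eb t).
  have -> : \sum_t theta (ea t + eb t) * w t = \sum_t theta (ea t) * w t + \sum_t theta (eb t) * w t.
    by rewrite -big_split; apply: eq_bigr => t _; rewrite rmorphD mulrDl.
  by rewrite opprD addrACA; exact: (vanishingD ha hb).
have WM a b : W b -> W (theta a * b).
  move=> [eb hb]; exists (fun t => a * eb t).
  have -> : \sum_t theta (a * eb t) * w t = theta a * \sum_t theta (eb t) * w t.
    by rewrite mulr_sumr; apply: eq_bigr => t _; rewrite rmorphM mulrA.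
  by rewrite -mulrBr; exact: (vanishingM _ hb).
have Wsum I (s : seq I) (Q : pred I) (f : I -> S) : (forall i, W (f i)) -> W (\sum_(i <- s | Q i) f i).
  by move=> Wf; apply: big_ind => //; apply: WI; exact: vanishing0.
have WX (m : 'X_{1..n.+1}) : W 'X_[m].
  have [N] := ubnP (mdeg m); elim: N m => // N IH m; rewrite ltnS => mN.
  have WN a N' : a \is N'.-homog -> (N' < N)%N -> W a.
    move=> ha lt; rewrite (mpolyE a) big_seq; apply: big_ind => [|//|m' m'a].
      by apply: WI; exact: vanishing0.
    rewrite -mul_mpolyC -thetaC; apply/WM/IH; by rewrite (dhomogP _ _ _ ha m' m'a).
  have [lt|le] := ltnP (mdeg m) d.
    exists (fun t => if (enum_val t : T) == m :> 'X_{1..n.+1} then 1 else 0).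
    rewrite (bigD1 (enum_rank (BMultinom lt))) //= /w enum_rankK eqxx rmorph1 mul1r big1 => [|t tm].
      by rewrite addr0 subrr; exact: vanishing0.
    case: eqP => [e'|_]; last by rewrite rmorph0 mul0r.
    case/eqP: tm; rewrite -[t]enum_valK; congr enum_rank; exact: val_inj.
  have [i le_i] := mnm_large le; have gm : gen G 'X_[F, m].
    by rewrite (mpolyX_dvd le_i); apply: genM; exact: eE.
  have [s hs] := genE _ gm; have := vanishing_homog (mdeg m) hs.
  rewrite linearB /= pihomog_dE ?dhomogX // (linear_sum (pihomog mdeg (mdeg m))) /= => hs'.
  rewrite -['X_[_]](subrK (\sum_a pihomog mdeg (mdeg m) (linear_form (c a) * s a))).
  apply: (WD _ _ (WI _ hs')); apply: Wsum => a; have hc := linear_form_homog (c a).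
  case E : (mdeg m) => [|N']; first by rewrite (pihomog_mul0 _ hc) //; apply: WI; exact: vanishing0.
  rewrite (pihomog_mul (s a) N' hc : pihomog mdeg N'.+1 _ = _) -thetaX; apply: WM; apply: (WN _ N'); first exact: pihomogP.
  by rewrite -E.
exists _, w => a; rewrite -/(W a) (mpolyE a); apply: Wsum => m.
by rewrite -mul_mpolyC -thetaC; apply: WM.
Qed.

(** Cayley and Hamilton for multiplication by a on the span of w, read at the generic point of X,
    where some w t is nonzero because 1 lies in the span. *)
Lemma integral_over a : irreducible X -> exists p : {poly {mpoly F[k]}}, p \is monic /\
  vanishing X (map_poly theta p).[a].
Proof.
move=> irr; have [M [w wE]] := finite_span; have [L [j [y yE]]] := cone_generic irr.
have [C hC] : exists C : 'M[{mpoly F[k]}]_M, forall t,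
    vanishing X (a * w t - \sum_t' theta (C t t') * w t').
  have /choice [C hC] := fun t => wE (a * w t); exists (\matrix_(t, t') C t t') => t.
  by rewrite (eq_bigr (fun t' => theta (C t t') * w t')) => [|t' _]; rewrite ?mxE.
pose ev : {rmorphism S -> L} := mmap j y; pose al : {rmorphism {mpoly F[k]} -> L} := ev \o theta.
have ev0 p : vanishing X p -> ev p = 0 by move=> /yE.
pose Y : 'rV[L]_M := \row_t ev (w t).
have Y0 : Y != 0.
  apply/eqP => Y0; have [e1 he] := wE 1.
  have : ev 1 = 0.
    rewrite -(subrK (\sum_t theta (e1 t) * w t) 1) rmorphD (ev0 _ he) add0r rmorph_sum big1 // => t _.
    have /rowP/(_ t) := Y0; rewrite !mxE => wt.
    by rewrite rmorphM wt mulr0.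
  by rewrite rmorph1 => /eqP; rewrite oner_eq0.
exists (char_poly C^T); split; first exact: char_poly_monic.
apply/yE; change (ev (map_poly theta (char_poly C^T)).[a] = 0).
rewrite -horner_map -map_poly_comp -[map_poly _ _]/(map_poly al _) map_char_poly.
apply/rootP; rewrite -eigenvalue_root_char; apply/eigenvalueP; exists Y => //.
apply/rowP => t; rewrite !mxE; apply/esym/eqP; rewrite -subr_eq0.
have := ev0 _ (hC t); rewrite rmorphB rmorphM rmorph_sum => /= h.
rewrite -[X in _ == X]h; apply/eqP; congr (_ - _); apply: eq_bigr => t' _.
by rewrite !mxE rmorphM mulrC.
Qed.
End Span.

Lemma algind_full (L : fieldType) (j : {rmorphism F -> L}) d r (z : 'I_d -> L) (f : 'I_r -> 'I_d) :
  algind j (z \o f) -> (d <= r)%N -> algind j z.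
Proof.
move=> ind le; have finj : injective f.
  move=> a b ab; apply/eqP; apply: contrapT => /negP nab.
  have : 'X_a - 'X_b = 0 :> {mpoly F[r]}.
    by apply: ind; rewrite rmorphB /= !mmapX !mmap1U /= ab subrr.
  move/(congr1 (mcoeff U_(a))); rewrite mcoeffB !mcoeffXU eqxx eq_sym (negbTE nab) subr0 mcoeff0.
  by move/eqP; rewrite oner_eq0.
have rd : (#|'I_d| <= #|'I_r|)%N by rewrite !card_ord.
have [B fB Bf] := inj_card_bij finj rd.
move=> Q Q0; have : msub (fun i => 'X_(B i)) Q = 0 :> {mpoly F[r]}.
  apply: ind; rewrite -[RHS]Q0 /msub (mmap_comp (mmap j (z \o f) : {rmorphism _ -> _})).
  rewrite (_ : (_ \o @mpolyC _ _) = j); last by apply/funext => a; rewrite /= mmapC.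
  by apply: mmap_ext => i; rewrite /= mmapX mmap1U /= Bf.
move=> h; apply: mpoly_eq0_everywhere => u.
have := congr1 (meval (fun i => u (f i))) h; rewrite meval0 msub_meval => h0.
by rewrite -[RHS]h0; apply: meval_eq => i; rewrite mevalXU Bf.
Qed.

(** The projection is finite, so a derivation that kills the m + 1 forms kills all coordinates;
    counting then shows that the forms are independent. *)
Lemma normalization_indep X m (c : 'I_m.+1 -> V) : closed X -> irreducible X -> dim_ge X m ->
  (forall v, pcone X v -> (forall a, dotp (c a) v = 0) -> False) ->
  forall Q, vanishing X (theta c Q) -> Q = 0.
Proof.
move=> cX iX dX nz Q XQ; have [rX [A [rXm iA]]] := dim_coords charF cX iX dX.
have [L [j [y yE]]] := cone_generic iX.
pose p a := y (A a); have ip : algind j p.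
  move=> R R0; apply: iA; apply/yE; rewrite /msub (mmap_comp (mmap j y : {rmorphism _ -> _})) -[RHS]R0.
  rewrite (_ : (_ \o @mpolyC _ _) = j); last by apply/funext => a; rewrite /= mmapC.
  by apply: mmap_ext => i; rewrite /= /coords mmapX mmap1U.
pose z a := mmap j y (linear_form (c a)).
pose E k (g : 'I_k -> L) := [seq g i : L | i <- enum 'I_k].
have Em k (g : 'I_k -> L) i : g i \in E k g by apply: map_f; rewrite mem_enum.
have [||B e sB Bs Bp de ez _ i|r1 [r2 [f1 [f2 [ler le1 ind1 ind2]]]]] :=
  algind_count charF (z := z) (h := fun i : 'I_0 => 0) (s := E _ z ++ E _ y) ip.
- by move=> i; rewrite mem_cat Em.
- by case.
- have Bz a : B (z a) by apply: Bs; rewrite mem_cat Em.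
  have By a : B (y a) by apply: Bs; rewrite mem_cat Em orbT.
  have [q [qm qX]] := integral_over cX nz 'X_(A i) iX.
  pose al : {rmorphism {mpoly F[m.+1]} -> L} := mmap j z.
  apply: (der_algebraic j charF (al := al) sB de.1 (Bp i) _ qm).
    move=> a; split; first by apply: mmap_subring => // b; case: (de.2 b).
    by rewrite [al a]/(mmap j z a) (der_mmap _ sB de Bz) big1 // => b _; rewrite ez mulr0.
  apply/rootP; rewrite -[RHS](iffRL (yE _) qX).
  rewrite -[mmap _ _ _]/((mmap j y : {rmorphism S -> L}) _) -horner_map /= mmapX mmap1U.
  rewrite -map_poly_comp; congr (_.[_]); apply: eq_map_poly => b /=.
  by rewrite theta_mmap.
case: r2 f2 ind2 ler => [|r2] f2; last by case: (f2 ord0).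
move=> _ ler; have /algind_full : algind j (z \o f1) by [].
by apply; [lia|rewrite -theta_mmap; exact/yE].
Qed.
End Finite.

Section LocalStructure.
Variables (F : closedFieldType) (n : nat).
Local Notation S := {mpoly F[n.+1]}.
Local Notation V := 'rV[F]_n.+1.
Local Notation P := (proj F n).
Implicit Types (X Y Z C : set P).
Hypothesis charF : forall k, k.+1%:R != 0 :> F.

Lemma pcone_cuts Z ts v : pcone (cuts Z ts) v <-> pcone Z v /\ forall t, t \in ts -> dotp t v = 0.
Proof.
elim: ts => [|t ts IH] /=; first by split=> [Zv|[]].
rewrite pcone_cut IH; split=> [[[Zv ht] tv]|[Zv ht]].
  by split=> // t'; rewrite inE => /orP[/eqP ->|/ht].
by split; [split=> // t' t't|]; apply: ht; rewrite inE ?eqxx // t't orbT.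
Qed.

(** Each coordinate is integral over the forms c, so on a fibre it is a root of one fixed monic
    polynomial. *)
Lemma finite_fiber X k (c : 'I_k -> V) (v0 : V) : closed X -> irreducible X ->
  (forall v, pcone X v -> (forall a, dotp (c a) v = 0) -> False) ->
  exists s : seq V, forall v, pcone X v -> (forall a, dotp (c a) v = dotp (c a) v0) -> v \in s.
Proof.
move=> cX iX nz.
pose ev : {rmorphism {mpoly F[k]} -> F} := meval (fun a => dotp (c a) v0).
have [r hr] : exists r : seq F, forall v i, pcone X v -> (forall a, dotp (c a) v = dotp (c a) v0) ->
    v 0 i \in r.
  have /choice [r hr] : forall i, exists r : seq F, forall v, pcone X v ->
      (forall a, dotp (c a) v = dotp (c a) v0) -> v 0 i \in r.
    move=> i; have [p [pm pX]] := integral_over cX nz 'X_i iX.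
    have [r rE] := closed_field_poly_normal (map_poly ev p).
    exists r => v Xv hv; rewrite -root_prod_XsubC.
    have /monicP pm' : map_poly ev p \is monic by exact: monic_map.
    move: rE; rewrite pm' scale1r => <-; apply/rootP.
    have /vanishingE /(_ v Xv) <- := pX.
    rewrite -[RHS]/((meval (v 0) : {rmorphism S -> F}) _) -horner_map /= mevalXU -map_poly_comp.
    congr (_.[_]); apply: eq_map_poly => q /=; rewrite theta_eval; apply: meval_eq => a.
    by rewrite hv.
  exists (flatten [seq r i | i <- enum 'I_n.+1]) => v i Xv hv; apply/flatten_mapP.
  by exists i; rewrite ?mem_enum //; exact: hr.
exists [seq \row_i r`_(f i : nat) | f : {ffun 'I_n.+1 -> 'I_(size r)}] => v Xv hv.
have lt (i : 'I_n.+1) : (index (v ord0 i) r < size r)%N by rewrite index_mem; exact: hr.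
apply/mapP; exists [ffun i => Ordinal (lt i)]; first by rewrite mem_enum.
by apply/rowP => i; rewrite mxE ffunE /= nth_index //; exact: hr.
Qed.

(** The first m + 1 forms make the projection of X finite. The last one separates v0 from the rest
    of its finite fibre and completes the injectivity on K, of which the others leave at most a
    line. *)
Lemma projection_exists X m (l v0 : V) (K : {vspace V}) : closed X -> irreducible X ->
  dim_le X m -> ~ vanishing X (linear_form l) -> (\dim K <= m.+1)%N ->
  exists c : 'I_m.+2 -> V, [/\ c ord0 = l,
    forall v, pcone X v -> (forall a : 'I_m.+1, dotp (c (widen_ord (leqnSn _) a)) v = 0) -> False,
    forall w, w \in K -> (forall a, dotp (c a) w = 0) -> w = 0 &
    forall v, pcone X v -> (forall a, dotp (c a) v = dotp (c a) v0) -> v = v0].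
Proof.
move=> cX iX dX lX dK; pose Z := cut X l; have cZ : closed Z by exact: closed_cut.
have dZ : dim_lt Z m.
  move=> C cC iC CZ dC; apply: dX.
  apply: (dim_ge_proper (f := linear_form l) charF cC iC cX iX) => //; first by move=> x /CZ [].
  by move=> x w Cx xw; rewrite meval_linear_form; have [_] := CZ x Cx; exact.
have [ts [sts dts cts [K' [dK' hK']]]] := choose_forms charF cZ dZ dK (leqnn m).
rewrite subnn in dts dK'; have e0 := dim_lt0 cts dts.
pose c' (a : 'I_m.+1) := nth 0 (l :: ts) a.
have nz v : pcone X v -> (forall a, dotp (c' a) v = 0) -> False.
  move=> Xv h; have : pcone (cuts Z ts) v; last by rewrite e0 => -[x []].
  apply/pcone_cuts; split; first by apply/pcone_cut; split=> //; exact: (h ord0).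
  move=> t tts; have lt : (index t (l :: ts) < m.+1)%N.
    by rewrite -sts -[(size ts).+1]/(size (l :: ts)) index_mem inE tts orbT.
  by have := h (Ordinal lt); rewrite /c' /= nth_index // inE tts orbT.
have [s hs] := finite_fiber v0 cX iX nz.
pose w := vpick K'.
have [x|t ht] := avoid_zeros (s := [seq x <- w :: [seq v - v0 | v <- s] | x != 0]).
  by rewrite mem_filter => /andP[].
pose c (a : 'I_m.+2) := nth 0 (l :: rcons ts t) a.
have cw a : c (widen_ord (leqnSn _) a) = c' a.
  rewrite /c /c'; case: a => [[|a] la] //=; rewrite nth_rcons.
  by rewrite ltnS -sts in la; rewrite la.
have ct : c ord_max = t by rewrite /c /= nth_rcons sts ltnn eqxx.
exists c; split=> //.
- by move=> v Xv h; apply: (nz v Xv) => a; rewrite -cw.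
- move=> u uK hu; apply/eqP; apply: contrapT => /negP u0.
  have uK' : u \in K'.
    apply: hK' => // t' t't; have lt : (index t' ts < size ts)%N by rewrite index_mem.
    have lt' : ((index t' ts).+1 < m.+2)%N by rewrite !ltnS -sts ltnW.
    by have := hu (Ordinal lt'); rewrite /c /= nth_rcons lt nth_index.
  have K0 : K' != 0%VS by apply: contraNneq u0 => e; rewrite e memv0 in uK'.
  have w0 : w != 0 by rewrite vpick0.
  have KE : (K' = <[w]>)%VS.
    by apply/esym/eqP; rewrite eqEdim -memvE memv_pick dim_vline w0.
  move: uK'; rewrite KE => /vlineP [a uE]; have := hu ord_max.
  rewrite ct uE dotpZ => /eqP; rewrite mulf_eq0 (negbTE (ht w _)) ?orbF.
    by move=> /eqP a0; move: u0; rewrite uE a0 scale0r eqxx.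
  by rewrite mem_filter w0 mem_head.
- move=> v Xv h; apply/eqP; apply: contrapT => /negP vv.
  have := h ord_max; rewrite ct => /eqP; rewrite -subr_eq0.
  have -> : dotp t v - dotp t v0 = dotp t (v - v0).
    by rewrite -scaleN1r dotpD dotpZ mulN1r.
  rewrite (negbTE (ht _ _)) // mem_filter subr_eq0 vv inE; apply/orP; right.
  by apply: map_f; apply: hs => // a; rewrite -cw.
Qed.

Lemma mderiv_linear_form (l : V) i : (linear_form l)^`M(i) = (l 0 i)%:MP.
Proof.
rewrite /linear_form linear_sum (bigD1 i) //= big1 ?addr0 => [|k ki]; rewrite mderivZ mderivXU.
  by rewrite eqxx -mul_mpolyC mulr1.
by rewrite eq_sym (negbTE ki) scaler0.
Qed.

Lemma eval_mderiv_sum (I : finType) (f : I -> S) i (v : 'I_n.+1 -> F) :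
  (\sum_a f a)^`M(i).@[v] = \sum_a (f a)^`M(i).@[v].
Proof.
by apply: (big_morph (fun p : S => p^`M(i).@[v])) => [p q|];
  rewrite ?mderivD ?mevalD ?mderiv0 ?meval0.
Qed.

Section Unit.
Variables (X : set P) (k : nat) (c : 'I_k -> V) (v0 : V).
Hypothesis cX : closed X.
Hypothesis iX : irreducible X.
Hypothesis Xv0 : pcone X v0.
Hypothesis nz : forall v, pcone X v -> (forall a, dotp (c a) v = 0) -> False.
Hypothesis inj_tan : forall w : V, (forall p, vanishing X p -> \sum_(i < n.+1) p^`M(i).@[v0 0] * w 0 i = 0) ->
  (forall a, dotp (c a) w = 0) -> w = 0.
Hypothesis inj_fib : forall v, pcone X v -> (forall a, dotp (c a) v = dotp (c a) v0) -> v = v0.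
Let x i : S := 'X_i - (v0 0 i)%:MP.
Let G p := vanishing X p \/ exists a, p = linear_form (c a) - (dotp (c a) v0)%:MP.

Let x0 i : (x i).@[v0 0] = 0.
Proof. by rewrite /x mevalB mevalXU mevalC subrr. Qed.

Let expand p : exists q : 'I_n.+1 -> S, p = p.@[v0 0]%:MP + \sum_i q i * x i.
Proof.
elim/mpoly_alg_ind: p => [a|i|p q [p' pE] [q' qE]|p q [p' pE] [q' qE]].
- by exists (fun=> 0); rewrite mevalC big1 ?addr0 // => i _; rewrite mul0r.
- exists (fun k => (k == i)%:R); rewrite mevalXU (bigD1 i) //= eqxx mul1r big1 ?addr0.
    by rewrite /x addrC subrK.
  by move=> k' ki; rewrite (negbTE ki) mul0r.
- exists (fun i => p' i + q' i); rewrite mevalD mpolyCD {1}pE {1}qE.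
  under [in RHS]eq_bigr => i _ do rewrite mulrDl.
  by rewrite big_split addrACA.
- exists (fun i => p' i * q + p.@[v0 0]%:MP * q' i).
  under [in RHS]eq_bigr => i _ do rewrite mulrDl mulrAC -[_%:MP * _ * _]mulrA.
  rewrite big_split /= -mulr_suml -mulr_sumr mevalM mpolyCM.
  set sp := \sum_i p' i * x i in pE *; set sq := \sum_i q' i * x i in qE *.
  have -> : p * q = p.@[v0 0]%:MP * q + sp * q by rewrite -mulrDl -pE.
  have -> : p.@[v0 0]%:MP * q = p.@[v0 0]%:MP * (q.@[v0 0]%:MP + sq) by rewrite -qE.
  by ring.
Qed.

Let gen_zero v : (forall p, G p -> p.@[v] = 0) -> forall i, v i = v0 0 i.
Proof.
move=> hv i; pose u : V := \row_i v i; have uv : u 0 =1 v by move=> i'; rewrite mxE.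
have cE a : dotp (c a) u = dotp (c a) v0.
  apply/eqP; rewrite -subr_eq0 -meval_linear_form -[X in _ - X](mevalC (u 0)) -mevalB.
  by rewrite (meval_eq _ uv) hv //; right; exists a.
have [u0|u0] := eqVneq u 0.
  exfalso; apply: (nz Xv0) => a; rewrite -cE u0 /dotp big1 // => i' _.
  by rewrite mxE mulr0.
rewrite -uv (inj_fib _ cE) //; apply: closed_pcone => // p Xp.
by rewrite (meval_eq _ uv); apply: hv; left.
Qed.

(** No nonzero tangent vector is killed by all the forms c, so the differentials at v0 of the
    generators G span the whole dual space. *)
Let tangent_gen i : exists g, [/\ gen G g, g.@[v0 0] = 0 & forall i', g^`M(i').@[v0 0] = (i' == i)%:R].
Proof.
have [k' [f gf]] := vanishing_gens X.
have vX : on_cone idfun X (v0 0) by exact: on_cone_point.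
pose M := col_mx (jac idfun (v0 0) f) (\matrix_a c a).
have full : row_full M.
  rewrite /row_full -mxrank_tr -/(row_free _) -kermx_eq0; apply/eqP/row_matrixP => b; rewrite row0.
  set w := row b _; have : w *m M^T = 0 by apply/sub_kermxP; exact: row_sub.
  rewrite tr_col_mx mul_mx_row => /eqP; rewrite row_mx_eq0 => /andP[/eqP w1 /eqP w2].
  apply: inj_tan => [p Ip|a].
    have /submxP [s sE] := grad_gens gf vX Ip.
    by rewrite dot_grad sE -mulmxA -[jac _ _ _]trmxK -trmx_mul w1 trmx0 mulmx0 mxE.
  have /rowP/(_ a) := w2; rewrite [RHS]mxE mxE => h; rewrite -[RHS]h dotpC.
  by apply: eq_bigr => i' _; rewrite !mxE.
have /submxP [s sE] : ((delta_mx 0 i : V) <= M)%MS by apply: submx_full.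
rewrite -[s]hsubmxK mul_row_col in sE; set s1 := lsubmx s in sE; set s2 := rsubmx s in sE.
exists (\sum_a s1 0 a *: f a + \sum_a s2 0 a *: (linear_form (c a) - (dotp (c a) v0)%:MP)); split.
- by apply: genD; apply: (big_ind (gen G)) => [|p q|a _]; (exact: gen0 || exact: genD ||
    rewrite -mul_mpolyC; apply: genM; apply: gen_mem); [left; exact: gf.1|right; exists a].
- rewrite mevalD !raddf_sum /= !big1 ?addr0 // => a _; rewrite mevalZ.
    by rewrite mevalB mevalC meval_linear_form subrr mulr0.
  by rewrite (_ : (f a).@[_] = 0) ?mulr0 //; exact: (vX _ (gf.1 a)).
- move=> i'; have /rowP/(_ i') := sE; rewrite mxE eqxx /= => ->.
  rewrite mderivD mevalD [RHS]mxE; congr (_ + _).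
    rewrite eval_mderiv_sum mxE; apply: eq_bigr => a _ /=.
    by rewrite mderivZ mevalZ [jac _ _ _ _ _]mxE.
  rewrite eval_mderiv_sum mxE; apply: eq_bigr => a _ /=.
  by rewrite mderivZ mevalZ mderivB mderivC subr0 mderiv_linear_form mevalC [X in _ = _ * X]mxE.
Qed.

Let cotangent i : exists (m : 'I_n.+1 -> S) g, [/\ forall k, (m k).@[v0 0] = 0, gen G g &
  x i = g + \sum_k m k * x k].
Proof.
have [g [gG g0 dg]] := tangent_gen i; have [q qE] := expand g.
rewrite g0 mpolyC0 add0r in qE.
have q0 b : (q b).@[v0 0] = (b == i)%:R.
  rewrite -dg qE eval_mderiv_sum (bigD1 b) //= big1 ?addr0 => [|a ab].
    by rewrite mderivM mevalD !mevalM x0 mulr0 add0r mderivB mderivXU mderivC subr0 eqxx meval1 mulr1.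
  by rewrite mderivM mevalD !mevalM x0 mulr0 add0r mderivB mderivXU mderivC subr0 eq_sym (negbTE ab) meval0 mulr0.
exists (fun k => (k == i)%:R - q k), g; split=> //.
  by move=> b; rewrite mevalB q0 rmorph_nat subrr.
under eq_bigr => b _ do rewrite mulrBl.
rewrite sumrB -qE (bigD1 i) //= eqxx mul1r big1 => [|b bi]; last by rewrite (negbTE bi) mul0r.
by rewrite addr0 addrC subrK.
Qed.

(** The ideal of v0 is generated by the equations of X and of the fibre: the determinant trick on
    [cotangent] puts D (x i) in the ideal of G with D(v0) = 1, and D has no common zero with G,
    whose only zero is v0. *)
Let max_gen i : gen G (x i).
Proof.
have /choice [mg hmg] : forall i, exists mg : ('I_n.+1 -> S) * S,
    [/\ forall b, (mg.1 b).@[v0 0] = 0, gen G mg.2 & x i = mg.2 + \sum_b mg.1 b * x b].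
  by move=> i'; have [m [g h]] := cotangent i'; exists (m, g).
pose m i := (mg i).1; pose g i := (mg i).2.
have hg i' : [/\ forall b, (m i' b).@[v0 0] = 0, gen G (g i') & x i' = g i' + \sum_b m i' b * x b] := hmg i'.
pose M : 'M[S]_n.+1 := \matrix_(i, k) m i k; pose D := \det (1%:M - M).
have D0 : D.@[v0 0] = 1.
  rewrite -[_.@[_]]/((meval (v0 0) : {rmorphism S -> F}) D) -det_map_mx (_ : map_mx _ _ = 1%:M) ?det1 //.
  apply/matrixP => a b; rewrite !mxE /= mevalB; have [m0 _ _] := hg a.
  by rewrite m0 subr0 rmorph_nat.
have Dx b : gen G (D * x b).
  have E : (1%:M - M) *m (\col_k x k) = \col_k g k.
    apply/colP => a; rewrite mulmxBl mul1mx !mxE; have [_ _ xE] := hg a.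
    rewrite (eq_bigr (fun b' => m a b' * x b')) => [|b' _]; last by rewrite !mxE.
    by rewrite {1}xE addrK.
  have := congr1 (mulmx (\adj (1%:M - M))) E; rewrite mulmxA mul_adj_mx mul_scalar_mx.
  move/colP/(_ b); rewrite !mxE => ->; apply: (big_ind (gen G)) => [|p q|a _]; [exact: gen0|exact: genD|].
  by rewrite [X in _ * X]mxE; apply: genM; have [] := hg a.
have [|e] := @nullstellensatz _ _ (fun p => G p \/ p = D) 1.
  move=> v hv; have v0E := gen_zero (fun p Gp => hv p (or_introl Gp)).
  have : D.@[v] = 0 by apply: hv; right.
  by rewrite (meval_eq _ v0E) D0 meval1.
rewrite expr1n => h1; have : forall p, gen (fun p => G p \/ p = D) p -> gen G (p * x i).
  move=> p; elim=> [|r q a [Gq|->] _ IH]; first by rewrite mul0r; exact: gen0.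
    by rewrite mulrDl; apply: genD => //; rewrite mulrAC; apply: genM; exact: gen_mem.
  by rewrite mulrDl -mulrA; apply: genD => //; apply: genM; exact: Dx.
by move/(_ 1 h1); rewrite mul1r.
Qed.

(** A finite unramified projection with v0 alone in its fibre is an isomorphism onto its image near
    v0: modulo the fibre each generator w t is a constant, so w = k + C w with C zero at the image
    point, and u = det(1 - C) serves as denominator. *)
Lemma local_unit : exists u : {mpoly F[k]}, (theta c u).@[v0 0] = 1 /\
  forall a, exists g, vanishing X (theta c u * a - theta c g).
Proof.
have [M [w wE]] := finite_span cX nz; have [L [j [y yE]]] := cone_generic iX.
have [ev [ev0 evC]] : exists ev : {rmorphism S -> L}, (forall p, ev p = 0 <-> vanishing X p) /\
    forall b, ev b%:MP = j b.
  by exists (mmap j y); split=> // b; rewrite /= mmapC.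
have [al [alX alC alE]] : exists al : {rmorphism {mpoly F[k]} -> L},
    [/\ forall b, al 'X_b = ev (linear_form (c b)), forall b, al b%:MP = j b &
    forall g, ev (theta c g) = al g].
  by exists (ev \o theta c); split=> // b /=; rewrite ?thetaX // thetaC.
have ev00 : ev 0 = 0 by exact: rmorph0.
have wE' r : exists e : 'I_M -> {mpoly F[k]}, ev r = \sum_t al (e t) * ev (w t).
  have [e eE] := wE r; exists e; apply/eqP; rewrite -subr_eq0.
  have := iffRL (ev0 _) eE; rewrite rmorphB rmorph_sum => h.
  by rewrite -[X in _ == X]h; apply/eqP; congr (_ - _); apply: eq_bigr => t' _; rewrite rmorphM alE.
pose pt a := dotp (c a) v0.
have [C [kk hC]] : exists (C : 'M[{mpoly F[k]}]_M) (kk : 'I_M -> F),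
    (forall t t', (C t t').@[pt] = 0) /\
    forall t, ev (w t) = j (kk t) + \sum_t' al (C t t') * ev (w t').
  have /choice [C hC] : forall t, exists C : 'I_M -> {mpoly F[k]}, (forall t', (C t').@[pt] = 0) /\
     ev (w t) = j (w t).@[v0 0] + \sum_t' al (C t') * ev (w t').
    move=> t; have [q qE] := expand (w t); have genx : gen G (\sum_i q i * x i).
      by apply: (big_ind (gen G)) => [|p p'|i _]; [exact: gen0|exact: genD|apply: genM; exact: max_gen].
    have gC p : gen G p -> exists C : 'I_M -> {mpoly F[k]}, (forall t', (C t').@[pt] = 0) /\
        ev p = \sum_t' al (C t') * ev (w t').
      elim=> [|r g a Gg _ [Ca [Ca0 aE]]].
        exists (fun=> 0); split=> [t'|]; first by rewrite meval0.
        by rewrite ev00 big1 // => t' _; rewrite rmorph0 mul0r.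
      case: Gg => [Ig|[b ->]].
        by exists Ca; split=> //; rewrite rmorphD rmorphM (iffRL (ev0 g) Ig) mulr0 addr0.
      have [e eE] := wE' r; exists (fun t' => Ca t' + e t' * ('X_b - (pt b)%:MP)); split=> [t'|].
        by rewrite mevalD Ca0 add0r mevalM mevalB mevalXU mevalC subrr mulr0.
      under eq_bigr => t' _ do rewrite rmorphD mulrDl.
      rewrite big_split /= -aE rmorphD rmorphM; congr (_ + _).
      rewrite eE mulr_suml; apply: eq_bigr => t' _.
      rewrite !(rmorphM, rmorphB) alX alC.
      by rewrite evC mulrAC.
    have [C [C0 CE]] := gC _ genx; exists C; split=> //.
    by rewrite {1}qE rmorphD CE evC.
  exists (\matrix_(t, t') C t t'), (fun t => (w t).@[v0 0]); split=> [t t'|t].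
    by rewrite mxE; case: (hC t).
  have [_ ->] := hC t; congr (_ + _); by apply: eq_bigr => t' _; rewrite mxE.
case: hC => C0 CE; pose N := 1%:M - C; pose u := \det N.
have uw t : exists g, al u * ev (w t) = al g.
  exists (\sum_t' \adj N t t' * (kk t')%:MP).
  have E : map_mx al N *m (\col_t ev (w t)) = map_mx al (\col_t (kk t)%:MP).
    apply/colP => t'; rewrite /N map_mxB map_mx1 mulmxBl mul1mx !mxE alC.
    rewrite [X in X - _]CE; apply/eqP; rewrite subr_eq; apply/eqP; congr (_ + _).
    by apply: eq_bigr => t'' _; rewrite !mxE.
  have := congr1 (mulmx (map_mx al (\adj N))) E.
  rewrite mulmxA -!map_mxM mul_adj_mx map_scalar_mx mul_scalar_mx.
  move/colP/(_ t); rewrite [LHS]mxE [X in _ * X = _]mxE => ->; rewrite mxE; congr (al _).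
  by rewrite mxE; apply: eq_bigr => t' _; congr (_ * _); rewrite mxE.
exists u; split.
  rewrite theta_eval -[_.@[_]]/((meval pt : {rmorphism _ -> F}) u) -det_map_mx (_ : map_mx _ _ = 1%:M) ?det1 //.
  by apply/matrixP => a b; rewrite !mxE /= mevalB C0 subr0 rmorph_nat.
move=> a; have [e eE] := wE' a; have /choice [g gE] := uw.
exists (\sum_t e t * g t); apply/ev0; rewrite rmorphB rmorphM eE.
apply/eqP; rewrite subr_eq0; apply/eqP.
transitivity (al u * \sum_t al (e t) * ev (w t)); first by congr (_ * _); exact: alE.
transitivity (al (\sum_t e t * g t)); last exact: (esym (alE _)).
have -> : al (\sum_t e t * g t) = \sum_t al (e t * g t) by exact: rmorph_sum.
rewrite [LHS]mulr_sumr.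
have E t : al u * (al (e t) * ev (w t)) = al (e t * g t) by rewrite rmorphM -gE mulrCA.
by under eq_bigr => t _ do rewrite E.
Qed.
End Unit.
End LocalStructure.

(** * Divisibility and normality of hypersurfaces *)

Section Divisibility.
Variable R : idomainType.
Implicit Types a b p u : R.

Definition dvd a b := exists c, b = c * a.

Definition prime_elt p := [/\ p != 0, ~ dvd p 1 & forall a b, dvd p (a * b) -> dvd p a \/ dvd p b].

(** Only existence is asked: uniqueness is implicit in the factors being prime rather than
    irreducible. *)
Inductive factored : R -> Prop :=
| factored_unit u : dvd u 1 -> factored u
| factored_mul p a : prime_elt p -> factored a -> factored (p * a).

Definition factorial := forall a, a != 0 -> factored a.

Lemma dvd_refl a : dvd a a. Proof. by exists 1; rewrite mul1r. Qed.
Lemma dvd_mull a b c : dvd a b -> dvd a (c * b).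
Proof. by move=> [d ->]; exists (c * d); rewrite mulrA. Qed.
Lemma dvd_mulr a b c : dvd a b -> dvd a (b * c).
Proof. by rewrite mulrC; exact: dvd_mull. Qed.
Lemma dvdD a b c : dvd a b -> dvd a c -> dvd a (b + c).
Proof. by move=> [x ->] [y ->]; exists (x + y); rewrite mulrDl. Qed.
Lemma dvd_ideal a : is_ideal (dvd a).
Proof. by split=> [|b c|b c]; [exists 0; rewrite mul0r|exact: dvdD|exact: dvd_mull]. Qed.
Lemma dvd_trans a b c : dvd a b -> dvd b c -> dvd a c.
Proof. by move=> [x ->] [y ->]; exists (y * x); rewrite mulrA. Qed.
Lemma dvdB a b c : dvd a b -> dvd a c -> dvd a (b - c).
Proof. by move=> [x ->] [y ->]; exists (x - y); rewrite mulrBl. Qed.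
Lemma dvd_subr a b c : dvd a (b - c) -> dvd a b <-> dvd a c.
Proof.
move=> bc; split=> h; first by rewrite -(subKr b c); exact: dvdB.
by rewrite -(subrK c b); exact: dvdD.
Qed.

Lemma prime_dvd_ideal p : prime_elt p -> prime_ideal (dvd p).
Proof. by move=> [p0 p1 pr]; split=> //; exact: dvd_ideal. Qed.

Lemma prime_exp p a n : prime_elt p -> dvd p (a ^+ n) -> dvd p a.
Proof.
move=> [_ p1 pr]; elim: n => [|n IH]; first by rewrite expr0.
by rewrite exprS => /pr [].
Qed.

Lemma prime_factor (Q : R -> Prop) a : prime_ideal Q -> factored a -> Q a ->
  exists p, [/\ prime_elt p, Q p & dvd p a].
Proof.
move=> [[_ _ QM] Q1 pr]; elim=> [u [c cu]|p b pp _ IH].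
  by move=> Qu; case: Q1; rewrite cu; exact: QM.
case/pr => [Qp|/IH [q [qp Qq qb]]]; first by exists p; split=> //; exists b; rewrite mulrC.
by exists q; split=> //; exact: dvd_mull.
Qed.
End Divisibility.

Lemma factorial_field (F : fieldType) : factorial F.
Proof. by move=> a a0; apply: factored_unit; exists a^-1; rewrite mulVf. Qed.

Lemma prime_iso (R S : idomainType) (f : {rmorphism R -> S}) (g : {rmorphism S -> R}) p :
  cancel f g -> cancel g f -> prime_elt p -> prime_elt (f p).
Proof.
move=> fK gK [p0 p1 pr]; have fd a b : dvd (f a) b <-> dvd a (g b).
  split=> [[c ->]|[c cE]]; first by exists (g c); rewrite rmorphM fK.
  by exists (f c); rewrite -rmorphM -cE gK.
split.
- by apply: contra p0 => /eqP e; rewrite -(fK p) e rmorph0.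
- by move/fd; rewrite rmorph1.
- by move=> a b /fd; rewrite rmorphM => /pr [] /fd; [left|right].
Qed.

Lemma factorial_iso (R S : idomainType) (f : {rmorphism R -> S}) (g : {rmorphism S -> R}) :
  cancel f g -> cancel g f -> factorial R -> factorial S.
Proof.
move=> fK gK fR a a0; rewrite -(gK a).
have : factored (g a) by apply: fR; apply: contra a0 => /eqP e; rewrite -(gK a) e rmorph0.
elim=> [u [c cu]|p b pp _ IH]; first by apply: factored_unit; exists (f c); rewrite -rmorphM -cu rmorph1.
by rewrite rmorphM; apply: factored_mul => //; exact: prime_iso pp.
Qed.

Section Poly.
Variable R : idomainType.
Implicit Types (p q f g : {poly R}) (c : R).

Lemma dvd_polyC c f : dvd c%:P f <-> forall i, dvd c f`_i.
Proof.
split=> [[g ->] i|/choice [g gE]]; first by rewrite coefMC; exists g`_i.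
exists (\poly_(i < size f) g i); apply/polyP => i; rewrite coefMC coef_poly.
by case: ltnP => h; [exact: gE|rewrite mul0r nth_default].
Qed.

Lemma prime_map c : prime_elt c -> exists (L : fieldType) (h : {rmorphism R -> L}),
  (forall a, h a = 0 <-> dvd c a) /\ forall f, map_poly h f = 0 <-> dvd c%:P f.
Proof.
move=> pc; have [L [h [hE _]]] := prime_residue_field (prime_dvd_ideal pc).
exists L, h; split=> // f; rewrite dvd_polyC; split=> [/polyP h0 i|h0].
  by apply/hE; have := h0 i; rewrite coef_map coef0.
by apply/polyP => i; rewrite coef_map coef0; apply/hE.
Qed.

Lemma prime_polyC c : prime_elt c -> prime_elt c%:P.
Proof.
move=> pc; have [c0 c1 _] := pc; have [L [h [_ hE]]] := prime_map pc; split.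
- by rewrite polyC_eq0.
- by move/dvd_polyC/(_ 0%N); rewrite coefC.
- move=> a b /hE; rewrite rmorphM => /eqP; rewrite mulf_eq0 => /orP[/eqP|/eqP] /hE; by [left|right].
Qed.

(** A nonzero element of least size in the ideal of q and a is their greatest common divisor over
    the fraction field; the constants e clear denominators. *)
Lemma common_divisor q a : q != 0 -> exists r al be, [/\ r != 0, r = al * q + be * a,
  exists e, e != 0 /\ dvd r (e%:P * q) & exists e, e != 0 /\ dvd r (e%:P * a)].
Proof.
move=> q0; pose I r := exists al be, r = al * q + be * a.
have [k [r [r0 Ir sr]] min] : exists2 k, exists r, [/\ r != 0, I r & size r = k] &
    forall r, r != 0 -> I r -> (k <= size r)%N.
  have ex : exists k, `[< exists r, [/\ r != 0, I r & size r = k] >].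
    exists (size q); apply/asboolP; exists q; split=> //; exists 1, 0.
    by rewrite mul1r mul0r addr0.
  have [k /asboolP hk min] := ex_minnP ex; exists k => // r r0 Ir.
  by apply: min; apply/asboolP; exists r.
have dv b : I b -> exists e, e != 0 /\ dvd r (e%:P * b).
  move=> Ib; pose k' := Pdiv.Idomain.scalp b r; pose s := Pdiv.Idomain.divp b r.
  pose t := Pdiv.Idomain.modp b r; have E : lead_coef r ^+ k' *: b = s * r + t by exact: Pdiv.Idomain.divp_eq.
  have lt : (size t < size r)%N by rewrite Pdiv.CommonIdomain.ltn_modpN0.
  exists (lead_coef r ^+ k'); split; first by rewrite expf_neq0 // lead_coef_eq0.
  exists s; rewrite mul_polyC E; have [->|t0] := eqVneq t 0; first by rewrite addr0.
  suff : (size r <= size t)%N by rewrite leqNgt lt.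
  rewrite sr; apply: min => //; move: Ir Ib => [x [y rE]] [x' [y' bE]].
  exists (lead_coef r ^+ k' *: x' - s * x), (lead_coef r ^+ k' *: y' - s * y).
  have -> : t = lead_coef r ^+ k' *: b - s * r by rewrite E addrC addKr.
  by rewrite {2}rE bE -!mul_polyC; ring.
have [al [be rE]] := Ir; exists r, al, be; split=> //; apply: dv.
  by exists 1, 0; rewrite mul1r mul0r addr0.
by exists 0, 1; rewrite mul1r mul0r add0r.
Qed.

(** Bezout's identity with denominators cleared. The prime p divides h r = e p, hence h or r: in the
    first case r is constant, in the second p divides a constant multiple of f. *)
Lemma coprime_const p f : prime_elt p -> (1 < size p)%N -> ~ dvd p f ->
  exists al be c, c != 0 /\ al * p + be * f = c%:P.
Proof.
move=> [p0 p1 pr] sp pf; have [r [al [be [r0 rE [e [e0 [h hE]]] re']]]] := common_divisor f p0.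
have nc c : c != 0 -> ~ dvd p c%:P.
  move=> c0 [d dE]; have : (size c%:P <= 1)%N by exact: size_polyC_leq1.
  rewrite dE size_mul //; last by apply: contra_neq c0 => d0; apply/eqP; rewrite -polyC_eq0 dE d0 mul0r.
  have : d != 0 by apply: contra_neq c0 => d0; apply/eqP; rewrite -polyC_eq0 dE d0 mul0r.
  by rewrite -size_poly_gt0; move: (size d) (size p) sp => x y; lia.
have [|ph|pr'] := pr h r; first by rewrite -hE; exists e%:P.
- exists al, be, r`_0; rewrite -rE; have [h1 h1E] := ph.
  have eE : e%:P = h1 * r.
    by apply: (mulIf p0); rewrite hE h1E; ring.
  have sr : (size r <= 1)%N.
    have h10 : h1 != 0 by apply: contra_neq e0 => d0; apply/eqP; rewrite -polyC_eq0 eE d0 mul0r.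
    have := size_polyC_leq1 e; rewrite eE size_mul //.
    by rewrite -size_poly_gt0 in h10; move: (size r) (size h1) h10 => x y; lia.
  have rC := size1_polyC sr; split; last by [].
  by apply: contra r0 => /eqP e'; rewrite rC e'.
- have [e' [e'0 re]] := re'; case: (pr e'%:P f) => [|/nc|//]; last by case.
  exact: dvd_trans pr' re.
Qed.

Lemma prime_cancel_const c p f : factored c -> (forall a, prime_elt a -> ~ dvd a%:P p) ->
  dvd p (c%:P * f) -> dvd p f.
Proof.
move=> fc np; elim: fc f => [u [v vu]|a b pa _ IH] f [h hE].
  by exists (v%:P * h); rewrite -mulrA -hE mulrA -polyCM -vu mul1r.
have [a0 _ _] := pa; have [_ _ pr] := prime_polyC pa.
have [|[h' h'E]|ap] := pr h p; first by rewrite -hE polyCM -mulrA mulrC; exists (b%:P * f).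
  apply: IH; exists h'; apply: (@mulfI _ a%:P); first by rewrite polyC_eq0.
  transitivity ((a * b)%:P * f); first by rewrite polyCM mulrA.
  by rewrite hE h'E; ring.
by case: (np a pa).
Qed.

(** Gauss's lemma. Among the polynomials of least positive degree that divide f up to constants, q
    is taken with the largest ideal of multiples, which makes it primitive; noetherianity replaces
    the content. *)
Lemma factorial_poly : noeth {poly R} -> factorial R -> factorial {poly R}.
Proof.
move=> nR fR f; have [k] := ubnP (size f); elim: k f => // k IH f; rewrite ltnS => sf f0.
have [s1|s1] := leqP (size f) 1.
  rewrite (size1_polyC s1); have : f`_0 != 0 by apply: contra f0 => /eqP e; rewrite (size1_polyC s1) e.
  move/fR; elim=> [u [c cu]|p a pp _ h].
    by apply: factored_unit; exists c%:P; rewrite -polyCM -cu.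
  by rewrite polyCM; apply: factored_mul => //; exact: prime_polyC.
pose cand d q := (1 < size q)%N /\ size q = d /\ exists c, c != 0 /\ dvd q (c%:P * f).
have [d [q0 cq0] mind] : exists2 d, exists q, cand d q &
    forall d' q, cand d' q -> (d <= d')%N.
  have ex : exists d, `[< exists q, cand d q >].
    exists (size f); apply/asboolP; exists f; split=> //; split=> //; exists 1.
    by rewrite oner_neq0 mul1r; split=> //; exact: dvd_refl.
  have [d /asboolP hd min] := ex_minnP ex; exists d => // d' q hq.
  by apply: min; apply/asboolP; exists q.
have [||I [[q [cq IE]] max]] := @noeth_maximal _ (fun I => exists q, cand d q /\ I = dvd q) nR.
- by move=> I [q [_ ->]]; exact: dvd_ideal.
- by exists (dvd q0), q0.
have [sq [sqd [c [c0 qf]]]] := cq.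
have q_n0 : q != 0 by rewrite -size_poly_gt0; apply: ltn_trans sq.
have np a : prime_elt a -> ~ dvd a%:P q.
  move=> [a0 a1 _] [q1 qE]; have q10 : q1 != 0 by apply: contra q_n0 => /eqP e; rewrite qE e mul0r.
  have sq1 : size q1 = size q.
    by rewrite qE mulrC mul_polyC size_scale.
  have c1 : exists q2, cand d q2 /\ dvd q1 = dvd q2.
    exists q1; split=> //; split; first by rewrite sq1.
    split; first by rewrite sq1.
    by exists c; split=> //; apply: dvd_trans qf; rewrite qE; exists a%:P; rewrite mulrC.
  have Iq1 : forall b, I b -> dvd q1 b.
    by rewrite IE => b; apply: dvd_trans; rewrite qE; exists a%:P; rewrite mulrC.
  have := max _ c1 Iq1 q1 (dvd_refl q1); rewrite IE => -[e' e'E]; apply: a1.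
  have ea : e' * a%:P = 1.
    by apply: (mulIf q10); rewrite mul1r {2}e'E qE; ring.
  by exists e'`_0; rewrite -coefMC ea coef1.
have canc b g : b != 0 -> dvd q (b%:P * g) -> dvd q g.
  by move=> b0; apply: prime_cancel_const => //; exact: fR.
have pq : prime_elt q.
  split=> // [[e eE]|a b qab].
    have e0 : e != 0 by apply: contra_eq_neq eE => ->; rewrite mul0r oner_eq0.
    have := size_poly1 R; rewrite eE size_mul //.
    by rewrite -size_poly_gt0 in e0; move: (size q) (size e) sq e0 => x y; lia.
  have [qa|nqa] := pselect (dvd q a); [by left|right].
  have [r [al [be [r0 rE [e [e0 [h hE]]] [e' [e'0 [h' h'E]]]]]]] := common_divisor a q_n0.
  have [sr|sr] := leqP (size r) 1.
    have rC := size1_polyC sr; apply: (canc r`_0).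
      by apply: contra r0 => /eqP E; rewrite rC E.
    rewrite -rC rE mulrDl; apply: dvdD; first by rewrite mulrAC; apply: dvd_mull; exact: dvd_refl.
    by rewrite -mulrA; exact: dvd_mull.
  have le : (size q <= size r)%N.
    rewrite sqd; apply: (mind _ r); split=> //; split=> //; exists (e * c); rewrite mulf_neq0 //; split=> //.
    rewrite polyCM -mulrA; case: qf => q' ->; exists (q' * h); rewrite -mulrA -hE; ring.
  have h0 : h != 0.
    by apply: contra_neq e0 => h0; move/eqP: hE; rewrite h0 mul0r mulf_eq0 (negbTE q_n0) orbF polyC_eq0 => /eqP.
  have sh : (size h <= 1)%N.
    have : size (e%:P * q) = size q by rewrite mul_polyC size_scale.
    by rewrite hE size_mul //; move: (size h) (size r) (size q) le sr => x y z; lia.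
  have hC := size1_polyC sh; case: nqa; apply: (canc (h`_0 * e')).
    by rewrite mulf_neq0 //; apply: contra h0 => /eqP E; rewrite hC E.
  by exists (h' * e%:P); rewrite -mulrA hE {2}hC polyCM -mulrA h'E; ring.
have [f' fE] : dvd q f by exact: canc qf.
have f'0 : f' != 0 by apply: contra f0 => /eqP e; rewrite fE e mul0r.
rewrite fE mulrC; apply: factored_mul => //; apply: IH => //.
move: sf; rewrite fE size_mul //; move: (size f') (size q) sq => x y; lia.
Qed.

Lemma monic_small (q r : {poly R}) : q \is monic -> (size r < size q)%N -> dvd q r -> r = 0.
Proof.
move=> qm lt [c cE]; apply/eqP; apply: contraTT lt => r0; rewrite -leqNgt cE.
have c0 : c != 0 by apply: contra r0 => /eqP e; rewrite cE e mul0r.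
rewrite size_Mmonic //; rewrite -size_poly_gt0 in c0; by move: (size c) (size q) c0 => x y; lia.
Qed.

Lemma monic_div q f : q \is monic -> exists d r, f = d * q + r /\ (size r < size q)%N.
Proof.
move=> qm; exists (Pdiv.Ring.rdivp f q), (Pdiv.Ring.rmodp f q); split.
  exact: Pdiv.RingMonic.rdivp_eq.
by apply: Pdiv.Ring.ltn_rmodpN0; exact: monic_neq0.
Qed.

Lemma dvd_monic g q : g \is monic -> dvd q g -> exists u v, [/\ u * v = 1, v *: q \is monic &
  forall f, dvd q f <-> dvd (v *: q) f].
Proof.
move=> gm [h hE]; have := monicP gm; rewrite hE lead_coefM => e.
exists (lead_coef q), (lead_coef h); split; first by rewrite mulrC.
  by apply/monicP; rewrite lead_coefZ.
move=> f; split=> [[x ->]|[x ->]].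
  by exists (lead_coef q *: x); rewrite -scalerAl -scalerAr scalerA [_ * lead_coef h]mulrC e scale1r.
by exists (lead_coef h *: x); rewrite -scalerAl scalerAr.
Qed.

(** A prime of R[T] that meets R in 0 comes from a prime of K[T], K the fraction field, and is
    therefore principal; the monic element g makes its generator monic. *)
Lemma principal_prime (Q : {poly R} -> Prop) g : factorial {poly R} -> prime_ideal Q ->
  (forall c, Q c%:P -> c = 0) -> g \is monic -> Q g ->
  exists p, [/\ p \is monic, prime_elt p, Q p, dvd p g & forall f, Q f -> dvd p f].
Proof.
move=> fR pQ Q0 gm Qg; have [[_ QD QM] Q1 pr] := pQ.
have [q [pq Qq qg]] := prime_factor pQ (fR _ (monic_neq0 gm)) Qg.
have [u [v [uv vm vE]]] := dvd_monic gm qg; exists (v *: q).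
have [q0 q1 qpr] := pq.
have pv : prime_elt (v *: q).
  split; first exact: monic_neq0.
    by move/vE.
  by move=> a b /vE/qpr [] /vE; [left|right].
have Qv : Q (v *: q) by rewrite -mul_polyC; exact: QM.
have sv : (1 < size (v *: q))%N.
  rewrite ltnNge; apply/negP => s1; have := size1_polyC s1 => e; have /Q0 e0 : Q ((v *: q)`_0)%:P by rewrite -e.
  by move: (monic_neq0 vm); rewrite e e0 eqxx.
split=> //; first exact/vE.
move=> f Qf; apply: contrapT => nf; have [al [be [c [c0 E]]]] := coprime_const pv sv nf.
by move/eqP: c0; apply; apply: Q0; rewrite -E; apply: QD; exact: QM.
Qed.
End Poly.

Definition mem2 (R : comNzRingType) (b r x : R) := exists s t, x = s * b + t * r.

Lemma mem2_ideal (R : comNzRingType) (b r : R) : is_ideal (mem2 b r).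
Proof.
split=> [|x y [s [t ->]] [s' [t' ->]]|x y [s [t ->]]]; first by exists 0, 0; rewrite !mul0r addr0.
  by exists (s + s'), (t + t'); ring.
by exists (x * s), (x * t); ring.
Qed.

Lemma factorial_upoly (L : fieldType) : factorial {poly L}.
Proof. by apply: factorial_poly; [apply: noeth_poly; exact: noeth_field|exact: factorial_field]. Qed.

(** The logarithmic derivative r' / r has at most simple poles, at prime factors of r, and all of
    these divide h. *)
Lemma dvd_deriv_mul (L : fieldType) (r h : {poly L}) d : r != 0 -> dvd r (h ^+ d) -> dvd r (r^`() * h).
Proof.
move/factorial_upoly; elim=> [u [v vu] _|p a pp _ IH ph].
  exists (u^`() * h * v); transitivity (u^`() * h * (v * u)); last by ring.
  by rewrite -vu mulr1.
have [a' a'E] : dvd a (a^`() * h) by apply: IH; apply: dvd_trans ph; exists p.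
have [h' hE] : dvd p h by apply: (prime_exp pp); apply: dvd_trans ph; exists a; rewrite mulrC.
exists (p^`() * h' + a'); rewrite derivM mulrDl -[p * a^`() * h]mulrA a'E hE; ring.
Qed.

(** * Conductors and extension across codimension two *)

Section Hartogs.
Variable R : idomainType.
Hypothesis fR : factorial R.
Implicit Types (x a pi rho u : {poly R}) (b c g al : R).

Lemma monic_cancel c x rho : rho \is monic -> c != 0 -> dvd rho (c%:P * x) -> dvd rho x.
Proof.
move=> rm c0; have [d [r [-> lt]]] := monic_div x rm => h.
have : c%:P * r = 0.
  apply: (monic_small rm); first by rewrite mul_polyC size_scale.
  by apply: (iffLR (dvd_subr _)) h; exists (c%:P * d); ring.
by move/eqP; rewrite mulf_eq0 polyC_eq0 (negbTE c0) => /eqP ->; exists d; rewrite addr0.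
Qed.

(** Modulo the monic [rho] the quotient is free over R, so that [al], which the prime g does not
    divide, is a regular element modulo g. *)
Lemma monic_mod g al x rho : rho \is monic -> prime_elt g -> ~ dvd g al ->
  mem2 g%:P rho (al%:P * x) -> mem2 g%:P rho x.
Proof.
move=> rm pg ng [s [t E]]; have [d [r [xE lt]]] := monic_div x rm.
have [d' [r' [sE lt']]] := monic_div s rm.
have rr : al%:P * r - r' * g%:P = 0.
  apply: (monic_small rm); last first.
    exists (d' * g%:P + t - al%:P * d); apply/eqP; rewrite -subr_eq0; apply/eqP.
    transitivity (al%:P * x - (s * g%:P + t * rho)); last by rewrite E subrr.
    by rewrite xE sE; ring.
  rewrite (leq_ltn_trans (size_polyD _ _)) // gtn_max size_polyN.
  by rewrite [r' * _]mulrC !mul_polyC !(leq_ltn_trans (size_scale_leq _ _)).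
have [_ _ prg] := prime_polyC pg.
have [|/dvd_polyC/(_ 0%N)|[r2 r2E]] := prg al%:P r; last by exists r2, d; rewrite xE r2E addrC.
  by exists r'; apply/eqP; rewrite -subr_eq0 rr.
by rewrite coefC.
Qed.

(** R[T]/(rho) is free over the factorial ring R, so divisibility by b can be tested at each prime
    factor g of b separately, up to powers of u and elements that g does not divide. A fraction a /
    b defined where u is nonzero, outside codimension two, thus extends there. *)
Lemma hartogs u a b rho : rho \is monic -> b != 0 ->
  (forall g, prime_elt g -> dvd g b -> exists al e, ~ dvd g al /\ mem2 b%:P rho (u ^+ e * al%:P * a)) ->
  exists e, mem2 b%:P rho (u ^+ e * a).
Proof.
move=> rm /fR; elim=> [v [w wv] _|g b' pg _ IH H].
  by exists 0%N, (a * w%:P), 0; rewrite expr0 mul1r mul0r addr0 -mulrA -polyCM -wv mulr1.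
have [g0 _ _] := pg; have [|al [e [ng [s [t E]]]]] := H g pg; first by exists b'; rewrite mulrC.
have [g' pg' [d dE]|e' [s' [t' E']]] := IH.
  have [|al' [e' [ng' [s' [t' E']]]]] := H g' pg'; first by exists (g * d); rewrite dE mulrA.
  by exists al', e'; split=> //; exists (s' * g%:P), t'; rewrite E' polyCM; ring.
have b'0 : b' != 0 \/ b' = 0 by case: eqVneq; [right|left].
case: b'0 => [b'0|b'0]; last first.
  by exists e', 0, t'; rewrite E' b'0 polyC0 mulr0 mul0r.
have : dvd rho (b'%:P * (u ^+ e * al%:P * s' - u ^+ e' * s * g%:P)).
  exists (u ^+ e' * t - u ^+ e * al%:P * t').
  apply: (addrI (u ^+ e * al%:P * t' * rho + u ^+ e' * (s * (g * b')%:P))).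
  transitivity (u ^+ e * al%:P * (s' * b'%:P + t' * rho)); first by rewrite polyCM; ring.
  transitivity (u ^+ e' * (s * (g * b')%:P + t * rho)); last by ring.
  by rewrite -E -E'; ring.
move/(monic_cancel rm b'0) => [h hE].
have [s2 [t2 E2]] : mem2 g%:P rho (u ^+ e * s').
  apply: (monic_mod rm pg ng); exists (u ^+ e' * s), h; rewrite -hE; ring.
exists (e + e')%N, s2, (t2 * b'%:P + u ^+ e * t').
rewrite exprD -mulrA E' mulrDr mulrA E2 polyCM; ring.
Qed.

(** A power of the derivative of [pi] carries elements a / b integral over R[T]/(pi) into this ring.
    Modulo a prime factor g of b the integral equation says that [pi] divides a^d; then
    [dvd_deriv_mul] puts pi' a in the ideal (g, pi), and b loses the factor g. *)
Lemma conductor pi b a d (c : nat -> {poly R}) : pi \is monic -> b != 0 ->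
  dvd pi (a ^+ d + \sum_(i < d) c i * a ^+ i * b%:P ^+ (d - i)) ->
  exists M, mem2 b%:P pi (pi^`() ^+ M * a).
Proof.
move=> pm /fR fb; elim: fb a c => [v [w wv] a c _|g b' pg _ IH a c H].
  by exists 0%N, (a * w%:P), 0; rewrite expr0 mul1r mul0r addr0 -mulrA -polyCM -wv mulr1.
have [g0 _ _] := pg.
have [L [h [hE HE]]] := prime_map pg; have hg : h g = 0 by apply/hE; exact: dvd_refl.
have [a1 [t1 aE]] : mem2 g%:P pi (pi^`() * a).
  have [t tE] : dvd (map_poly h pi) ((map_poly h pi)^`() * map_poly h a).
    apply: (@dvd_deriv_mul _ _ _ d); first by exact: (monic_neq0 (monic_map h pm)).
    have [q qE] := H; exists (map_poly h q); rewrite -rmorphM -qE rmorphD rmorphXn rmorph_sum /=.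
    rewrite big1 ?addr0 // => i _.
    have hz : map_poly h (g * b')%:P = 0 by rewrite map_polyC /= rmorphM hg mul0r.
    have hz' : map_poly h ((g * b')%:P ^+ (d - i)) = 0.
      by rewrite rmorphXn /= hz expr0n subn_eq0 leqNgt ltn_ord.
    by rewrite rmorphM /= hz' mulr0.
  have [q [r [E lt]]] := monic_div (pi^`() * a) pm.
  have : map_poly h r = 0.
    apply: (monic_small (monic_map h pm)).
      by rewrite (leq_ltn_trans (size_poly _ _)) // size_map_poly_id0 // (monicP pm) rmorph1 oner_neq0.
    exists (t - map_poly h q); rewrite mulrBl -tE deriv_map -rmorphM E rmorphD rmorphM /=; ring.
  by move/(iffLR (HE _)) => [r' rE]; exists r', q; rewrite E rE addrC.
have [|M [s [t E]]] := IH a1 (fun i => c i * pi^`() ^+ (d - i)).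
  have gd0 : g ^+ d != 0 by rewrite expf_neq0.
  apply: (monic_cancel pm gd0).
  have [q qE] := H.
  have sub i : dvd pi ((pi^`() * a) ^+ i - (a1 * g%:P) ^+ i).
    rewrite aE subrXX; exists (t1 * \sum_(j < i) (a1 * g%:P + t1 * pi) ^+ (i.-1 - j) * (a1 * g%:P) ^+ j).
    ring.
  have : dvd pi (pi^`() ^+ d * (a ^+ d + \sum_(i < d) c i * a ^+ i * (g * b')%:P ^+ (d - i))).
    by apply: dvd_mull; exact: H.
  apply: (iffLR (dvd_subr _)).
  have -> : pi^`() ^+ d * (a ^+ d + \sum_(i < d) c i * a ^+ i * (g * b')%:P ^+ (d - i)) =
     (pi^`() * a) ^+ d + \sum_(i < d) c i * pi^`() ^+ (d - i) * (pi^`() * a) ^+ i * (g * b')%:P ^+ (d - i).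
    rewrite mulrDr -exprMn mulr_sumr; congr (_ + _); apply: eq_bigr => i _.
    rewrite -{1}(subnK (ltnW (ltn_ord i))) exprD exprMn; ring.
  have -> : (g ^+ d)%:P * (a1 ^+ d + \sum_(i < d) c i * pi^`() ^+ (d - i) * a1 ^+ i * b'%:P ^+ (d - i)) =
     (a1 * g%:P) ^+ d + \sum_(i < d) c i * pi^`() ^+ (d - i) * (a1 * g%:P) ^+ i * (g * b')%:P ^+ (d - i).
    rewrite rmorphXn mulrDr exprMn mulrC mulr_sumr; congr (_ + _); apply: eq_bigr => i _.
    rewrite -{1}(subnK (ltnW (ltn_ord i))) exprD /= polyCM !exprMn; ring.
  rewrite opprD addrACA -sumrB; apply: dvdD => //.
  apply: (big_ind (dvd pi)) => [|x y|i _]; [by exists 0; rewrite mul0r|exact: dvdD|].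
  rewrite -mulrBl -mulrBr; apply: dvd_mulr; apply: dvd_mull; exact: sub.
exists M.+1, s, (t * g%:P + pi^`() ^+ M * t1).
rewrite exprSr -mulrA aE mulrDr mulrA E polyCM; ring.
Qed.

Lemma integral_scale (pi a b : {poly R}) d (c : nat -> {poly R}) (w al : {poly R}) : dvd pi (w * a ^+ d + \sum_(i < d) c i * a ^+ i * b ^+ (d - i)) ->
  (0 < d)%N -> exists c' : nat -> {poly R}, dvd pi ((al * (w * a)) ^+ d + \sum_(i < d) c' i * (al * (w * a)) ^+ i * (al * b) ^+ (d - i)).
Proof.
move=> H d0; exists (fun i => c i * w ^+ (d.-1 - i)).
have := dvd_mull (al ^+ d * w ^+ d.-1) H; congr (dvd pi _).
rewrite mulrDr !exprMn; congr (_ + _).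
  have -> : w ^+ d = w * w ^+ d.-1 by rewrite -exprS prednK.
  ring.
rewrite mulr_sumr; apply: eq_bigr => i _; rewrite !exprMn.
have -> : al ^+ d = al ^+ i * al ^+ (d - i) by rewrite -exprD subnKC // ltnW.
have -> : w ^+ d.-1 = w ^+ (d.-1 - i) * w ^+ i by rewrite -exprD subnK // -ltnS prednK.
ring.
Qed.

(** The denominator of [conductor] is a constant: multiplying a and b by [be] replaces b by the
    constant e modulo [pi]. *)
Lemma conductor_gen (pi a b : {poly R}) d (c : nat -> {poly R}) : pi \is monic -> prime_elt pi -> (0 < d)%N ->
  ~ dvd pi b -> dvd pi (a ^+ d + \sum_(i < d) c i * a ^+ i * b ^+ (d - i)) ->
  exists M, mem2 b pi (pi^`() ^+ M * a).
Proof.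
move=> pm pp d0 nb H; have [p0 p1 pr] := pp.
have sp : (1 < size pi)%N.
  rewrite ltnNge; apply/negP => s1; apply: p1; have := size1_polyC s1 => e.
  have := monicP pm; rewrite e lead_coefC => ->; exact: dvd_refl.
have [al [be [e [e0 E]]]] := coprime_const pp sp nb.
have [|c' H'] := @integral_scale pi a b d c 1 be _ d0; first by rewrite mul1r.
rewrite mul1r in H'.
have nbe : ~ dvd pi be.
  move=> [x xE]; move/eqP: e0; apply; apply/eqP; rewrite -polyC_eq0; apply/eqP.
  apply: (monic_small pm); first exact: leq_ltn_trans (size_polyC_leq1 _) sp.
  by exists (al + x * b); rewrite -E xE; ring.
have [|M [s [t Et]]] := @conductor pi e (be * a) d c' pm e0.
  apply: (iffLR (dvd_subr _)) H'; rewrite opprD addrACA subrr add0r -sumrB.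
  apply: (big_ind (dvd pi)) => [|x y|i _]; [by exists 0; rewrite mul0r|exact: dvdD|].
  rewrite -mulrBr; apply: dvd_mull; rewrite subrXX; apply: dvd_mulr.
  by exists (- al); rewrite -E; ring.
exists M; have : dvd pi (be * (pi^`() ^+ M * a - s * b)).
  exists (t + s * al); transitivity (pi^`() ^+ M * (be * a) - s * (be * b)); first by ring.
  rewrite Et -E; ring.
case/pr => [//|[x xE]]; exists s, x; rewrite -xE; ring.
Qed.
End Hartogs.

(* Serre's criterion, in coordinates, for the localisation at Q of the hypersurface rho = 0:
   [big] says that the part of its singular locus where u <> 0 has codimension at least two. *)
Section LocalNormal.
Variables (R : idomainType) (rho u : {poly R}) (Q : {poly R} -> Prop).
Variables (I : Type) (der : I -> {poly R} -> {poly R}).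
Hypothesis fR : factorial R.
Hypothesis fU : factorial {poly R}.
Hypothesis rm : rho \is monic.
Hypothesis pQ : prime_ideal Q.
Hypothesis Qrho : Q rho.
Hypothesis Qu : ~ Q u.
Hypothesis nosq : forall p, prime_elt p -> Q p -> ~ dvd (p * p) rho.

Let QD x y : Q x -> Q y -> Q (x + y). Proof. by case: pQ => -[_ + _] _ _; apply. Qed.
Let QM x y : Q y -> Q (x * y). Proof. by case: pQ => -[_ _ +] _ _; apply. Qed.
Let Qdvd x y : Q x -> dvd x y -> Q y. Proof. by move=> Qx [z ->]; exact: QM. Qed.
Let Qpr x y : Q (x * y) -> Q x \/ Q y. Proof. by case: pQ => _ _; apply. Qed.
Let Qexp x e : ~ Q x -> ~ Q (x ^+ e).
Proof.
move=> Qx; elim: e => [|e IH]; first by rewrite expr0; case: pQ.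
by rewrite exprS => /Qpr [].
Qed.

(** Prime factors of [rho] outside Q become units in the localisation, and those in Q are simple. *)
Lemma local_reduced a w k : ~ Q w -> dvd rho (w * a ^+ k) -> exists w', ~ Q w' /\ dvd rho (w' * a).
Proof.
move=> Qw; have := nosq; elim: (fU (monic_neq0 rm)) => [v [z zv] _ _|p r pp _ IH ns H].
  exists 1; split; first by case: pQ.
  by exists (a * z); transitivity (a * (z * v)); [rewrite -zv mulr1 mul1r|ring].
have [||w' [Qw' [h hE]]] := IH.
- move=> p' pp' Qp' d; apply: (ns p' pp' Qp'); exact: dvd_mull.
- by apply: dvd_trans H; exists p.
have [Qp|nQp] := pselect (Q p); last first.
  exists (w' * p); split; first by case/Qpr.
  by exists h; rewrite mulrAC hE; ring.
exists w'; split=> //; have [_ _ pr] := pp.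
have [|pw|pa] := pr w (a ^+ k); first by apply: dvd_trans H; exists r; rewrite mulrC.
  by case: Qw; exact: Qdvd Qp pw.
have [|[h' h'E]|[r' r'E]] := pr h r; first by rewrite -hE; apply: dvd_mull; exact: prime_exp pa.
  by exists h'; rewrite hE h'E; ring.
by case: (ns p pp Qp); exists r'; rewrite r'E; ring.
Qed.

Hypothesis derM : forall i x y, der i (x * y) = x * der i y + der i x * y.
Hypothesis big : forall D, is_ideal D ->
  (forall q, prime_ideal q -> (forall x, D x -> q x) -> ~ q u -> q rho /\ forall i, q (der i rho)) ->
  forall g, prime_elt g -> exists al e, ~ dvd g al /\ D (u ^+ e * al%:P).
Hypothesis cond : forall p a b d (c : nat -> {poly R}), p \is monic -> prime_elt p -> dvd p rho ->
  ~ dvd p b -> (0 < d)%N -> dvd p (a ^+ d + \sum_(i < d) c i * a ^+ i * b ^+ (d - i)) ->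
  forall r, prime_ideal r -> (forall x, mem2 b p (x * a) -> r x) -> forall i, r (der i p).

Let monic_factor p : prime_elt p -> dvd p rho -> exists p', [/\ p' \is monic, prime_elt p', dvd p' rho &
  forall f, dvd p f <-> dvd p' f].
Proof.
move=> [p0 p1 pr] pd; have [v [z [vz zm zE]]] := dvd_monic rm pd; exists (z *: p); split=> //.
  split; first exact: monic_neq0.
    by move/zE.
  by move=> x y /zE/pr [] /zE; [left|right].
exact/zE.
Qed.

Let size_prime (p : {poly R}) : p \is monic -> prime_elt p -> (1 < size p)%N.
Proof.
move=> pm [p0 p1 pr]; rewrite ltnNge; apply/negP => s1; apply: p1; have := size1_polyC s1 => e.
by have := monicP pm; rewrite e lead_coefC => ->; exact: dvd_refl.
Qed.

Let mult_ideal (x b p : {poly R}) : is_ideal (fun d => mem2 b p (d * x)).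
Proof.
have [m0 mD mM] := mem2_ideal b p; split; first by rewrite mul0r.
  by move=> a c ha hc; rewrite mulrDl; exact: mD.
by move=> a c hc; rewrite -mulrA; exact: mM.
Qed.

Lemma local_domain : exists p c, [/\ p \is monic, prime_elt p, Q p, rho = p * c & ~ Q c].
Proof.
have [p0 [pp0 Qp0 pd0]] := prime_factor pQ (fU (monic_neq0 rm)) Qrho.
have [p [pm pp pd pE]] := monic_factor pp0 pd0.
have Qp : Q p by apply: Qdvd Qp0 _; apply/pE; exact: dvd_refl.
have [c cE] := pd; rewrite mulrC in cE; exists p, c; split=> // Qc.
have c0 : c != 0 by apply: contraTneq rm => c0; rewrite cE c0 mulr0 monicE lead_coef0 eq_sym oner_eq0.
have [q0 [qq0 Qq0 qd0]] := prime_factor pQ (fU c0) Qc.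
have [|q [qm qq qd qE]] := monic_factor qq0 _; first by rewrite cE; exact: dvd_mull.
have Qq : Q q by apply: Qdvd Qq0 _; apply/qE; exact: dvd_refl.
have qc : dvd q c by apply/qE.
have sp := size_prime pm pp; have [_ _ prp] := pp; have [_ _ prq] := qq.
have [pq|npq] := pselect (dvd p q).
  by apply: (nosq pp Qp); have [x xE] := dvd_trans pq qc; exists x; rewrite cE xE; ring.
have [s [t [b [b0 E]]]] := coprime_const pp sp npq.
have constN r : r \is monic -> prime_elt r -> ~ dvd r b%:P.
  move=> rm' pr'; move=> h; move/eqP: b0; apply; apply/eqP; rewrite -polyC_eq0; apply/eqP.
  apply: (monic_small rm') h; exact: leq_ltn_trans (size_polyC_leq1 _) (size_prime rm' pr').
have pqm : p * q \is monic by rewrite monicMr.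
have [c' c'E] : dvd (p * q) rho by have [x xE] := qc; exists x; rewrite cE xE; ring.
have [|e [x [y H]]] := @hartogs _ fR u (t * q) b (p * q) pqm b0.
  move=> g pg _; apply: (big (mult_ideal (t * q) b%:P (p * q))) pg => r pr Dr nru.
  have [[_ rD rM] _ _] := pr.
  have rp : r p by apply: Dr; exists 0, t; ring.
  have rq : r q by apply: Dr; exists q, (- s); rewrite -E; ring.
  rewrite c'E; split; first by apply/rM/rM.
  by move=> i; rewrite !derM; apply: (rD); [apply/rM/rD; [rewrite mulrC; exact: rM|exact: rM]|apply/rM/rM].
have pe : dvd p (u ^+ e - x).
  have [|//|[z zE]] := prp (u ^+ e - x) (t * q).
    exists (x * s + y * q); transitivity (u ^+ e * (t * q) - x * (t * q)); first by ring.
    rewrite H -E; ring.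
  by case: (constN p pm pp); rewrite -E; exists (s + z); rewrite mulrDl zE; ring.
have qx : dvd q x.
  have [|//|[z zE]] := prq x (s * p).
    exists (u ^+ e * t - y * p - x * t); transitivity (u ^+ e * (t * q) - y * (p * q) - x * (t * q)); last by ring.
    rewrite H -E; ring.
  by case: (constN q qm qq); rewrite -E zE; exists (z + t); ring.
apply: (Qexp (e := e) Qu); rewrite -(subrK x (u ^+ e)); apply: QD; [exact: Qdvd Qp pe|exact: Qdvd Qq qx].
Qed.

Lemma local_integral a b w : ~ Q w -> dvd rho (w * (a * b)) ->
  exists w', ~ Q w' /\ (dvd rho (w' * a) \/ dvd rho (w' * b)).
Proof.
have [p [c [pm [p0 p1 pr] Qp rE Qc]]] := local_domain.
move=> Qw /(dvd_trans (b := rho) (a := p)) h; have {h} : dvd p (w * (a * b)).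
  by apply: h; exists c; rewrite rE mulrC.
case/pr => [pw|/pr [] [z zE]]; first by case: Qw; exact: Qdvd Qp pw.
  by exists c; split=> //; left; exists z; rewrite zE rE; ring.
by exists c; split=> //; right; exists z; rewrite zE rE; ring.
Qed.

(** With the denominator made constant, a prime containing the denominators of a1 / e contains the
    derivatives of p by [cond], so it lies in the singular locus, which [big] puts in codimension
    two; [hartogs] extends the fraction. *)
Lemma local_normal a b w d (c : nat -> {poly R}) : ~ Q w -> (forall w', ~ Q w' -> ~ dvd rho (w' * b)) ->
  dvd rho (w * a ^+ d + \sum_(i < d) c i * a ^+ i * b ^+ (d - i)) ->
  exists w' h, ~ Q w' /\ dvd rho (w' * a - h * b).
Proof.
have [p [k [pm pp Qp rE Qk]]] := local_domain; have [p0 p1 pr] := pp.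
have pd : dvd p rho by exists k; rewrite rE mulrC.
have sp := size_prime pm pp.
move=> Qw nb H; have {nb} pb : ~ dvd p b.
  by move=> [x xE]; apply: (nb k Qk); exists x; rewrite xE rE; ring.
have {}H := dvd_trans pd H.
have d0 : (0 < d)%N.
  case: d H => // H; case: Qw; apply: Qdvd Qp _; move: H; by rewrite big_ord0 addr0 expr0 mulr1.
have [al [be [e [e0 E]]]] := coprime_const pp sp pb.
have [c' H1] := integral_scale be H d0.
have nce : ~ dvd p e%:P.
  move=> h; move/eqP: e0; apply; apply/eqP; rewrite -polyC_eq0; apply/eqP.
  apply: (monic_small pm) h; exact: leq_ltn_trans (size_polyC_leq1 _) sp.
pose a1 := be * (w * a).
have H2 : dvd p (a1 ^+ d + \sum_(i < d) c' i * a1 ^+ i * e%:P ^+ (d - i)).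
  apply: (iffLR (dvd_subr _)) H1; rewrite opprD addrACA subrr add0r -sumrB.
  apply: (big_ind (dvd p)) => [|x y|i _]; [by exists 0; rewrite mul0r|exact: dvdD|].
  rewrite -mulrBr; apply: dvd_mull; rewrite subrXX; apply: dvd_mulr.
  by exists (- al); rewrite -E; ring.
have [|e' [x [y H3]]] := @hartogs _ fR u a1 e p pm e0.
  move=> g pg _; apply: (big (mult_ideal a1 e%:P p)) pg => r pr' Dr nru.
  have [[_ rD rM] r1 rpr] := pr'.
  have rp : r p by apply: Dr; exists 0, a1; ring.
  have rd i : r (der i p) by exact: (cond pm pp pd nce d0 H2 pr' Dr).
  rewrite rE; split; first by rewrite mulrC; exact: rM.
  by move=> i; rewrite derM; apply: rD; [rewrite mulrC; exact: rM|rewrite mulrC; exact: rM].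
exists (k * (u ^+ e' * w)), (k * x); split.
  by case/Qpr => // /Qpr [|//]; exact: Qexp.
have : dvd p (be * (u ^+ e' * w * a - x * b)).
  exists (y + x * al); transitivity (u ^+ e' * a1 - x * (be * b)); first by rewrite /a1; ring.
  rewrite H3 -E; ring.
case/pr => [[z zE]|[z zE]].
  by case: nce; exists (al + z * b); rewrite -E zE; ring.
by exists z; transitivity (k * (u ^+ e' * w * a - x * b)); [ring|rewrite zE rE; ring].
Qed.
End LocalNormal.

Lemma mdeg_widen_max d (m : 'X_{1..d.+1}) :
  mdeg m = (mdeg [multinom m (widen_ord (leqnSn d) i) | i < d] + m ord_max)%N.
Proof. by rewrite !mdegE big_ord_recr /=; congr addn; apply: eq_bigr => i _; rewrite mnmE. Qed.

(** * Charts *)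

Section UpolyIso.
Variable F : closedFieldType.

Lemma of_upolyX d : of_upoly 'X = 'X_ord_max :> {mpoly F[d.+1]}.
Proof. by rewrite /of_upoly horner_morphX. Qed.
Lemma of_upolyC d (a : {mpoly F[d]}) : of_upoly a%:P = mwiden a.
Proof. by rewrite /of_upoly horner_morphC. Qed.

Lemma of_upolyD d (p q : {poly {mpoly F[d]}}) : of_upoly (p + q) = of_upoly p + of_upoly q.
Proof. exact: rmorphD. Qed.
Lemma of_upolyM d (p q : {poly {mpoly F[d]}}) : of_upoly (p * q) = of_upoly p * of_upoly q.
Proof. exact: rmorphM. Qed.

Lemma muni_mon d (m : 'X_{1..d.+1}) : muni 'X_[m] =
  'X_[[multinom m (widen_ord (leqnSn d) i) | i < d]] *: 'X^(m ord_max) :> {poly {mpoly F[d]}}.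
Proof. by rewrite muniE msuppX big_seq1 mcoeffX eqxx scale1r. Qed.

Lemma muniXmax d : muni 'X_ord_max = 'X :> {poly {mpoly F[d]}}.
Proof.
rewrite muni_mon mnm1E eqxx expr1 (_ : [multinom _ | i < d] = 0%MM) ?mpolyX0 ?scale1r //.
by apply/mnmP => i; rewrite mnmE mnm1E mnm0E; case: eqP => // /(congr1 val) /= e; move: (ltn_ord i); rewrite -e ltnn.
Qed.

Lemma muniXwiden d (k : 'I_d) : muni 'X_(widen_ord (leqnSn d) k) = ('X_k)%:P :> {poly {mpoly F[d]}}.
Proof.
rewrite muni_mon mnm1E (_ : (_ == _) = false) ?expr0 ?alg_polyC; last first.
  by apply/eqP => /(congr1 val) /= e; move: (ltn_ord k); rewrite e ltnn.
by congr ('X_[_])%:P; apply/mnmP => i; rewrite mnmE !mnm1E -!val_eqE.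
Qed.

Lemma mwidenXU d (k : 'I_d) : mwiden 'X_k = 'X_(widen_ord (leqnSn d) k) :> {mpoly F[d.+1]}.
Proof. by rewrite mwidenX mnmwiden1. Qed.

Lemma widen_max d (i : 'I_d.+1) : i = ord_max \/ exists k, i = widen_ord (leqnSn d) k.
Proof.
have [k ->|->] := unliftP ord_max i; last by left.
by right; exists k; apply: val_inj; rewrite /= /bump leqNgt ltn_ord.
Qed.

Lemma muniK d : cancel (@muni d F) (@of_upoly F d).
Proof.
move=> p0; elim/mpoly_alg_ind: p0 => [c|i|p q IHp IHq|p q IHp IHq].
- by rewrite muniC of_upolyC mwidenC.
- have [->|[k ->]] := widen_max i; first by rewrite muniXmax of_upolyX.
  by rewrite muniXwiden of_upolyC mwidenXU.
- rewrite muniD of_upolyD; exact: f_equal2 IHp IHq.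
- rewrite muniM of_upolyM; exact: f_equal2 IHp IHq.
Qed.

Lemma muni_mwiden d (a : {mpoly F[d]}) : muni (mwiden a) = a%:P.
Proof.
elim/mpoly_alg_ind: a => [c|i|p q IHp IHq|p q IHp IHq].
- by rewrite mwidenC muniC.
- by rewrite mwidenXU muniXwiden.
- by rewrite mwidenD muniD IHp IHq polyCD.
- by rewrite mwidenM muniM IHp IHq polyCM.
Qed.

Lemma of_upolyK d : cancel (@of_upoly F d) (@muni d F).
Proof.
move=> p; elim/poly_ind: p => [|p c IH]; first by rewrite !rmorph0.
by rewrite of_upolyD of_upolyM of_upolyX of_upolyC muniD muniM IH muniXmax muni_mwiden.
Qed.

Lemma factorial_mpoly d : factorial {mpoly F[d]}.
Proof.
elim: d => [|d IH].
  apply: (@factorial_iso F _ (@mpolyC 0 F) (meval (fun=> 0))); last exact: factorial_field.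
    by move=> c; rewrite /= mevalC.
  by move=> p; have [c ->] := mpoly0C p; rewrite /= mevalC.
apply: (factorial_iso (@of_upolyK d) (@muniK d)).
by apply: factorial_poly => //; apply: noeth_poly; exact: noeth_mpoly.
Qed.

Lemma factorial_mpoly_poly d : factorial {poly {mpoly F[d]}}.
Proof. by apply: factorial_poly; [apply: noeth_poly; exact: noeth_mpoly|exact: factorial_mpoly]. Qed.

Lemma mderiv_mwiden d (a : {mpoly F[d]}) : (mwiden a)^`M(ord_max) = 0.
Proof.
elim/mpoly_alg_ind: a => [c|i|p q IHp IHq|p q IHp IHq].
- by rewrite mwidenC mderivC.
- rewrite mwidenXU mderivXU (_ : (_ == _) = false) //.
  by apply/eqP => /(congr1 val) /= e; move: (ltn_ord i); rewrite -e ltnn.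
- by rewrite mwidenD mderivD IHp IHq addr0.
- by rewrite mwidenM mderivM IHp IHq mulr0 mul0r addr0.
Qed.

Lemma mderiv_of_upoly d (p : {poly {mpoly F[d]}}) : (of_upoly p)^`M(ord_max) = of_upoly p^`().
Proof.
elim/poly_ind: p => [|p c IH]; first by rewrite deriv0 !rmorph0 mderiv0.
rewrite derivD derivM derivX derivC addr0 mulr1 !(of_upolyD, of_upolyM) of_upolyX of_upolyC.
by rewrite mderivD mderivM IH mderiv_mwiden addr0 mderivXU eqxx mulr1.
Qed.

Lemma mderiv_msub k d (g : 'I_k -> {mpoly F[d]}) p b :
  (msub g p)^`M(b) = \sum_i msub g p^`M(i) * (g i)^`M(b).
Proof.
elim/mpoly_alg_ind: p => [c|i|p q IHp IHq|p q IHp IHq].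
- by rewrite /msub mmapC mderivC big1 // => i _; rewrite mderivC raddf0 mul0r.
- rewrite (bigD1 i) //= big1 ?addr0 => [|a ai].
    by rewrite mderivXU eqxx rmorph1 mul1r /msub mmapX mmap1U.
  by rewrite mderivXU (negbTE ai) rmorph0 mul0r.
- rewrite rmorphD /= mderivD IHp IHq -big_split; apply: eq_bigr => i _.
  by rewrite mderivD rmorphD mulrDl.
- rewrite rmorphM /= mderivM IHp IHq mulr_suml mulr_sumr -big_split; apply: eq_bigr => i _ /=.
  rewrite mderivM rmorphD !rmorphM /=; ring.
Qed.

Lemma pihomog_muni d (h : {mpoly F[d.+1]}) e i : (muni (pihomog mdeg e h))`_i =
  if (i <= e)%N then pihomog mdeg (e - i) (muni h)`_i else 0.
Proof.
have gen (a a' b b' : {poly {mpoly F[d]}}) : a`_i = (if (i <= e)%N then pihomog mdeg (e - i) b`_i else 0) ->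
    a'`_i = (if (i <= e)%N then pihomog mdeg (e - i) b'`_i else 0) ->
    (a + a')`_i = if (i <= e)%N then pihomog mdeg (e - i) (b + b')`_i else 0.
  by move=> E E'; rewrite !coefD E E'; case: ifP => _; rewrite ?addr0 // pihomogD.
elim/mpolyind: h => [|c m h _ _ IH]; first by rewrite pihomog0 muni0 coef0 pihomog0 if_same.
have -> : muni (c *: 'X_[m] + h) = muni (c *: 'X_[m]) + muni h by exact: muniD.
have -> : pihomog mdeg e (c *: 'X_[m] + h) = pihomog mdeg e (c *: 'X_[m]) + pihomog mdeg e h by exact: pihomogD.
have -> : muni (pihomog mdeg e (c *: 'X_[m]) + pihomog mdeg e h) =
  muni (pihomog mdeg e (c *: 'X_[m])) + muni (pihomog mdeg e h) by exact: muniD.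
apply: gen IH; set t := 'X_[m].
set t' : {mpoly F[d]} := 'X_[[multinom m (widen_ord (leqnSn d) i0) | i0 < d]].
have mt : muni t = t' *: 'X^(m ord_max) by exact: muni_mon.
have -> : muni (c *: t) = c%:MP *: muni t by exact: muniZ.
have -> : muni (pihomog mdeg e (c *: t)) = c%:MP *: (if mdeg m == e then muni t else 0).
  by rewrite linearZ /= pihomogX muniZ; case: ifP => _ //; rewrite muni0.
move: (muni t) mt => w ->.
rewrite !coefZ !mul_mpolyC.
have -> : pihomog mdeg (e - i) (c *: (t' * ('X^(m ord_max))`_i)) = c *: pihomog mdeg (e - i) (t' * ('X^(m ord_max))`_i) by rewrite linearZ.
have -> : (if mdeg m == e then t' *: 'X^(m ord_max) else 0)`_i =
  if mdeg m == e then (t' *: 'X^(m ord_max))`_i else 0 by case: ifP; rewrite ?coef0.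
rewrite ?coefZ coefXn; have [->|ne] := eqVneq i (m ord_max); last by rewrite mulr0 pihomog0 scaler0 !if_same scaler0.
rewrite mulr1 pihomogX (mdeg_widen_max m); case: (leqP (m ord_max) e) => ie.
  by rewrite -[in LHS](subnK ie) eqn_add2r.
by rewrite gtn_eqF ?scaler0 // (leq_trans ie) // leq_addl.
Qed.

Lemma msub_homog k d (g : 'I_k -> {mpoly F[d]}) q e : (forall i, g i \is 1%N.-homog) ->
  q \is e.-homog -> msub g q \is e.-homog.
Proof.
move=> hg hq; rewrite [q]mpolyE big_seq rmorph_sum; apply: rpred_sum => m mq /=.
rewrite -mul_mpolyC rmorphM /= /msub mmapC mul_mpolyC; apply: rpredZ.
rewrite mmapX /mmap1; have <- : mdeg m = e by move/dhomogP: hq; apply.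
rewrite mdegE; elim/big_ind2: _ => [|p e1 q' e2 h1 h2|i _]; [exact: dhomog1|exact: dhomogM|].
elim: (m i) => [|N IH]; first by rewrite expr0; exact: dhomog1.
by rewrite exprS -add1n; apply: dhomogM.
Qed.

Lemma pihomog_msub k d (g : 'I_k -> {mpoly F[d]}) Q e : (forall i, g i \is 1%N.-homog) ->
  pihomog mdeg e (msub g Q) = msub g (pihomog mdeg e Q).
Proof.
move=> hg; have le : (msize Q <= maxn (msize Q) e.+1)%N by exact: leq_maxl.
rewrite {1}(pihomog_partitionE (mf := mdeg) le) rmorph_sum (linear_sum (pihomog mdeg e)) /=.
have lte : (e < maxn (msize Q) e.+1)%N by exact: leq_maxr.
rewrite (bigD1 (Ordinal lte)) //= pihomog_dE; last by apply: msub_homog => //; exact: pihomogP.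
rewrite big1 ?addr0 // => a ae; apply: (@pihomog_ne0 _ _ _ a).
  by apply: contra ae => /eqP e'; apply/eqP; exact: val_inj.
by apply: msub_homog => //; exact: pihomogP.
Qed.

(** Homogeneity accompanies monicity because it lets a general linear change of variables keep the
    polynomial monic up to a constant. *)
Definition tame k (p : {poly {mpoly F[k]}}) := p \is monic /\ of_upoly p \is (size p).-1.-homog.

(** The component of degree size p - 1 is monic of that degree in the last variable, so it differs
    from p by a multiple of p of smaller degree, which is 0. *)
Lemma tame_pihomog k (p : {poly {mpoly F[k]}}) : p \is monic ->
  dvd p (muni (pihomog mdeg (size p).-1 (of_upoly p))) -> tame p.
Proof.
move=> pm; set d := (size p).-1; set h := muni _ => pdv.
have sp : size p = d.+1 by rewrite prednK // size_poly_gt0 monic_neq0.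
split=> //; have -> : of_upoly p = of_upoly h; last by rewrite muniK; exact: pihomogP.
congr of_upoly; apply/eqP; rewrite -subr_eq0; apply/eqP; apply: (monic_small pm); last first.
  by apply: dvdB pdv; exact: dvd_refl.
rewrite sp ltnS; apply/leq_sizeP => i di; rewrite coefB /h pihomog_muni of_upolyK.
have [/eqP E|ne] := eqVneq i d; last first.
  by rewrite leqNgt ltn_neqAle eq_sym ne di /= subr0 nth_default // sp ltn_neqAle eq_sym ne.
have -> : p`_i = 1 by rewrite (eqP E); exact: (monicP pm).
by rewrite (eqP E) leqnn subnn pihomog_dE ?subrr //; exact: dhomog1.
Qed.
End UpolyIso.

Section Hypersurface.
Variables (F : closedFieldType) (n : nat).
Local Notation S := {mpoly F[n.+1]}.
Local Notation V := 'rV[F]_n.+1.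
Local Notation P := (proj F n).
Implicit Types (X Y Z C : set P).
Hypothesis charF : forall k, k.+1%:R != 0 :> F.

Lemma thetaD k (c : 'I_k -> V) p q : theta c (p + q) = theta c p + theta c q.
Proof. exact: rmorphD. Qed.
Lemma thetaM k (c : 'I_k -> V) p q : theta c (p * q) = theta c p * theta c q.
Proof. exact: rmorphM. Qed.
Lemma theta0 k (c : 'I_k -> V) : theta c 0 = 0.
Proof. exact: rmorph0. Qed.
Lemma theta1 k (c : 'I_k -> V) : theta c 1 = 1.
Proof. exact: rmorph1. Qed.

Lemma theta_mwiden k (c : 'I_k.+1 -> V) Q :
  theta c (mwiden Q) = theta (fun a => c (widen_ord (leqnSn k) a)) Q.
Proof.
elim/mpoly_alg_ind: Q => [a|i|p q IHp IHq|p q IHp IHq].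
- by rewrite mwidenC !thetaC.
- by rewrite mwidenXU !thetaX.
- by rewrite mwidenD !thetaD IHp IHq.
- by rewrite mwidenM !thetaM IHp IHq.
Qed.

Lemma theta_of_upoly k (c : 'I_k.+1 -> V) p : theta c (of_upoly p) =
  (map_poly (theta (fun a => c (widen_ord (leqnSn k) a))) p).[linear_form (c ord_max)].
Proof.
elim/poly_ind: p => [|p a IH]; first by rewrite !rmorph0 horner0.
rewrite of_upolyD of_upolyM of_upolyX of_upolyC thetaD thetaM thetaX.
rewrite rmorphD rmorphM /= map_polyX map_polyC hornerD hornerM hornerX hornerC.
by rewrite IH theta_mwiden.
Qed.

(** The equations of the image of X form a prime ideal that meets the coefficients in 0 and contains
    a monic element, so [principal_prime] applies. A homogeneous component of the generator lies in
    the ideal too, whence tameness. *)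
Lemma hypersurface X m (c : 'I_m.+2 -> V) : closed X -> irreducible X -> dim_ge X m ->
  (forall v, pcone X v -> (forall a : 'I_m.+1, dotp (c (widen_ord (leqnSn _) a)) v = 0) -> False) ->
  exists p : {poly {mpoly F[m.+1]}}, tame p /\
    forall Q, vanishing X (theta c Q) <-> exists q, Q = q * of_upoly p.
Proof.
move=> cX iX dX nz; have [[_ ID IM] I1 Ipr] := irreducible_prime iX.
pose Q (q : {poly {mpoly F[m.+1]}}) := vanishing X (theta c (of_upoly q)).
have pQ : prime_ideal Q.
  split; first split.
  - by rewrite /Q (rmorph0 (@of_upoly F _)) theta0; exact: (@vanishing0 F n X).
  - by move=> a b Qa Qb; rewrite /Q of_upolyD thetaD; exact: ID Qa Qb.
  - by move=> a b Qb; rewrite /Q of_upolyM thetaM; apply: IM.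
  - by rewrite /Q (rmorph1 (@of_upoly F _)) theta1.
  - by move=> a b; rewrite /Q of_upolyM thetaM; exact: Ipr.
have Q0 a : Q a%:P -> a = 0.
  rewrite /Q of_upolyC theta_mwiden; exact: (normalization_indep charF cX iX dX nz).
have [g [gm Qg]] := integral_over cX nz (linear_form (c ord_max)) iX.
rewrite -theta_of_upoly in Qg.
have [p [pm _ Qp _ div]] := principal_prime (factorial_mpoly_poly (d := _)) pQ Q0 gm Qg.
exists p; split; last first.
  move=> q; split=> [Xq|[q' ->]]; last by rewrite thetaM; apply: IM.
  have [|h hE] := div (muni q); first by rewrite /Q muniK.
  by exists (of_upoly h); rewrite -[q]muniK hE of_upolyM.
apply: (tame_pihomog pm); apply: div; rewrite /Q muniK.
rewrite (_ : theta c _ = pihomog mdeg (size p).-1 (theta c (of_upoly p))); first exact: vanishing_homog.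
by apply/esym; apply: pihomog_msub => i; exact: linear_form_homog.
Qed.
End Hypersurface.

Lemma meval_bigsum (R : comNzRingType) k (I : finType) (f : I -> {mpoly R[k]}) q :
  (\sum_i f i).@[q] = \sum_i (f i).@[q].
Proof. exact: raddf_sum. Qed.

Section Chart.
Variables (F : closedFieldType) (n : nat).
Local Notation S := {mpoly F[n.+1]}.
Local Notation V := 'rV[F]_n.+1.
Local Notation P := (proj F n).
Implicit Types (X Y Z C : set P).
Hypothesis charF : forall k, k.+1%:R != 0 :> F.

(* Near the points where [u] does not vanish, the linear forms [c] identify X with the
   hypersurface of equation [p], with inverse [G / u]; the condition [u(0) = 0] makes
   [G / u] avoid the vertex of the cone. *)
Definition chart X m (c : 'I_m.+2 -> V) (u : {mpoly F[m.+2]}) (G : 'I_n.+1 -> {mpoly F[m.+2]})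
    (p : {poly {mpoly F[m.+1]}}) :=
  [/\ forall i, vanishing X (theta c u * 'X_i - theta c (G i)), tame p,
      forall Q, vanishing X (theta c Q) <-> exists q, Q = q * of_upoly p & u.@[fun=> 0] = 0].

Lemma chart_exists X m (l v0 : V) : closed X -> irreducible X -> nonsingular X -> has_dim X m ->
  ~ vanishing X (linear_form l) -> pcone X v0 ->
  exists (c : 'I_m.+2 -> V) u G p, [/\ chart X c u G p, c ord0 = l, (theta c u).@[v0 0] = 1 &
    forall a, exists g, vanishing X (theta c u * a - theta c g)].
Proof.
move=> cX iX nX dX lX Xv0; have [x [Xx xv]] := Xv0.
have [m' [dX' [K [dK tK]]]] := nX x Xx; have E := has_dim_uniq dX' dX; rewrite {m'}E in dX' dK.
have [c [cl nz injK injf]] := projection_exists charF v0 cX iX dX.2 lX (eq_leq dK).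
have nz2 v : pcone X v -> (forall a, dotp (c a) v = 0) -> False by move=> Xv h; apply: (nz v Xv) => a.
have tan (w : V) : (forall p, vanishing X p -> \sum_(i < n.+1) p^`M(i).@[v0 0] * w 0 i = 0) ->
    (forall a, dotp (c a) w = 0) -> w = 0.
  move=> h; apply: injK; have : tangent X x w by apply/(tangentE w xv Xx).
  by rewrite tK.
have [u [u1 ue]] := local_unit cX iX Xv0 nz2 tan injf.
have [p [pt pE]] := hypersurface charF cX iX dX.1 nz.
have [a a0] : exists a, dotp (c a) v0 != 0.
  by apply: contrapT => h; apply: (nz2 v0 Xv0) => a; apply/eqP; apply: contrapT => /negP ?; apply: h; exists a.
(* The extra linear form makes u' vanish at the origin, and its coefficient keeps the value 1 at
   v0. *)
pose u' := (dotp (c a) v0)^-1 *: 'X_a * u.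
have ue' b : exists g, vanishing X (theta c u' * b - theta c g).
  have [g hg] := ue b; exists ((dotp (c a) v0)^-1 *: 'X_a * g).
  rewrite /u' !thetaM -mulrA -mulrBr; exact: (@vanishingM F n X).
have [G hG] := choice (fun i : 'I_n.+1 => ue' 'X_i).
exists c, u', G, p; split; [|exact: cl| |exact: ue']; last first.
  by rewrite theta_eval /u' mevalM mevalZ mevalXU mulVf // mul1r -theta_eval.
by split; [exact: hG|exact: pt|exact: pE|rewrite /u' mevalM mevalZ mevalXU mulr0 mul0r].
Qed.

Section ChartPoint.
Variables (X : set P) (m : nat) (c : 'I_m.+2 -> V) (u : {mpoly F[m.+2]}).
Variables (G : 'I_n.+1 -> {mpoly F[m.+2]}) (p : {poly {mpoly F[m.+1]}}).
Hypothesis cX : closed X.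
Hypothesis iX : irreducible X.
Hypothesis mn : (m <= n)%N.
Hypothesis sX : smooth_rank X (n - m).
Hypothesis ch : chart X c u G p.
Local Notation E := (of_upoly p).

Lemma chart_linear b : exists h, 'X_b * u - \sum_i c b 0 i *: G i = h * E.
Proof.
have [hG _ pE _] := ch; apply/pE/vanishingE => v Xv.
rewrite theta_eval mevalB mevalM mevalXU meval_bigsum {1}/dotp mulr_suml -sumrB big1 // => i _.
move/vanishingE: (hG i) => /(_ v Xv); rewrite mevalB mevalM mevalXU !theta_eval => h.
rewrite mevalZ -mulrA -mulrBr [X in _ * X](_ : _ = 0) ?mulr0 // -[RHS]h; ring.
Qed.

Lemma chart_vanishing f : vanishing X f -> exists h, msub G f = h * E.
Proof.
move=> Xf; have [hG _ pE _] := ch; apply/pE/vanishingE => v Xv.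
rewrite theta_eval msub_meval.
have e i : (G i).@[fun a => dotp (c a) v] = ((theta c u).@[v 0] *: v) 0 i.
  move/vanishingE: (hG i) => /(_ v Xv); rewrite mevalB mevalM mevalXU -theta_eval mxE => /eqP.
  by rewrite subr_eq0 => /eqP.
rewrite (meval_eq _ e); have [->|u0] := eqVneq ((theta c u).@[v 0]) 0.
  have X0 : X !=set0 by case: iX.
  by rewrite -[RHS](vanishing_at0 X0 Xf); apply: meval_eq => i; rewrite !mxE mul0r.
by move/vanishingE: Xf; apply; exact: pconeZ.
Qed.

Section Point.
Variable q : 'I_m.+2 -> F.
Hypothesis Eq : E.@[q] = 0.
Hypothesis uq : u.@[q] != 0.
Let v : V := \row_i (G i).@[q].

Lemma chart_point_linear b : dotp (c b) v = u.@[q] * q b.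
Proof.
have [h /(congr1 (meval q))] := chart_linear b.
rewrite mevalB !mevalM mevalXU Eq mulr0 meval_bigsum => /eqP; rewrite subr_eq0 => /eqP e.
rewrite mulrC e; apply: eq_bigr => i _; by rewrite mevalZ !mxE.
Qed.

Lemma chart_point : pcone X v.
Proof.
have [_ _ _ u0] := ch; apply: closed_pcone => // [|f Xf].
  have [b b0] : exists b, q b != 0.
    apply: contrapT => h; move/eqP: uq; apply; rewrite -[RHS]u0; apply: meval_eq => b.
    by apply/eqP; apply: contrapT => /negP ?; apply: h; exists b.
  apply: contraNneq b0 => v0; move: (chart_point_linear b).
  rewrite v0 /dotp big1 => [/esym/eqP|i _]; last by rewrite mxE mulr0.
  by rewrite mulf_eq0 (negbTE uq).
have [h /(congr1 (meval q))] := chart_vanishing Xf.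
by rewrite mevalM Eq mulr0 msub_meval => e; rewrite -[RHS]e; apply: meval_eq => i; rewrite mxE.
Qed.

(** If q were singular on the hypersurface, the relations of the chart could be differentiated at q
    in all m + 2 directions: W, which is u times the derivative of G / u, would have rank m + 2 and
    be killed by n - m independent gradients in dimension n + 1. *)
Lemma chart_smooth : exists b, E^`M(b).@[q] != 0.
Proof.
apply: contrapT => h; have d0 b : E^`M(b).@[q] = 0.
  by apply/eqP; apply: contrapT => /negP ?; apply: h; exists b.
have [f [fX ff _]] := sX chart_point; have yv := on_cone_point chart_point.
pose W : 'M[F]_(m.+2, n.+1) := \matrix_(b, i) ((G i)^`M(b).@[q] - v 0 i / u.@[q] * u^`M(b).@[q]).
pose C : 'M[F]_(m.+2, n.+1) := \matrix_(b, i) c b 0 i.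
have WC : W *m C^T = u.@[q]%:M.
  apply/matrixP => b b'; rewrite !mxE.
  have [k /(congr1 (fun g => g^`M(b).@[q]))] := chart_linear b'.
  rewrite mderivB !mderivM mderivXU mevalB !mevalD !mevalM mevalXU Eq d0 !mulr0 addr0 => /eqP.
  rewrite subr_eq0 => /eqP e; have lin := chart_point_linear b'.
  transitivity (\sum_i c b' 0 i * (G i)^`M(b).@[q] - dotp (c b') v / u.@[q] * u^`M(b).@[q]).
    rewrite /dotp !mulr_suml -sumrB; apply: eq_bigr => i _; rewrite [W b i]mxE !mxE; ring.
  have -> : \sum_i c b' 0 i * (G i)^`M(b).@[q] = (\sum_i c b' 0 i *: G i)^`M(b).@[q].
    by rewrite eval_mderiv_sum; apply: eq_bigr => i _; rewrite mderivZ mevalZ.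
  rewrite -e lin [u.@[q] * _ / _]mulrAC divff // mul1r addrK.
  by case: eqP => _; rewrite ?meval1 ?mul1r // meval0 mul0r.
have WD : W *m (jac idfun (v 0) f)^T = 0.
  apply/matrixP => b a; rewrite !mxE.
  have [k /(congr1 (fun g => g^`M(b).@[q]))] := chart_vanishing (fX a).1.
  rewrite mderivM mevalD !mevalM Eq d0 !mulr0 addr0 mderiv_msub meval_bigsum => e.
  have eu : \sum_i v 0 i * (f a)^`M(i).@[v 0] = 0.
    by rewrite -[RHS](euler yv (fX a).1); apply: eq_bigr => i _; rewrite mulrC.
  transitivity (\sum_i (msub G (f a)^`M(i) * (G i)^`M(b)).@[q] -
      (\sum_i v 0 i * (f a)^`M(i).@[v 0]) / u.@[q] * u^`M(b).@[q]); last by rewrite e eu !mul0r subr0.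
  rewrite !mulr_suml -sumrB; apply: eq_bigr => i _; rewrite [W b i]mxE [_^T _ _]mxE [jac _ _ _ _ _]mxE.
  rewrite mevalM msub_meval.
  have -> : (f a)^`M(i).@[fun i0 => (G i0).@[q]] = (f a)^`M(i).@[v 0] by apply: meval_eq => i0; rewrite mxE.
  rewrite -[mmap _ _ _]/((f a)^`M(i).@[v 0]); ring.
have rW : (m.+2 <= \rank W)%N.
  have rk : \rank (W *m C^T) = m.+2 by rewrite WC -scalemx1 mxrank_scale_nz // mxrank1.
  by have := mxrankM_maxl W C^T; rewrite rk.
have := mulmx0_rank_max WD; rewrite mxrank_tr; have := ff; rewrite /row_free => /eqP ->.
by move: rW mn; lia.
Qed.

(** The gradient at the point of the equation [theta c E] of X is then a nonzero multiple of the
    form c b0. *)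
Lemma chart_conormal b0 : (forall b, b != b0 -> E^`M(b).@[q] = 0) ->
  conormal idfun X (fun i => (G i).@[q]) (c b0 0).
Proof.
move=> hb; have [_ [pm ph] pE _] := ch.
have E0 : E^`M(b0).@[q] != 0.
  have [b] := chart_smooth; have [->//|bb] := eqVneq b b0; by rewrite hb // eqxx.
have vy : on_cone idfun X (fun i => (G i).@[q]).
  have := on_cone_point chart_point; congr (on_cone _ _ _); apply/funext => i; exact: mxE.
pose y i := (u.@[q])^-1 * (G i).@[q].
have yy : on_cone idfun X y by exact: (on_coneZ (j := idfun) (u.@[q])^-1 vy).
rewrite (_ : (fun i => (G i).@[q]) = fun i => u.@[q] * y i); last by apply/funext => i; rewrite /y mulVKf.
apply: conormalZ => //; exists 1%N, (fun=> theta c E), (fun=> (E^`M(b0).@[q])^-1); split=> [_|i].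
  by apply/pE; exists 1; rewrite mul1r.
rewrite big_ord1 -[mmap _ _ _]/((theta c E)^`M(i).@[y]) /theta mderiv_msub meval_bigsum.
have dy b : (linear_form (c b)).@[y] = q b.
  apply: (mulfI uq); rewrite -chart_point_linear /linear_form meval_bigsum /dotp mulr_sumr.
  by apply: eq_bigr => k _; rewrite /= mevalZ mevalXU mxE mulrCA mulVKf.
have ev b : (msub (fun a => linear_form (c a)) E^`M(b)).@[y] = E^`M(b).@[q].
  by rewrite msub_meval; apply: meval_eq => k; rewrite dy.
rewrite (bigD1 b0) //= big1 => [|b bb]; rewrite mevalM ev mderiv_linear_form mevalC.
  by rewrite addr0 mulKf.
by rewrite hb // mul0r.
Qed.
End Point.
End ChartPoint.
End Chart.

Section Face.
Variable F : closedFieldType.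

(** Restriction to a coordinate hyperplane. As the first form of a chart is the equation l,
    [face ord0] describes the hyperplane section. *)
Definition face k (i : 'I_k.+1) : {mpoly F[k.+1]} -> {mpoly F[k]} :=
  msub (fun a => if unlift i a is Some b then 'X_b else 0).
Definition coface k (i : 'I_k.+1) : {mpoly F[k]} -> {mpoly F[k.+1]} :=
  msub (fun b => 'X_(lift i b)).

Section Basic.
Variables (k : nat) (i : 'I_k.+1).
Lemma faceD p q : face i (p + q) = face i p + face i q. Proof. exact: rmorphD. Qed.
Lemma faceM p q : face i (p * q) = face i p * face i q. Proof. exact: rmorphM. Qed.
Lemma faceC a : face i a%:MP = a%:MP. Proof. by rewrite /face /msub mmapC. Qed.
Lemma faceX : face i 'X_i = 0. Proof. by rewrite /face /msub mmapX mmap1U unlift_none. Qed.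
Lemma faceXlift b : face i 'X_(lift i b) = 'X_b. Proof. by rewrite /face /msub mmapX mmap1U liftK. Qed.
Lemma cofaceD p q : coface i (p + q) = coface i p + coface i q. Proof. exact: rmorphD. Qed.
Lemma cofaceM p q : coface i (p * q) = coface i p * coface i q. Proof. exact: rmorphM. Qed.
Lemma cofaceC a : coface i a%:MP = a%:MP. Proof. by rewrite /coface /msub mmapC. Qed.
Lemma cofaceX b : coface i 'X_b = 'X_(lift i b). Proof. by rewrite /coface /msub mmapX mmap1U. Qed.

Lemma cofaceK : cancel (coface i) (face i).
Proof.
move=> p; elim/mpoly_alg_ind: p => [c|b|p q IHp IHq|p q IHp IHq].
- by rewrite cofaceC faceC.
- by rewrite cofaceX faceXlift.
- by rewrite cofaceD faceD; exact: f_equal2.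
- by rewrite cofaceM faceM; exact: f_equal2.
Qed.

Lemma face_split (p : {mpoly F[k.+1]}) : exists h, p = coface i (face i p) + h * 'X_i.
Proof.
elim/mpoly_alg_ind: p => [c|b|p q [h hp] [h' hq]|p q [h hp] [h' hq]].
- by exists 0; rewrite faceC cofaceC mul0r addr0.
- have [a ->|->] := unliftP i b; first by exists 0; rewrite faceXlift cofaceX mul0r addr0.
  by exists 1; rewrite faceX mul1r /coface /msub mmap0 add0r.
- exists (h + h'); rewrite faceD cofaceD.
  by move: (coface i _) (coface i _) hp hq => a b -> ->; ring.
- exists (coface i (face i p) * h' + h * (coface i (face i q) + h' * 'X_i)); rewrite faceM cofaceM.
  by move: (coface i _) (coface i _) hp hq => a b -> ->; ring.
Qed.

Lemma face_eval p (q : 'I_k -> F) : (face i p).@[q] =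
  p.@[fun a => if unlift i a is Some b then q b else 0].
Proof.
rewrite msub_meval; apply: meval_eq => a; case: (unlift i a) => [b|]; [exact: mevalXU|exact: meval0].
Qed.

Lemma mderiv_face p b : (face i p)^`M(b) = face i p^`M(lift i b).
Proof.
rewrite mderiv_msub (bigD1 (lift i b)) //= big1 ?addr0 => [|a ab].
  by rewrite liftK mderivXU eqxx; exact: mulr1.
case: unliftP ab => [a' ->|_ _]; last by rewrite raddf0 mulr0.
by rewrite (inj_eq lift_inj) => ne; rewrite mderivXU eq_sym (negbTE ne); exact: mulr0.
Qed.

Lemma mderiv_coface p : (coface i p)^`M(i) = 0.
Proof.
by rewrite mderiv_msub big1 // => a _; rewrite mderivXU (negbTE (neq_lift _ _)); exact: mulr0.
Qed.
End Basic.

Lemma face_mwiden k (a : {mpoly F[k.+1]}) : face ord0 (mwiden a) = mwiden (face ord0 a).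
Proof.
elim/mpoly_alg_ind: a => [c|b|p q IHp IHq|p q IHp IHq].
- by rewrite mwidenC !faceC mwidenC.
- have wl (j : 'I_k) : widen_ord (leqnSn k.+1) (lift ord0 j) = lift ord0 (widen_ord (leqnSn k) j).
    by apply: val_inj.
  have [j ->|->] := unliftP ord0 b; first by rewrite mwidenXU wl !faceXlift mwidenXU.
  rewrite mwidenXU (_ : widen_ord _ _ = ord0); last by apply: val_inj.
  by rewrite !faceX mwiden0.
- by rewrite mwidenD !faceD mwidenD; exact: f_equal2.
- by rewrite mwidenM !faceM mwidenM; exact: f_equal2.
Qed.

Definition uface k (p : {poly {mpoly F[k.+1]}}) : {poly {mpoly F[k]}} :=
  map_poly (msub (fun a => if unlift ord0 a is Some b then 'X_b else 0)) p.

Lemma of_upoly_face k (p : {poly {mpoly F[k.+1]}}) : of_upoly (uface p) = face ord0 (of_upoly p).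
Proof.
have f0 : face ord0 0 = 0 :> {mpoly F[k.+1]} by rewrite -(mpolyC0 k.+2) faceC mpolyC0.
elim/poly_ind: p => [|p c IH]; first by rewrite /uface rmorph0 (rmorph0 (@of_upoly F _)) (rmorph0 (@of_upoly F _)) f0.
rewrite /uface rmorphD rmorphM /= map_polyX map_polyC !of_upolyD !of_upolyM !of_upolyX !of_upolyC.
rewrite faceD faceM face_mwiden; congr (_ * _ + _); first exact: IH.
have -> : ord_max = lift ord0 ord_max :> 'I_k.+2 by apply: val_inj.
by rewrite faceXlift.
Qed.

Lemma tame_uface k (p : {poly {mpoly F[k.+1]}}) : tame p -> tame (uface p).
Proof.
move=> [pm ph]; split; first exact: monic_map.
rewrite of_upoly_face /uface size_map_poly_id0 ?(monicP pm) ?rmorph1 ?oner_neq0 //.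
apply: msub_homog => // a; case: (unlift ord0 a) => [b|]; last exact: dhomog0.
by rewrite dhomogX; apply/eqP; exact: mdeg1.
Qed.
End Face.

(** * Singularities of a section in a chart *)

Section Local.
Variables (F : closedFieldType) (n : nat).
Local Notation S := {mpoly F[n.+1]}.
Local Notation V := 'rV[F]_n.+1.
Local Notation P := (proj F n).
Hypothesis charF : forall k, k.+1%:R != 0 :> F.
Variables (X : set P) (m s : nat) (c : 'I_m.+2 -> V) (u : {mpoly F[m.+2]}).
Variables (G : 'I_n.+1 -> {mpoly F[m.+2]}) (p : {poly {mpoly F[m.+1]}}).
Hypothesis cX : closed X.
Hypothesis iX : irreducible X.
Hypothesis nX : nonsingular X.
Hypothesis dX : has_dim X m.
Hypothesis dS : has_dim (secant_variety X) s.
Hypothesis lX : ~ vanishing X (linear_form (c ord0)).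
Hypothesis ch : chart X c u G p.
Let rho := uface p.
Let u0 := face ord0 u.

(** Where the equation of the section and all its derivatives vanish, the equation of X has at most
    one nonzero derivative, in the direction of l; so l is tangent there by [chart_conormal], and
    [contact_count] bounds the locus. *)
Lemma chart_contact (I : {mpoly F[m.+1]} -> Prop) b (beta : 'I_b -> 'I_m.+1) :
  prime_ideal I -> I (of_upoly rho) -> (forall a, I (of_upoly rho)^`M(a)) -> ~ I u0 ->
  (forall Q : {mpoly F[b]}, I (msub (fun a => 'X_(beta a)) Q) -> Q = 0) -> (m + b <= s)%N.
Proof.
move=> pI Ir Id Iu ind; have [mn sX] := nonsingular_smooth nX dX.
have key (q : 'I_m.+1 -> F) : zero_locus I q -> u0.@[q] != 0 ->
    exists q', [/\ (of_upoly p).@[q'] = 0, u.@[q'] != 0, forall g, (face ord0 g).@[q] = g.@[q'],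
     forall a, (of_upoly p)^`M(lift ord0 a).@[q'] = 0 & forall a, q' (lift ord0 a) = q a].
  move=> Iq uq; pose q' a := if unlift ord0 a is Some b then q b else 0.
  have fE g : (face ord0 g).@[q] = g.@[q'] by exact: face_eval.
  exists q'; split=> [|||a|a] //.
  - by rewrite -fE -of_upoly_face; exact: Iq.
  - by rewrite -fE.
  - by rewrite -fE -mderiv_face -of_upoly_face; exact: Iq.
  - by rewrite /q' liftK.
apply: (contact_count charF (l := c ord0) (u0 := u0) (G := fun i => face ord0 (G i)) (beta := beta)
  (tB := fun a => c (lift ord0 (beta a))) cX iX nX dX dS lX pI Iu _ _ ind) => [q Iq uq|q a Iq].
  have [q' [E0 u0' fE Ed _]] := key q Iq uq.
  split.
    have -> : \row_i (face ord0 (G i)).@[q] = \row_i (G i).@[q'] by apply/rowP => i; rewrite !mxE fE.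
    exact: (chart_point cX iX ch E0 u0').
  have -> : (fun i => (face ord0 (G i)).@[q]) = fun i => (G i).@[q'] by apply/funext => i; exact: fE.
  apply: (chart_conormal cX iX mn sX ch E0 u0') => b' b0.
  case: (unliftP ord0 b') => [a ab|be]; first by rewrite ab; exact: Ed.
  by rewrite be eqxx in b0.
have [h hE] := chart_linear ch (lift ord0 (beta a)).
move: hE => /(congr1 (fun g => (face ord0 g).@[q])); rewrite !face_eval.
set q' := (fun _ => _); rewrite mevalB !mevalM mevalXU meval_bigsum.
have -> : (of_upoly p).@[q'] = 0 by rewrite -[LHS]face_eval -of_upoly_face; exact: Iq.
rewrite mulr0 {1}/q' liftK => /eqP; rewrite subr_eq0 => /eqP e.
rewrite [RHS]mulrC e; apply: eq_bigr => i _; by rewrite mevalZ face_eval.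
Qed.

Variable Q : {poly {mpoly F[m]}} -> Prop.
Hypothesis pQ : prime_ideal Q.
Hypothesis Qu : ~ Q (muni u0).

Lemma comp_muni_prime (I : {poly {mpoly F[m]}} -> Prop) : prime_ideal I -> prime_ideal (fun w => I (muni w)).
Proof.
move=> [[I0 ID IM] I1 Ip]; split; first split.
- by rewrite muni0.
- by move=> a b; rewrite muniD; exact: ID.
- by move=> a b; rewrite muniM; exact: IM.
- by rewrite muni1.
- by move=> a b; rewrite muniM; exact: Ip.
Qed.

(** The section would be singular all along a double factor, on which the m coefficient variables
    are independent, and this would give 2 m <= s. *)
Lemma chart_nosq : (s + 1 <= 2 * m)%N -> forall pi, prime_elt pi -> Q pi -> ~ dvd (pi * pi) rho.
Proof.
move=> sm pi ppi Qpi [h hE]; have [[_ _ QM] _ _] := pQ.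
have [rm _] : tame rho by apply: tame_uface; have [] := ch.
have ppi' := comp_muni_prime (prime_dvd_ideal ppi).
have dr : dvd pi rho by exists (h * pi); rewrite hE mulrA.
suff : (m + m <= s)%N by move: sm; lia.
apply: (chart_contact (beta := widen_ord (leqnSn m)) ppi').
- by rewrite of_upolyK.
- move=> a; rewrite hE !of_upolyM mderivM mderivM muniD !muniM muniD !muniM !of_upolyK.
  apply: dvdD; first by apply: dvd_mull; apply: dvd_mull; exact: dvd_refl.
  apply: dvd_mull; apply: dvdD; [apply: dvd_mull; exact: dvd_refl|apply: dvd_mulr; exact: dvd_refl].
- by move=> [k kE]; apply: Qu; rewrite kE; exact: QM.
- move=> R; have -> : msub (fun a => 'X_(widen_ord (leqnSn m) a)) R = mwiden R by [].
  rewrite muni_mwiden; have [x [y [_ vm vE]]] := dvd_monic rm dr.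
  move=> /vE dR; apply/eqP; rewrite -polyC_eq0; apply/eqP; apply: (monic_small vm) dR.
  rewrite size_polyC; apply: leq_ltn_trans (leq_b1 _) _.
  rewrite ltnNge; apply/negP => sz; have v1 : y *: pi = 1.
    by move/monicP: vm; rewrite (size1_polyC sz) lead_coefC => ->.
  by case: ppi => _ n1 _; apply: n1; apply/vE; rewrite v1; exact: dvd_refl.
Qed.

Definition pder (a : 'I_m.+1) (w : {poly {mpoly F[m]}}) := muni (of_upoly w)^`M(a).

Lemma pder_mul a x y : pder a (x * y) = x * pder a y + pder a x * y.
Proof. by rewrite /pder of_upolyM mderivM muniD !muniM !of_upolyK addrC. Qed.

Lemma prime_elt_mderiv k (g : {mpoly F[k]}) : prime_elt g -> exists i, g^`M(i) != 0.
Proof.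
move=> [g0 g1 _]; apply: contrapT => h; have [i|a aE] := mderiv_eq0 (p := g) charF.
  by apply/eqP; apply: contrapT => /negP ?; apply: h; exists i.
apply: g1; exists a^-1%:MP; rewrite aE -mpolyCM mulVf ?mpolyC1 //.
by apply: contraNneq g0 => a0; rewrite aE a0 mpolyC0.
Qed.

(* Were [a] a nonzero multiple of [g] independent of a variable occurring in [g], differentiating
   would make it a multiple of all powers of [g]. *)
Lemma prime_elt_indep k (g a : {mpoly F[k]}) i : prime_elt g -> g^`M(i) != 0 -> a^`M(i) = 0 ->
  dvd g a -> a = 0.
Proof.
move=> pg gi ai ga; apply/eqP; apply: contrapT => /negP a0; have [g0 g1 gp] := pg.
have ms : (1 < msize g)%N.
  rewrite ltnNge; apply/negP => /msize1_polyC gE; move: gi; by rewrite gE mderivC eqxx.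
have ngi : ~ dvd g g^`M(i).
  move=> [h hE]; have h0 : h != 0 by apply: contraNneq gi => h0; rewrite hE h0 mul0r.
  have : (msize g^`M(i) <= (msize g).-1)%N by apply: msize_mderiv; rewrite prednK // ltnW.
  rewrite hE msizeM //.
  have : (0 < msize h)%N by rewrite lt0n msize_poly_eq0.
  by move: ms; move: (msize h) (msize g) => A B; lia.
have dp d : (g ^+ d.+1)^`M(i) = d.+1%:R * g ^+ d * g^`M(i).
  elim: d => [|d IH]; first by rewrite expr1 expr0 !mul1r.
  by rewrite exprS mderivM IH -[d.+2]addn1 natrD exprS; ring.
have pw e : dvd (g ^+ e) a.
  elim: e => [|e [h hE]]; first by exists a; rewrite expr0 mulr1.
  suff [h' h'E] : dvd g h by exists h'; rewrite hE h'E exprSr; ring.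
  case: e hE => [|e] hE; first by move: ga; rewrite hE expr0 mulr1.
  have e0 : h^`M(i) * g + (e.+1%:R * h) * g^`M(i) = 0.
    apply: (@mulIf _ (g ^+ e)); first exact: expf_neq0.
    transitivity (a^`M(i)); last by rewrite ai mul0r.
    by rewrite hE mderivM dp exprS; ring.
  have : dvd g (e.+1%:R * h * g^`M(i)).
    exists (- h^`M(i)); apply/eqP; rewrite -subr_eq0 mulNr opprK addrC e0; exact: eqxx.
  move=> /gp [/gp[[b bE]|//]|//]; case: g1; exists (b * (e.+1%:R^-1)%:MP).
  rewrite mulrAC -bE -[e.+1%:R](rmorph_nat (@mpolyC k F)) -mpolyCM divff //.
have [h hE] := pw (msize a); have h0 : h != 0 by apply: contraNneq a0 => h0; rewrite hE h0 mul0r.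
have sz e : (e < msize (g ^+ e))%N.
  elim: e => [|e IH]; first by rewrite expr0 msize1.
  rewrite exprS msizeM ?expf_neq0 //; move: IH ms; move: (msize _) (msize g) => A B; lia.
have := sz (msize a); have := msizeM h0 (expf_neq0 (msize a) g0); rewrite -hE.
have : (0 < msize h)%N by rewrite lt0n msize_poly_eq0.
move=> h1 h2; rewrite {1}h2; move: h1; set w := g ^+ _.
by move: (msize h) (msize w) => [|A] B //= _; rewrite ltnNge leq_addl.
Qed.

Lemma prime_elt_vars k (g : {mpoly F[k]}) : prime_elt g -> exists beta : 'I_k.-1 -> 'I_k,
  forall R : {mpoly F[k.-1]}, dvd g (msub (fun b => 'X_(beta b)) R) -> R = 0.
Proof.
case: k g => [|k] g pg; have [i gi] := prime_elt_mderiv pg; first by case: i gi.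
exists (lift i) => R gR; rewrite -[R](cofaceK i) (_ : coface i R = 0).
  by rewrite -(mpolyC0 k.+1) faceC mpolyC0.
exact: (prime_elt_indep pg gi (mderiv_coface i R) gR).
Qed.

Lemma msub_widen k d (beta : 'I_k -> 'I_d) (R : {mpoly F[k]}) :
  msub (fun b => 'X_(widen_ord (leqnSn d) (beta b))) R = mwiden (msub (fun b => 'X_(beta b)) R).
Proof.
elim/mpoly_alg_ind: R => [a|i|p1 p2 IH1 IH2|p1 p2 IH1 IH2].
- by rewrite /msub !mmapC mwidenC.
- by rewrite /msub !mmapX !mmap1U mwidenXU.
- transitivity (mwiden (msub (fun b => 'X_(beta b)) p1) + mwiden (msub (fun b => 'X_(beta b)) p2)).
    by rewrite -IH1 -IH2; exact: rmorphD.
  by rewrite -mwidenD; congr mwiden; apply/esym; exact: rmorphD.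
- transitivity (mwiden (msub (fun b => 'X_(beta b)) p1) * mwiden (msub (fun b => 'X_(beta b)) p2)).
    by rewrite -IH1 -IH2; exact: rmorphM.
  by rewrite -mwidenM; congr mwiden; apply/esym; exact: rmorphM.
Qed.

(** Otherwise some prime q contains D, misses u, and contains only constants divisible by g. It lies
    in the singular locus, and the m - 1 variables that are independent modulo g are independent
    modulo q, so [chart_contact] would give m + (m - 1) <= s. *)
Lemma chart_big : (s + 2 <= 2 * m)%N -> forall D : {poly {mpoly F[m]}} -> Prop, is_ideal D ->
  (forall q, prime_ideal q -> (forall x, D x -> q x) -> ~ q (muni u0) -> q rho /\ forall i, q (pder i rho)) ->
  forall g, prime_elt g -> exists al e, ~ dvd g al /\ D (muni u0 ^+ e * al%:P).
Proof.
move=> sm D iD hD g pg; apply: contrapT => h; have [g0 g1 gp] := pg.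
pose A x := exists al e, ~ dvd g al /\ x = muni u0 ^+ e * al%:P.
have [||a Da [al [e [ga aE]]]|q [pq Dq Aq]] := prime_avoiding (S := A) iD.
- by exists 1, 0%N; rewrite expr0 mul1r.
- move=> a b [al [e [ga ->]]] [be [f [gb ->]]]; exists (al * be), (e + f)%N; split.
    by move=> /gp[].
  by rewrite exprD polyCM; ring.
- by apply: h; exists al, e; rewrite -aE.
have qu : ~ q (muni u0) by move=> /Aq; apply; exists 1, 1%N; rewrite expr1 mulr1.
have [qr qd] := hD q pq Dq qu.
have qg a : q a%:P -> dvd g a.
  by move=> /Aq h'; apply: contrapT => ga; apply: h'; exists a, 0%N; rewrite expr0 mul1r.
have [beta hb] := prime_elt_vars pg; have pq' := comp_muni_prime pq.
suff : (m + m.-1 <= s)%N by move: sm; lia.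
apply: (chart_contact (beta := fun b => widen_ord (leqnSn m) (beta b)) pq').
- by rewrite of_upolyK.
- by move=> a; exact: qd.
- exact: qu.
- by move=> R; rewrite msub_widen muni_mwiden => /qg; exact: hb.
Qed.
End Local.

Section Shear.
Variables (F : closedFieldType) (m : nat).
Hypothesis charF : forall k, k.+1%:R != 0 :> F.
Local Notation U := {mpoly F[m.+1]}.
Local Notation W := {poly {mpoly F[m]}}.

Definition top_point (k : 'I_m.+1) : F := (k == ord_max)%:R.

Lemma homog0_const k (f : {mpoly F[k]}) : f \is 0%N.-homog -> f = (f@_0)%:MP.
Proof.
move=> /dhomogP h; apply/mpolyP => mm; rewrite mcoeffC.
have [->|ne] := eqVneq mm 0%MM; first by rewrite mulr1.
rewrite mulr0; apply/eqP; rewrite mcoeff_eq0; apply/negP => /h /eqP.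
by rewrite mdeg_eq0 (negbTE ne).
Qed.

Lemma homog_eval0 k (f : {mpoly F[k]}) d : f \is d.+1.-homog -> f.@[fun=> 0] = 0.
Proof.
move=> hf; rewrite -[LHS](@mmap_ext _ _ _ _ (fun i => 0 * 0)) => [|i]; last by rewrite mul0r.
by rewrite (homog_mmapd idfun 0 (fun=> 0) hf) expr0n mul0r.
Qed.

Lemma of_upoly_eval (w : W) q : (of_upoly w).@[q] =
  (map_poly (meval (fun i => q (widen_ord (leqnSn m) i))) w).[q ord_max].
Proof.
have wE (a : {mpoly F[m]}) : (mwiden a).@[q] = a.@[fun i => q (widen_ord (leqnSn m) i)].
  by rewrite -[mwiden a]/(msub _ a) msub_meval; apply: meval_eq => i; exact: mevalXU.
elim/poly_ind: w => [|w a IH]; first by rewrite (rmorph0 (@of_upoly F m)) meval0 rmorph0 horner0.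
rewrite of_upolyD of_upolyM of_upolyX of_upolyC mevalD mevalM mevalXU wE IH.
by rewrite rmorphD rmorphM /= map_polyX map_polyC hornerD hornerM hornerX hornerC.
Qed.

Lemma muni_lead (h : U) d : h \is d.-homog ->
  (size (muni h) <= d.+1)%N /\ (muni h)`_d = (h.@[top_point])%:MP.
Proof.
move=> hh; have cE i : (muni h)`_i = if (i <= d)%N then pihomog mdeg (d - i) (muni h)`_i else 0.
  by rewrite -pihomog_muni (pihomog_dE hh).
have sz : (size (muni h) <= d.+1)%N by apply/leq_sizeP => i di; rewrite cE leqNgt di.
split=> //; have c0 : (muni h)`_d \is 0%N.-homog by rewrite cE leqnn subnn; exact: pihomogP.
rewrite [LHS](homog0_const c0); congr _%:MP.
rewrite -[h in RHS]muniK of_upoly_eval; set z := (fun i => _).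
have z0 (f : {mpoly F[m]}) : f.@[z] = f.@[fun=> 0].
  apply: meval_eq => i; rewrite /z /top_point (_ : (_ == _) = false) //.
  by apply/eqP => /(congr1 val) /= e; move: (ltn_ord i); rewrite e ltnn.
rewrite (horner_coef_wide (n := d.+1)); last first.
  by apply: leq_trans sz; rewrite map_polyE; apply: leq_trans (size_Poly _) _; rewrite size_map.
rewrite big_ord_recr big1 /= => [|i _]; rewrite /top_point eqxx expr1n mulr1 coef_map /= z0.
  by rewrite add0r [in RHS](homog0_const c0) mevalC.
have id := ltn_ord i; rewrite cE ltnW // (@homog_eval0 _ _ (d - i).-1) //.
by rewrite prednK ?subn_gt0 //; exact: pihomogP.
Qed.

Section Shift.
Variables (j : 'I_m) (t : F).
Local Notation wj := (widen_ord (leqnSn m) j).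

Definition shear : U -> U := msub (fun k => 'X_k + ((k == wj)%:R * t)%:MP * 'X_ord_max).

Lemma shearX k : shear 'X_k = 'X_k + ((k == wj)%:R * t)%:MP * 'X_ord_max.
Proof. by rewrite /shear /msub mmapX mmap1U. Qed.
Lemma shearC a : shear a%:MP = a%:MP. Proof. by rewrite /shear /msub mmapC. Qed.
Lemma shearD p q : shear (p + q) = shear p + shear q. Proof. exact: rmorphD. Qed.
Lemma shearM p q : shear (p * q) = shear p * shear q. Proof. exact: rmorphM. Qed.

Lemma max_widen : (ord_max == wj) = false.
Proof. by apply/eqP => /(congr1 val) /= e; move: (ltn_ord j); rewrite -e ltnn. Qed.

Lemma mderiv_shear p : (shear p)^`M(ord_max) = shear (p^`M(ord_max) + t%:MP * p^`M(wj)).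
Proof.
rewrite shearD shearM shearC mderiv_msub.
have dE k : ('X_k + ((k == wj)%:R * t)%:MP * 'X_ord_max : U)^`M(ord_max) =
    (ord_max == k)%:R + ((k == wj)%:R * t)%:MP.
  by rewrite mderivD mderivM mderivC !mderivXU eqxx mul0r add0r mulr1.
rewrite (bigD1 ord_max) //= (bigD1 wj) /=; last by rewrite eq_sym max_widen.
rewrite big1 => [|k /andP[k1 k2]]; rewrite dE.
  by rewrite dE eqxx max_widen mul0r mpolyC0 addr0 mulr1 eqxx mul1r add0r addr0 mulrC.
by rewrite eq_sym (negbTE k1) (negbTE k2) mul0r mpolyC0 addr0 mulr0.
Qed.

Lemma shear_homog p d : p \is d.-homog -> shear p \is d.-homog.
Proof.
apply: msub_homog => k; apply: rpredD; first by rewrite dhomogX; apply/eqP; exact: mdeg1.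
by rewrite mul_mpolyC; apply: rpredZ; rewrite dhomogX; apply/eqP; exact: mdeg1.
Qed.
End Shift.

Lemma shearK j t : cancel (shear j t) (shear j (- t)).
Proof.
move=> p; elim/mpoly_alg_ind: p => [c|k|p q IHp IHq|p q IHp IHq].
- by rewrite !shearC.
- rewrite shearX shearD shearM shearC !shearX max_widen mul0r mpolyC0 mul0r addr0.
  by rewrite mulrN mpolyCN mulNr -addrA addNr addr0.
- by rewrite !shearD; exact: f_equal2.
- by rewrite !shearM; exact: f_equal2.
Qed.

Lemma shear_iso j t : exists f g : {rmorphism W -> W}, [/\ cancel f g, cancel g f,
  forall w, f w = muni (shear j t (of_upoly w)) & forall w, g w = muni (shear j (- t) (of_upoly w))].
Proof.
pose sh x : {rmorphism U -> U} := msub (fun k => 'X_k + ((k == widen_ord (leqnSn m) j)%:R * x)%:MP * 'X_ord_max).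
exists (@muni m F \o sh t \o @of_upoly F m), (@muni m F \o sh (- t) \o @of_upoly F m).
have key x : cancel (fun w : W => muni (shear j x (of_upoly w))) (fun w => muni (shear j (- x) (of_upoly w))).
  by move=> w; rewrite muniK shearK of_upolyK.
split=> //; first exact: key.
by move=> w; rewrite -[RHS](key (- t)) opprK.
Qed.

Lemma prime_assoc (R : idomainType) (x y : R) : prime_elt x -> y != 0 ->
  (forall f, dvd x f <-> dvd y f) -> prime_elt y.
Proof.
move=> [x0 x1 xp] y0 e; split=> // [/e //|a b /e /xp[] /e]; [by left|by right].
Qed.

Lemma prime_exp_ideal (R : comPzRingType) (I : R -> Prop) x k : prime_ideal I -> I (x ^+ k) -> I x.
Proof.
move=> [_ I1 Ip]; elim: k => [|k IH]; first by rewrite expr0 => /I1.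
by rewrite exprS => /Ip[].
Qed.

(** The leading coefficient after the shear is the value of the form at the top point moved by t in
    the direction j; it is 1 for t = 0, hence nonzero for some nonzero t. *)
Lemma shear_lead (rho : W) j : tame rho -> exists t (c : F), [/\ t != 0, c != 0 &
  c%:MP *: muni (shear j t (of_upoly rho)) \is monic].
Proof.
move=> [rm rh]; set d := (size rho).-1 in rh; pose wj := widen_ord (leqnSn m) j.
pose f : {poly F} := mmap (@polyC F) (fun k => (top_point k)%:P + ((k == wj)%:R)%:P * 'X) (of_upoly rho).
have fE x : f.[x] = (of_upoly rho).@[fun k => top_point k + (k == wj)%:R * x].
  rewrite -[LHS]/(horner_eval x f) /f (mmap_comp (horner_eval x) (@polyC F)).
  rewrite /meval; have -> : horner_eval x \o @polyC F = idfun.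
    by apply/funext => a; rewrite /= /horner_eval hornerC.
  apply: mmap_ext => k; by rewrite /= /horner_eval hornerD hornerM !hornerC hornerX.
have f0 : f != 0.
  apply: contraTneq (oner_neq0 F) => f0; rewrite negbK; apply/eqP.
  have [_ lE] := muni_lead rh; rewrite of_upolyK in lE.
  have l1 : rho`_d = 1 by exact: (monicP rm).
  have e1 : (of_upoly rho).@[top_point] = 1.
    by have := congr1 (meval (fun=> 0)) lE; rewrite l1 meval1 mevalC.
  have := fE 0; rewrite f0 horner0 => ->; rewrite -e1; apply: meval_eq => k; by rewrite mulr0 addr0.
have [t t0 ft] : exists2 t, t != 0 & f.[t] != 0.
  apply: contrapT => h; move/eqP: f0; apply; apply: poly_eq0_everywhere => t t0.
  by apply/eqP; apply: contrapT => /negP ft; apply: h; exists t.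
have [sz lE] := muni_lead (shear_homog j t rh).
have le : (shear j t (of_upoly rho)).@[top_point] = f.[t].
  rewrite fE msub_meval; apply: meval_eq => k.
  by rewrite mevalD mevalM mevalC !mevalXU {2}/top_point eqxx mulr1.
rewrite le in lE; exists t, (f.[t])^-1; split=> //; first by rewrite invr_eq0.
have cd : ((f.[t])^-1%:MP *: muni (shear j t (of_upoly rho)))`_d = 1.
  by rewrite coefZ lE -mpolyCM mulVf.
rewrite monicE lead_coefE; suff -> : size ((f.[t])^-1%:MP *: muni (shear j t (of_upoly rho))) = d.+1.
  by rewrite cd.
apply/eqP; rewrite eqn_leq (leq_trans (size_scale_leq _ _) sz) /=.
by apply: contraTltn (oner_neq0 {mpoly F[m]}) => /leq_sizeP /(_ d (leqnn _)); rewrite cd => ->; rewrite eqxx.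
Qed.

(** [conductor_gen] only reaches the derivative in the last variable. A shear in the direction j
    keeps the polynomial monic up to a constant and turns this derivative into itself plus t times
    the j-th one, so the others follow by subtraction. *)
Lemma tame_conductor (rho p a b : W) d (c : nat -> W) : tame rho -> p \is monic -> prime_elt p ->
  dvd p rho -> ~ dvd p b -> (0 < d)%N ->
  dvd p (a ^+ d + \sum_(i < d) c i * a ^+ i * b ^+ (d - i)) ->
  forall r, prime_ideal r -> (forall x, mem2 b p (x * a) -> r x) -> forall i, r (pder i p).
Proof.
move=> tr pm pp pr nb d0 hd r pI hr; have [[_ rD rM] r1 rp] := pI.
have fR := @factorial_mpoly F m.
have rmax : r (pder ord_max p).
  have [M hM] := conductor_gen fR pm pp d0 nb hd.
  have := prime_exp_ideal pI (hr _ hM); rewrite /pder mderiv_of_upoly of_upolyK; exact.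
move=> i; have [->//|[j ->]] := widen_max i; set wj := widen_ord _ j.
have [t [k [t0 k0 gm]]] := shear_lead j tr; have [f [g [fg gf fE gE]]] := shear_iso j t.
rewrite -fE in gm.
have dfp x : dvd p x -> dvd (f p) (f x) by move=> [h ->]; exists (f h); rewrite rmorphM.
have dfp' x : dvd (f p) (f x) -> dvd p x.
  by move=> [h hE]; exists (g h); rewrite -[x]fg hE rmorphM fg.
have ppf : prime_elt (f p) by exact: (prime_iso fg gf pp).
have [|x [v [xv vm vE]]] := dvd_monic (q := f p) gm.
  by rewrite -mul_polyC; apply: dvd_mull; exact: dfp.
have ppv : prime_elt (v *: f p) by apply: (prime_assoc ppf _ vE); exact: monic_neq0.
have [||M [s1 [s2 sE]]] := conductor_gen (b := f b) (a := f a) (c := fun i => f (c i)) fR vm ppv d0.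
- by move=> /vE /dfp'.
- apply/vE; have -> : f a ^+ d + \sum_(i0 < d) f (c i0) * f a ^+ i0 * f b ^+ (d - i0) =
      f (a ^+ d + \sum_(i0 < d) c i0 * a ^+ i0 * b ^+ (d - i0)); last exact: dfp.
  rewrite rmorphD rmorphXn rmorph_sum /=; congr (_ + _); apply: eq_bigr => e _.
  by rewrite !rmorphM !rmorphXn.
have rx : r (g ((v *: f p)^`()) ^+ M).
  apply: hr; exists (g s1), (g s2 * g v%:P).
  have := congr1 g sE; rewrite rmorphM rmorphXn /= fg => ->.
  by rewrite rmorphD !rmorphM /= fg -mul_polyC rmorphM /= fg mulrA.
have {rx} rx := prime_exp_ideal pI rx.
have gfp : g (f p)^`() = pder ord_max p + t%:MP%:P * pder wj p.
  have -> : (f p)^`() = f (pder ord_max p + t%:MP%:P * pder wj p); last exact: fg.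
  rewrite fE -[LHS]of_upolyK -mderiv_of_upoly fE muniK mderiv_shear; congr (muni (shear _ _ _)).
  have e1 : of_upoly (pder ord_max p) = (of_upoly p)^`M(ord_max) by exact: muniK.
  have e2 : of_upoly (pder wj p) = (of_upoly p)^`M(wj) by exact: muniK.
  have -> : of_upoly (pder ord_max p + t%:MP%:P * pder wj p) =
    of_upoly (pder ord_max p) + of_upoly t%:MP%:P * of_upoly (pder wj p) by rewrite of_upolyD of_upolyM.
  have -> : of_upoly t%:MP%:P = t%:MP :> U by rewrite of_upolyC mwidenC.
  exact: (f_equal2 +%R (esym e1) (f_equal2 *%R erefl (esym e2))).
have {rx} : r (g (f p)^`()).
  have -> : (f p)^`() = x%:P * (v *: f p)^`() by rewrite derivZ mul_polyC scalerA xv scale1r.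
  by rewrite rmorphM; exact: rM.
have raux (A B : W) : r (A + B) -> r A -> r B.
  move=> rAB rA; have -> : B = (A + B) + (-1) * A by ring.
  by apply: rD => //; exact: rM.
rewrite gfp => h; have ht := raux _ _ h rmax.
have rinv (A z z' : W) : z' * z = 1 -> r (z * A) -> r A.
  by move=> e h'; have := rM z' _ h'; rewrite mulrA e mul1r.
by apply: (rinv _ _ (t^-1%:MP%:P) _ ht); rewrite -polyCM -(@mpolyCM m F t^-1 t) mulVf // mpolyC1.
Qed.
End Shear.

(** * Hyperplane sections *)

Section StalkField.
Variables (F : closedFieldType) (n : nat).
Local Notation S := {mpoly F[n.+1]}.
Variables (J : ideal F n) (Q : prime_idealr S).
Hypothesis hJ : homogeneous_set J.
Hypothesis hQ : homogeneous_set [set p | p \in Q].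
Hypothesis JQ : forall p, J p -> p \in Q.

Definition locally_zero (s : S) := exists w, w \notin Q /\ J (w * s).

Lemma notin_component w : w \notin Q -> exists d, pihomog mdeg d w \notin Q.
Proof.
move=> wQ; apply: contrapT => h; move/negP: wQ; apply.
rewrite (pihomog_partitionE (mf := mdeg) (leqnn (msize w))); apply: rpred_sum => d _.
by apply: contrapT => /negP nQ; apply: h; exists d.
Qed.

Lemma notin_J w x : w \notin Q -> x \notin Q -> ~ J (w * x).
Proof. by move=> wQ xQ /JQ; apply/negP; exact: notin_primeM. Qed.

(** The multiplier w need not be homogeneous: one of its components lies outside Q, and J is
    homogeneous. *)
Lemma stalk_eq0 (a : hfrac Q) : \pi_(stalk J Q) a = 0 <-> locally_zero (hnum a).
Proof.
split=> [/eqP/stalkP[w [_ wQ]]|[w [wQ Jw]]]; first by rewrite /= mulr1 mul0r subr0 => h; exists w.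
apply/eqP/stalkP; have [d dQ] := notin_component wQ; exists (pihomog mdeg d w).
split=> //; first by exists d; exact: pihomogP.
rewrite /= mulr1 mul0r subr0 mulrC -(pihomog_mul _ _ (hnum_homog a)) mulrC.
exact: hJ.
Qed.

Lemma stalk_exp (a : hfrac Q) k : exists b : hfrac Q,
  (\pi_(stalk J Q) a) ^+ k = \pi_(stalk J Q) b /\ hnum b = hnum a ^+ k.
Proof.
elim: k => [|k [b [bE hb]]]; first by exists (hfrac_const Q (dhomog1 _ _)).
exists (hfrac_mul a b); rewrite exprS bE exprS /= hb; split=> //; exact: stalk_mulE.
Qed.

Lemma stalk_reduced : (forall s k, locally_zero (s ^+ k) -> locally_zero s) ->
  reduced_ring (stalk J Q).
Proof.
move=> h; elim/quotW=> a k; have [b [-> hb]] := stalk_exp a k.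
by move=> /stalk_eq0; rewrite hb => /h /stalk_eq0.
Qed.

Section Residue.
Variables (K : fieldType) (kap : {rmorphism S -> K}).
Hypothesis kapE : forall s, kap s = 0 <-> locally_zero s.

Lemma kap_notin w : w \notin Q -> kap w != 0.
Proof. by move=> wQ; apply/eqP => /kapE [w' [w'Q /notin_J]]; apply. Qed.

Lemma kap_homog s d : kap s = 0 -> kap (pihomog mdeg d s) = 0.
Proof.
(* Keeping track of degrees by powers of 'X reduces the claim to the integrality of K['X]. *)
move=> /kapE[w [wQ Jw]].
pose Psi : {rmorphism S -> {poly K}} :=
  mmap (polyC \o kap \o @mpolyC n.+1 F) (fun i => 'X * (kap 'X_i)%:P).
have PsiE p : Psi p = \sum_(d < msize p) 'X^d * (kap (pihomog mdeg d p))%:P.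
  rewrite /Psi /= homog_mmap; apply: eq_bigr => e _; congr (_ * _).
  rewrite -(mmap_comp (@polyC K) (kap \o @mpolyC n.+1 F) (fun i => kap 'X_i)).
  rewrite -(mmap_comp kap (@mpolyC n.+1 F) (fun i => 'X_i)); congr (kap _)%:P.
  by apply/esym; exact: (@mmap_hom _ _ _ (@mpolyC n.+1 F) idfun).
have Psi0 p : Psi p = 0 -> forall e, kap (pihomog mdeg e p) = 0.
  move=> p0 e; have [pe|] := leqP (msize p) e; first by rewrite pihomog_big // rmorph0.
  move=> ep; have := congr1 (fun q : {poly K} => q`_e) p0; rewrite PsiE coef0 coef_sum.
  rewrite (bigD1 (Ordinal ep)) //= big1 ?addr0 => [|i ie]; last first.
    rewrite coefMC coefXn (_ : (_ == _) = false) ?mul0r //.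
    by apply/negbTE; apply: contra ie => /eqP e'; apply/eqP; apply: val_inj.
  by rewrite coefMC coefXn eqxx mul1r.
have : Psi w * Psi s = 0.
  rewrite -rmorphM PsiE big1 // => e _.
  have -> : kap (pihomog mdeg e (w * s)) = 0; last by rewrite polyC0 mulr0.
  apply/kapE; exists 1; split; first exact: notin_prime1.
  by rewrite mul1r; exact: hJ.
move/eqP; rewrite mulf_eq0 => /orP[]/eqP /Psi0 h; last exact: h.
by have [e /kap_notin] := notin_component wQ; rewrite h eqxx.
Qed.

Definition stalk_val (x : stalk J Q) : K := kap (hnum (repr x)) / kap (hden (repr x)).

Lemma stalk_valE (a : hfrac Q) : stalk_val (\pi_(stalk J Q) a) = kap (hnum a) / kap (hden a).
Proof.
have [w [_ wQ Jw]] := stalk_reprP J a; rewrite /stalk_val; set b := repr _ in Jw *.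
apply/eqP; rewrite eqr_div ?kap_notin ?hden_notin // -subr_eq0 -!rmorphM -rmorphB; apply/eqP.
by apply/kapE; exists w; split=> //; rewrite -opprB mulrN; exact: idealN.
Qed.

Lemma stalk_val_additive : zmod_morphism stalk_val.
Proof.
elim/quotW=> a; elim/quotW=> b.
have -> : \pi_(stalk J Q) a - \pi_(stalk J Q) b = \pi_(stalk J Q) (hfrac_add a (hfrac_opp b)).
  by rewrite -[- _]/(stalk_opp _) stalk_oppE -[_ + _]/(stalk_add _ _) stalk_addE.
rewrite !stalk_valE /= rmorphD !rmorphM rmorphN; have := kap_notin (hden_notin a).
have := kap_notin (hden_notin b); move: (kap _) (kap _) => A B; move: (kap _) (kap _) => C D *.
by field; apply/andP.
Qed.

Lemma stalk_val_multiplicative : monoid_morphism stalk_val.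
Proof.
split; first by rewrite -[1]/(stalk1 J Q) stalk_valE /= rmorph1 divr1.
elim/quotW=> a; elim/quotW=> b.
rewrite -[_ * _]/(stalk_mul _ _) stalk_mulE !stalk_valE /= !rmorphM invfM.
by rewrite -!mulrA; congr (_ * _); rewrite mulrCA.
Qed.

HB.instance Definition _ := GRing.isZmodMorphism.Build (stalk J Q) K stalk_val stalk_val_additive.
HB.instance Definition _ := GRing.isMonoidMorphism.Build (stalk J Q) K stalk_val stalk_val_multiplicative.

Lemma stalk_val_eq0 x : stalk_val x = 0 -> x = 0.
Proof.
elim/quotW: x => a; rewrite stalk_valE => /eqP; rewrite mulf_eq0 invr_eq0.
by rewrite (negbTE (kap_notin (hden_notin a))) orbF => /eqP/kapE/stalk_eq0.
Qed.

Lemma stalk_val_inj : injective stalk_val.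
Proof.
by move=> x y e; apply/eqP; rewrite -subr_eq0; apply/eqP/stalk_val_eq0; rewrite rmorphB /= e subrr.
Qed.

(** The product w of the denominators clears the integral equation, and a and b are brought to one
    degree. The w' and h supplied by the hypothesis are not homogeneous; a component of w' outside Q
    and the component of h of the same degree serve as well, by [kap_homog]. *)
Lemma stalk_normal : (forall (A B w : S) d (C : nat -> S), w \notin Q -> kap B != 0 ->
    kap (w * A ^+ d + \sum_(i < d) C i * A ^+ i * B ^+ (d - i)) = 0 ->
    exists w' h, w' \notin Q /\ kap (w' * A) = kap (h * B)) ->
  normal_domain (stalk J Q).
Proof.
move=> clos; have p0 : prime_ideal (fun x : stalk J Q => x = 0).
  split; first by split=> [//|a b -> ->|a b ->]; rewrite ?addr0 ?mulr0.
    by move=> /(congr1 stalk_val); rewrite rmorph1 rmorph0 => /eqP; rewrite oner_eq0.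
  move=> a b /(congr1 stalk_val); rewrite rmorphM rmorph0 => /eqP; rewrite mulf_eq0.
  by move=> /orP[]/eqP/stalk_val_eq0; [left|right].
have [L [g [g0 gf]]] := prime_residue_field p0; exists L, g; split=> //.
  move=> x y e; apply/eqP; rewrite -subr_eq0; apply/eqP/g0; by rewrite rmorphB e subrr.
move=> z d c zE; have [a [b [gb zab]]] := gf z.
have {zE} : g (a ^+ d + \sum_(i < d) c i * a ^+ i * b ^+ (d - i)) = 0.
  have ga : g a = z * g b by rewrite zab divfK.
  rewrite rmorphD rmorphXn rmorph_sum /= ga.
  transitivity ((z ^+ d + \sum_(i < d) g (c i) * z ^+ i) * g b ^+ d); last by rewrite zE mul0r.
  rewrite mulrDl exprMn mulr_suml; congr (_ + _); apply: eq_bigr => i _.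
  have ed : g b ^+ d = g b ^+ (d - i) * g b ^+ i by rewrite -exprD subnK // ltnW.
  rewrite !rmorphM !rmorphXn /= ga exprMn ed; ring.
move=> /g0 /(congr1 stalk_val); rewrite rmorph0 rmorphD rmorphXn rmorph_sum /= => eK.
have b0 : stalk_val b != 0.
  by apply: contraNneq gb => /stalk_val_eq0 ->; rewrite rmorph0.
have frac x : exists A D e, [/\ A \is e.-homog, D \is e.-homog, D \notin Q & stalk_val x * kap D = kap A].
  elim/quotW: x => f; exists (hnum f), (hden f), (hdeg f); split; rewrite ?hnum_homog ?hden_homog ?hden_notin //.
  by rewrite stalk_valE divfK // kap_notin // hden_notin.
have [A [Da [ea [hA hDa DaQ aE]]]] := frac a; have [B [Db [eb [hB hDb DbQ bE]]]] := frac b.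
have [Cn hCn] := choice (fun i : 'I_d => frac (c i)).
have [Cd hCd] := choice hCn; pose w := \prod_i Cd i.
have wQ : w \notin Q.
  rewrite /w; elim/big_ind: _ => [|x y|i _]; [exact: notin_prime1|exact: notin_primeM|].
  by have [e []] := hCd i.
pose C k : S := if insub k is Some i then Cn i * \prod_(j | j != i) Cd j else 0.
have CE (i : 'I_d) : kap (C i) = kap w * stalk_val (c i).
  have [e [_ _ _ cE]] := hCd i; have wE : w = Cd i * \prod_(j | j != i) Cd j by rewrite /w (bigD1 i).
  rewrite /C valK wE !rmorphM -cE; ring.
have kA : kap (A * Db) = stalk_val a * (kap Da * kap Db) by rewrite rmorphM -aE mulrA.
have kB : kap (B * Da) = stalk_val b * (kap Da * kap Db) by rewrite rmorphM -bE; ring.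
have dd : kap Da * kap Db != 0 by rewrite mulf_neq0 // kap_notin.
have [||w' [h [w'Q e]]] := clos (A * Db) (B * Da) w d C wQ.
- by rewrite kB mulf_neq0.
- rewrite rmorphD rmorphM rmorphXn rmorph_sum /= kA.
  transitivity (kap w * (kap Da * kap Db) ^+ d * (stalk_val a ^+ d +
    \sum_(i < d) stalk_val (c i * a ^+ i * b ^+ (d - i)))); last by rewrite eK mulr0.
  rewrite mulrDr exprMn mulr_sumr; congr (_ + _); first by ring.
  apply: eq_bigr => i _; rewrite !rmorphM !rmorphXn /= CE kA kB !exprMn.
  have ed (x : K) : x ^+ d = x ^+ (d - i) * x ^+ i by rewrite -exprD subnK // ltnW.
  rewrite (ed (kap Da)) (ed (kap Db)); ring.
have [k kQ] := notin_component w'Q.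
have hAB : (A * Db) \is (ea + eb).-homog by exact: dhomogM.
have hBA : (B * Da) \is (ea + eb).-homog by rewrite addnC; exact: dhomogM.
have e' : kap (pihomog mdeg k w') * kap (A * Db) = kap (pihomog mdeg k h) * kap (B * Da).
  apply/eqP; rewrite -subr_eq0 -!rmorphM -rmorphB; apply/eqP.
  rewrite mulrC -(pihomog_mul w' k hAB) [X in _ - X]mulrC -(pihomog_mul h k hBA) -pihomogB.
  by apply: kap_homog; rewrite (mulrC _ w') (mulrC _ h) rmorphB e subrr.
pose y := \pi_(stalk J Q) (HFrac (pihomogP mdeg k h) (pihomogP mdeg k w') kQ).
have ay : a = b * y.
  apply: stalk_val_inj; have -> : stalk_val (b * y) = stalk_val b * stalk_val y by exact: rmorphM.
  have -> : stalk_val y = kap (pihomog mdeg k h) / kap (pihomog mdeg k w') by rewrite /y stalk_valE.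
  apply: (mulIf dd); rewrite -kA; apply: (mulfI (kap_notin kQ)); rewrite e' kB.
  have := kap_notin kQ; move: (kap (pihomog mdeg k w')) (kap (pihomog mdeg k h)) => W H W0.
  by move: (stalk_val b) (kap Da * kap Db) => sb D; field.
by exists y; rewrite zab ay rmorphM [g b * _]mulrC mulfK.
Qed.
End Residue.
End StalkField.

(** * Comparison of the local rings of the section and of the hypersurface *)

Section Cong.
Variables (S : comNzRingType) (J : S -> Prop).
Hypothesis iJ : is_ideal J.
Definition cong (x y : S) := J (x - y).
Let JD x y : J x -> J y -> J (x + y). Proof. by case: iJ => _ + _; apply. Qed.
Let JM x y : J y -> J (x * y). Proof. by case: iJ => _ _; apply. Qed.
Lemma cong_trans x y z : cong x y -> cong y z -> cong x z.
Proof. by move=> a b; rewrite /cong -(subrK y x) -addrA; exact: JD. Qed.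
Lemma cong_sym x y : cong x y -> cong y x.
Proof. by move=> a; rewrite /cong -opprB -mulN1r; exact: JM. Qed.
Lemma cong_refl x : cong x x. Proof. by rewrite /cong subrr; case: iJ. Qed.
Lemma congD x y z w : cong x y -> cong z w -> cong (x + z) (y + w).
Proof. by move=> a b; rewrite /cong opprD addrACA; exact: JD. Qed.
Lemma congM x y z w : cong x y -> cong z w -> cong (x * z) (y * w).
Proof.
move=> a b; rewrite /cong; have -> : x * z - y * w = z * (x - y) + y * (z - w) by ring.
by apply: JD; exact: JM.
Qed.
Lemma congX x y k : cong x y -> cong (x ^+ k) (y ^+ k).
Proof. by move=> a; elim: k => [|k IH]; rewrite ?expr0 ?exprS; [exact: cong_refl|exact: congM]. Qed.
Lemma cong_sum k (f g : 'I_k -> S) : (forall i, cong (f i) (g i)) -> cong (\sum_i f i) (\sum_i g i).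
Proof. by move=> h; elim/big_ind2: _ => [|*|*]; [exact: cong_refl|exact: congD|exact: h]. Qed.
Lemma congJ x y : cong x y -> J x -> J y.
Proof. by move=> /cong_sym a b; rewrite -(subrK x y); exact: JD. Qed.
End Cong.

Section LocalTransfer.
Variables (S : comNzRingType) (J Q : S -> Prop) (R : idomainType) (N : {poly R} -> S).
Variables (rho u : {poly R}).
Local Notation W := {poly R}.
Hypothesis iJ : is_ideal J.
Hypothesis pQ : prime_ideal Q.
Hypothesis JQ : forall x, J x -> Q x.
Hypothesis N0 : N 0 = 0.
Hypothesis N1 : N 1 = 1.
Hypothesis ND : forall x y, N (x + y) = N x + N y.
Hypothesis NM : forall x y, N (x * y) = N x * N y.
Hypothesis Qu : ~ Q (N u).
Hypothesis Jrho : J (N rho).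
Hypothesis rep : forall a, exists w, cong J (N u * a) (N w).
Hypothesis J_dvd : forall w, J (N w) -> dvd rho (u * w).

Definition loc0 (s : S) := exists w, ~ Q w /\ J (w * s).

Let JD x y : J x -> J y -> J (x + y). Proof. by case: iJ => _ + _; apply. Qed.
Let JM x y : J y -> J (x * y). Proof. by case: iJ => _ _; apply. Qed.
Let Qpr x y : Q (x * y) -> Q x \/ Q y. Proof. by case: pQ => _ _; apply. Qed.
Let congQ x y : cong J x y -> Q x -> Q y.
Proof. by move=> /(cong_sym iJ) /JQ h; case: pQ => -[_ QD _] _ _ Qx; rewrite -(subrK x y); exact: QD. Qed.
Let NX x k : N (x ^+ k) = N x ^+ k.
Proof. by elim: k => [|k IH]; rewrite ?expr0 ?N1 // !exprS NM IH. Qed.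

Let Q' w := Q (N w).
Let pQ' : prime_ideal Q'.
Proof.
case: pQ => -[Q0 QD QM] Q1 _; split; first split.
- by rewrite /Q' N0.
- by move=> x y; rewrite /Q' ND; exact: QD.
- by move=> x y; rewrite /Q' NM; exact: QM.
- by rewrite /Q' N1.
- by move=> x y; rewrite /Q' NM; exact: Qpr.
Qed.
Let nQM x y : ~ Q' x -> ~ Q' y -> ~ Q' (x * y).
Proof. by rewrite /Q' NM => a b /Qpr[]. Qed.
Let nQX x k : ~ Q' x -> ~ Q' (x ^+ k).
Proof. by move=> nx h; apply: nx; exact: prime_exp_ideal pQ' h. Qed.

(** With [of_local], a dictionary: if (N U) a is congruent to N w, then a vanishes in the
    localisation of S/J at Q iff w does in that of R[T]/(rho) at the inverse image of Q. *)
Let to_local U a w : ~ Q' U -> cong J (N U * a) (N w) -> loc0 a ->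
  exists v, ~ Q' v /\ dvd rho (v * w).
Proof.
move=> nU aw [w0 [w0Q Jw0]]; have [w1 hw1] := rep w0.
have w1Q : ~ Q' w1 by move=> /(congQ (cong_sym iJ hw1)) /Qpr[].
have Jw : J (N (w1 * w)).
  rewrite NM; apply: (congJ iJ (x := N u * w0 * (N U * a))); first exact: congM.
  by rewrite mulrACA; exact: JM.
by exists (u * w1); split; [exact: nQM|rewrite -mulrA; exact: J_dvd].
Qed.

Let of_local U a w v : ~ Q' U -> cong J (N U * a) (N w) -> ~ Q' v -> dvd rho (v * w) -> loc0 a.
Proof.
move=> nU aw nv [k kE]; exists (N v * N U); split; first by move=> /Qpr[].
rewrite -mulrA; apply: (congJ iJ (x := N v * N w)).
  by apply: (congM iJ (cong_refl iJ _)); exact: cong_sym.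
by rewrite -NM kE NM; exact: JM.
Qed.

Hypothesis fR : factorial R.
Hypothesis fU : factorial {poly R}.
Hypothesis rm : rho \is monic.
Hypothesis nosq : forall p, prime_elt p -> Q (N p) -> ~ dvd (p * p) rho.

Lemma loc0_reduced a k : loc0 (a ^+ k) -> loc0 a.
Proof.
move=> lz; have [w aw] := rep a.
have awk : cong J (N (u ^+ k) * a ^+ k) (N (w ^+ k)) by rewrite !NX -exprMn; exact: congX.
have [v [nv dv]] := to_local (@nQX _ k Qu) awk lz.
have [v' [nv' dv']] := local_reduced fU rm pQ' nosq nv dv.
exact: of_local Qu aw nv' dv'.
Qed.

Variables (I : Type) (der : I -> W -> W).
Hypothesis derM : forall i x y, der i (x * y) = x * der i y + der i x * y.
Hypothesis big : forall D, is_ideal D ->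
  (forall q, prime_ideal q -> (forall x, D x -> q x) -> ~ q u -> q rho /\ forall i, q (der i rho)) ->
  forall g, prime_elt g -> exists al e, ~ dvd g al /\ D (u ^+ e * al%:P).
Hypothesis cond : forall p a b d (c : nat -> W), p \is monic -> prime_elt p -> dvd p rho ->
  ~ dvd p b -> (0 < d)%N -> dvd p (a ^+ d + \sum_(i < d) c i * a ^+ i * b ^+ (d - i)) ->
  forall r, prime_ideal r -> (forall x, mem2 b p (x * a) -> r x) -> forall i, r (der i p).

Lemma loc0_prime : prime_ideal loc0.
Proof.
split; first split.
- by exists 1; split; [case: pQ|rewrite mulr0; case: iJ].
- move=> a b [v [nv Jv]] [w [nw Jw]]; exists (v * w); split; first by move=> /Qpr[].
  have -> : v * w * (a + b) = w * (v * a) + v * (w * b) by ring.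
  by apply: JD; exact: JM.
- by move=> a b [w [nw Jw]]; exists w; split=> //; rewrite mulrCA; exact: JM.
- by move=> [w [nw]]; rewrite mulr1 => /JQ.
- move=> a b lz; have [v av] := rep a; have [w bw] := rep b.
  have abw : cong J (N (u * u) * (a * b)) (N (v * w)) by rewrite !NM mulrACA; exact: congM.
  have [x [nx dx]] := to_local (nQM Qu Qu) abw lz.
  have [y [ny [dy|dy]]] := local_integral fR fU rm pQ' (JQ Jrho) Qu nosq derM big nx dx.
    by left; exact: of_local Qu av ny dy.
  by right; exact: of_local Qu bw ny dy.
Qed.

Lemma loc0_closed A B w d (C : nat -> S) : ~ Q w -> ~ loc0 B ->
  loc0 (w * A ^+ d + \sum_(i < d) C i * A ^+ i * B ^+ (d - i)) ->
  exists w' h, ~ Q w' /\ loc0 (w' * A - h * B).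
Proof.
move=> nw nB lz; have [a aA] := rep A; have [b bB] := rep B; have [w1 ww] := rep w.
have [c cC] := choice (fun i => rep (C i)).
have w1Q : ~ Q' w1 by move=> /(congQ (cong_sym iJ ww)) /Qpr[].
have [|v [nv dv]] := to_local (U := u ^+ d.+1) (w := w1 * a ^+ d + \sum_(i < d) c i * a ^+ i * b ^+ (d - i)) (@nQX _ d.+1 Qu) _ lz.
  have Nsum : N (\sum_(i < d) c i * a ^+ i * b ^+ (d - i)) = \sum_(i < d) N (c i) * N a ^+ i * N b ^+ (d - i).
    rewrite (big_morph N ND N0); apply: eq_bigr => i _; by rewrite !NM !NX.
  rewrite ND NM !NX Nsum mulrDr mulr_sumr; apply: (congD iJ).
    rewrite (_ : _ * _ = (N u * w) * (N u * A) ^+ d); last by rewrite exprMn exprS; ring.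
    by apply: (congM iJ ww); exact: congX.
  apply: (cong_sum iJ) => i.
  rewrite (_ : _ * _ = (N u * C i) * (N u * A) ^+ i * (N u * B) ^+ (d - i)); last first.
    have -> : N u ^+ d.+1 = N u * (N u ^+ i * N u ^+ (d - i)) by rewrite exprS -exprD subnKC // ltnW.
    by rewrite !exprMn; ring.
  by apply: (congM iJ); [apply: (congM iJ (cC i))|]; exact: congX.
have dv' : dvd rho ((v * w1) * a ^+ d + \sum_(i < d) (v * c i) * a ^+ i * b ^+ (d - i)).
  move: dv; congr (dvd _ _); rewrite mulrDr mulrA mulr_sumr; congr (_ + _).
  by apply: eq_bigr => i _; rewrite !mulrA.
have nb w' : ~ Q' w' -> ~ dvd rho (w' * b).
  by move=> nw' h; apply: nB; exact: of_local Qu bB nw' h.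
have [w' [h [nw' dh]]] := local_normal (c := fun i => v * c i) fR fU rm pQ' (JQ Jrho) Qu nosq derM big cond (nQM nv w1Q) nb dv'.
exists (N w'), (N h); split=> //; apply: (of_local (U := u) (w := w' * a - h * b) (v := 1) Qu).
- have -> : N (w' * a - h * b) = N w' * N a + (- N h) * N b.
    have NN x : N (- x) = - N x by apply/eqP; rewrite -addr_eq0 -ND addNr N0.
    by rewrite ND NN !NM mulNr.
  have -> : N u * (N w' * A - N h * B) = N w' * (N u * A) + (- N h) * (N u * B) by ring.
  by apply: (congD iJ); apply: (congM iJ (cong_refl iJ _)).
- by rewrite /Q' N1; case: pQ.
- by rewrite mul1r.
Qed.
End LocalTransfer.

Section Transfer.
Variables (F : closedFieldType) (n : nat).
Local Notation S := {mpoly F[n.+1]}.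
Local Notation V := 'rV[F]_n.+1.
Local Notation P := (proj F n).
Hypothesis charF : forall k, k.+1%:R != 0 :> F.

Section HyperplaneSection.
Variables (X : set P) (h : P) (l : V).
Hypothesis hl : hcoord h l.
Let J := section_ideal X h.

Lemma linear_formZ (a : F) (v : V) : linear_form (a *: v) = a%:MP * linear_form v.
Proof.
rewrite /linear_form mulr_sumr; apply: eq_bigr => i _.
by rewrite mxE mul_mpolyC scalerA.
Qed.

Lemma section_idealE g : J g <-> exists q r, vanishing X q /\ g = q + r * linear_form l.
Proof.
split=> [[q [r [l' [Xq l'h ->]]]]|[q [r [Xq ->]]]]; last first.
  by exists q, r, l; split=> //; case: hl.
move: l'h; rewrite (hcoord_line hl) => /vlineP[a ->].
by exists q, (r * a%:MP); split=> //; rewrite linear_formZ mulrA.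
Qed.

Lemma section_homog : homogeneous_set J.
Proof.
move=> g d /section_idealE[q [r [Xq ->]]]; apply/section_idealE.
rewrite pihomogD [r * _]mulrC; case: d => [|d].
  rewrite (pihomog_mul0 _ (linear_form_homog l)) //.
  by exists (pihomog mdeg 0 q), 0; split; [exact: vanishing_homog|rewrite mul0r].
have -> : pihomog mdeg d.+1 (linear_form l * r) = linear_form l * pihomog mdeg d r.
  exact: pihomog_mul (linear_form_homog l).
by exists (pihomog mdeg d.+1 q), (pihomog mdeg d r); split; [exact: vanishing_homog|rewrite [_ * linear_form l]mulrC].
Qed.

(** A closed point in the closure of Q: a polynomial nonzero at v0 lies outside Q, so a chart around
    v0 also covers Q. *)
Lemma section_point (Q : prime_idealr S) : closed X -> proj_point J Q -> exists v0,
  [/\ pcone X v0, dotp l v0 = 0 & forall q, q \in Q -> q.@[v0 0] = 0].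
Proof.
move=> cX [hQ JQ [i iQ]].
have [v [vQ vi]] : exists v, (forall q, q \in Q -> q.@[v] = 0) /\ v i != 0.
  apply: contrapT => nv; have [v hv|k] := @nullstellensatz F n.+1 (fun q => q \in Q) 'X_i.
    rewrite mevalXU; apply/eqP; apply: contrapT => /negP vi; apply: nv; by exists v.
  have iI : is_ideal (fun q => q \in Q).
    by split=> [|a b aQ bQ|a b bQ]; [exact: rpred0|exact: rpredD|rewrite prime_idealrM bQ orbT].
  move/(gen_min iI (fun _ => id)); elim: k => [|k IH]; first by rewrite expr0 idealr1.
  by rewrite exprS prime_idealrM (negbTE iQ).
pose w : V := \row_a v a.
have wv q : q.@[w 0] = q.@[v] by apply: meval_eq => a; rewrite mxE.
exists w; split=> [||q /vQ]; last by rewrite wv.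
  apply: closed_pcone => // [|q Xq].
    by apply: contraNneq vi => w0; have := wv 'X_i; rewrite w0 !mevalXU mxE => <-.
  by rewrite wv vQ // JQ //; apply/section_idealE; exists q, 0; split=> //; rewrite mul0r addr0.
rewrite -meval_linear_form wv vQ // JQ //; apply/section_idealE.
by exists 0, 1; split; [exact: (@vanishing0 F n X)|rewrite mul1r add0r].
Qed.

Variables (m s : nat) (c : 'I_m.+2 -> V) (u : {mpoly F[m.+2]}).
Variables (G : 'I_n.+1 -> {mpoly F[m.+2]}) (p : {poly {mpoly F[m.+1]}}).
Hypothesis cX : closed X.
Hypothesis iX : irreducible X.
Hypothesis nX : nonsingular X.
Hypothesis dX : has_dim X m.
Hypothesis dS : has_dim (secant_variety X) s.
Hypothesis lX : ~ vanishing X (linear_form l).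
Hypothesis ch : chart X c u G p.
Hypothesis cl : c ord0 = l.
Hypothesis uE : forall a, exists g, vanishing X (theta c u * a - theta c g).
Local Notation W := {poly {mpoly F[m]}}.
Let mu : {mpoly F[m.+1]} -> S := theta (fun a => c (lift ord0 a)).
Definition chart_ring (w : W) : S := mu (of_upoly w).
Let N := chart_ring.
Let rho : W := uface p.
Let uu : W := muni (face ord0 u).

Let ND x y : N (x + y) = N x + N y. Proof. by rewrite /N /chart_ring of_upolyD; exact: thetaD. Qed.
Let NM x y : N (x * y) = N x * N y. Proof. by rewrite /N /chart_ring of_upolyM; exact: thetaM. Qed.
Let N1 : N 1 = 1. Proof. by rewrite /N /chart_ring (rmorph1 (@of_upoly F m)); exact: theta1. Qed.
Let N0 : N 0 = 0. Proof. by rewrite /N /chart_ring (rmorph0 (@of_upoly F m)); exact: theta0. Qed.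

Let iJ : is_ideal J. Proof. by split; [exact: ideal0|exact: idealD|exact: idealM]. Qed.
Let JX q : vanishing X q -> J q.
Proof. by move=> Xq; apply/section_idealE; exists q, 0; split=> //; rewrite mul0r addr0. Qed.

Let muc q : theta c (coface ord0 q) = mu q.
Proof.
elim/mpoly_alg_ind: q => [a|i|q1 q2 IH1 IH2|q1 q2 IH1 IH2].
- by rewrite cofaceC thetaC /mu thetaC.
- by rewrite cofaceX thetaX /mu thetaX.
- by rewrite cofaceD thetaD /mu thetaD; exact: f_equal2.
- by rewrite cofaceM thetaM /mu thetaM; exact: f_equal2.
Qed.

Let N_face g : cong J (theta c g) (N (muni (face ord0 g))).
Proof.
rewrite /N /chart_ring muniK; have [q qE] := face_split ord0 g.
rewrite {1}qE thetaD thetaM muc thetaX cl /cong addrC addKr.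
by apply/section_idealE; exists 0, (theta c q); split; [exact: (@vanishing0 F n X)|rewrite add0r].
Qed.

Let rep a : exists w, cong J (N uu * a) (N w).
Proof.
have [g hg] := uE a; exists (muni (face ord0 g)).
apply: (cong_trans iJ _ (N_face g)); apply: (cong_trans iJ _ (JX hg)).
by apply: (congM iJ _ (cong_refl iJ a)); exact: (cong_sym iJ (N_face u)).
Qed.

Let N_rho : J (N rho).
Proof.
have [_ _ pE _] := ch; have e : N rho = N (muni (face ord0 (of_upoly p))).
  by rewrite -of_upoly_face of_upolyK.
rewrite e; apply: (congJ iJ (N_face _)); apply: JX.
by apply/pE; exists 1; rewrite mul1r.
Qed.

(** If N w = q + r l with q zero on X, then u r comes from a polynomial g of the chart, so u w - g
    X_0 is a multiple of the equation of the hypersurface; X_0 is then set to 0. *)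
Let N_dvd w : J (N w) -> dvd rho (uu * w).
Proof.
move=> /section_idealE[q [r [Xq e]]]; have [g hg] := uE r; have [_ _ pE _] := ch.
have [k kE] : exists k, u * coface ord0 (of_upoly w) - g * 'X_ord0 = k * of_upoly p.
  apply/pE; apply/vanishingE => v Xv; move/vanishingE: hg => /(_ v Xv); move/vanishingE: Xq => /(_ v Xv).
  have tc : (theta c (u * coface ord0 (of_upoly w))).@[v 0] = (theta c u).@[v 0] * (N w).@[v 0].
    by rewrite thetaM mevalM muc /N /chart_ring.
  have tg : (theta c (g * 'X_ord0)).@[v 0] = (theta c g).@[v 0] * (linear_form l).@[v 0].
    by rewrite thetaM thetaX cl mevalM.
  have -> : (theta c (u * coface ord0 (of_upoly w) - g * 'X_ord0)).@[v 0] =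
      (theta c (u * coface ord0 (of_upoly w))).@[v 0] - (theta c (g * 'X_ord0)).@[v 0].
    by rewrite -mevalB; congr meval; exact: rmorphB.
  rewrite tc tg e => Xq0; rewrite (mevalB (v 0) (theta c u * r)) mevalM => /eqP; rewrite subr_eq0 => /eqP <-.
  by rewrite mevalD mevalM Xq0; ring.
exists (muni (face ord0 k)).
have fE : face ord0 (u * coface ord0 (of_upoly w)) = face ord0 (k * of_upoly p + g * 'X_ord0).
  by rewrite -kE subrK.
move: fE; rewrite faceD !faceM cofaceK faceX mulr0 addr0 -of_upoly_face => /(congr1 (@muni m F)).
by rewrite !muniM !of_upolyK.
Qed.

Variable Q : prime_idealr S.
Hypothesis JQ : forall g, J g -> g \in Q.
Hypothesis uQ : theta c u \notin Q.

Let pQ : prime_ideal (fun g => g \in Q).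
Proof.
split; first split.
- exact: rpred0.
- by move=> x y; exact: rpredD.
- by move=> x y yQ; rewrite prime_idealrM yQ orbT.
- by rewrite idealr1.
- by move=> x y; rewrite prime_idealrM => /orP.
Qed.

Let loc0E a : locally_zero J Q a <-> loc0 J (fun g => g \in Q) a.
Proof. by split=> -[w [/negP wQ Jw]]; exists w. Qed.

Let Quu : ~ N uu \in Q.
Proof.
move=> h'; move/negP: uQ; apply; rewrite -(subrK (N uu) (theta c u)).
by apply: rpredD => //; apply: JQ; exact: N_face.
Qed.

Let rm : rho \is monic.
Proof. by have [_ tp _ _] := ch; have [] := tame_uface tp. Qed.

Let lX0 : ~ vanishing X (linear_form (c ord0)). Proof. by rewrite cl. Qed.

Let pQ' : prime_ideal (fun w => N w \in Q).
Proof.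
case: pQ => -[Q0 QD QM] Q1 Qp; split; first split.
- by rewrite N0.
- by move=> x y; rewrite ND; exact: QD.
- by move=> x y; rewrite NM; exact: QM.
- by rewrite N1.
- by move=> x y; rewrite NM; exact: Qp.
Qed.

Lemma section_loc0_reduced : (s + 1 <= 2 * m)%N -> forall a k,
  locally_zero J Q (a ^+ k) -> locally_zero J Q a.
Proof.
move=> sm a k /loc0E lz; apply/loc0E.
have nosq := chart_nosq charF cX iX nX dX dS lX0 ch pQ' Quu sm.
exact: (loc0_reduced iJ pQ JQ N0 N1 ND NM Quu N_rho rep N_dvd (@factorial_mpoly_poly F m) rm nosq lz).
Qed.

Lemma section_loc0_normal : (s + 2 <= 2 * m)%N -> prime_ideal (locally_zero J Q) /\
  forall A B w d (C : nat -> S), w \notin Q -> ~ locally_zero J Q B ->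
  locally_zero J Q (w * A ^+ d + \sum_(i < d) C i * A ^+ i * B ^+ (d - i)) ->
  exists w' h, w' \notin Q /\ locally_zero J Q (w' * A - h * B).
Proof.
move=> sm; have sm' : (s + 1 <= 2 * m)%N by move: sm; lia.
have nosq := chart_nosq charF cX iX nX dX dS lX0 ch pQ' Quu sm'.
have fU := @factorial_mpoly_poly F m; have fR := @factorial_mpoly F m.
have big := chart_big charF cX iX nX dX dS lX0 ch sm.
have tr : tame rho by have [_ tp _ _] := ch; exact: tame_uface.
have cond := fun p a b d c => @tame_conductor F m rho p a b d c tr.
have eqv : locally_zero J Q = loc0 J (fun g => g \in Q) by apply/funext => a; apply/propext; exact: loc0E.
have pl := loc0_prime iJ pQ JQ N0 N1 ND NM Quu N_rho rep N_dvd fR fU rm nosq (@pder_mul F m) big.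
rewrite eqv; split; first exact: pl.
move=> A B w d C /negP nw nB lz.
have [w' [h' [/negP nw' lz']]] := loc0_closed iJ pQ JQ N0 N1 ND NM Quu N_rho rep N_dvd fR fU rm nosq (@pder_mul F m) big cond nw nB lz.
by exists w', h'.
Qed.
End HyperplaneSection.

Lemma section_schemes X m s (h : P) : closed X -> irreducible X -> nonsingular X -> non_degenerate X ->
  has_dim X m -> has_dim (secant_variety X) s ->
  ((s + 1 <= 2 * m)%N -> reduced_scheme (section_ideal X h)) /\
  ((s + 2 <= 2 * m)%N -> normal_scheme (section_ideal X h)).
Proof.
move=> cX iX nX ne dX dS; have [l hl] := hcoord_ex h.
have lX : ~ vanishing X (linear_form l).
  move=> lX; apply: (ne h) => x Xx v xv; apply/(hyperplaneE _ hl).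
  by have := lX x v Xx xv; rewrite meval_linear_form.
have chart_at (Q : prime_idealr S) : proj_point (section_ideal X h) Q -> exists (c : 'I_m.+2 -> V) u G p,
    [/\ chart X c u G p, c ord0 = l, forall a, exists g, vanishing X (theta c u * a - theta c g) & theta c u \notin Q].
  move=> QP; have [v0 [Xv0 lv0 Qv0]] := section_point hl cX QP.
  have [c [u [G [p [ch cl u1 uE]]]]] := chart_exists charF cX iX nX dX lX Xv0.
  exists c, u, G, p; split=> //; apply/negP => /Qv0; rewrite u1 => /eqP; by rewrite oner_eq0.
have hJ := section_homog (X := X) hl.
split=> sm Q QP; have [c [u [G [p [ch cl uE uQ]]]]] := chart_at Q QP; have [hQ JQ _] := QP.
  apply: (stalk_reduced hJ).
  exact: (section_loc0_reduced hl cX iX nX dX dS lX ch cl uE JQ uQ sm).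
have [pL clos] := section_loc0_normal hl cX iX nX dX dS lX ch cl uE JQ uQ sm.
have [K [kap [kapE _]]] := prime_residue_field pL.
apply: (stalk_normal hJ JQ kapE) => A B w d C wQ B0 e.
have nB : ~ locally_zero (section_ideal X h) Q B by move=> /kapE B0'; rewrite B0' eqxx in B0.
have [w' [h' [nw' lz]]] := clos A B w d C wQ nB (iffLR (kapE _) e).
exists w', h'; split=> //; apply/eqP; rewrite -subr_eq0 -rmorphB; apply/eqP/kapE; exact: lz.
Qed.
End Transfer.

(** * The twisted normal bundle *)

Section Regular.
Variables (F : closedFieldType) (n : nat).
Local Notation S := {mpoly F[n.+1]}.
Local Notation V := 'rV[F]_n.+1.
Local Notation P := (proj F n).
Variable X : set P.

Lemma regular_ext m f g x (U : set P) : open U -> U x ->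
  (forall y v, X y -> U y -> hcoord y v -> f y v = g y v) ->
  regular_at X m f x -> regular_at X m g x.
Proof.
move=> oU Ux fg [e [a [b [W [ha hb oW Wx h]]]]]; exists e, a, b, (U `&` W).
split=> // [|y v Xy [Uy Wy] yv]; first exact: openI.
by rewrite -fg //; exact: h.
Qed.

Lemma regular_add m f g x : regular_at X m f x -> regular_at X m g x ->
  regular_at X m (fun y v => f y v + g y v) x.
Proof.
move=> [e [a [b [W [ha hb oW Wx h]]]]] [e' [a' [b' [W' [ha' hb' oW' Wx' h']]]]].
exists (e + e')%N, (a * b' + a' * b), (b * b'), (W `&` W'); split.
- apply: rpredD; first by rewrite addnAC; exact: dhomogM.
  by rewrite -addnA addnC; exact: dhomogM.
- exact: dhomogM.
- exact: openI.
- by [].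
- move=> y v Xy [Wy W'y] yv; have [b0 ->] := h y v Xy Wy yv; have [b0' ->] := h' y v Xy W'y yv.
  by rewrite mevalD !mevalM mulf_neq0 // addf_div.
Qed.

Lemma regular_mul m d f g x : regular_at X m f x -> regular_at X d g x ->
  regular_at X (m + d) (fun y v => f y v * g y v) x.
Proof.
move=> [e [a [b [W [ha hb oW Wx h]]]]] [e' [a' [b' [W' [ha' hb' oW' Wx' h']]]]].
exists (e + e')%N, (a * a'), (b * b'), (W `&` W'); split.
- by rewrite addnACA; exact: dhomogM.
- exact: dhomogM.
- exact: openI.
- by [].
- move=> y v Xy [Wy W'y] yv; have [b0 ->] := h y v Xy Wy yv; have [b0' ->] := h' y v Xy W'y yv.
  by rewrite !mevalM mulf_neq0 // mulf_div.
Qed.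

Lemma regular_form m g x : g \is m.-homog -> regular_at X m (fun _ v => g.@[v 0]) x.
Proof.
move=> hg; exists 0%N, g, 1, setT; split=> //; [exact: dhomog1|exact: openT|].
by move=> y v _ _ _; rewrite meval1 oner_neq0 divr1.
Qed.

Lemma regular_sum (I : Type) (r : seq I) m (f : I -> P -> V -> F) x :
  (forall i, regular_at X m (f i) x) -> regular_at X m (fun y v => \sum_(i <- r) f i y v) x.
Proof.
move=> h; elim: r => [|i r IH].
  have z : (0 : S) \is m.-homog by exact: dhomog0.
  have := regular_form x z.
  by apply: (regular_ext openT) => // y v _ _ _; rewrite big_nil meval0.
apply: (regular_ext openT) (regular_add (h i) IH) => // y v _ _ _; by rewrite big_cons.
Qed.

Lemma regular_div m d f g x : g \is d.-homog -> (exists v, hcoord x v /\ g.@[v 0] != 0) ->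
  regular_at X (m + d) f x -> regular_at X m (fun y v => f y v / g.@[v 0]) x.
Proof.
move=> hg [v0 [xv0 gv0]] [e [a [b [W [ha hb oW Wx h]]]]].
have oG : open (nonzero_locus [set g]).
  by rewrite open_zariski; exists [set g]; split=> // _ ->; exists d.
exists (e + d)%N, a, (b * g), (W `&` nonzero_locus [set g]); split.
- by rewrite -addnA [(d + m)%N]addnC.
- exact: dhomogM.
- exact: openI.
- by split=> //; exists g; split=> //; exists v0.
- move=> y v Xy [Wy [_ [-> [v1 [yv1 gv1]]]]] yv; have [b0 ->] := h y v Xy Wy yv.
  have gv := form_neq0 (ex_intro _ d hg) yv1 yv gv1.
  by rewrite mevalM mulf_neq0 // invfM mulrA.
Qed.

Lemma regular_const (a : F) x : regular_at X 0 (fun _ _ => a) x.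
Proof.
have z : (a%:MP : S) \is 0%N.-homog.
  by have -> : a%:MP = a *: 1 :> S; [rewrite -mul_mpolyC mulr1|apply: rpredZ; exact: dhomog1].
have := regular_form x z; apply: (regular_ext openT) => // y v _ _ _.
by rewrite mevalC.
Qed.
End Regular.

Section NormalMaps.
Variables (F : closedFieldType) (n : nat).
Local Notation S := {mpoly F[n.+1]}.
Local Notation V := 'rV[F]_n.+1.
Local Notation P := (proj F n).
Hypothesis charF : forall k, k.+1%:R != 0 :> F.
Variable X : set P.

Definition dirder (p : S) (v w : V) : F := \sum_k p^`M(k).@[v 0] * w 0 k.

Lemma dirderD p q v w : dirder (p + q) v w = dirder p v w + dirder q v w.
Proof. by rewrite -big_split; apply: eq_bigr => k _; rewrite mderivD mevalD mulrDl. Qed.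

Lemma dirder_lin p v a w w' : dirder p v (a *: w + w') = a * dirder p v w + dirder p v w'.
Proof. by rewrite mulr_sumr -big_split; apply: eq_bigr => k _; rewrite !mxE /=; ring. Qed.

Lemma dirder_sum p v (I : Type) (r : seq I) (a : I -> F) (w : I -> V) :
  dirder p v (\sum_(i <- r) a i *: w i) = \sum_(i <- r) a i * dirder p v (w i).
Proof.
elim: r => [|i r IH]; last by rewrite !big_cons dirder_lin IH.
by rewrite !big_nil /dirder big1 // => k _; rewrite mxE mulr0.
Qed.

Lemma dirderM x p q v w : X x -> hcoord x v -> vanishing X q ->
  dirder (p * q) v w = p.@[v 0] * dirder q v w.
Proof.
move=> Xx xv Xq; rewrite mulr_sumr; apply: eq_bigr => k _.
by rewrite mderivM mevalD !mevalM (Xq x v Xx xv) mulr0 add0r mulrA.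
Qed.

Lemma dirder_homog d q (v : V) w c : q \is d.+1.-homog -> dirder q (c *: v) w = c ^+ d * dirder q v w.
Proof.
move=> hq; rewrite mulr_sumr; apply: eq_bigr => k _.
by rewrite (form_scale v c (mderiv_homog k hq)) mulrA.
Qed.

(** The default 0 is the one that [normal_map] prescribes off the ideal of X and off the coordinates
    of x. *)
Definition nval (w : V) (x : P) : S -> V -> F^o := fun p v =>
  if `[< [/\ X x, vanishing X p & hcoord x v] >] then dirder p v w else 0.

Lemma nvalE w x p v : X x -> vanishing X p -> hcoord x v -> nval w x p v = dirder p v w.
Proof. by move=> *; rewrite /nval asboolT. Qed.

Lemma nvalP w x : nval w x \in normal_map X x.
Proof.
apply/asboolP; have N p v : ~ [/\ X x, vanishing X p & hcoord x v] -> nval w x p v = 0.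
  by move=> h; rewrite /nval asboolF.
split=> [p v h|p q v Xp Xq|p q v Xq|d q v c Xq hq c0].
- by apply: N => -[_ Xp xv]; apply: h.
- have [Xx|nX] := pselect (X x); last by rewrite !N ?addr0 // => -[].
  have [xv|nv] := pselect (hcoord x v); last by rewrite !N ?addr0 // => -[].
  by rewrite !nvalE ?dirderD //; exact: vanishingD.
- have [Xx|nX] := pselect (X x); last by rewrite !N ?mulr0 // => -[].
  have [xv|nv] := pselect (hcoord x v); last by rewrite !N ?mulr0 // => -[].
  by rewrite !nvalE ?(dirderM _ _ Xx xv) //; exact: vanishingM.
- have [Xx|nX] := pselect (X x); last by rewrite !N ?mulr0 // => -[].
  have [xv|nv] := pselect (hcoord x v); first by rewrite !nvalE ?(dirder_homog _ _ _ hq) //; exact: hcoordZ.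
  have nv' : ~ hcoord x (c *: v).
    have ci : c^-1 != 0 by rewrite invr_eq0.
    by move=> xv; apply: nv; have := hcoordZ xv ci; rewrite scalerA mulVf // scale1r.
  by rewrite (N _ (c *: v)) ?N ?mulr0 // => -[].
Qed.

Definition nsec (w : V) (x : P) : tnormal X x := TNormal (nvalP w x).

Lemma tnormal_eq x (f g : tnormal X x) :
  (forall p v, vanishing X p -> hcoord x v -> tnormal_val f p v = tnormal_val g p v) -> f = g.
Proof.
move=> h; apply: val_inj; apply/funext => p; apply/funext => v.
have [[Xp xv]|nh] := pselect (vanishing X p /\ hcoord x v); first exact: h.
have z (k : tnormal X x) : tnormal_val k p v = 0 by have /asboolP[z _ _ _] := tnormalP k; exact: z.
exact: etrans (z f) (esym (z g)).
Qed.

Lemma tnormal_valP x a (f g : tnormal X x) p v :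
  tnormal_val (a *: f + g) p v = a * tnormal_val f p v + tnormal_val g p v.
Proof. by []. Qed.

Lemma nsec_lin x a w w' : nsec (a *: w + w') x = a *: nsec w x + nsec w' x.
Proof.
apply: tnormal_eq => p v Xp xv; rewrite tnormal_valP /= /nval.
by case: asboolP => _; rewrite ?dirder_lin // mulr0 addr0.
Qed.

Lemma nsec0 x : nsec 0 x = 0.
Proof. by have := nsec_lin x (-1) 0 0; rewrite scaler0 addr0 scaleN1r addNr. Qed.

Lemma nsec_sum x (I : Type) (r : seq I) (a : I -> F) (w : I -> V) :
  nsec (\sum_(i <- r) a i *: w i) x = \sum_(i <- r) a i *: nsec (w i) x.
Proof.
by elim: r => [|i r IH]; rewrite ?big_nil ?nsec0 // !big_cons nsec_lin IH.
Qed.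

Lemma vanishing_ind (Pr : S -> Prop) : Pr 0 ->
  (forall p q, vanishing X p -> vanishing X q -> Pr p -> Pr q -> Pr (p + q)) ->
  (forall d p, vanishing X p -> p \is d.-homog -> Pr p) -> forall p, vanishing X p -> Pr p.
Proof.
move=> P0 PD Ph p Xp; suff : vanishing X p /\ Pr p by case.
rewrite [X in _ X /\ Pr X](pihomog_partitionE (mf := mdeg) (leqnn (msize p))).
elim/big_ind: _ => [|a b [Xa Pa] [Xb Pb]|d _].
- by split=> //; exact: vanishing0.
- by split; [exact: vanishingD|exact: PD].
- by split; [exact: vanishing_homog|apply: Ph (pihomogP _ _ _); exact: vanishing_homog].
Qed.

(** Taylor's expansion modulo products of two elements of I. In the application [I2] consists of the
    elements of I that a normal map kills at the point. *)
Lemma taylor1 (I I2 : S -> Prop) k (a b : 'I_k -> S) (q : {mpoly F[k]}) : is_ideal I -> is_ideal I2 ->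
  (forall p q, I p -> I q -> I2 (p * q)) -> (forall i, I (a i - b i)) ->
  I2 (msub a q - msub b q - \sum_i msub b q^`M(i) * (a i - b i)).
Proof.
move=> iI [Z0 ZD ZM] II Iab; have [I0 ID IM] := iI.
pose L q := \sum_i msub b q^`M(i) * (a i - b i).
have IL q' : I (L q') by rewrite /L; elim/big_ind: _ => [||i _]; [exact: I0|exact: ID|exact: IM].
elim/mpoly_alg_ind: q => [c|j|p q IHp IHq|p q IHp IHq].
- rewrite /msub !mmapC subrr sub0r big1 ?oppr0 // => i _; by rewrite mderivC raddf0 mul0r.
- rewrite (bigD1 j) //= big1 ?addr0 => [|i ij]; last by rewrite mderivXU (negbTE ij) rmorph0 mul0r.
  by rewrite mderivXU eqxx rmorph1 mul1r /msub !mmapX !mmap1U subrr.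
- have dE : L (p + q) = L p + L q.
    by rewrite -big_split; apply: eq_bigr => i _; rewrite mderivD rmorphD mulrDl.
  have e (g : 'I_k -> S) : msub g (p + q) = msub g p + msub g q by exact: rmorphD.
  rewrite -/(L _) dE !e; move: IHp IHq; rewrite -/(L p) -/(L q).
  move: (msub a p) (msub a q) (msub b p) (msub b q) (L p) (L q) => A B C D E G Zp Zq.
  have -> : A + B - (C + D) - (E + G) = (A - C - E) + (B - D - G) by ring.
  exact: ZD Zp Zq.
- have dE : L (p * q) = msub b q * L p + msub b p * L q.
    rewrite !mulr_sumr -big_split; apply: eq_bigr => i _.
    rewrite mderivM (_ : msub b _ = msub b p^`M(i) * msub b q + msub b p * msub b q^`M(i)); last first.
      by rewrite -!(rmorphM (msub b)) -(rmorphD (msub b)).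
    by move: (msub b _) (msub b _) (msub b _) (msub b _) => A B C D; rewrite /=; ring.
  have e (g : 'I_k -> S) : msub g (p * q) = msub g p * msub g q by exact: rmorphM.
  rewrite -/(L _) dE !e; move: IHp IHq (IL p) (IL q); rewrite -/(L p) -/(L q).
  move: (msub a p) (msub a q) (msub b p) (msub b q) (L p) (L q) => A B C D E G Zp Zq IE IG.
  have -> : A * B - C * D - (D * E + C * G) = B * (A - C - E) + C * (B - D - G) + E * (B - D - G) + E * G by ring.
  exact: ZD (ZD _ _ (ZD _ _ (ZM _ _ Zp) (ZM _ _ Zq)) (ZM _ _ Zq)) (II _ _ IE IG).
Qed.

(** For a form g of degree d in the ideal, u^d g = g(u X) is, modulo elements killed by f, the sum
    of g(G) = h E and a combination of the u X_i - G_i. So f is determined by its values at E and at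
    the u X_i - G_i; the value of h at the point comes from differentiating g(G) = h E in a
    direction b0 where E has nonzero derivative. This dictates w. *)
Lemma normal_surj m (x : P) (f : tnormal X x) : closed X -> irreducible X -> nonsingular X ->
  has_dim X m -> X x -> exists w, f = nsec w x.
Proof.
move=> cX iX nX dX Xx; have [v0 xv0] := hcoord_ex x.
have Xv0 : pcone X v0 by exists x.
have [i0 vi0] : exists i, v0 0 i != 0.
  by apply/rV0Pn; exact: pcone_neq0 Xv0.
have lX : ~ vanishing X (linear_form (delta_mx 0 i0)).
  move=> /vanishingE /(_ v0 Xv0); rewrite meval_linear_form /dotp (bigD1 i0) //= big1 ?addr0 => [|i ii].
    by rewrite mxE !eqxx mul1r => /eqP; rewrite (negbTE vi0).
  by rewrite mxE (negbTE ii) andbF mul0r.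
have [c [u [G [p [ch _ u1 _]]]]] := chart_exists charF cX iX nX dX lX Xv0.
have [mn sX] := nonsingular_smooth nX dX.
have [eX _ pE _] := ch; have /asboolP[_ fD fM fZ] := tnormalP f.
pose psi q := tnormal_val f q v0.
pose q0 a := dotp (c a) v0.
have uq : u.@[q0] != 0 by rewrite -theta_eval u1 oner_neq0.
have XE : vanishing X (theta c (of_upoly p)) by apply/pE; exists 1; rewrite mul1r.
have Eq : (of_upoly p).@[q0] = 0 by rewrite -theta_eval; move/vanishingE: XE; apply.
have [b0 Eb] := chart_smooth cX iX mn sX ch Eq uq.
have Gq i : (G i).@[q0] = v0 0 i.
  move/vanishingE: (eX i) => /(_ v0 Xv0); rewrite mevalB mevalM u1 mul1r mevalXU theta_eval => /eqP.
  by rewrite subr_eq0 => /eqP.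
pose e i := theta c u * 'X_i - theta c (G i).
pose w : V := \row_i (psi (e i) + (G i)^`M(b0).@[q0] / (of_upoly p)^`M(b0).@[q0] * psi (theta c (of_upoly p))).
have key g : vanishing X g -> psi g = dirder g v0 w.
  move=> Xg; elim/vanishing_ind: Xg => [|g1 g2 X1 X2 h1 h2|d {}g Xg hg].
  - have -> : psi 0 = 0 by rewrite /psi -(mul0r 0) fM ?meval0 ?mul0r //; exact: vanishing0.
    by rewrite /dirder big1 // => k _; rewrite mderiv0 meval0 mul0r.
  - by rewrite /psi fD // dirderD; congr (_ + _); [exact: h1|exact: h2].
  have [h hE] := chart_vanishing iX ch Xg.
  pose Z z := vanishing X z /\ psi z = 0.
  have iZ : is_ideal Z.
    split=> [|y z [Xy y0] [Xz z0]|y z [Xz z0]]; split.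
    - exact: vanishing0.
    - by rewrite /psi -(mul0r 0) fM ?meval0 ?mul0r //; exact: vanishing0.
    - exact: vanishingD.
    - by rewrite /psi fD // -/(psi y) -/(psi z) y0 z0 addr0.
    - exact: vanishingM.
    - by rewrite /psi fM // -/(psi z) z0 mulr0.
  have ZZ y z : vanishing X y -> vanishing X z -> Z (y * z).
    by move=> Xy Xz; split; [exact: vanishingM|rewrite /psi fM // (Xy x v0) // mul0r].
  have [XT T0] := taylor1 (a := fun i => theta c u * 'X_i) (b := fun i => theta c (G i)) g
    (vanishing_ideal_is X) iZ ZZ eX.
  have mG : msub (fun i => theta c (G i)) g = theta c h * theta c (of_upoly p).
    rewrite -thetaM -hE /theta [RHS](mmap_comp (msub (fun a => linear_form (c a))) (@mpolyC _ F)).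
    rewrite /msub; have -> : mmap (@mpolyC n.+1 F) (fun a => linear_form (c a)) \o @mpolyC m.+2 F = @mpolyC n.+1 F.
      by apply/funext => a; rewrite /= mmapC.
    by [].
  have mu : msub (fun i => theta c u * 'X_i) g = theta c u ^+ d * g.
    rewrite /msub (homog_mmapd (@mpolyC n.+1 F) (theta c u) (fun i => 'X_i) hg); congr (_ * _).
    by apply/esym; exact: (@mmap_hom _ _ _ (@mpolyC n.+1 F) idfun).
  have psiD y z : vanishing X y -> vanishing X z -> psi (y + z) = psi y + psi z by exact: fD.
  have psiM y z : vanishing X z -> psi (y * z) = y.@[v0 0] * psi z by exact: fM.
  have psiS (y : 'I_n.+1 -> S) : psi (\sum_i y i * e i) = \sum_i (y i).@[v0 0] * psi (e i).
    have Xs : forall r : seq 'I_n.+1, vanishing X (\sum_(i <- r) y i * e i) /\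
        psi (\sum_(i <- r) y i * e i) = \sum_(i <- r) (y i).@[v0 0] * psi (e i).
      elim=> [|i r [Xr IH]]; rewrite ?big_nil ?big_cons.
        by split; [exact: vanishing0|rewrite -(mul0r 0) psiM ?meval0 ?mul0r //; exact: vanishing0].
      have Xi : vanishing X (y i * e i) by apply: vanishingM; exact: eX.
      have Xir := vanishingD Xi Xr; split; first exact: Xir.
      by rewrite (psiD _ _ Xi Xr) IH (psiM _ _ (eX i)).
    by have [] := Xs (index_enum _).
  have gG (q : S) : (msub (fun i => theta c (G i)) q).@[v0 0] = q.@[v0 0].
    by rewrite msub_meval; apply: meval_eq => i; rewrite theta_eval Gq.
  have split_g : theta c u ^+ d * g = (msub (fun i => theta c u * 'X_i) g - msub (fun i => theta c (G i)) g -
      \sum_i msub (fun i => theta c (G i)) g^`M(i) * e i) +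
      (theta c h * theta c (of_upoly p) + \sum_i msub (fun i => theta c (G i)) g^`M(i) * e i).
    by rewrite mu mG; ring.
  have Xsum : vanishing X (\sum_i msub (fun i => theta c (G i)) g^`M(i) * e i).
    by elim/big_ind: _ => [|y z|i _]; [exact: vanishing0|exact: vanishingD|apply: vanishingM; exact: eX].
  have XhE : vanishing X (theta c h * theta c (of_upoly p)) by exact: vanishingM.
  have : psi (theta c u ^+ d * g) = psi g by rewrite psiM // -[_.@[_]]/(meval (v0 0) _) rmorphXn /= u1 expr1n mul1r.
  rewrite split_g psiD //; last exact: vanishingD.
  rewrite T0 add0r psiD // psiM // psiS theta_eval => <-.
  have hb : \sum_i g^`M(i).@[v0 0] * (G i)^`M(b0).@[q0] = h.@[q0] * (of_upoly p)^`M(b0).@[q0].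
    have := congr1 (fun z => z^`M(b0).@[q0]) hE; rewrite mderiv_msub meval_bigsum mderivM mevalD !mevalM Eq mulr0 add0r => <-.
    apply: eq_bigr => i _; rewrite mevalM msub_meval; congr (_ * _).
    by apply: meval_eq => k; rewrite Gq.
  rewrite /dirder -[h.@[_]](mulfK Eb) -hb !mulr_suml -big_split; apply: eq_bigr => i _ /=.
  by rewrite mxE gG; ring.
exists w; apply: tnormal_eq => g v Xg xv; rewrite /= nvalE //.
have [t [t0 ->]] := hcoord_scale xv0 xv.
elim/vanishing_ind: Xg => [|g1 g2 X1 X2 h1 h2|[|d] {}g Xg hg].
- have -> : tnormal_val f 0 (t *: v0) = 0.
    by rewrite -(mul0r 0) fM ?meval0 ?mul0r //; exact: vanishing0.
  by rewrite /dirder big1 // => k _; rewrite mderiv0 meval0 mul0r.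
- by rewrite fD // h1 h2 dirderD.
- have g0 : g = 0.
    rewrite [g](homog0_const hg); have := Xg x v0 Xx xv0; rewrite {1}[g](homog0_const hg) mevalC => ->.
    exact: mpolyC0.
  rewrite g0; have -> : tnormal_val f 0 (t *: v0) = 0.
    by rewrite -(mul0r 0) fM ?meval0 ?mul0r //; exact: vanishing0.
  by rewrite /dirder big1 // => k _; rewrite mderiv0 meval0 mul0r.
- by rewrite (fZ d) // (dirder_homog _ _ _ hg) -(key g Xg).
Qed.
End NormalMaps.

Section Frames.
Variables (F : closedFieldType) (n : nat).
Local Notation S := {mpoly F[n.+1]}.
Local Notation V := 'rV[F]_n.+1.
Local Notation P := (proj F n).
Hypothesis charF : forall k, k.+1%:R != 0 :> F.

Lemma det_homog r (M : 'M[S]_r) (d : 'I_r -> nat) : (forall a b, M a b \is (d a).-homog) ->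
  \det M \is (\sum_a d a).-homog.
Proof.
move=> h; have hp (t : {perm 'I_r}) : \prod_i M i (t i) \is (\sum_a d a).-homog by exact: dhomog_prod_ord.
by apply: rpred_sum => s _; rewrite mulr_sign; have := hp s; case: (odd_perm s) => hs; rewrite ?rpredN.
Qed.

Lemma adj_homog r (M : 'M[S]_r) (d : 'I_r -> nat) a b : (forall a b, M a b \is (d a).-homog) ->
  exists e, (\adj M) a b \is e.-homog /\ (e + d b = \sum_a d a)%N.
Proof.
case: r M d a b => [|r] M d a b h; first by case: a.
exists (\sum_k d (lift b k))%N; split; last by rewrite (bigD1_ord b) //= addnC.
rewrite mxE /cofactor; set D := \det _.
have hD : D \is (\sum_k d (lift b k)).-homog.
  by apply: det_homog => i j; rewrite !mxE; exact: h.
by rewrite -signr_odd mulr_sign; case: odd; rewrite ?rpredN.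
Qed.

Variables (X : set P) (m : nat).
Hypothesis cX : closed X.
Hypothesis iX : irreducible X.
Hypothesis nX : nonsingular X.
Hypothesis dX : has_dim X m.
Local Notation r := (n - m)%N.

Definition frame_data (f : 'I_r -> S) (df : 'I_r -> nat) :=
  forall a, vanishing X (f a) /\ f a \is (df a).+1.-homog.

Lemma frame_data_exists x : X x -> exists (f : 'I_r -> S) df (c : 'I_r -> 'I_n.+1),
  frame_data f df /\ exists v, hcoord x v /\ (minor f c).@[v 0] != 0.
Proof.
move=> Xx; have [v xv] := hcoord_ex x; have Xv : pcone X v by exists x.
have [mn sX] := nonsingular_smooth nX dX; have [f [hf rf _]] := sX v Xv.
have [c c0] := minor_neq0 rf.
(* A form of degree 0 in the ideal is zero and would make the minor vanish, so all degrees are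
   positive. *)
have [|df hdf] := choice (P := fun (a : 'I_r) (d : nat) => f a \is d.+1.-homog).
  move=> a; have [d hd] := (hf a).2; case: d hd => [|d] hd; last by exists d.
  have fa0 : f a = 0.
    rewrite [f a](homog0_const hd); have := (hf a).1 x v Xx xv; rewrite {1}[f a](homog0_const hd) mevalC => ->.
    exact: mpolyC0.
  move/eqP: c0; case; rewrite (expand_det_row _ a) big1 // => b _.
  by rewrite !mxE fa0 mderiv0 -[mmap _ _ _]/(meval (v 0) 0) meval0 mul0r.
exists f, df, c; split=> [a|]; first by split; [exact: (hf a).1|exact: hdf].
exists v; split=> //; have := mmap_minor idfun (v 0) f c; rewrite -[mmap _ _ _]/((minor f c).@[v 0]) => ->.
exact: c0.
Qed.

Variables (f : 'I_r -> S) (df : 'I_r -> nat) (c : 'I_r -> 'I_n.+1).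
Hypothesis fd : frame_data f df.
Let delta := minor f c.
Let A a b := (\adj (minor_mx f c)) a b.

Definition frame_open : set P := nonzero_locus [set minor f c].
Definition frame (a : 'I_r) (x : P) : tnormal X x := nsec X (delta_mx 0 (c a)) x.

Lemma minor_entry_homog a b : minor_mx f c a b \is (df a).-homog.
Proof. by rewrite mxE; exact: (mderiv_homog (c b) (fd a).2). Qed.

Lemma minor_deg : delta \is (\sum_a df a).-homog.
Proof. by apply: det_homog => a b; exact: minor_entry_homog. Qed.

Lemma minor_form : Defs.form delta.
Proof. by exists (\sum_a df a)%N; exact: minor_deg. Qed.

Lemma adj_deg a b : exists e, A a b \is e.-homog /\ (e + df b = \sum_a df a)%N.
Proof. by apply: adj_homog => i j; exact: minor_entry_homog. Qed.

Lemma open_frame : open frame_open.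
Proof.
rewrite open_zariski; exists [set delta]; split=> // _ ->; exists (\sum_a df a)%N; exact: minor_deg.
Qed.

Lemma frame_openP x v : hcoord x v -> frame_open x <-> delta.@[v 0] != 0.
Proof.
move=> xv; split=> [[_ [-> [w [xw dw]]]]|d0]; last by exists delta; split=> //; exists v.
exact: form_neq0 minor_form xw xv dw.
Qed.

Section AtPoint.
Variables (x : P) (v : V).
Hypothesis Xx : X x.
Hypothesis xv : hcoord x v.
Hypothesis dv : delta.@[v 0] != 0.
Let M a b := (f a)^`M(c b).@[v 0].

Lemma adjM a b : \sum_k (A a k).@[v 0] * M k b = (a == b)%:R * delta.@[v 0].
Proof.
have := congr1 (fun B : 'M[S]_r => (B a b).@[v 0]) (mul_adj_mx (minor_mx f c)).
rewrite !mxE meval_bigsum => e; transitivity (\sum_k ((\adj (minor_mx f c)) a k * minor_mx f c k b).@[v 0]).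
  by apply: eq_bigr => k _; rewrite mevalM [minor_mx _ _ _ _]mxE.
by rewrite e; case: (a == b); rewrite ?mulr1n ?mulr0n ?meval0 ?mul0r ?mul1r.
Qed.

Lemma Madj a b : \sum_k M a k * (A k b).@[v 0] = (a == b)%:R * delta.@[v 0].
Proof.
have := congr1 (fun B : 'M[S]_r => (B a b).@[v 0]) (mul_mx_adj (minor_mx f c)).
rewrite !mxE meval_bigsum => e; transitivity (\sum_k (minor_mx f c a k * (\adj (minor_mx f c)) k b).@[v 0]).
  by apply: eq_bigr => k _; rewrite mevalM [minor_mx _ _ _ _]mxE.
by rewrite e; case: (a == b); rewrite ?mulr1n ?mulr0n ?meval0 ?mul0r ?mul1r.
Qed.

(* Near x the gradients of the f_a span the conormal space, and delta is their Cramer determinant. *)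
Lemma nsec_eq0 w : (forall b, dirder (f b) v w = 0) -> nsec X w x = 0.
Proof.
move=> h; rewrite -(nsec0 X x); apply: tnormal_eq => p v' Xp xv'; rewrite /= !nvalE //.
have [t [t0 v'E]] := hcoord_scale xv xv'; have [mn sX] := nonsingular_smooth nX dX.
have Xv' : pcone X v' by exists x.
have dv' : delta.@[v' 0] != 0 by exact: form_neq0 minor_form xv xv' dv.
have [s sE] := smooth_cramer sX (fun a => (fd a).1) Xv' dv' Xp.
rewrite [RHS]big1 => [|k _]; last by rewrite mxE mulr0.
transitivity (\sum_b s 0 b * dirder (f b) v' w).
  under [RHS]eq_bigr => b _ do rewrite mulr_sumr.
  rewrite exchange_big; apply: eq_bigr => k _.
  have : (grad idfun (v' 0) p) 0 k = (s *m jac idfun (v' 0) f) 0 k by rewrite sE.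
  rewrite !mxE => e; transitivity (mmap idfun (v' 0) p^`M(k) * w 0 k); first by [].
  by rewrite e mulr_suml; apply: eq_bigr => b _; rewrite mxE mulrA.
by apply: big1 => b _; rewrite v'E (dirder_homog _ _ _ (fd b).2) h !mulr0.
Qed.

Lemma dirder_delta p k : dirder p v (delta_mx 0 k) = p^`M(k).@[v 0].
Proof.
rewrite /dirder (bigD1 k) //= big1 ?addr0 => [|i ik]; first by rewrite mxE !eqxx mulr1.
by rewrite mxE (negbTE ik) andbF mulr0.
Qed.

Lemma frame_expand w : nsec X w x =
  \sum_a ((\sum_b (A a b).@[v 0] * dirder (f b) v w) / delta.@[v 0]) *: frame a x.
Proof.
rewrite -nsec_sum; set w' := \sum_a _; apply/eqP; rewrite -subr_eq0 -scaleN1r addrC -nsec_lin.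
apply/eqP/nsec_eq0 => b; rewrite dirder_lin mulN1r; apply/eqP; rewrite addrC subr_eq0; apply/eqP.
rewrite dirder_sum; apply: (mulfI dv); rewrite [RHS]mulr_sumr.
transitivity (\sum_a \sum_k M b a * (A a k).@[v 0] * dirder (f k) v w); last first.
  apply: eq_bigr => a _; rewrite dirder_delta -/(M b a) mulrA mulrCA mulfV // mulr1 mulrC mulr_sumr.
  by apply: eq_bigr => k _; rewrite mulrA.
rewrite exchange_big /=.
have e k : \sum_a M b a * (A a k).@[v 0] * dirder (f k) v w = (b == k)%:R * delta.@[v 0] * dirder (f k) v w.
  by rewrite -Madj mulr_suml.
rewrite (eq_bigr _ (fun k _ => e k)) (bigD1 b) //= big1 ?addr0 => [|k kb]; first by rewrite eqxx mul1r.
by rewrite eq_sym (negbTE kb) !mul0r.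
Qed.

Lemma frame_coef (g : 'I_r -> F) a :
  (\sum_b (A a b).@[v 0] * tnormal_val (\sum_k g k *: frame k x) (f b) v) / delta.@[v 0] = g a.
Proof.
have fE b : tnormal_val (\sum_k g k *: frame k x) (f b) v = \sum_k M b k * g k.
  rewrite -nsec_sum /= nvalE //; last exact: (fd b).1.
  by rewrite dirder_sum; apply: eq_bigr => k _; rewrite dirder_delta mulrC.
apply: (mulIf dv); rewrite divfK //.
transitivity (\sum_k \sum_b (A a b).@[v 0] * M b k * g k).
  rewrite exchange_big; apply: eq_bigr => b _; rewrite fE mulr_sumr; apply: eq_bigr => k _; by rewrite mulrA.
have e k : \sum_b (A a b).@[v 0] * M b k * g k = (a == k)%:R * delta.@[v 0] * g k.
  by rewrite -adjM mulr_suml.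
rewrite (eq_bigr _ (fun k _ => e k)) (bigD1 a) //= big1 ?addr0 => [|k ka]; first by rewrite eqxx mul1r mulrC.
by rewrite eq_sym (negbTE ka) !mul0r.
Qed.
End AtPoint.

(** By Cramer's rule the coefficients of a section are combinations of its values on the f b over
    the minor, hence regular; conversely the frame sends p to its partial derivatives. *)
Lemma frame_local : local_frame X (E := twisted_normal X) frame_open frame.
Proof.
split; first exact: open_frame.
  move=> y Xy Uy u; have [v yv] := hcoord_ex y; have dv := iffLR (frame_openP yv) Uy.
  have [w uE] := normal_surj charF u cX iX nX dX Xy.
  exists (fun a => (\sum_b (A a b).@[v 0] * dirder (f b) v w) / delta.@[v 0]); split.
    by rewrite uE; exact: frame_expand.
  move=> g gE; apply/funext => a; rewrite -[RHS](frame_coef Xy yv dv g a) -gE uE.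
  by congr (_ / _); apply: eq_bigr => b _; rewrite /= nvalE //; exact: (fd b).1.
move=> s g sg x Xx Ux; split.
  move=> rs a; apply: (regular_ext open_frame Ux (f := fun y v =>
      (\sum_b (A a b).@[v 0] * tnormal_val (s y) (f b) v) / delta.@[v 0])).
    move=> y v Xy Uy yv; rewrite sg //; apply: frame_coef => //; exact/(frame_openP yv).
  have [v xv] := hcoord_ex x; apply: (regular_div minor_deg); first by exists v; split=> //; exact/(frame_openP xv).
  rewrite add0n; apply: regular_sum => b; have [e [he eE]] := adj_deg a b.
  by rewrite -eE; apply: regular_mul; [exact: regular_form|exact: rs (fd b).1 (fd b).2].
move=> rg d p Xp hp; apply: (regular_ext open_frame Ux (f := fun y v => \sum_a g a y * p^`M(c a).@[v 0])).
  move=> y v Xy Uy yv; rewrite sg // -nsec_sum /= nvalE //.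
  by rewrite dirder_sum; apply: eq_bigr => a _; rewrite dirder_delta.
apply: regular_sum => a; rewrite -[d]add0n; apply: regular_mul; first exact: rg.
by apply: regular_form; exact: (mderiv_homog (c a) hp).
Qed.
End Frames.

(** * Global generation and ampleness *)

Section Ample.
Variables (F : closedFieldType) (n : nat).
Local Notation S := {mpoly F[n.+1]}.
Local Notation V := 'rV[F]_n.+1.
Local Notation P := (proj F n).
Hypothesis charF : forall k, k.+1%:R != 0 :> F.

Lemma bievalE r (p : {mpoly S[r]}) (v : V) t : bieval p v t = mmap (meval (v 0)) t p.
Proof.
pose g : {rmorphism {mpoly S[r]} -> F} := meval t \o map_mpoly (meval (v 0)).
rewrite -[LHS]/(g p) (mmap_hom (j := meval (v 0)) (g := g)).
  by apply: mmap_ext => i; rewrite /g /= map_mpolyX mevalXU.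
by move=> a; rewrite /g /= map_mpolyC mevalC.
Qed.

Lemma regular_pos (X : set P) m f x v0 : regular_at X m f x -> X x -> hcoord x v0 -> f x v0 != 0 ->
  exists O : set P, [/\ open O, O x & forall y v, X y -> O y -> hcoord y v -> f y v != 0].
Proof.
move=> [e [a [b [W [ha hb oW Wx h]]]]] Xx xv0 f0.
have fa : Defs.form a by eexists; exact: ha.
exists (W `&` nonzero_locus [set a]); split.
- apply: openI => //; rewrite open_zariski; exists [set a]; split=> // _ ->; exact: fa.
- split=> //; exists a; split=> //; exists v0; split=> //.
  have [b0 fE] := h x v0 Xx Wx xv0; apply: contraNneq f0 => a0; by rewrite fE a0 mul0r.
- move=> y v Xy [Wy [_ [-> [w [yw aw]]]]] yv; have [b0 ->] := h y v Xy Wy yv.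
  by rewrite mulf_neq0 ?invr_eq0 //; exact: form_neq0 fa yw yv aw.
Qed.

Lemma regular_bieval (X : set P) r d m (p : {mpoly S[r]}) (h : 'I_r -> P -> F) x : bihomog d m p ->
  (forall i, regular_at X 0 (fun y _ => h i y) x) ->
  regular_at X d (fun y v => bieval p v (fun i => h i y)) x.
Proof.
move=> [_ hp] hr.
suff reg : regular_at X d (fun y v => \sum_(mu <- msupp p) (p@_mu).@[v 0] * \prod_i h i y ^+ mu i) x.
  by apply: (regular_ext openT _ _ reg) => // y v _ _ _; rewrite bievalE.
apply: regular_sum => mu; rewrite -[d]addn0; apply: regular_mul; first exact: regular_form.
have pw i k : regular_at X 0 (fun y _ => h i y ^+ k) x.
  elim: k => [|k IH]; first exact: regular_const.
  by have := regular_mul (hr i) IH; apply: (regular_ext openT) => // y v _ _ _; rewrite exprS.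
elim: (index_enum _) => [|i s IH].
  by have := regular_const X 1 x; apply: (regular_ext openT) => // y v _ _ _; rewrite big_nil.
by have := regular_mul (pw i (mu i)) IH; apply: (regular_ext openT) => // y v _ _ _; rewrite big_cons.
Qed.

Variables (X : set P) (m : nat).
Hypothesis cX : closed X.
Hypothesis iX : irreducible X.
Hypothesis nX : nonsingular X.
Hypothesis dX : has_dim X m.
Local Notation r := (n - m)%N.
Local Notation E := (twisted_normal X).
Local Notation Q := (pbundle X E).

Lemma open_subbase (A : set Q) : pbundle_subbase A -> open A.
Proof.
move=> hA; exists [set A]; last by rewrite bigcup_set1.
by move=> _ ->; exact: (@finI_from1 _ _ _ id).
Qed.

Lemma frame_at x : X x -> exists (f : 'I_r -> S) df (c : 'I_r -> 'I_n.+1),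
  [/\ frame_data X f df, frame_open f c x & local_frame X (E := E) (frame_open f c) (frame X c)].
Proof.
move=> Xx; have [f [df [c [fd [v [xv dv]]]]]] := frame_data_exists nX dX Xx.
exists f, df, c; split=> //; first exact/(frame_openP c fd xv).
exact: (frame_local charF cX iX nX dX c fd).
Qed.

(** Continuity of the projection of P(E) to X: forms on X are bihomogeneous polynomials of degree 0
    in the fibre coordinates. *)
Lemma open_base (O : set P) : open O -> open [set q : Q | O (pbase q)].
Proof.
rewrite open_zariski => -[B [hB ->]]; rewrite openE => q /= [p [Bp [v [qv pv]]]].
have [f [df [c [fd Uq lf]]]] := frame_at (pbase_in q); have [d hd] := hB p Bp.
pose A : set Q := [set q | frame_open f c (pbase q) /\ exists phi v,
  [/\ @quotient_by F n X E q phi, hcoord (pbase q) v & bieval p%:MP v (@frame_coords F n X E r (frame X c) q phi) != 0]].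
have bE w t : bieval (p%:MP : {mpoly S[r]}) w t = p.@[w 0] by rewrite bievalE mmapC.
have oA : open A.
  apply: open_subbase; exists r, (frame_open f c), (frame X c), d, 0%N, p%:MP; split=> //.
  split; first by have -> : p%:MP = p *: 1 :> {mpoly S[r]}; [rewrite -mul_mpolyC mulr1|apply: rpredZ; exact: dhomog1].
  by move=> mu; rewrite mcoeffC; case: (_ == _); rewrite ?mulr1 // mulr0; exact: dhomog0.
rewrite /interior nbhsE; exists A.
  split=> //; split=> //; have [phi [_ kE]] := pker_quot q.
  by exists phi, v; split=> //; rewrite bE.
by move=> q' [_ [phi [w [_ qw]]]]; rewrite bE => pw; exists p; split=> //; exists w.
Qed.

Definition nsigma (w : V) : osection X E := fun q phi => phi (nsec X w (pbase q) : E (pbase q)).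

Lemma nsigma_global w : global_section 1 (nsigma w).
Proof.
move=> q0; have [f [df [c [fd Uq lf]]]] := frame_at (pbase_in q0).
pose A a b := (\adj (minor_mx f c)) a b.
(* The numerators of the coordinates of [nsec] in the frame; the adjugate gives them all one degree,
   which is that of the denominator [minor f c]. *)
pose C a : S := \sum_b A a b * \sum_k w 0 k *: (f b)^`M(k).
have hC a : C a \is (\sum_a df a).-homog.
  apply: rpred_sum => b _; have [e [he <-]] := adj_deg c fd a b; apply: dhomogM he _.
  by apply: rpred_sum => k _; apply: rpredZ; exact: mderiv_homog (fd b).2.
exists r, [set q : Q | frame_open f c (pbase q)], (frame_open f c), (frame X c), (\sum_a df a)%N, 0%N.
exists (\sum_a (C a)%:MP * 'X_a), (minor f c)%:MP; split=> //.
- exact: open_base (open_frame c fd).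
- split; split.
  + apply: rpred_sum => a _; rewrite mul_mpolyC; apply: rpredZ; rewrite dhomogX; apply/eqP; exact: mdeg1.
  + move=> mu; rewrite raddf_sum; apply: rpred_sum => a _ /=; rewrite mcoeffCM mcoeffX.
    by case: (_ == _); [rewrite mulr1; exact: hC|rewrite mulr0; exact: dhomog0].
  + by have -> : (minor f c)%:MP = minor f c *: 1 :> {mpoly S[r]}; [rewrite -mul_mpolyC mulr1|apply: rpredZ; exact: dhomog1].
  + move=> mu; rewrite mcoeffC; case: (_ == _); rewrite ?mulr1 ?mulr0; [exact: (minor_deg c fd)|exact: dhomog0].
- move=> q phi v Uq' qphi qv; have dv := iffLR (frame_openP c fd qv) Uq'.
  split; [exact: Uq'|by rewrite bievalE mmapC|].
  set t := @frame_coords F n X E r (frame X c) q phi.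
  have e1 : nsigma w phi = \sum_a (\sum_b (A a b).@[v 0] * dirder (f b) v w) / (minor f c).@[v 0] * t a.
    rewrite /nsigma (frame_expand nX dX fd (pbase_in q) qv dv) linear_sum; apply: eq_bigr => a _.
    by rewrite linearZ.
  have e2 : bieval (\sum_a (C a)%:MP * 'X_a) v t = \sum_a (C a).@[v 0] * t a.
    rewrite bievalE; transitivity (\sum_a mmap (meval (v 0)) t ((C a)%:MP * 'X_a)); first exact: rmorph_sum.
    by apply: eq_bigr => a _; rewrite rmorphM /= mmapC mmapX mmap1U.
  rewrite e1 e2 bievalE mmapC mulr_suml; apply: eq_bigr => a _; rewrite mulrAC; congr (_ * _ * _).
  rewrite /C meval_bigsum; apply: eq_bigr => b _.
  by rewrite mevalM meval_bigsum; congr (_ * _); apply: eq_bigr => k _; rewrite mevalZ mulrC.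
Qed.

Lemma nsigma_generated : globally_generated X E 1.
Proof.
move=> q; have [phi [[u u0] kE]] := pker_quot q; have [w uE] := normal_surj charF u cX iX nX dX (pbase_in q).
by exists (nsigma w), phi; split; [exact: nsigma_global|exact: kE|rewrite /nsigma -uE].
Qed.

(** Composed with w |-> dp(w), the quotient q becomes the linear form l up to a scalar: q is the
    pair of its base point and the hyperplane l tangent there, which places P(N(-1)) in the product
    of X and the dual space. *)
Definition contact_point (l : V) (q : Q) := exists (phi : {linear E (pbase q) -> F^o}) (a : F),
  [/\ @quotient_by F n X E q phi, a != 0 & forall w, phi (nsec X w (pbase q) : E (pbase q)) = a * dotp l w].

(** Along the fibre the sections [nsigma w] determine the linear form l up to a scalar, and l is
    nonzero because they generate. *)
Lemma section_fiber_contact (q0 : Q) : exists l : V, l != 0 /\ forall q, section_fiber 1 q0 q -> contact_point l q.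
Proof.
have [phi0 [[u0 pu0] k0]] := pker_quot q0; have Xq0 := pbase_in q0.
pose g (phi : {linear E (pbase q0) -> F^o}) w : F := phi (nsec X w (pbase q0) : E (pbase q0)).
have gE (phi : {linear E (pbase q0) -> F^o}) w : g phi w = dotp (\row_k g phi (delta_mx 0 k)) w.
  rewrite {1}[w]row_sum_delta /g nsec_sum linear_sum; apply: eq_bigr => k _.
  by rewrite linearZ mxE mulrC.
exists (\row_k g phi0 (delta_mx 0 k)); split.
  apply/eqP => l0; have [w uE] := normal_surj charF u0 cX iX nX dX Xq0.
  apply: pu0; rewrite uE -[LHS]/(g phi0 w) gE l0 /dotp big1 // => k _; by rewrite mxE mul0r.
move=> q [psi0 [psi [a [q0psi qpsi a0 h]]]].
have [t [t0 tE]] : exists t, t != 0 /\ forall u, psi0 u = t * phi0 u.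
  have ker u : psi0 u = 0 <-> phi0 u = 0.
    have e : [set u | psi0 u = 0] = [set u | phi0 u = 0] by rewrite -q0psi -k0.
    by have := congr1 (fun A : set (E (pbase q0)) => A u) e => /= ->.
  have pu0' : phi0 u0 != 0 by apply/eqP.
  exists (psi0 u0 / phi0 u0); split.
    by rewrite mulf_neq0 ?invr_eq0 //; apply/eqP => /ker.
  move=> u; have /ker : phi0 (u - (phi0 u / phi0 u0) *: u0) = 0.
    by rewrite linearB linearZ /= -[_ *: _]/(_ * _) divfK // subrr.
  rewrite linearB linearZ /= => /eqP; rewrite subr_eq0 => /eqP ->.
  by rewrite -[_ *: _]/(_ * _) mulrC mulrA mulrAC.
exists psi, (a * t); split=> //; first by rewrite mulf_neq0.
by move=> w; have := h _ (nsigma_global w); rewrite /nsigma => ->; rewrite tE mulrA -gE.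
Qed.

(* The projection to X is a homeomorphism from the set of contact points to its image. *)
Lemma contact_nbhs (l : V) (O : set Q) (q0 : Q) : open O -> O q0 -> contact_point l q0 ->
  exists U : set P, [/\ open U, U (pbase q0) & forall q, contact_point l q -> U (pbase q) -> O q].
Proof.
move=> [D hD <-] [B DB Bq0] [phi0 [a0 [k0 a00 l0]]]; have [D' sD' BE] := hD _ DB.
have sub (A : set Q) : pbundle_subbase A -> A q0 -> exists U : set P,
    [/\ open U, U (pbase q0) & forall q, contact_point l q -> U (pbase q) -> A q].
  move=> [r' [U [e [d [m' [p [lf hp ->]]]]]]] /= [Uq [phi [v [qphi qv pv]]]].
  have [f [df [c [fd fq lf']]]] := frame_at (pbase_in q0); have [_ uniq_e reg_e] := lf'.
  have [oU _ reg_U] := lf.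
  have [g gE] : exists g : 'I_r' -> P -> 'I_r -> F, forall i y, X y -> frame_open f c y ->
      e i y = \sum_a g i y a *: (frame X c a y : E y).
    have h i y : exists g : 'I_r -> F, X y -> frame_open f c y ->
        e i y = \sum_a g a *: (frame X c a y : E y).
      have [[Xy Uy]|nXU] := pselect (X y /\ frame_open f c y).
        by have [g [gE _]] := uniq_e y Xy Uy (e i y); exists g.
      by exists (fun=> 0) => Xy Uy; case: nXU.
    have [g hg] := choice (fun iy : 'I_r' * P => h iy.1 iy.2).
    by exists (fun i y => g (i, y)) => i y; exact: (hg (i, y)).
  have Xq := pbase_in q0.
  have rege i : regular_section_at (v := E) (e i) (pbase q0).
    apply/(reg_U (e i) (fun k _ => (i == k)%:R) _ _ Xq Uq) => [y Xy Uy|k]; last exact: regular_const.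
    rewrite (bigD1 i) //= big1 ?addr0 => [|k ki]; first by rewrite eqxx scale1r.
    by rewrite eq_sym (negbTE ki) scale0r.
  have regg i a : regular_at X 0 (fun y _ => g i y a) (pbase q0).
    have := iffLR (reg_e (e i) (fun a y => g i y a) (fun y Xy Uy => gE i y Xy Uy) _ Xq fq) (rege i).
    exact.
  (* At contact points the coordinates in any other frame e are, up to a common scalar a, these
     functions of the base point; a polynomial of degree m' in them is thus a ^ m' times a regular
     function on X. *)
  pose h i y := \sum_a g i y a * l 0 (c a).
  have regh i : regular_at X 0 (fun y _ => h i y) (pbase q0).
    apply: regular_sum => a; have := regular_mul (regg i a) (regular_const X (l 0 (c a)) (pbase q0)).
    exact.
  have coordE q psi a : @quotient_by F n X E q psi ->
      (forall w, psi (nsec X w (pbase q) : E (pbase q)) = a * dotp l w) -> frame_open f c (pbase q) ->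
      forall i, @frame_coords F n X E r' e q psi i = a * h i (pbase q).
    move=> qpsi psiE fq' i; rewrite /frame_coords (gE i _ (pbase_in q) fq') linear_sum mulr_sumr.
    apply: eq_bigr => b _; rewrite linearZ /= psiE -[_ *: _]/(_ * _) mulrCA; congr (_ * (_ * _)).
    rewrite /dotp (bigD1 (c b)) //= big1 ?addr0 => [|k kc]; first by rewrite mxE !eqxx mulr1.
    by rewrite mxE (negbTE kc) andbF mulr0.
  have bE q psi a w : @quotient_by F n X E q psi ->
      (forall w, psi (nsec X w (pbase q) : E (pbase q)) = a * dotp l w) -> frame_open f c (pbase q) ->
      bieval p w (@frame_coords F n X E r' e q psi) = a ^+ m' * bieval p w (fun i => h i (pbase q)).
    move=> qpsi psiE fq'; rewrite !bievalE -(homog_mmapd _ _ _ hp.1); apply: mmap_ext => i.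
    exact: coordE.
  have [t [t0 tE]] : exists t, t != 0 /\ forall u, phi u = t * phi0 u.
    have ker u : phi u = 0 <-> phi0 u = 0.
      have e' : [set u | phi u = 0] = [set u | phi0 u = 0] by rewrite -qphi -k0.
      by have := congr1 (fun A : set (E (pbase q0)) => A u) e' => /= ->.
    have [chi [[u0 cu0] kc]] := pker_quot q0.
    have pu0' : phi0 u0 != 0.
      apply/eqP => h0; apply: cu0; have e' : [set u | chi u = 0] = [set u | phi0 u = 0] by rewrite -kc -k0.
      by have := congr1 (fun A : set (E (pbase q0)) => A u0) e' => /= ->.
    exists (phi u0 / phi0 u0); split.
      by rewrite mulf_neq0 ?invr_eq0 //; apply/eqP => /ker/eqP; rewrite (negbTE pu0').
    move=> u; have /ker : phi0 (u - (phi0 u / phi0 u0) *: u0) = 0.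
      by rewrite linearB linearZ /= -[_ *: _]/(_ * _) divfK // subrr.
    rewrite linearB linearZ /= => /eqP; rewrite subr_eq0 => /eqP ->.
    by rewrite -[_ *: _]/(_ * _) mulrC mulrA mulrAC.
  have bh0 : bieval p v (fun i => h i (pbase q0)) != 0.
    have := bE q0 phi (t * a0) v qphi _ fq.
    have lt w : phi (nsec X w (pbase q0) : E (pbase q0)) = t * a0 * dotp l w by rewrite tE l0 mulrA.
    move=> /(_ lt) e'; apply: contraNneq pv => b0; by rewrite e' b0 mulr0.
  have [W [oW Wq hW]] := regular_pos (regular_bieval hp regh) Xq qv bh0.
  exists (W `&` U `&` frame_open f c); split.
  - by apply: openI; [exact: openI|exact: (open_frame c fd)].
  - by [].
  - move=> q [psi [a [qpsi a'0 psiE]]] [[Wq' Uq'] fq']; split=> //; have [w qw] := hcoord_ex (pbase q).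
    exists psi, w; split=> //; rewrite (bE q psi a w qpsi psiE fq') mulf_neq0 ?expf_neq0 //.
    exact: hW (pbase_in q) Wq' qw.
have : forall s : seq (set Q), {subset s <= D'} -> exists U : set P,
    [/\ open U, U (pbase q0) & forall q, contact_point l q -> U (pbase q) -> forall A, A \in s -> A q].
  elim=> [|A s IH] sD; first by exists setT; split=> //; exact: openT.
  have [|U [oU Uq hU]] := IH; first by move=> C Cs; apply: sD; rewrite inE Cs orbT.
  have AD : A \in D' by apply: sD; rewrite inE eqxx.
  have [||W [oW Wq hW]] := sub A; [exact: set_mem (sD' A AD)|by move: Bq0; rewrite -BE; apply|].
  exists (U `&` W); split=> //; first exact: openI.
  by move=> q cq [Uq' Wq'] C; rewrite inE => /orP[/eqP ->|]; [exact: hW|exact: hU].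
move=> /(_ (enum_fset D')) [|U [oU Uq hU]]; first by [].
exists U; split=> // q cq Uq'; have Bq : B q by rewrite -BE => A AD; exact: (hU q cq Uq' A AD).
by exists B.
Qed.

Lemma contact_conormal (l : V) (q : Q) v : l != 0 -> contact_point l q -> hcoord (pbase q) v ->
  conormal idfun X (v 0) (l 0).
Proof.
move=> l0 [phi [a [_ a0 phiE]]] qv; have hl := hcoord_pt l0.
apply/(tangent_hyperplane (pbase_in q) qv hl) => w tw; apply/(hyperplaneE _ hl).
have nw : nsec X w (pbase q) = 0.
  rewrite -(nsec0 X (pbase q)); apply: tnormal_eq => p v' Xp qv'; have Xq := pbase_in q.
  by rewrite /= !nvalE // /dirder tw // big1 // => k _; rewrite mxE mulr0.
have := phiE w; rewrite nw linear0 => /esym/eqP; rewrite mulf_eq0 (negbTE a0) => /eqP.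
exact.
Qed.

(** The chain is pushed to X, where [contact_nbhs] keeps it strict. The closure Y of its top lies in
    the contact locus of l, tangency being a closed condition, and at least k + 2 coordinates are
    independent on the cone of Y. *)
Lemma contact_dim (s k : nat) (l : V) (A : set Q) : non_degenerate X -> has_dim (secant_variety X) s ->
  l != 0 -> (forall q, A q -> contact_point l q) -> dim_ge A k.+1 -> (m + k + 2 <= s)%N.
Proof.
move=> ne dS l0 Al [Z [hZ sZ]]; pose B i := closure ((@pbase F n X E) @` Z i).
have ZA i : (i <= k.+1)%N -> forall q, Z i q -> A q.
  by move=> ik q; have [_ <-] := hZ i ik; case.
have iB i : (i <= k.+1)%N -> irreducible (B i).
  move=> ik; apply: irreducible_closure; have [[[q Zq] hir] _] := hZ i ik; split.
    by exists (pbase q), q.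
  move=> C1 C2 cC1 cC2 sC.
  have cl (C : set P) : closed C -> closed [set q : Q | C (pbase q)].
    move=> cC; have := open_base (closed_openC cC); rewrite -openC.
    by congr open.
  have [h|h] := hir _ _ (cl _ cC1) (cl _ cC2) (fun q Zq => sC _ (ex_intro2 _ _ q Zq erefl)).
    by left=> _ [q' Zq' <-]; exact: h.
  by right=> _ [q' Zq' <-]; exact: h.
have sB i : (i < k.+1)%N -> B i `<` B i.+1.
  move=> ik; have [sub nsub] := sZ i ik; split.
    by apply: closureS => _ [q Zq <-]; exists q => //; exact: sub.
  move=> h; apply: nsub => q Zq; have [_ <-] := hZ i (ltnW ik); split; last exact: ZA Zq.
  move=> O; rewrite nbhsE => -[O' [oO' O'q] sO].
  have [U [oU Uq hU]] := contact_nbhs oO' O'q (Al q (ZA _ ik q Zq)).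
  have [|_ [[q' Zq' <-] Uq']] := h (pbase q) _ U (open_nbhs_nbhs (conj oU Uq)).
    by apply: subset_closure; exists q.
  exists q'; split=> //; apply: sO; apply: hU => //; exact: Al (ZA _ (ltnW ik) q' Zq').
have mB' d i : (i + d = k.+1)%N -> B i `<=` B k.+1.
  elim: d i => [|d IH] i e; first by rewrite -e addn0.
  apply: subset_trans (sB i _).1 (IH i.+1 _); first by rewrite -e addnS ltnS leq_addr.
  by rewrite addSnnS.
have mB i : (i <= k.+1)%N -> B i `<=` B k.+1 by move=> /subnKC; exact: mB'.
set Y := B k.+1; have cY : closed Y by exact: closed_closure.
have iY : irreducible Y by exact: iB.
have dY : dim_ge Y k.+1.
  exists B; split=> // i ik; split; first exact: iB.
  by rewrite /B -(iffLR (closure_id _) (@closed_closure _ _)); apply: setIidl; exact: mB.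
have YX : Y `<=` X.
  rewrite (iffLR (closure_id X) cX); apply: closureS => _ [q _ <-]; exact: pbase_in.
have [mn sX] := nonsingular_smooth nX dX.
have con v : pcone Y v -> conormal idfun X (v 0) (l 0).
  move=> Yv; have Xv : pcone X v by have [x [Yx xv]] := Yv; exists x; split=> //; exact: YX.
  have [f [hf rf _]] := sX v Xv; have [c c0] := minor_neq0 rf.
  have mE (w : V) : \det (colsub c (jac idfun (w 0) f)) = (minor f c).@[w 0] by rewrite -mmap_minor.
  rewrite mE in c0; apply/(mcoef_conormal _ sX (on_cone_point Xv) (fun a => (hf a).1) c0) => i.
  pose K := \sum_i' l 0 i' *: mcoef f c i i'.
  have KE (w : V) : \sum_i' l 0 i' * mmap idfun (w 0) (mcoef f c i i') = K.@[w 0].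
    by rewrite meval_bigsum; apply: eq_bigr => i' _; rewrite mevalZ.
  rewrite KE; apply: (mulfI c0); rewrite mulr0 -mevalM; have [x [Yx xv]] := Yv.
  have : vanishing ((@pbase F n X E) @` Z k.+1) (minor f c * K).
    move=> _ w [q Zq <-] qw; rewrite mevalM; have [->|mw] := eqVneq (minor f c).@[w 0] 0; first by rewrite mul0r.
    have Xw : pcone X w by exists (pbase q); split=> //; exact: pbase_in.
    have cw := contact_conormal l0 (Al q (ZA _ (leqnn _) q Zq)) qw.
    have := iffLR (mcoef_conormal _ sX (on_cone_point Xw) (fun a => (hf a).1) mw) cw i.
    by rewrite KE => ->; rewrite mulr0.
  by move/vanishing_closure; apply; [exact: Yx|exact: xv].
have [r' [be [kr ind]]] := dim_coords charF cY iY dY.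
have [i0 Yi0] : exists i, ~ vanishing Y 'X_i.
  have [[x Yx] _] := iY; have [v xv] := hcoord_ex x.
  have /rV0Pn[i vi] : v != 0 by case: xv.
  by exists i => h; move: vi; have := h x v Yx xv; rewrite mevalXU => ->; rewrite eqxx.
have lX : ~ vanishing X (linear_form l).
  move=> lX; apply: (ne (pt l0)) => x Xx v xv; apply/(hyperplaneE _ (hcoord_pt l0)).
  by have := lX x v Xx xv; rewrite meval_linear_form.
have row_q (q : 'I_n.+1 -> F) : zero_locus (vanishing Y) q -> q i0 != 0 -> pcone Y (\row_i q i).
  move=> Iq q0; apply: closed_pcone => // [|p Yp].
    by apply: contraNneq q0 => h; have := congr1 (fun z : V => z 0 i0) h; rewrite !mxE => ->.
  by rewrite -[RHS](Iq p Yp); apply: meval_eq => i; rewrite mxE.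
(* The cone of Y parametrises itself: with u0 = X_i0 and G = X_i0 X_i, the quotient G / u0 is
   X_i. *)
have := contact_count charF (l := l) (I := vanishing Y) (u0 := 'X_i0) (G := fun i => 'X_i0 * 'X_i)
  (beta := be) (tB := fun a => delta_mx 0 (be a)) cX iX nX dX dS lX (irreducible_prime iY) Yi0.
move=> H; suff : (m + r' <= s)%N by move: kr; lia.
apply: H => [q Iq|q a Iq|R].
- rewrite mevalXU => q0; have Yq := row_q q Iq q0.
  have e : \row_i ('X_i0 * 'X_i).@[q] = q i0 *: \row_i q i by apply/rowP => i; rewrite !mxE mevalM !mevalXU.
  have Xq : pcone X (\row_i q i) by have [x [Yx xv]] := Yq; exists x; split=> //; exact: YX.
  split; first by rewrite e; exact: pconeZ.
  have := conormalZ q0 (on_cone_point Xq) (con _ Yq); congr (conormal _ _ _ _).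
  by apply/funext => i; rewrite mevalM !mevalXU mxE.
- rewrite (bigD1 (be a)) //= big1 ?addr0 => [|i ia]; first by rewrite mxE !eqxx mul1r mevalM !mevalXU.
  by rewrite mxE (negbTE ia) andbF mul0r.
- by move=> h; exact: ind.
Qed.

(** The first power of the tautological line bundle is enough: a fibre of dimension k + 1 would
    force m + k + 2 <= s. *)
Lemma normal_ample (s k : nat) : non_degenerate X -> has_dim (secant_variety X) s ->
  (s <= k + m + 1)%N -> k_ample X E k.
Proof.
move=> ne dS sk; split.
  exists r => x Xx; have [f [df [c [_ fx lf]]]] := frame_at Xx.
  by exists (frame_open f c), (frame X c).
exists 1%N; split=> //; first exact: nsigma_generated.
move=> q0 dk; have [l [l0 hl]] := section_fiber_contact q0.
have := contact_dim ne dS l0 hl dk; move: sk; lia.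
Qed.
End Ample.

Lemma dim_ge_ambient (F : closedFieldType) n (Y : set (proj F n)) d :
  (forall k, k.+1%:R != 0 :> F) -> closed Y -> irreducible Y -> dim_ge Y d -> (d <= n)%N.
Proof.
move=> charF cY iY dY; have [r [A [dr ind]]] := dim_coords charF cY iY dY.
suff Ainj : injective A by have := leq_card A Ainj; rewrite !card_ord => rn; move: dr rn; lia.
move=> a b ab; apply/eqP; apply: contrapT => /negP nab.
have : 'X_a - 'X_b = 0 :> {mpoly F[r]}.
  apply: ind; rewrite /msub rmorphB /= !mmapX !mmap1U /coords ab subrr; exact: vanishing0.
move/eqP; rewrite subr_eq0 => /eqP /(congr1 (meval (fun i => (i == a)%:R))).
by rewrite !mevalXU eqxx eq_sym (negbTE nab) => /eqP; rewrite oner_eq0.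
Qed.

Theorem corollary1 (R : realType) (N n s : nat) (X : set (proj R[i] N))
    (X_manifold : manifold X) (X_nondegenerate : non_degenerate X)
    (dimX : has_dim X n) (dimSX : has_dim (secant_variety X) s) :
  (* (i) *)
  (forall k : nat, (s <= k + n + 1)%N -> k_ample X (twisted_normal X) k) /\
  (* (ii) *)
  ((forall nstar : nat, has_dim (dual_variety X) nstar ->
      (n + (N - s) <= nstar)%N) /\
   (secant_variety X <> [set: proj R[i] N]%classic ->
      variety (dual_variety X) /\ ~ nonsingular (dual_variety X))) /\
  (* (iii) *)
  (((s + 1 <= 2 * n)%N ->
      forall h : proj R[i] N, reduced_scheme (section_ideal X h)) /\
   ((s + 2 <= 2 * n)%N ->
      forall h : proj R[i] N, normal_scheme (section_ideal X h))).
Proof.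
have charF k : k.+1%:R != 0 :> R[i] by rewrite Num.Theory.pnatr_eq0.
have [[cX iX] nX] := X_manifold; have [_ sX] := nonsingular_smooth nX dimX.
split; last split.
- by move=> k; exact: (@normal_ample R[i] N charF X n cX iX nX dimX s k X_nondegenerate dimSX).
(* This makes the truncated difference N - s the true one. *)
- have sN : (s <= N)%N.
    have iS := secant_irreducible charF iX (two_points_secant dimSX).
    exact: (dim_ge_ambient charF (@closed_closure _ _) iS dimSX.1).
  split=> [d dX|SX].
    have ne : dual_variety X !=set0.
      have [[Z [hZ _]] _] := dX; have [[[h Zh] _] ZE] := hZ 0%N (leq0n d).
      by exists h; move: Zh; rewrite -ZE => -[].
    have := dual_bound charF cX iX nX X_nondegenerate dimX dimSX ne dX.2; move: sN; lia.
  have [ne ns] := dual_singular charF cX iX nX X_nondegenerate dimX dimSX SX.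
  split=> //; split; first exact: (dual_closed cX iX sX).
  exact: (dual_irreducible iX ne).
- have sch h := section_schemes charF h cX iX nX X_nondegenerate dimX dimSX.
  by split=> sn h; have [h1 h2] := sch h; [exact: h1|exact: h2].
Qed.
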